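(* There exists an absolute constant $C>0$ such that the following holds for all $d\in\mathbb N$, all probability measures $R$ on $\mathbb R^d$, all symmetric measurable $u:\mathbb R^d\times\mathbb R^d\to\mathbb R$ and all $n\ge 2$ (with $0<\sigma_{\max}<\infty$). If $\nu\in(2,3]$ and $\{\phi_k\}_{k\ge1},\{\lambda_k\}_{k\ge1}$ are such that $\varepsilon_{K;\nu}\to0$ as $K\to\infty$, then $$\sup_{t\in\mathbb R}\Big|\mathbb P\Big(\tfrac{\sqrt{n(n-1)}}{\sigma_{\max}}D_n>t\Big)-\lim_{K\to\infty}\mathbb P\Big(\tfrac{\sqrt{n(n-1)}}{\sigma_{\max}}U_n^K>t\Big)\Big|\le C\,n^{-\frac{\nu-2}{4\nu+2}}\Big(\frac{(M_{\mathrm{full};\nu})^\nu}{\sigma_{\max}^\nu}+\frac{((n-1)^{1/2}M_{\mathrm{cond};\nu})^\nu}{\sigma_{\max}^\nu}\Big)^{\frac1{2\nu+1}}\le 2^{\frac1{2\nu+1}}C\,n^{-\frac{\nu-2}{4\nu+2}}\Big(\frac{M_{\max;\nu}}{\sigma_{\max}}\Big)^{\frac{\nu}{2\nu+1}}.$$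
   Context: Let $\mathbf X_1,\dots,\mathbf X_n$ be i.i.d. with law $R$ on $\mathbb R^d$, $D=\mathbb E[u(\mathbf X_1,\mathbf X_2)]$, and $D_n=\frac1{n(n-1)}\sum_{1\le i\ne j\le n}u(\mathbf X_i,\mathbf X_j)$. Write $\|Y\|_{L_\nu}=\mathbb E[|Y|^\nu]^{1/\nu}$. Define $M_{\mathrm{cond};\nu}=\|\mathbb E[u(\mathbf X_1,\mathbf X_2)|\mathbf X_2]-D\|_{L_\nu}$, $M_{\mathrm{full};\nu}=\|u(\mathbf X_1,\mathbf X_2)-D\|_{L_\nu}$, $\sigma_{\mathrm{cond}}=M_{\mathrm{cond};2}$, $\sigma_{\mathrm{full}}=M_{\mathrm{full};2}$, $\sigma_{\max}=\max\{\sigma_{\mathrm{full}},(n-1)^{1/2}\sigma_{\mathrm{cond}}\}$, $M_{\max;\nu}=\max\{M_{\mathrm{full};\nu},(n-1)^{1/2}M_{\mathrm{cond};\nu}\}$. For functions $\phi_k:\mathbb R^d\to\mathbb R$ (with $\mathbb E[\phi_k(\mathbf X_1)^2]<\infty$) and reals $\lambda_k$, $k\ge1$, let $\varepsilon_{K;\nu}=\big\|\sum_{k=1}^K\lambda_k\phi_k(\mathbf X_1)\phi_k(\mathbf X_2)-u(\mathbf X_1,\mathbf X_2)\big\|_{L_\nu}$. For $K\in\mathbb N$ let $\Lambda^K=\mathrm{diag}\{\lambda_1,\dots,\lambda_K\}$, $\phi^K(x)=(\phi_1(x),\dots,\phi_K(x))^\top$, $\mu^K=\mathbb E[\phi^K(\mathbf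 X_1)]$, $\Sigma^K=\mathrm{Cov}[\phi^K(\mathbf X_1)]$. With $\eta_i^K$ i.i.d. standard Gaussian vectors in $\mathbb R^K$, $$U_n^K=\frac1{n(n-1)}\sum_{1\le i\ne j\le n}(\eta_i^K)^\top(\Sigma^K)^{1/2}\Lambda^K(\Sigma^K)^{1/2}\eta_j^K+\frac2n\sum_{i=1}^n(\mu^K)^\top\Lambda^K(\Sigma^K)^{1/2}\eta_i^K+D.$$ *)

(* Defs.v *)
From HB Require Import structures.
From mathcomp Require Import all_boot all_order all_algebra.
From mathcomp Require Import all_classical all_reals all_analysis.

Set Implicit Arguments.
Unset Strict Implicit.
Unset Printing Implicit Defensive.

Import Order.TTheory GRing.Theory Num.Theory.
Import numFieldNormedType.Exports.

Local Open Scope classical_set_scope.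
Local Open Scope ring_scope.

(* R^d is d.-tuple R, whose sigma-algebra in the library is generated by the
   coordinate maps into R with its Borel sets, i.e. it is the Borel
   sigma-algebra of R^d. *)

Section Probability.
Context (dO : measure_display) (Omega : measurableType dO) (R : realType).
Variable P : probability Omega R.

Definition has_law (dT : measure_display) (T : measurableType dT)
    (Y : Omega -> T) (law : set T -> \bar R) : Prop :=
  forall A : set T, measurable A -> P (Y @^-1` A) = law A.

Definition mutually_independent (dT : measure_display) (T : measurableType dT)
    (I : finType) (Y : I -> Omega -> T) : Prop :=
  forall (J : {set I}) (A : I -> set T),
    (forall i, i \in J -> measurable (A i)) ->
    P (\bigcap_(i in [set` J]) (Y i @^-1` A i)) =
    (\prod_(i in J) fine (P (Y i @^-1` A i)))%:E.

Definition std_gaussian_vector (K : nat) (Y : Omega -> K.-tuple R) : Prop :=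
  mutually_independent (fun (k : 'I_K) w => tnth (Y w) k) /\
  forall k : 'I_K, has_law (fun w => tnth (Y w) k) (normal_prob 0 1).

(* Z is a version of E[Y | X]: it is measurable with respect to sigma(X),
   integrable, and has the same integral as Y on every event of sigma(X). *)
Definition is_cond_expectation (dT : measure_display) (T : measurableType dT)
    (Y : Omega -> R) (X : Omega -> T) (Z : Omega -> R) : Prop :=
  [/\ measurable_fun [set: g_sigma_algebra_preimageType X] Z,
      P.-integrable [set: Omega] (EFin \o Z) &
      forall A : set Omega, g_sigma_algebra_preimage X A ->
        (\int[P]_(w in A) (Z w)%:E = \int[P]_(w in A) (Y w)%:E)%E].

(* An arbitrary version; the zero function if there is none, which does not
   happen when Y is integrable. *)
Definition cond_expectation (dT : measure_display) (T : measurableType dT)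
    (Y : Omega -> R) (X : Omega -> T) : Omega -> R :=
  xget (cst 0) [set Z | is_cond_expectation Y X Z].

Definition mean_vec (K : nat) (Y : Omega -> 'cV[R]_K) : 'cV[R]_K :=
  \col_k fine ('E_P[fun w => Y w k ord0]).

Definition cov_mx (K : nat) (Y : Omega -> 'cV[R]_K) : 'M[R]_K :=
  \matrix_(k, l)
    fine (covariance P (fun w => Y w k ord0) (fun w => Y w l ord0)).

End Probability.

Definition is_psd_sqrtmx (R : realType) (K : nat) (A S : 'M[R]_K) : Prop :=
  [/\ S^T = S, forall v : 'cV[R]_K, 0 <= (v^T *m S *m v) ord0 ord0 &
      S *m S = A].

(* The positive semidefinite square root of a symmetric positive semidefinite
   matrix; 0 for a matrix that has none. *)
Definition psd_sqrtmx (R : realType) (K : nat) (A : 'M[R]_K) : 'M[R]_K :=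
  xget 0 [set S | is_psd_sqrtmx A S].

Section UStatistic.
Context (dO : measure_display) (Omega : measurableType dO) (R : realType)
  (d : nat).
Variables (P : probability Omega R) (u : d.-tuple R -> d.-tuple R -> R).

Definition U_stat (n : nat) (X : 'I_n -> Omega -> d.-tuple R) (w : Omega) : R :=
  (n%:R * (n%:R - 1))^-1 *
    \sum_(i < n) \sum_(j < n | i != j) u (X i w) (X j w).

Variables X1 X2 : Omega -> d.-tuple R.

Definition U_mean : R := fine ('E_P[fun w => u (X1 w) (X2 w)]).

(* The norms take values in \bar R and are +oo when the moment is infinite. *)
Definition M_cond (nu : R) : \bar R :=
  Lnorm P nu%:E (fun w =>
    (cond_expectation P (fun w' => u (X1 w') (X2 w')) X2 w - U_mean)%:E).

Definition M_full (nu : R) : \bar R :=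
  Lnorm P nu%:E (fun w => (u (X1 w) (X2 w) - U_mean)%:E).

Definition sigma_cond : \bar R := M_cond 2.

Definition sigma_full : \bar R := M_full 2.

Definition sigma_max (n : nat) : \bar R :=
  Order.max sigma_full ((Num.sqrt (n%:R - 1))%:E * sigma_cond)%E.

Definition M_max (n : nat) (nu : R) : \bar R :=
  Order.max (M_full nu) ((Num.sqrt (n%:R - 1))%:E * M_cond nu)%E.

(* Sequences indexed by k >= 1 are shifted to start at 0, so that the first K
   terms are those of index k < K. *)
Variables (phi : nat -> d.-tuple R -> R) (lam : nat -> R).

Definition eps_approx (K : nat) (nu : R) : \bar R :=
  Lnorm P nu%:E (fun w =>
    (\sum_(k < K) lam k * phi k (X1 w) * phi k (X2 w)
      - u (X1 w) (X2 w))%:E).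

Definition phi_vec (K : nat) (x : d.-tuple R) : 'cV[R]_K := \col_(k < K) phi k x.

Definition Lambda_mx (K : nat) : 'M[R]_K := diag_mx (\row_(k < K) lam k).

Definition mu_vec (K : nat) : 'cV[R]_K := mean_vec P (phi_vec K \o X1).

Definition Sigma_mx (K : nat) : 'M[R]_K := cov_mx P (phi_vec K \o X1).

(* The Gaussian vectors may live on a probability space of their own. *)
Definition U_gauss (Omega' : Type) (n K : nat)
    (eta : 'I_n -> Omega' -> K.-tuple R) (w : Omega') : R :=
  let S := psd_sqrtmx (Sigma_mx K) in
  let L := Lambda_mx K in
  let z (i : 'I_n) : 'cV[R]_K := \col_k tnth (eta i w) k in
  (n%:R * (n%:R - 1))^-1 *
    \sum_(i < n) \sum_(j < n | i != j)
      ((z i)^T *m S *m L *m S *m z j) ord0 ord0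
  + 2 / n%:R * \sum_(i < n) ((mu_vec K)^T *m L *m S *m z i) ord0 ord0
  + U_mean.

End UStatistic.

(* Main.v *)
Require Import Defs.
From HB Require Import structures.
From mathcomp Require Import all_boot all_order all_algebra.
From mathcomp Require Import all_classical all_reals all_analysis.
From mathcomp Require Import measurable_realfun.
From mathcomp Require Import zify ring lra.
From mathcomp Require spectral complex.

(** Let a = sqrt (n (n - 1)) / sigma_max. Replacing u by its truncated expansion
    and centring the features turns a D_n into a polynomial of degree two
    ([qform]) in n independent centred vectors, and a U_n^K is the same
    polynomial at Gaussian vectors with the same covariance. Two facts compare
    the laws of these polynomials.

    Replacement. The polynomial is affine in each vector, so the method of
    Lindeberg exchanges data for Gaussian vectors one at a time: for a test
    function that rises from 0 to 1 on an interval of length 3 delta, the first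
    two moments cancel and an exchange costs delta^(-nu) times the moment of order
    nu of a linear form whose coefficient is itself a sum of independent centred
    vectors. A moment inequality for such sums bounds the total cost by
    delta^(-nu) kappa up to a constant ([gauss_replacement],
    [fixed_gauss_replacement]), where kappa is n^(1 - nu/2) sigma_max^(-nu) times
    the sum of the powers of the full norm and of the conditional norm multiplied
    by sqrt (n - 1). The constants do not depend on K since every estimate
    concerns linear forms and never single coordinates.

    Anti-concentration. The Gaussian polynomial Q has variance bounded below, by
    the choice of sigma_max and because second moments pass to the truncated
    kernel ([gauss_variance_ge1]). Its characteristic function is bounded by
    squaring: for two independent Gaussian samples x and y, rotated by 45
    degrees, the difference of the values of Q is bilinear, hence Gaussian given
    one of them ([charfun_sqr_le]). The resulting decay like the inverse square
    root, tested against the kernel of Fejer, shows that Q lies in an interval of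
    length delta with probability at most of the order of sqrt delta
    ([anti_concentration]).

    Smoothing the indicator of a half line at scale delta then costs
    delta^(-nu) kappa + sqrt delta; the choice delta = kappa^(2 / (2 nu + 1)) gives
    kappa^(1 / (2 nu + 1)), which is the stated rate ([data_gauss_close]). Between
    two truncation orders there is no replacement to pay for: the smoothed
    probabilities differ by the approximation errors alone, while the
    anti-concentration bound is uniform in K. So the probabilities for the
    Gaussian polynomials form a Cauchy sequence, uniformly in t
    ([gauss_prob_cauchy]), and the bound passes to their limit. *)

Set Implicit Arguments.
Unset Strict Implicit.
Unset Printing Implicit Defensive.

Import Order.TTheory GRing.Theory Num.Theory.
Import numFieldNormedType.Exports.

Local Open Scope classical_set_scope.
Local Open Scope ring_scope.

(** * Bounded functions and powers of a probability *)

Section BoundedMeasurable.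
Context (d : measure_display) (T : measurableType d) (R : realType).

(** Bounded functions serve as test functions throughout: inner integrals of a
    bounded measurable function are again such, so Fubini applies freely. *)
Definition bmeas (f : T -> R) : Prop :=
  measurable_fun setT f /\ exists M : R, forall x, `|f x| <= M.

Lemma bmeas_integrable (m : probability T R) (f : T -> R) :
  bmeas f -> m.-integrable setT (EFin \o f).
Proof.
move=> [mf [M fM]]; apply: measurable_bounded_integrable => //.
  by rewrite /= probability_setT ltry.
exists M; split; first exact: num_real.
by move=> x Mx y _ /=; exact: le_trans (fM y) (ltW Mx).
Qed.

Lemma Rintegral_fine (m : probability T R) (f : T -> R) :
  m.-integrable setT (EFin \o f) ->
  ((\int[m]_x f x)%R%:E = \int[m]_x (f x)%:E)%E.
Proof. by move=> fi; rewrite fineK // integrable_fin_num. Qed.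

Lemma Rintegral_bound (m : probability T R) (f : T -> R) (M : R) :
  measurable_fun setT f -> (forall x, `|f x| <= M) -> `|\int[m]_x f x| <= M.
Proof.
move=> mf fM.
have fi : m.-integrable setT (EFin \o f) by apply: bmeas_integrable; split=> //; exists M.
apply: le_trans (le_normr_Rintegral _ fi) _ => //.
have -> : M = \int[m]_(x in setT) (fun=> M) x.
  by rewrite Rintegral_cst//= probability_setT mulr1.
apply: le_Rintegral => //; first exact: integrable_norm.
apply: bmeas_integrable; split; first exact: measurable_cst.
by exists `|M|.
Qed.

End BoundedMeasurable.

Section BoundedFubini.
Context (d1 d2 : measure_display) (T1 : measurableType d1)
  (T2 : measurableType d2) (R : realType).
Variables (m1 : probability T1 R) (m2 : probability T2 R).

Lemma bmeas_inner (f : T1 * T2 -> R) : bmeas f ->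
  bmeas (fun x => \int[m2]_y f (x, y)).
Proof.
move=> bf; case: (bf) => mf [M fM]; split; last first.
  exists M => x; apply: Rintegral_bound; last by [].
  exact: measurableT_comp.
have fi : (m1 \x m2)%E.-integrable setT (EFin \o f).
  exact: (@bmeas_integrable _ _ _ (m1 \x m2)%E).
apply/measurable_EFinP.
have := measurable_fubini_F fi.
apply: eq_measurable_fun => x _ /=.
rewrite /fubini_F Rintegral_fine//.
by apply: bmeas_integrable; split; [exact: measurableT_comp|exists M].
Qed.

Lemma Fubini_bmeas1 (f : T1 * T2 -> R) : bmeas f ->
  \int[(m1 \x m2)%E]_z f z = \int[m1]_x \int[m2]_y f (x, y).
Proof.
move=> bf; have fi := @bmeas_integrable _ _ _ (m1 \x m2)%E _ bf.
have bF := bmeas_inner bf.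
case: (bf) => mf [M fM].
apply: EFin_inj; rewrite !Rintegral_fine//; last exact: bmeas_integrable.
rewrite -integral12_prod_meas1//; apply: eq_integral => x _.
rewrite /fubini_F Rintegral_fine//.
by apply: bmeas_integrable; split; [exact: measurableT_comp|exists M].
Qed.

End BoundedFubini.

Section BoundedFubini2.
Context (d1 d2 : measure_display) (T1 : measurableType d1)
  (T2 : measurableType d2) (R : realType).
Variables (m1 : probability T1 R) (m2 : probability T2 R).

Lemma bmeas_swap (f : T1 * T2 -> R) : bmeas f -> bmeas (fun z => f (z.2, z.1)).
Proof.
move=> [mf [M fM]]; split; last by exists M.
by apply: measurableT_comp => //; exact: measurable_swap.
Qed.

Lemma Fubini_bmeas (f : T1 * T2 -> R) : bmeas f ->
  \int[m1]_x \int[m2]_y f (x, y) = \int[m2]_y \int[m1]_x f (x, y).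
Proof.
move=> bf; have fi := @bmeas_integrable _ _ _ (m1 \x m2)%E _ bf.
have bF := @bmeas_inner _ _ _ _ _ m1 m2 _ bf.
have bG := @bmeas_inner _ _ _ _ _ m2 m1 _ (bmeas_swap bf).
case: (bf) => mf [M fM].
apply: EFin_inj; rewrite !Rintegral_fine//; try exact: bmeas_integrable.
transitivity (\int[m1]_x \int[m2]_y ((EFin \o f) (x, y)))%E.
  apply: eq_integral => x _; rewrite Rintegral_fine//.
  by apply: bmeas_integrable; split; [exact: measurableT_comp|exists M].
rewrite Fubini//; apply: eq_integral => y _; rewrite Rintegral_fine//.
by apply: bmeas_integrable; split; [exact: measurableT_comp|exists M].
Qed.
End BoundedFubini2.

Section MeasurableInner.
Context (d1 d2 : measure_display) (T1 : measurableType d1)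
  (T2 : measurableType d2) (R : realType).
Local Open Scope ereal_scope.

Lemma measurable_inner (m2 : {sigma_finite_measure set T2 -> \bar R})
    (F : T1 * T2 -> \bar R) : measurable_fun setT F -> (forall z, 0 <= F z) ->
  measurable_fun setT (fun x => \int[m2]_y F (x, y)).
Proof. by move=> mF F0; exact: (@measurable_fun_fubini_tonelli_F _ _ _ _ _ m2 F mF F0). Qed.

Lemma measurable_inner2 (m1 : {sigma_finite_measure set T1 -> \bar R})
    (F : T1 * T2 -> \bar R) : measurable_fun setT F -> (forall z, 0 <= F z) ->
  measurable_fun setT (fun y => \int[m1]_x F (x, y)).
Proof. by move=> mF F0; exact: (@measurable_fun_fubini_tonelli_G _ _ _ _ _ m1 F mF F0). Qed.

Lemma tonelli_swap (m1 : {sigma_finite_measure set T1 -> \bar R})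
    (m2 : {sigma_finite_measure set T2 -> \bar R}) (f : T1 -> T2 -> \bar R) :
  measurable_fun setT (fun z => f z.1 z.2) -> (forall x y, 0 <= f x y) ->
  \int[m1]_x \int[m2]_y f x y = \int[m2]_y \int[m1]_x f x y.
Proof.
by move=> mf f0; exact: (@fubini_tonelli _ _ _ _ _ m1 m2 (fun z => f z.1 z.2)).
Qed.

End MeasurableInner.

Section PowerMeasure.
Context (d : measure_display) (T : measurableType d) (R : realType).
Variable m : probability T R.

Definition tcons (n : nat) (z : T * n.-tuple T) : n.+1.-tuple T :=
  [the n.+1.-tuple T of z.1 :: z.2].

Lemma measurable_tcons (n : nat) : measurable_fun setT (@tcons n).
Proof. exact: measurable_cons. Qed.

HB.instance Definition _ n :=
  isMeasurableFun.Build _ _ _ _ (@tcons n) (@measurable_tcons n).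

(** Defined by recursion on the length, so that inductions peel off one factor at
    a time. *)
Fixpoint pow (n : nat) : probability (n.-tuple T) R :=
  match n with
  | 0 => [the probability _ _ of @dirac _ (0.-tuple T) [tuple] R]
  | k.+1 => [the probability _ _ of
      distribution (m \x pow k)%E [the {mfun _ >-> _} of @tcons k]]
  end.

Lemma ge0_integral_powS (n : nat) (F : n.+1.-tuple T -> \bar R) :
  measurable_fun setT F -> (forall x, 0 <= F x)%E ->
  (\int[pow n.+1]_t F t = \int[m]_x \int[pow n]_t F (tcons (x, t)))%E.
Proof.
move=> mF F0 /=; rewrite ge0_integral_distribution//.
have mFt : measurable_fun setT (F \o @tcons n).
  exact: measurableT_comp mF (@measurable_tcons n).
by rewrite fubini_tonelli1//= => x; exact: F0.
Qed.

Lemma ge0_integral_powS2 (n : nat) (F : n.+1.-tuple T -> \bar R) :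
  measurable_fun setT F -> (forall x, 0 <= F x)%E ->
  (\int[pow n.+1]_t F t = \int[pow n]_t \int[m]_x F (tcons (x, t)))%E.
Proof.
move=> mF F0 /=; rewrite ge0_integral_distribution//.
have mFt : measurable_fun setT (F \o @tcons n).
  exact: measurableT_comp mF (@measurable_tcons n).
by rewrite fubini_tonelli2//= => x; exact: F0.
Qed.

Lemma bmeas_comp d' (T' : measurableType d') (g : T' -> T) (f : T -> R) :
  measurable_fun setT g -> bmeas f -> bmeas (f \o g).
Proof.
move=> mg [mf [M fM]]; split; first exact: measurableT_comp.
by exists M => x /=.
Qed.

End PowerMeasure.

(** * Joint laws of independent families *)

Section PowerMeasureUnique.
Context (d : measure_display) (T : measurableType d) (R : realType).
Variable m : probability T R.

Definition rect (n : nat) (A : 'I_n -> set T) : set (n.-tuple T) :=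
  [set t | forall i, A i (tnth t i)].

Lemma measurable_rect n (A : 'I_n -> set T) :
  (forall i, measurable (A i)) -> measurable (rect A).
Proof.
move=> mA.
rewrite (_ : rect A = \bigcap_(i in [set` [set: 'I_n]]) ((@tnth n T)^~ i @^-1` A i)).
  apply: fin_bigcap_measurable => // i _.
  by rewrite -[X in measurable X]setTI; exact: measurable_tnth.
apply/seteqP; split => t /=.
  by move=> H i _; exact: H.
by move=> H i; apply: H; rewrite /= inE.
Qed.

Lemma pow_rect n (A : 'I_n -> set T) : (forall i, measurable (A i)) ->
  pow m n (rect A) = (\prod_(i < n) fine (m (A i)))%:E.
Proof.
elim: n A => [|n IH] A mA /=.
  rewrite big_ord0 diracE mem_set//; by case.
rewrite big_ord_recl EFinM fineK ?fin_num_measure//.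
rewrite -(IH (fun i => A (lift ord0 i)))//.
rewrite -product_measure1E//; last exact: measurable_rect.
rewrite /distribution /pushforward; congr (product_measure1 _ _ _).
apply/seteqP; split => -[x t] /=.
  move=> H; split; first by have := H ord0; rewrite tnth0.
  by move=> i; have := H (lift ord0 i); rewrite tnthS.
move=> [H0 H1] i; case: (unliftP ord0 i) => [j ->|->].
  by rewrite tnthS; exact: H1.
by rewrite tnth0.
Qed.

(** Rectangles form a generating class stable under intersection. *)
Lemma pow_unique n (mu : {measure set (n.-tuple T) -> \bar R}) :
  (forall A : 'I_n -> set T, (forall i, measurable (A i)) ->
    mu (rect A) = (\prod_(i < n) fine (m (A i)))%:E) ->
  forall B, measurable B -> mu B = pow m n B.
Proof.
move=> muR B mB.
pose G := [set B | exists2 A : 'I_n -> set T, (forall i, measurable (A i)) & B = rect A].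
have rT : rect (fun=> setT) = setT :> set (n.-tuple T).
  by apply/seteqP; split => t.
apply: (measure_unique G (fun=> setT)) => //.
- rewrite /measurable/=; apply/seteqP; split => X.
    apply: smallest_sub; first exact: smallest_sigma_algebra.
    rewrite -bigcup_seq => Y [i _ [C mC <-]] /=.
    apply: sub_sigma_algebra => /=.
    exists (fun j => if j == i then C else setT).
      by move=> j; case: ifP.
    rewrite setTI; apply/seteqP; split => t /=.
      by move=> Ct j; case: eqP => // ->.
    by move=> /(_ i); rewrite eqxx.
  apply: smallest_sub; first exact: sigma_algebra_measurable.
  by move=> _ [A mA ->]; exact: measurable_rect.
- move=> _ _ [A mA ->] [A' mA' ->].
  exists (fun i => A i `&` A' i); first by move=> i; exact: measurableI.
  apply/seteqP; split => t /=; first by move=> [H1 H2] i; split.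
  by move=> H; split => i; have [] := H i.
- by move=> _; exists (fun=> setT).
- by rewrite bigcup_const.
- by move=> _ [A mA ->]; rewrite muR//; exact/esym/pow_rect.
- move=> _; rewrite -rT muR// ltry//.
Qed.

End PowerMeasureUnique.

Section LawOfTuple.
Context (dO d : measure_display) (Omega : measurableType dO)
  (T : measurableType d) (R : realType).
Variables (P : probability Omega R) (m : probability T R).

Lemma measurable_mktuple n (Y : 'I_n -> {mfun Omega >-> T}) :
  measurable_fun setT (fun w => [tuple Y i w | i < n]).
Proof.
apply/measurable_fun_tnthP => i.
rewrite (_ : _ \o _ = Y i)//; apply/funext => w /=.
by rewrite tnth_mktuple.
Qed.

(** Independence gives the values on rectangles, which determine the law. *)
Lemma law_mktuple n (Y : 'I_n -> {mfun Omega >-> T}) :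
  mutually_independent P (fun i => Y i : Omega -> T) ->
  (forall i, has_law P (Y i) m) ->
  forall B, measurable B ->
    P [set w | B [tuple Y i w | i < n]] = pow m n B.
Proof.
move=> Yi Yl B mB.
pose Y' : Omega -> n.-tuple T := fun w => [tuple Y i w | i < n].
pose Ym := isMeasurableFun.Build _ _ _ _ Y' (@measurable_mktuple n Y).
pose Yf : {mfun Omega >-> n.-tuple T} := HB.pack Y' Ym.
have := @pow_unique _ _ _ m n (distribution P Yf) _ _ mB.
apply => A mA.
have := Yi [set: 'I_n]%SET A (fun i _ => mA i).
rewrite (_ : \bigcap_(i in [set` _]) _ = Y' @^-1` rect A); last first.
  apply/seteqP; split => w /=.
    by move=> H i; rewrite tnth_mktuple; apply: H; rewrite /= inE.
  by move=> H i _; have := H i; rewrite tnth_mktuple.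
move=> E; apply: (etrans E); congr (_%:E); rewrite big_mkcond/=.
by apply: eq_bigr => i _; rewrite inE Yl.
Qed.

Lemma law_pair n (Y : 'I_n -> {mfun Omega >-> T}) (i j : 'I_n) : i != j ->
  mutually_independent P (fun i => Y i : Omega -> T) ->
  (forall i, has_law P (Y i) m) ->
  forall B : set (T * T), measurable B ->
    P [set w | B (Y i w, Y j w)] = (m \x m)%E B.
Proof.
move=> ij Yi Yl B mB.
pose Y' : Omega -> T * T := fun w => (Y i w, Y j w).
have mY' : measurable_fun setT Y' by apply/measurable_fun_pairP; split.
pose Ym := isMeasurableFun.Build _ _ _ _ Y' mY'.
pose Yf : {mfun Omega >-> (T * T)%type} := HB.pack Y' Ym.
have := @product_measure_unique _ _ _ _ _ m m (distribution P Yf) _ B mB.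
move=> -> // A1 A2 mA1 mA2.
have := Yi [set i; j]%SET (fun k => if k == i then A1 else A2).
rewrite (_ : \bigcap_(i in [set` _]) _ = Y' @^-1` (A1 `*` A2)); last first.
  apply/seteqP; split => w /=.
    move=> H; split.
      by have := H i; rewrite eqxx; apply; rewrite /= !inE eqxx.
    by have := H j; rewrite eq_sym (negbTE ij); apply; rewrite /= !inE eqxx orbT.
  move=> [H1 H2] k; rewrite /= !inE => /orP[/eqP->|/eqP->].
    by rewrite eqxx.
  by rewrite eq_sym (negbTE ij).
move=> E; apply: (etrans (E _)); first by move=> k _; case: ifP.
rewrite big_setU1/=; last by rewrite inE.
rewrite big_set1 eqxx eq_sym (negbTE ij) !Yl//.
by rewrite EFinM !fineK// fin_num_measure.
Qed.

End LawOfTuple.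

(** * Affine changes of variable *)

Section LebesgueAffine.
Context {R : realType}.
Local Notation mu := (@lebesgue_measure R).

Let aff (a b : R) : measurableTypeR R -> measurableTypeR R := fun x => a * x + b.

Let measurable_aff a b : measurable_fun setT (aff a b).
Proof.
apply: measurable_funD => //; exact: measurable_funM.
Qed.

Lemma lebesgue_measure_affine (a b : R) (A : set (measurableTypeR R)) :
  a != 0 -> measurable A ->
  mu A = (`|a|%:E * mu (aff a b @^-1` A))%E.
Proof.
move=> a0 mA.
pose fm := isMeasurableFun.Build _ _ _ _ (aff a b) (measurable_aff a b).
pose ff : {mfun measurableTypeR R >-> measurableTypeR R} := HB.pack (aff a b) fm.
pose nu := mscale (NngNum (normr_ge0 a)) (pushforward mu ff).
transitivity (nu (measurable_aff a b) A); last by [].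
apply: lebesgue_measure_unique => // _ [[x y]] /= _ <-.
rewrite /nu /mscale /= /pushforward.
have [ap|an|] := ltgtP 0 a; last by move=> /eqP; rewrite eq_sym (negbTE a0).
- rewrite (_ : ff @^-1` _ = `](x - b) / a, (y - b) / a]%classic); last first.
    apply/seteqP; split => z /=; rewrite /aff !in_itv/=;
      by rewrite ltr_pdivrMr// ler_pdivlMr// ltrBlDr lerBrDr mulrC.
  rewrite !lebesgue_measure_itv/= !lte_fin gtr0_norm// ltr_pM2r ?invr_gt0//.
  rewrite ltrD2r; case: ifP => _; last by rewrite mule0.
  rewrite -EFinB -EFinM; congr EFin; field.
  by rewrite gt_eqF.
- rewrite (_ : ff @^-1` _ = `[(y - b) / a, (x - b) / a[%classic); last first.
    apply/seteqP; split => z /=; rewrite /aff !in_itv/=;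
      by rewrite ltr_ndivlMr// ler_ndivrMr// ltrBlDr lerBrDr mulrC andbC.
  rewrite !lebesgue_measure_itv/= !lte_fin ltr0_norm// ltr_nM2r ?invr_lt0//.
  rewrite ltrD2r; case: ifP => _; last by rewrite mule0.
  rewrite -EFinB -EFinM; congr EFin; field.
  by rewrite lt_eqF.
Qed.

Lemma ge0_integral_affine (a b : R) (f : R -> \bar R) : a != 0 ->
  measurable_fun setT f -> (forall x, 0 <= f x)%E ->
  (\int[mu]_x f x = `|a|%:E * \int[mu]_x f (a * x + b)%R)%E.
Proof.
move=> a0 mf f0.
pose fm := isMeasurableFun.Build _ _ _ _ (aff a b) (measurable_aff a b).
pose ff : {mfun measurableTypeR R >-> measurableTypeR R} := HB.pack (aff a b) fm.
pose nu := mscale (NngNum (normr_ge0 a)) (pushforward mu ff).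
transitivity (\int[nu (measurable_aff a b)]_x f x)%E.
  by apply: eq_measure_integral => A mA _; exact: lebesgue_measure_affine.
rewrite ge0_integral_mscale//=; congr (_ * _)%E.
rewrite ge0_integral_pushforward//.
Qed.

Lemma ge0_integral_normal (m s : R) (f : R -> \bar R) :
  measurable_fun setT f -> (forall x, 0 <= f x)%E ->
  (\int[normal_prob m s]_x f x = \int[mu]_x (f x * (normal_pdf m s x)%:E))%E.
Proof.
move=> mf f0.
rewrite -(Radon_Nikodym_SigmaFinite.change_of_variables (normal_prob_dominates m s))//=.
apply: ae_eq_integral => //.
- apply: emeasurable_funM => //.
  exact: (measurable_int mu (Radon_Nikodym_SigmaFinite.f_integrable (normal_prob_dominates m s))).
- apply: emeasurable_funM => //; apply/measurable_EFinP; exact: measurable_normal_pdf.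
- apply: ae_eqe_mul2l => /=.
  apply: integral_ae_eq => //=.
  + apply: Radon_Nikodym_SigmaFinite.f_integrable; exact: normal_prob_dominates.
  + by apply/measurable_EFinP; exact: measurable_normal_pdf.
  + move=> E _ mE; rewrite -Radon_Nikodym_SigmaFinite.f_integral//.
    exact: normal_prob_dominates.
Qed.

End LebesgueAffine.

(** * Rotation invariance of the normal law *)

Section NormalRotation.
Context {R : realType}.
Local Notation mu := (@lebesgue_measure R).
Local Notation N01 := (@normal_prob R 0 1).

Lemma normal_pdf01E (x : R) : normal_pdf 0 1 x = normal_peak 1 * expR (- x ^+ 2 / 2).
Proof.
by rewrite normal_pdfE ?oner_eq0// /normal_fun subr0 expr1n.
Qed.

Let q (z : R * R) : R := normal_pdf 0 1 z.1 * normal_pdf 0 1 z.2.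

Let q_rot (c s x y : R) : c ^+ 2 + s ^+ 2 = 1 ->
  q (c * x + s * y, - s * x + c * y) = q (x, y).
Proof.
move=> cs; rewrite /q /= !normal_pdf01E [LHS]mulrACA [RHS]mulrACA -!expRD; congr (_ * expR _).
have -> : - (c * x + s * y) ^+ 2 / 2 + - (- s * x + c * y) ^+ 2 / 2 =
  (c ^+ 2 + s ^+ 2) * (- x ^+ 2 / 2 + - y ^+ 2 / 2) by ring.
by rewrite cs mul1r.
Qed.

Let measurable_q : measurable_fun setT q.
Proof.
by apply: measurable_funM; apply: measurableT_comp => //; exact: measurable_normal_pdf.
Qed.

Lemma ge0_integral_normal2 (F : R * R -> \bar R) :
  measurable_fun setT F -> (forall z, 0 <= F z)%E ->
  (\int[N01]_x \int[N01]_y F (x, y) =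
   \int[mu]_x \int[mu]_y (F (x, y) * (q (x, y))%:E))%E.
Proof.
move=> mF F0.
have mG : measurable_fun setT (fun x => \int[N01]_y F (x, y))%E.
  exact: measurable_inner.
rewrite ge0_integral_normal//; last by move=> x; exact: integral_ge0.
apply: eq_integral => x _.
have mFx : measurable_fun setT (fun y => F (x, y)) by exact: measurableT_comp.
rewrite ge0_integral_normal// -ge0_integralZr//.
- apply: eq_integral => y _.
  by rewrite -muleA -EFinM [X in (_ * X%:E)%E]mulrC.
- apply: emeasurable_funM => //; apply/measurable_EFinP; exact: measurable_normal_pdf.
- by move=> y _; rewrite mule_ge0// lee_fin normal_pdf_ge0.
- by rewrite lee_fin normal_pdf_ge0.
Qed.

Lemma ge0_integral_affineV (a b : R) (f : R -> \bar R) : a != 0 ->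
  measurable_fun setT f -> (forall x, 0 <= f x)%E ->
  (\int[mu]_x f (a * x + b)%R = `|a|^-1%:E * \int[mu]_x f x)%E.
Proof.
move=> a0 mf f0; rewrite [in RHS](ge0_integral_affine b a0 mf f0).
by rewrite muleA -EFinM mulVf ?normr_eq0// mul1e.
Qed.

(** For c <> 0, substituting u = c x + s y at fixed y and then
    v = y / c - (s / c) u at fixed u are affine changes of one variable whose
    factors cancel; for c = 0 the rotation exchanges the coordinates up to sign. *)
Lemma lebesgue_rotation (c s : R) (K : R * R -> \bar R) :
  c ^+ 2 + s ^+ 2 = 1 ->
  measurable_fun setT K -> (forall z, 0 <= K z)%E ->
  (\int[mu]_x \int[mu]_y K (c * x + s * y, - s * x + c * y)%R =
   \int[mu]_x \int[mu]_y K (x, y))%E.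
Proof.
move=> cs mK K0.
have mpair (f g : R * R -> R) : measurable_fun setT f -> measurable_fun setT g ->
    measurable_fun setT (fun z => K (f z, g z)).
  move=> mf mg; apply: (measurableT_comp mK).
  by apply/measurable_fun_pairP; split.
have mlin (a b : R) : measurable_fun setT (fun z : R * R => a * z.1 + b * z.2).
  by apply: measurable_funD => //; apply: measurable_funM.
have [c0|c0] := eqVneq c 0.
  have s2 : s ^+ 2 = 1 by rewrite -cs c0 expr0n add0r.
  have s0 : s != 0 by apply/eqP => s0; move: s2; rewrite s0 expr0n => /eqP; rewrite eq_sym oner_eq0.
  have s1 : `|s|^-1 = 1.
    by have /eqP := s2; rewrite -[s ^+ 2]real_normK ?num_real// sqrp_eq1// => /eqP ->; rewrite invr1.
  transitivity (\int[mu]_x \int[mu]_y K (y, - s * x)%R)%E.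
    apply: eq_integral => x _.
    have mKx : measurable_fun setT (fun y : R => K (y, - s * x)).
      by apply: (measurableT_comp mK); exact: pair2_measurable.
    have := @ge0_integral_affineV s 0 _ s0 mKx (fun=> K0 _).
    rewrite s1 mul1e => <-; apply: eq_integral => y _; congr K; congr pair.
      by rewrite c0 mul0r add0r addr0.
    by rewrite c0 mul0r addr0.
  rewrite (tonelli_swap mu mu (f := fun x y => K (y, - s * x))); last 2 first.
  - by apply: mpair; [exact: measurable_snd|apply: measurable_funM].
  - by move=> x y; exact: K0.
  apply: eq_integral => y _.
  have mKy : measurable_fun setT (fun x : R => K (y, x)).
    exact: measurableT_comp.
  have ms0 : - s != 0 by rewrite oppr_eq0.
  have := @ge0_integral_affineV (- s) 0 _ ms0 mKy (fun=> K0 _).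
  rewrite normrN s1 mul1e => <-; apply: eq_integral => x _.
  by rewrite addr0.
rewrite (tonelli_swap mu mu
  (f := fun x y => K (c * x + s * y, - s * x + c * y))); last 2 first.
- by apply: mpair; exact: mlin.
- by move=> x y; exact: K0.
transitivity (\int[mu]_y (`|c|^-1%:E * \int[mu]_u K (u, (c^-1 * y + - (s / c) * u)%R)))%E.
  apply: eq_integral => y _.
  have mKy : measurable_fun setT (fun u : R => K (u, c^-1 * y + - (s / c) * u)).
    apply: (measurableT_comp mK); apply: measurable_fun_pair => //.
    by apply: measurable_funD => //; apply: measurable_funM.
  rewrite -(@ge0_integral_affineV c (s * y) _ c0 mKy (fun=> K0 _)).
  apply: eq_integral => x _; congr K; congr pair.
  transitivity (c^-1 * y * (c ^+ 2 + s ^+ 2) - s / c * (c * x + s * y)).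
    by field.
  by rewrite cs mulr1 mulNr.
have mK2 : measurable_fun setT (fun z : R * R => K (z.2, c^-1 * z.1 + - (s / c) * z.2)).
  exact: mpair.
rewrite ge0_integralZl//; last 2 first.
  exact: (measurable_inner mu mK2 (fun=> K0 _)).
  by move=> y _; exact: integral_ge0.
rewrite (tonelli_swap mu mu (f := fun y u => K (u, c^-1 * y + - (s / c) * u)))//.
rewrite -ge0_integralZl//; last 2 first.
  exact: (measurable_inner2 mu mK2 (fun=> K0 _)).
  by move=> y _; exact: integral_ge0.
apply: eq_integral => u _.
have mKu : measurable_fun setT (fun v : R => K (u, v)) by exact: measurableT_comp.
have ci0 : c^-1 != 0 by rewrite invr_eq0.
rewrite (@ge0_integral_affineV c^-1 (- (s / c) * u) _ ci0 mKu (fun=> K0 _)).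
by rewrite normfV invrK muleA -EFinM mulVf ?normr_eq0// mul1e.
Qed.

(** The density of the pair only depends on the distance to the origin. *)
Lemma normal_rotation (c s : R) (F : R * R -> \bar R) :
  c ^+ 2 + s ^+ 2 = 1 ->
  measurable_fun setT F -> (forall z, 0 <= F z)%E ->
  (\int[N01]_x \int[N01]_y F (c * x + s * y, - s * x + c * y)%R =
   \int[N01]_x \int[N01]_y F (x, y))%E.
Proof.
move=> cs mF F0.
pose K z := (F z * (q z)%:E)%E.
have K0 z : (0 <= K z)%E.
  by rewrite mule_ge0// lee_fin mulr_ge0// normal_pdf_ge0.
have mK : measurable_fun setT K.
  by apply: emeasurable_funM => //; exact/measurable_EFinP.
have mlin (a b : R) : measurable_fun setT (fun z : R * R => a * z.1 + b * z.2).
  by apply: measurable_funD => //; apply: measurable_funM.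
rewrite (@ge0_integral_normal2 (fun z => F (c * z.1 + s * z.2, - s * z.1 + c * z.2)))//; last first.
  by apply: (measurableT_comp mF); apply: measurable_fun_pair; exact: mlin.
rewrite (ge0_integral_normal2 mF F0).
apply: (etrans _ (lebesgue_rotation cs mK K0)).
by apply: eq_integral => x _; apply: eq_integral => y _; rewrite /K q_rot.
Qed.

Let idR : measurableTypeR R -> R := fun x => x.
Let measurable_idR : measurable_fun setT idR.
Proof. by move=> _ A mA; rewrite setTI; exact: mA. Qed.
Let mfun_idR : {mfun measurableTypeR R >-> R} :=
  HB.pack idR (isMeasurableFun.Build _ _ _ _ idR measurable_idR).

(** The standard normal law on the real line with its Borel sets; the measure
    [normal_prob 0 1] lives on the same sets under another display. *)
Definition stdnormal : probability R R :=
  [the probability _ _ of distribution N01 mfun_idR].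

Lemma stdnormalE (A : set R) : stdnormal A = N01 A.
Proof. by []. Qed.

Lemma ge0_integral_stdnormal_prob (f : R -> \bar R) :
  measurable_fun setT f -> (forall x, 0 <= f x)%E ->
  (\int[stdnormal]_x f x = \int[N01]_x f x)%E.
Proof. by move=> mf f0; rewrite ge0_integral_distribution. Qed.

Lemma ge0_integral_stdnormal (f : R -> \bar R) :
  measurable_fun setT f -> (forall x, 0 <= f x)%E ->
  (\int[stdnormal]_x f x = \int[mu]_x (f x * (normal_pdf 0 1 x)%:E))%E.
Proof. by move=> mf f0; rewrite ge0_integral_stdnormal_prob// ge0_integral_normal. Qed.

Lemma stdnormal_rotation (c s : R) (F : R * R -> \bar R) :
  c ^+ 2 + s ^+ 2 = 1 ->
  measurable_fun setT F -> (forall z, 0 <= F z)%E ->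
  (\int[stdnormal]_x \int[stdnormal]_y F (c * x + s * y, - s * x + c * y)%R =
   \int[stdnormal]_x \int[stdnormal]_y F (x, y))%E.
Proof.
move=> cs mF F0.
have mlin (a b : R) : measurable_fun setT (fun z : R * R => a * z.1 + b * z.2).
  by apply: measurable_funD => //; apply: measurable_funM.
have E (G : R * R -> \bar R) : measurable_fun setT G -> (forall z, 0 <= G z)%E ->
    (\int[stdnormal]_x \int[stdnormal]_y G (x, y) = \int[N01]_x \int[N01]_y G (x, y))%E.
  move=> mG G0; rewrite ge0_integral_stdnormal_prob.
  - apply: eq_integral => x _; rewrite ge0_integral_stdnormal_prob//.
    exact: (measurableT_comp mG (pair1_measurable x)).
  - exact: (measurable_inner stdnormal mG G0).
  - by move=> x; apply: integral_ge0.
rewrite (E F mF F0).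
have mG : measurable_fun setT (fun z : R * R => F (c * z.1 + s * z.2, - s * z.1 + c * z.2)).
  by apply: (measurableT_comp mF); apply: measurable_fun_pair; exact: mlin.
apply: (etrans (E _ mG (fun z => F0 _))).
exact: (normal_rotation cs mF F0).
Qed.

End NormalRotation.

(** * Equality in law and normal moments *)

Section SameLaw.
Context (d1 d2 d : measure_display) (T1 : measurableType d1)
  (T2 : measurableType d2) (S : measurableType d) (R : realType).
Variables (m1 : probability T1 R) (m2 : probability T2 R).

(** Tested on nonnegative functions, whose integrals always make sense, since
    changes of variables produce equalities of this kind directly. *)
Definition same_law (f1 : T1 -> S) (f2 : T2 -> S) : Prop :=
  forall F : S -> \bar R, measurable_fun setT F -> (forall y, 0 <= F y)%E ->
  (\int[m1]_x F (f1 x) = \int[m2]_x F (f2 x))%E.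

Lemma same_law_integral (f1 : T1 -> S) (f2 : T2 -> S) (F : S -> \bar R) :
  same_law f1 f2 -> measurable_fun setT F ->
  (\int[m1]_x F (f1 x) = \int[m2]_x F (f2 x))%E.
Proof.
move=> sl mF; rewrite integralE [RHS]integralE; congr (_ - _)%E.
  have := sl (F^\+)%E (measurable_funepos mF) (funepos_ge0 F).
  by rewrite -[X in integral _ _ X = _]/(F^\+ \o f1)%E -[X in _ = integral _ _ X]/(F^\+ \o f2)%E -!funepos_comp.
have := sl (F^\-)%E (measurable_funeneg mF) (funeneg_ge0 F).
by rewrite -[X in integral _ _ X = _]/(F^\- \o f1)%E -[X in _ = integral _ _ X]/(F^\- \o f2)%E -!funeneg_comp.
Qed.

Lemma same_law_Rintegral (f1 : T1 -> S) (f2 : T2 -> S) (F : S -> R) :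
  same_law f1 f2 -> measurable_fun setT F ->
  \int[m1]_x F (f1 x) = \int[m2]_x F (f2 x).
Proof.
move=> sl mF; congr fine.
by apply: (same_law_integral (F := EFin \o F)) => //; exact/measurable_EFinP.
Qed.

End SameLaw.

Section NormalMoments.
Context {R : realType}.
Local Notation mu := (@lebesgue_measure R).
Local Notation N01 := (@stdnormal R).

Lemma ge0_le_integralT d (T : measurableType d) (m : {measure set T -> \bar R})
    (f g : T -> \bar R) :
  measurable_fun setT f -> measurable_fun setT g ->
  (forall x, 0 <= f x)%E -> (forall x, f x <= g x)%E ->
  (\int[m]_x f x <= \int[m]_x g x)%E.
Proof. by move=> mf mg f0 fg; apply: ge0_le_integral. Qed.

Lemma normal_exp_quad (A B : R) : 0 < 1 + 2 * A ->
  (\int[N01]_x (expR (- A * x ^+ 2 + B * x))%:E =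
   ((Num.sqrt (1 + 2 * A))^-1 * expR (B ^+ 2 / (2 * (1 + 2 * A))))%:E)%E.
Proof.
move=> A0; set r := Num.sqrt (1 + 2 * A).
have r0 : 0 < r by rewrite sqrtr_gt0.
have r2 : r ^+ 2 = 1 + 2 * A by rewrite sqr_sqrtr// ltW.
pose s := r^-1; have s0 : 0 < s by rewrite invr_gt0.
have s2 : s ^+ 2 = (1 + 2 * A)^-1 by rewrite exprVn r2.
have me : measurable_fun setT (fun x : R => (expR (- A * x ^+ 2 + B * x))%:E).
  apply/measurable_EFinP; apply: measurableT_comp => //.
  apply: measurable_funD; first by apply: measurable_funM => //; exact: measurable_funX.
  exact: measurable_funM.
rewrite ge0_integral_stdnormal//.
transitivity (\int[mu]_x ((s * expR (B ^+ 2 / (2 * (1 + 2 * A))))%:E *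
   (normal_pdf (B / (1 + 2 * A)) s x)%:E))%E.
  apply: eq_integral => x _; rewrite -!EFinM; congr EFin.
  rewrite normal_pdf01E normal_pdfE ?gt_eqF// /normal_fun.
  have -> : normal_peak s = normal_peak 1 * r.
    rewrite /normal_peak expr1n mul1r -mulrnAr sqrtrM ?sqr_ge0// sqrtr_sqr gtr0_norm//.
    by rewrite invfM /s invrK mulrC.
  rewrite mulrCA -expRD s2.
  have rs : r * s = 1 by rewrite /s mulfV// gt_eqF.
  have -> : - A * x ^+ 2 + B * x + - x ^+ 2 / 2 = B ^+ 2 / (2 * (1 + 2 * A)) +
     - (x - B / (1 + 2 * A)) ^+ 2 / ((1 + 2 * A)^-1 *+ 2).
    by field; rewrite gt_eqF.
  rewrite expRD; set e1 := expR _; set e2 := expR _; set p := normal_peak 1.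
  transitivity (p * (r * s) * e1 * e2); first by rewrite rs; ring.
  by ring.
rewrite integralZl//; last exact: integrable_normal_pdf.
by rewrite integral_normal_pdf mule1.
Qed.

Lemma measurable_exprn (k : nat) : measurable_fun setT (fun x : R => x ^+ k).
Proof. exact: measurable_funX. Qed.

Lemma normal_x4_bound : (\int[N01]_x (x ^+ 4)%:E <= 64%:E)%E.
Proof.
have A0 : 0 < 1 + 2 * (- (1 / 4)) :> R by lra.
have mE : measurable_fun setT (fun x : R => (expR (- - (1 / 4) * x ^+ 2 + 0 * x))%:E).
  apply/measurable_EFinP; apply: measurableT_comp => //.
  apply: measurable_funD; apply: measurable_funM => //; exact: measurable_funX.
apply: (@le_trans _ _ (\int[N01]_x (32%:E * (expR (- - (1 / 4) * x ^+ 2 + 0 * x))%:E))%E).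
  apply: ge0_le_integralT.
  - by apply/measurable_EFinP; exact: measurable_exprn.
  - exact: measurable_funeM.
  - by move=> x; rewrite lee_fin exprn_even_ge0.
  - move=> x; rewrite -EFinM lee_fin mul0r addr0 opprK.
    have y0 : 0 <= 1 / 4 * x ^+ 2 by rewrite mulr_ge0// sqr_ge0.
    have := expR_ge1Dxn 1 y0; rewrite (_ : 2`!%:R = 2 :> R)//.
    have -> : (1 / 4 * x ^+ 2) ^+ 2 = x ^+ 4 / 16 by field.
    lra.
rewrite ge0_integralZl//.
rewrite normal_exp_quad// expr0n mul0r expR0 mulr1 -EFinM lee_fin.
have s0 : 0 < Num.sqrt (1 + 2 * - (1 / 4)) :> R by rewrite sqrtr_gt0.
rewrite ler_pdivrMr//.
have : 1 / 2 <= Num.sqrt (1 + 2 * - (1 / 4)) :> R.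
  rewrite -[X in X <= _]gtr0_norm ?divr_gt0// -sqrtr_sqr ler_sqrt; last by lra.
  by lra.
by lra.
Qed.

Lemma normal_integrable_le4 (f : R -> R) (c : R) : measurable_fun setT f ->
  (forall x, `|f x| <= c * (1 + x ^+ 4)) -> N01.-integrable setT (EFin \o f).
Proof.
move=> mf fc.
have c0 : 0 <= c.
  by have := le_trans (normr_ge0 _) (fc 0); rewrite expr0n/= addr0 mulr1.
have mx : measurable_fun setT (fun x : R => (c * (1 + x ^+ 4))%:E).
  apply/measurable_EFinP; apply: measurable_funM => //.
  by apply: measurable_funD => //; exact: measurable_exprn.
apply/integrableP; split; first exact/measurable_EFinP.
apply: (@le_lt_trans _ _ (\int[N01]_x (c * (1 + x ^+ 4))%:E)%E).
  apply: ge0_le_integralT => //.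
  by apply: measurableT_comp => //; exact/measurable_EFinP.
have m4 : measurable_fun setT (fun x : R => (x ^+ 4)%:E).
  by apply/measurable_EFinP; exact: measurable_exprn.
have p4 (x : R) : 0 <= x ^+ 4 by rewrite exprn_even_ge0.
under eq_integral do rewrite EFinM EFinD.
rewrite ge0_integralZl//=; last 2 first.
- by apply: emeasurable_funD.
- by move=> x _; rewrite adde_ge0// lee_fin.
rewrite ge0_integralD//=; last by move=> x _; rewrite lee_fin.
rewrite integral_cst//= probability_setT mul1e.
apply: (@le_lt_trans _ _ (c%:E * (1 + 64%:E))%E); last by rewrite -EFinD -EFinM ltry.
apply: lee_wpmul2l; first by rewrite lee_fin.
by apply: leeD => //; exact: normal_x4_bound.
Qed.

Lemma normal_integrable_exp_quad (A B : R) : 0 < 1 + 2 * A ->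
  N01.-integrable setT (EFin \o (fun x => expR (- A * x ^+ 2 + B * x))).
Proof.
move=> A0.
have mf : measurable_fun setT (fun x : R => expR (- A * x ^+ 2 + B * x)).
  apply: measurableT_comp => //.
  by apply: measurable_funD; apply: measurable_funM => //; exact: measurable_funX.
apply/integrableP; split; first exact/measurable_EFinP.
under eq_integral do rewrite /= ger0_norm ?expR_ge0//.
by rewrite normal_exp_quad// ltry.
Qed.

Lemma normal_integrable_x2 : N01.-integrable setT (EFin \o (fun x => x ^+ 2)).
Proof.
apply: (@normal_integrable_le4 _ 1); first exact: measurable_exprn.
move=> x; rewrite ger0_norm ?sqr_ge0// mul1r.
have -> : x ^+ 4 = (x ^+ 2) ^+ 2 by ring.
have := sqr_ge0 (x ^+ 2 - 1); have := sqr_ge0 x; nra.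
Qed.

(** The inequality 1 + t x^2 <= exp (t x^2), integrated for small t of both signs
    against the explicit exponential moments, squeezes the second moment. *)
Lemma normal_x2 : \int[N01]_x (x ^+ 2) = 1.
Proof.
set I := \int[N01]_x _.
have key (t : R) : `|t| <= 1 / 4 -> 1 + t * I <= 1 + t + 4 * t ^+ 2.
  move=> t4; have /andP[t1 t2] : - (1 / 4) <= t <= 1 / 4 by rewrite -ler_norml.
  have A0 : 0 < 1 + 2 * (- t) by lra.
  have := normal_exp_quad 0 A0; have := normal_integrable_exp_quad 0 A0 => ie.
  rewrite -Rintegral_fine// expr0n mul0r expR0 mulr1 => -[] E.
  have -> : 1 + t * I = \int[N01]_x (1 + t * x ^+ 2).
    rewrite RintegralD//; last 2 first.
    - exact: finite_measure_integrable_cst.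
    - have := integrableZl measurableT t normal_integrable_x2.
      by apply: eq_integrable => // x _.
    rewrite Rintegral_cst// /= probability_setT mulr1 RintegralZl//.
    exact: normal_integrable_x2.
  apply: (@le_trans _ _ (Num.sqrt (1 + 2 * - t))^-1).
    rewrite -E; apply: le_Rintegral => //.
    - apply: (@normal_integrable_le4 _ (1 + `|t|)).
        by apply: measurable_funD => //; apply: measurable_funM.
      move=> x; have x2 := sqr_ge0 x; have x4 := sqr_ge0 (x ^+ 2 - 1).
      apply: le_trans (ler_normD _ _) _; rewrite normr1 normrM (ger0_norm x2).
      have -> : x ^+ 4 = (x ^+ 2) ^+ 2 by ring.
      have := normr_ge0 t; nra.
    - move=> x _; rewrite opprK mul0r addr0; exact: expR_ge1Dx.
  have p0 : 0 <= 1 + t + 4 * t ^+ 2 by have := sqr_ge0 t; nra.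
  rewrite -[leRHS]invrK lef_pV2 ?posrE ?sqrtr_gt0// ?invr_gt0; last by have := sqr_ge0 t; nra.
  have p1 : 0 < 1 + t + 4 * t ^+ 2 by have := sqr_ge0 t; nra.
  rewrite -[X in X <= _]ger0_norm ?invr_ge0// -sqrtr_sqr ler_sqrt; last by lra.
  rewrite exprVn -[leLHS]mul1r ler_pdivrMr ?exprn_gt0//.
  have -> : (1 + 2 * - t) * (1 + t + 4 * t ^+ 2) ^+ 2 =
    1 + t ^+ 2 * (5 - 10 * t - 32 * t ^+ 3) by ring.
  have t3 : t ^+ 3 <= 1 / 64 by have := sqr_ge0 (t + 1 / 4); nra.
  have := sqr_ge0 t; nra.
have H (e : R) : 0 < e <= 1 / 4 -> `|I - 1| <= 4 * e.
  move=> /andP[e0 e4].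
  have ne : `|e| <= 1 / 4 by rewrite gtr0_norm.
  have ne' : `|- e| <= 1 / 4 by rewrite normrN gtr0_norm.
  have h1 := key _ ne; have h2 := key _ ne'.
  have e2 : 0 < e * e by rewrite mulr_gt0.
  rewrite ler_norml; apply/andP; split.
    suff : e * (1 - I) <= e * (4 * e) by rewrite ler_pM2l//; lra.
    by move: h2; rewrite sqrrN expr2; lra.
  suff : e * (I - 1) <= e * (4 * e) by rewrite ler_pM2l.
  by move: h1; rewrite expr2; lra.
apply/eqP; rewrite -subr_eq0 -normr_le0; apply/ler_addgt0Pr => e e0.
rewrite add0r.
have [e1|e1] := leP e 1.
  have E4 : 4 * (e / 4) = e by field.
  by rewrite -[X in _ <= X]E4; apply: H; apply/andP; split; lra.
have E4 : 4 * (1 / 4) = 1 :> R by field.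
apply: le_trans (H (1 / 4) _) _; last by rewrite E4 ltW.
by apply/andP; split; lra.
Qed.

Lemma normal_sym : same_law N01 N01 (fun x => - x) id.
Proof.
move=> F mF F0.
have cs : (-1) ^+ 2 + 0 ^+ 2 = 1 :> R by rewrite expr0n addr0 sqrrN expr1n.
have mF2 : measurable_fun setT (fun z : R * R => F z.1) by exact: measurableT_comp.
have := stdnormal_rotation cs mF2 (fun z => F0 z.1).
have E (g : R -> \bar R) : (\int[N01]_x \int[N01]_y g x = \int[N01]_x g x)%E.
  by apply: eq_integral => x _; rewrite integral_cst//= probability_setT mule1.
rewrite /= E => <-; rewrite -E; apply: eq_integral => x _.
by apply: eq_integral => y _; rewrite mul0r addr0 mulN1r.
Qed.

Lemma normal_odd (f : R -> R) : measurable_fun setT f ->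
  N01.-integrable setT (EFin \o f) -> (forall x, f (- x) = - f x) ->
  \int[N01]_x f x = 0.
Proof.
move=> mf fi fo; have := same_law_Rintegral normal_sym mf.
rewrite /= => h.
have : \int[N01]_x f (- x) = - \int[N01]_x f x.
  rewrite -mulN1r -RintegralZl//; apply: eq_Rintegral => x _.
  by rewrite fo mulN1r.
by rewrite h => /eqP; rewrite -subr_eq0 opprK -mulr2n mulrn_eq0 => /eqP.
Qed.

End NormalMoments.

(** * Gaussian variables and their characteristic function *)

Section TrigBounds.
Context {R : realType}.
Implicit Types x y : R.

Lemma sin_mvt x : 0 < x -> exists2 c, 0 < c < x & sin x = cos c * x.
Proof.
move=> x0.
have d1 z : z \in `]0, x[ -> is_derive z 1 sin (cos z) by move=> _; exact: is_derive_sin.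
have c1 : {within `[0, x], continuous (@sin R)}.
  by apply: continuous_subspaceT => z; exact: continuous_sin.
have [c cx] := MVT x0 d1 c1.
rewrite sin0 !subr0 => E; exists c => //.
Qed.

Lemma sin_le x : 0 <= x -> sin x <= x.
Proof.
rewrite le_eqVlt => /predU1P[<-|x0]; first by rewrite sin0.
have [c _ ->] := sin_mvt x0; rewrite ger_pMl//; exact: cos_le1.
Qed.

Lemma sin2_le x : sin x ^+ 2 <= x ^+ 2.
Proof.
wlog x0 : x / 0 <= x.
  move=> H; have [|/ltW x0] := leP 0 x; first exact: H.
  by rewrite -[sin x ^+ 2]sqrrN -sinN -[x ^+ 2]sqrrN; apply: H; rewrite oppr_ge0.
have h : sin x <= x := sin_le x0.
have h' : - x <= sin x.
  have [x1|x1] := leP x 1.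
    have [->|xp] := eqVneq x 0; first by rewrite sin0 oppr0.
    have xp' : 0 < x by rewrite lt_neqAle eq_sym xp.
    have [c /andP[c0 cx] ->] := sin_mvt xp'.
    have := cos_geN1 c; nra.
  by apply: le_trans (sin_geN1 x); lra.
by nra.
Qed.

Lemma cos_half x : cos x = 1 - 2 * sin (x / 2) ^+ 2.
Proof.
have -> : cos x = cos ((x / 2) *+ 2) by congr cos; rewrite mulr2n; field.
by rewrite cos_mulr2n cos2sin2; ring.
Qed.

Lemma cos_ge x : 1 - x ^+ 2 / 2 <= cos x.
Proof.
rewrite cos_half; have := sin2_le (x / 2).
have -> : (x / 2) ^+ 2 = x ^+ 2 / 4 by field.
lra.
Qed.

(** On [0, 1] from the half angle formula and a lower bound of the sine; beyond,
    the right hand side exceeds one. *)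
Lemma cos_le x : cos x <= 1 - 3 / 8 * x ^+ 2 + 3 / 8 * x ^+ 4.
Proof.
wlog x0 : x / 0 <= x.
  move=> H; have [|/ltW x0] := leP 0 x; first exact: H.
  have := H (- x); rewrite cosN sqrrN (_ : (- x) ^+ 4 = x ^+ 4); last by ring.
  by apply; rewrite oppr_ge0.
have x4E : x ^+ 4 = (x ^+ 2) ^+ 2 by ring.
have [x1|x1] := leP x 1; last first.
  have : 1 <= x ^+ 2 by nra.
  have := cos_le1 x; rewrite x4E; nra.
have : 3 / 16 * x ^+ 2 <= sin (x / 2) ^+ 2.
  have [->|xp] := eqVneq x 0; first by rewrite expr0n mulr0 sqr_ge0.
  have xp' : 0 < x / 2 by rewrite divr_gt0// lt_neqAle eq_sym xp.
  have [c /andP[c0 cx] ->] := sin_mvt xp'.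
  have hc : 7 / 8 <= cos c.
    apply: le_trans (cos_ge c).
    have : c ^+ 2 <= 1 / 4 by nra.
    lra.
  have -> : (cos c * (x / 2)) ^+ 2 = cos c ^+ 2 * x ^+ 2 / 4 by field.
  have : 3 / 4 <= cos c ^+ 2 by nra.
  have := sqr_ge0 x; nra.
rewrite cos_half x4E; have := sqr_ge0 (x ^+ 2); nra.
Qed.

End TrigBounds.

Section GaussLaw.
Context {R : realType}.
Local Notation N01 := (@stdnormal R).

(** Here [s] matters only up to its sign, and [s = 0] gives the constant 0. *)
Definition gauss_law d (T : measurableType d) (m : probability T R)
    (f : T -> R) (s : R) : Prop :=
  measurable_fun setT f /\ same_law m N01 f (fun x => s * x).

Lemma gauss_law_normal (c : R) : gauss_law N01 (fun x => c * x) c.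
Proof. by split => //; apply: measurable_funM. Qed.

(** A rotation of the plane aligns the first axis with (s1, s2). *)
Lemma normal_add (s1 s2 : R) (F : R -> \bar R) :
  measurable_fun setT F -> (forall y, 0 <= F y)%E ->
  (\int[N01]_x \int[N01]_y F (s1 * x + s2 * y)%R =
   \int[N01]_x F (Num.sqrt (s1 ^+ 2 + s2 ^+ 2) * x)%R)%E.
Proof.
move=> mF F0.
have cst_int (g : R -> \bar R) : (\int[N01]_x \int[N01]_y g x = \int[N01]_x g x)%E.
  by apply: eq_integral => x _; rewrite integral_cst//= probability_setT mule1.
set r := Num.sqrt _.
have q0 : 0 <= s1 ^+ 2 + s2 ^+ 2 by rewrite addr_ge0// sqr_ge0.
have r2 : r ^+ 2 = s1 ^+ 2 + s2 ^+ 2 by rewrite sqr_sqrtr.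
have [r0|r0] := eqVneq r 0.
  move: r2; rewrite r0 expr0n /= => /esym/eqP.
  rewrite paddr_eq0 ?sqr_ge0// !sqrf_eq0 => /andP[/eqP -> /eqP ->].
  rewrite -[RHS]cst_int; apply: eq_integral => x _; apply: eq_integral => y _.
  by rewrite !mul0r addr0.
have cs : (s1 / r) ^+ 2 + (s2 / r) ^+ 2 = 1.
  by rewrite !expr_div_n -mulrDl -r2 divff// sqrf_eq0.
have mF2 : measurable_fun setT (fun z : R * R => F (r * z.1)).
  by apply: (measurableT_comp mF); apply: measurable_funM.
have := stdnormal_rotation cs mF2 (fun z => F0 _).
rewrite /= cst_int => <-.
apply: eq_integral => x _; apply: eq_integral => y _.
by congr F; field.
Qed.

Lemma gauss_law_prod d1 d2 (T1 : measurableType d1) (T2 : measurableType d2)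
    (m1 : probability T1 R) (m2 : probability T2 R) f1 f2 s1 s2 :
  gauss_law m1 f1 s1 -> gauss_law m2 f2 s2 ->
  gauss_law (m1 \x m2)%E (fun z => f1 z.1 + f2 z.2) (Num.sqrt (s1 ^+ 2 + s2 ^+ 2)).
Proof.
move=> [mf1 l1] [mf2 l2].
have mf : measurable_fun setT (fun z : T1 * T2 => f1 z.1 + f2 z.2).
  by apply: measurable_funD; exact: measurableT_comp.
split => // F mF F0.
rewrite fubini_tonelli1//=; last exact: measurableT_comp.
transitivity (\int[m1]_x \int[N01]_y F (f1 x + s2 * y)%R)%E.
  apply: eq_integral => x _; rewrite /fubini_F /=.
  by apply: (l2 (fun y => F (f1 x + y))) => //; apply: measurableT_comp => //; apply: measurable_funD.
rewrite -normal_add//.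
rewrite (l1 (fun x => \int[N01]_y F (x + s2 * y)%R)%E)//.
  apply: (measurable_inner N01 (F := fun z : R * R => F (z.1 + s2 * z.2))) => //.
  by apply: measurableT_comp => //; apply: measurable_funD => //; apply: measurable_funM.
by move=> y; apply: integral_ge0.
Qed.

Lemma gauss_law_pow d (T : measurableType d) (m : probability T R) n
    (f : 'I_n -> T -> R) (s : 'I_n -> R) :
  (forall i, gauss_law m (f i) (s i)) ->
  gauss_law (pow m n) (fun t => \sum_(i < n) f i (tnth t i))
    (Num.sqrt (\sum_(i < n) s i ^+ 2)).
Proof.
elim: n f s => [|n IH] f s fs.
  split.
    by rewrite (_ : (fun _ => _) = cst 0)//; apply/funext => t; rewrite big_ord0.
  move=> F mF F0.
  transitivity (F 0%R).
    transitivity (\int[pow m 0]_x (F 0%R))%E.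
      by apply: eq_integral => t _; rewrite big_ord0.
    by rewrite integral_cst//= diracT mule1.
  transitivity (\int[N01]_x (F 0%R))%E.
    by rewrite integral_cst//= probability_setT mule1.
  by apply: eq_integral => x _; rewrite big_ord0 sqrtr0 mul0r.
have mf i : measurable_fun setT (f i) by have [] := fs i.
have msum : measurable_fun setT (fun t : n.+1.-tuple T => \sum_(i < n.+1) f i (tnth t i)).
  apply: measurable_sum => i; apply: measurableT_comp => //; exact: measurable_tnth.
split => // F mF F0.
have [mg lg] := gauss_law_prod (fs ord0) (IH (fun i => f (lift ord0 i)) (fun i => s (lift ord0 i)) (fun i => fs _)).
rewrite ge0_integral_powS//; last exact: measurableT_comp.
have := lg F mF F0; rewrite fubini_tonelli1//=; last exact: measurableT_comp.
rewrite sqr_sqrtr; last by apply: sumr_ge0 => i _; exact: sqr_ge0.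
rewrite big_ord_recl => <-.
apply: eq_integral => x _; rewrite /fubini_F; apply: eq_integral => t _ /=.
rewrite big_ord_recl tnth0; congr (F (_ + _)).
by apply: eq_bigr => i _; rewrite tnthS.
Qed.

(** The characteristic function of the normal law, which is real by symmetry. *)
Definition cg (a : R) : R := \int[N01]_x cos (a * x).

Let measurable_cos_lin (a b : R) : measurable_fun setT (fun x : R => cos (b + a * x)).
Proof.
apply: (measurableT_comp (f := cos)); first by apply: continuous_measurable_fun; exact: continuous_cos.
by apply: measurable_funD => //; apply: measurable_funM.
Qed.

Let measurable_cos : measurable_fun setT (@cos R).
Proof. by apply: continuous_measurable_fun; exact: continuous_cos. Qed.
Let measurable_sin : measurable_fun setT (@sin R).
Proof. by apply: continuous_measurable_fun; exact: continuous_sin. Qed.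

Let bmeas_cos (a : R) : bmeas (fun x => cos (a * x)).
Proof.
split; first by apply: measurableT_comp => //; apply: measurable_funM.
by exists 1 => x; exact: cos_max.
Qed.
Let bmeas_sin (a : R) : bmeas (fun x => sin (a * x)).
Proof.
split; first by apply: measurableT_comp => //; apply: measurable_funM.
by exists 1 => x; exact: sin_max.
Qed.

Lemma cg_shift (a b : R) : \int[N01]_x cos (b + a * x) = cos b * cg a.
Proof.
under eq_Rintegral do rewrite cosD.
have ic := bmeas_integrable N01 (bmeas_cos a).
have si := bmeas_integrable N01 (bmeas_sin a).
have ic' : N01.-integrable setT (EFin \o (fun x => cos b * cos (a * x))).
  by have := integrableZl measurableT (cos b) ic; apply: eq_integrable.
have is' : N01.-integrable setT (EFin \o (fun x => sin b * sin (a * x))).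
  by have := integrableZl measurableT (sin b) si; apply: eq_integrable.
rewrite RintegralB// !RintegralZl// (normal_odd _ si) ?mulr0 ?subr0//.
- by have [] := bmeas_sin a.
- by move=> x; rewrite mulrN sinN.
Qed.

Lemma gauss_law_cos d (T : measurableType d) (m : probability T R) f s (b : R) :
  gauss_law m f s -> \int[m]_x cos (b + f x) = cos b * cg s.
Proof.
move=> [mf l]; rewrite -cg_shift.
apply: (same_law_Rintegral (F := fun y => cos (b + y)) l).
by have := measurable_cos_lin 1 b; under eq_fun do rewrite mul1r.
Qed.

Lemma cg_sqr (a : R) : cg (Num.sqrt (a ^+ 2 + a ^+ 2)) = cg a ^+ 2.
Proof.
have := gauss_law_cos 0 (gauss_law_prod (gauss_law_normal a) (gauss_law_normal a)).
rewrite cos0 mul1r => <-.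
rewrite Fubini_bmeas1/=; last first.
  split; last by exists 1 => z; exact: cos_max.
  apply: measurableT_comp => //; apply: measurable_funD => //.
  by apply: measurable_funD; apply: measurable_funM.
transitivity (\int[N01]_x (cg a * cos (a * x))).
  apply: eq_Rintegral => x _; rewrite [RHS]mulrC -cg_shift.
  by apply: eq_Rintegral => y _; rewrite add0r.
have ic := bmeas_integrable N01 (bmeas_cos a).
by rewrite RintegralZl// expr2.
Qed.

Lemma cgN (a : R) : cg (- a) = cg a.
Proof. by apply: eq_Rintegral => x _; rewrite mulNr cosN. Qed.

(** Near the origin the quartic bound of the cosine and the moments of order two
    and four suffice; the constant 1/256 lets the former absorb the latter. *)
Lemma cg_small (a : R) : a ^+ 2 <= 1 / 256 -> `|cg a| <= expR (- a ^+ 2 / 4).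
Proof.
move=> a2.
have ic := bmeas_integrable N01 (bmeas_cos a).
have a0 := sqr_ge0 a.
have ip (c1 c2 : R) : N01.-integrable setT (EFin \o (fun x => 1 - c1 * x ^+ 2 + c2 * x ^+ 4)).
  apply: (@normal_integrable_le4 _ _ (1 + `|c1| + `|c2|)).
    by apply: measurable_funD; [apply: measurable_funB => //|]; apply: measurable_funM.
  move=> x; apply: le_trans (ler_normD _ _) _.
  apply: le_trans (lerD (ler_normB _ _) (lexx _)) _.
  rewrite normr1 (normrM c1) (normrM c2) (ger0_norm (sqr_ge0 x)).
  have -> : x ^+ 4 = (x ^+ 2) ^+ 2 by ring.
  rewrite (ger0_norm (sqr_ge0 (x ^+ 2))).
  have := normr_ge0 c1; have := normr_ge0 c2; have := sqr_ge0 x.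
  have := sqr_ge0 (x ^+ 2 - 1); nra.
have ix4 : N01.-integrable setT (EFin \o (fun x => x ^+ 4)).
  apply: (@normal_integrable_le4 _ _ 1); first exact: measurable_exprn.
  by move=> x; rewrite ger0_norm ?exprn_even_ge0// mul1r lerDr.
have E (c1 c2 : R) : \int[N01]_x (1 - c1 * x ^+ 2 + c2 * x ^+ 4) =
    1 - c1 + c2 * \int[N01]_x (x ^+ 4).
  have i1 : N01.-integrable setT (EFin \o (fun x : R => 1 - c1 * x ^+ 2)).
    by have := ip c1 0; apply: eq_integrable => // x _ /=; rewrite mul0r addr0.
  have i0 : N01.-integrable setT (EFin \o (fun x : R => 1)).
    by have := ip 0 0; apply: eq_integrable => // x _ /=; rewrite !mul0r addr0 subr0.
  have i2 : N01.-integrable setT (EFin \o (fun x : R => c1 * x ^+ 2)).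
    by have := integrableZl measurableT c1 (@normal_integrable_x2 R); apply: eq_integrable.
  have i4 : N01.-integrable setT (EFin \o (fun x : R => c2 * x ^+ 4)).
    by have := integrableZl measurableT c2 ix4; apply: eq_integrable.
  rewrite RintegralD// RintegralB// !RintegralZl//; last exact: normal_integrable_x2.
  by rewrite normal_x2 mulr1 Rintegral_cst//= probability_setT mulr1.
have I4 : \int[N01]_x (x ^+ 4) <= 64.
  by rewrite -lee_fin Rintegral_fine//; exact: normal_x4_bound.
have up : cg a <= 1 - 3 / 8 * a ^+ 2 + 3 / 8 * a ^+ 4 * 64.
  apply: (@le_trans _ _ (\int[N01]_x (1 - (3 / 8 * a ^+ 2) * x ^+ 2 + (3 / 8 * a ^+ 4) * x ^+ 4))).
    apply: le_Rintegral => // x _; have := cos_le (a * x).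
    by rewrite !exprMn !mulrA.
  rewrite E lerD2l ler_wpM2l// mulr_ge0// exprn_even_ge0//.
have lo : 1 - a ^+ 2 / 2 <= cg a.
  apply: (@le_trans _ _ (\int[N01]_x (1 - (a ^+ 2 / 2) * x ^+ 2 + 0 * x ^+ 4))).
    by rewrite E mul0r addr0.
  apply: le_Rintegral => // x _; have := cos_ge (a * x).
  by rewrite exprMn mul0r addr0 mulrAC.
have a4 : a ^+ 4 = (a ^+ 2) ^+ 2 by ring.
rewrite ger0_norm; last by lra.
apply: le_trans (expR_ge1Dx _).
apply: le_trans up _; rewrite a4; nra.
Qed.

(** Squaring the characteristic function doubles the variance, so the Gaussian
    decay of [cg] near the origin spreads to the whole line. *)
Lemma cg_decay (a : R) : `|cg a| <= expR (- a ^+ 2 / 4).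
Proof.
have H n : forall a, a ^+ 2 <= 2 ^+ n / 256 -> `|cg a| <= expR (- a ^+ 2 / 4).
  elim: n => [|n IH] b; first by rewrite expr0; exact: cg_small.
  move=> b2; pose c := Num.sqrt (b ^+ 2 / 2).
  have c2 : c ^+ 2 = b ^+ 2 / 2 by rewrite sqr_sqrtr// divr_ge0// sqr_ge0.
  have -> : cg b = cg c ^+ 2.
    rewrite -cg_sqr c2 -mulrDr.
    have -> : b ^+ 2 * (2^-1 + 2^-1) = b ^+ 2 by field.
    rewrite sqrtr_sqr; have [b0|b0] := leP 0 b; first by rewrite ger0_norm.
    by rewrite ltr0_norm// cgN.
  have -> : - b ^+ 2 / 4 = - c ^+ 2 / 4 + - c ^+ 2 / 4 by rewrite c2; field.
  rewrite expRD normrX -expr2 lerXn2r ?nnegrE ?normr_ge0 ?expR_ge0//.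
  apply: IH; rewrite c2; move: b2; rewrite (exprS (2 : R) n); lra.
have [n Hn] : exists n : nat, a ^+ 2 * 256 <= n%:R.
  exists (Num.bound (a ^+ 2 * 256)); apply/ltW/archi_boundP.
  by apply: mulr_ge0; [exact: sqr_ge0|exact: ler0n].
apply: (H n); rewrite ler_pdivlMr ?ltr0n//; apply: le_trans Hn _.
by rewrite -natrX ler_nat ltnW// ltn_expl.
Qed.

End GaussLaw.

(** * Rotation invariance of powers of the normal law *)

Section RotationInvariance.
Context {R : realType}.
Local Notation N01 := (@stdnormal R).

(** Stated for an arbitrary pair of maps so that the invariance passes from the
    normal law to its powers, with the maps acting coordinatewise. *)
Definition rot_inv d (T : measurableType d) (m : probability T R)
    (rp rm : T -> T -> T) : Prop :=
  [/\ measurable_fun setT (fun z : T * T => rp z.1 z.2),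
      measurable_fun setT (fun z : T * T => rm z.1 z.2) &
      forall F : T * T -> \bar R, measurable_fun setT F -> (forall z, 0 <= F z)%E ->
      (\int[m]_x \int[m]_y F (rp x y, rm x y) = \int[m]_x \int[m]_y F (x, y))%E].

Lemma rot_inv_normal :
  rot_inv N01 (fun x y => (x + y) / Num.sqrt 2) (fun x y => (y - x) / Num.sqrt 2).
Proof.
have s2 : Num.sqrt 2 ^+ 2 = 2 :> R by rewrite sqr_sqrtr.
split.
- by apply: measurable_funM => //; apply: measurable_funD.
- by apply: measurable_funM => //; apply: measurable_funB.
- move=> F mF F0.
  have cs : (Num.sqrt 2)^-1 ^+ 2 + (Num.sqrt 2)^-1 ^+ 2 = 1 :> R.
    by rewrite exprVn s2; field.
  rewrite -(stdnormal_rotation cs mF F0).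
  apply: eq_integral => x _; apply: eq_integral => y _.
  by congr F; congr pair; ring.
Qed.

Context d (T : measurableType d) (m : probability T R) (rp rm : T -> T -> T).

Definition tmap2 (f : T -> T -> T) n (x y : n.-tuple T) : n.-tuple T :=
  [tuple f (tnth x i) (tnth y i) | i < n].

Lemma tmap2_cons (f : T -> T -> T) n (x0 y0 : T) (x y : n.-tuple T) :
  tmap2 f (tcons (x0, x)) (tcons (y0, y)) = tcons (f x0 y0, tmap2 f x y).
Proof.
apply: eq_from_tnth => i; rewrite tnth_mktuple.
by case: (unliftP ord0 i) => [j ->|->]; rewrite ?tnth0 ?tnthS ?tnth_mktuple.
Qed.

Lemma measurable_tmap2 (f : T -> T -> T) n :
  measurable_fun setT (fun z : T * T => f z.1 z.2) ->
  measurable_fun setT (fun z : n.-tuple T * n.-tuple T => tmap2 f z.1 z.2).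
Proof.
move=> mf; apply/measurable_fun_tnthP => i.
rewrite (_ : _ \o _ = fun z : n.-tuple T * n.-tuple T => f (tnth z.1 i) (tnth z.2 i)); last first.
  by apply/funext => z /=; rewrite tnth_mktuple.
have mt : measurable_fun setT (fun z : n.-tuple T * n.-tuple T => (tnth z.1 i, tnth z.2 i)).
  by apply: measurable_fun_pair; apply: (measurableT_comp (@measurable_tnth _ _ _ i)).
exact: (measurableT_comp mf mt).
Qed.

Lemma ge0_integral_powSS n (F : n.+1.-tuple T * n.+1.-tuple T -> \bar R) :
  measurable_fun setT F -> (forall z, 0 <= F z)%E ->
  (\int[pow m n.+1]_x \int[pow m n.+1]_y F (x, y) =
   \int[m]_x0 \int[m]_y0 \int[pow m n]_x \int[pow m n]_y
     F (tcons (x0, x), tcons (y0, y)))%E.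
Proof.
move=> mF F0.
have mc := @measurable_tcons _ T n.
rewrite ge0_integral_powS; last 2 first.
- exact: (measurable_inner (pow m n.+1)).
- by move=> x; apply: integral_ge0.
apply: eq_integral => x0 _.
transitivity (\int[pow m n]_x \int[m]_y0 \int[pow m n]_y
   F (tcons (x0, x), tcons (y0, y)))%E.
  apply: eq_integral => x _; rewrite ge0_integral_powS//.
  exact: measurableT_comp.
apply: (tonelli_swap (pow m n) m
  (f := fun x y0 => \int[pow m n]_y F (tcons (x0, x), tcons (y0, y)))%E).
  apply: (measurable_inner (pow m n)
    (F := fun z : (n.-tuple T * T) * n.-tuple T => F (tcons (x0, z.1.1), tcons (z.1.2, z.2)))) => //.
  apply: (measurableT_comp mF); apply: measurable_fun_pair.
    apply: (measurableT_comp mc); apply: measurable_fun_pair => //.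
    exact: measurableT_comp.
  apply: (measurableT_comp mc); apply: measurable_fun_pair => //.
  exact: measurableT_comp.
by move=> x y; apply: integral_ge0.
Qed.

Lemma rot_inv_pow n : rot_inv m rp rm ->
  rot_inv (pow m n) (@tmap2 rp n) (@tmap2 rm n).
Proof.
move=> [mrp mrm inv]; split; [exact: measurable_tmap2|exact: measurable_tmap2|].
elim: n => [|n IH] F mF F0.
  apply: eq_integral => x _; apply: eq_integral => y _.
  by congr F; congr pair; apply: eq_from_tnth; case.
have mc := @measurable_tcons _ T n.
have mF' (a b : T) : measurable_fun setT (fun z : n.-tuple T * n.-tuple T =>
    F (tcons (a, z.1), tcons (b, z.2))).
  apply: (measurableT_comp mF); apply: measurable_fun_pair;
    apply: (measurableT_comp mc); exact: measurable_fun_pair.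
rewrite (ge0_integral_powSS (F := fun z => F (tmap2 rp z.1 z.2, tmap2 rm z.1 z.2)))//; last first.
  by apply: (measurableT_comp mF); apply: measurable_fun_pair; exact: measurable_tmap2.
rewrite [RHS](ge0_integral_powSS mF F0).
pose G (z : T * T) := (\int[pow m n]_x \int[pow m n]_y F (tcons (z.1, x), tcons (z.2, y)))%E.
transitivity (\int[m]_x0 \int[m]_y0 G (rp x0 y0, rm x0 y0))%E; last first.
  have G0 z : (0 <= G z)%E.
    by apply: integral_ge0 => ? _; apply: integral_ge0.
  have mG : measurable_fun setT G.
    apply: (measurable_inner (pow m n)
      (F := fun w : (T * T) * n.-tuple T => \int[pow m n]_y F (tcons (w.1.1, w.2), tcons (w.1.2, y)))%E); last first.
      by move=> z; apply: integral_ge0.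
    apply: (measurable_inner (pow m n)
      (F := fun w : ((T * T) * n.-tuple T) * n.-tuple T =>
         F (tcons (w.1.1.1, w.1.2), tcons (w.1.1.2, w.2)))) => //.
    apply: (measurableT_comp mF); apply: measurable_fun_pair;
      apply: (measurableT_comp mc); apply: measurable_fun_pair => //;
      repeat (apply: measurableT_comp => //).
  exact: (inv G mG G0).
apply: eq_integral => x0 _; apply: eq_integral => y0 _.
have F0' z : (0 <= F (tcons (rp x0 y0, z.1), tcons (rm x0 y0, z.2)))%E by exact: F0.
apply: (etrans _ (IH _ (mF' (rp x0 y0) (rm x0 y0)) F0')).
apply: eq_integral => x _; apply: eq_integral => y _ /=.
by rewrite !tmap2_cons.
Qed.

End RotationInvariance.

Section FiniteInequalities.
Context {R : realType}.

Lemma expR_jensen (J : finType) (p x : J -> R) :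
  (forall j, 0 <= p j) -> \sum_j p j = 1 ->
  expR (\sum_j p j * x j) <= \sum_j p j * expR (x j).
Proof.
move=> p0 p1; set c := \sum_j _ * x _.
have h j : p j * (expR c * (1 + (x j - c))) <= p j * expR (x j).
  rewrite ler_wpM2l//.
  have -> : expR (x j) = expR c * expR (x j - c) by rewrite -expRD addrC subrK.
  by rewrite ler_wpM2l ?expR_ge0// expR_ge1Dx.
apply: le_trans (ler_sum _ (fun j _ => h j)).
have -> : \sum_j p j * (expR c * (1 + (x j - c))) =
  expR c * ((1 - c) * \sum_j p j + \sum_j p j * x j).
  rewrite mulrDr [_ * ((1 - c) * _)]mulrA !mulr_sumr -big_split/=.
  by apply: eq_bigr => j _; ring.
by rewrite p1 mulr1 -/c subrK mulr1.
Qed.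

Lemma sum_inv_sqrt (n : nat) :
  \sum_(0 <= m < n) (Num.sqrt (m.+1%:R : R))^-1 <= 2 * Num.sqrt n%:R.
Proof.
elim: n => [|n IH]; first by rewrite big_geq// sqrtr0 mulr0.
rewrite big_nat_recr//=; apply: le_trans (lerD IH (lexx _)) _.
set a := Num.sqrt n%:R; set b := Num.sqrt n.+1%:R.
have a0 : 0 <= a by exact: sqrtr_ge0.
have b0 : 0 < b by rewrite sqrtr_gt0.
have a2 : a ^+ 2 = n%:R by rewrite sqr_sqrtr.
have b2 : b ^+ 2 = n%:R + 1 by rewrite sqr_sqrtr// -natr1.
rewrite -(ler_pM2r b0) mulrDl mulVf ?gt_eqF//.
have := sqr_ge0 (b - a); nra.
Qed.

(** At most two indices lie at a given nonzero distance from [j]. *)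
Lemma sum_dist_le (B : nat -> R) (N j : nat) : (j < N)%N -> (forall m, 0 <= B m) ->
  \sum_(0 <= l < N) B ((j - l) + (l - j))%N <= B 0%N + 2 * \sum_(0 <= m < N) B m.+1.
Proof.
move=> jN B0.
rewrite (big_cat_nat (n := j))//=; last exact: ltnW.
rewrite [X in _ + X <= _]big_ltn// subnn addn0.
have h1 : \sum_(0 <= l < j) B ((j - l) + (l - j))%N <= \sum_(0 <= m < N) B m.+1.
  rewrite big_nat_rev /= add0n.
  rewrite [leRHS](big_cat_nat (n := j))//=; last exact: ltnW.
  apply: le_trans (_ : \sum_(0 <= m < j) B m.+1 <= _); last first.
    by rewrite lerDl sumr_ge0.
  rewrite big_nat [leRHS]big_nat; apply: ler_sum => l /andP[_ lj].
  by rewrite (_ : (_ + _)%N = l.+1)//; lia.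
have h2 : \sum_(j.+1 <= l < N) B ((j - l) + (l - j))%N <= \sum_(0 <= m < N) B m.+1.
  rewrite -{1}[j.+1]add0n big_addn.
  rewrite [leRHS](big_cat_nat (n := (N - j.+1)%N))//=; last exact: leq_subr.
  apply: le_trans (_ : \sum_(0 <= m < N - j.+1) B m.+1 <= _); last first.
    by rewrite lerDl sumr_ge0.
  apply: ler_sum => l _.
  by rewrite (_ : (_ + _)%N = l.+1)//; lia.
lra.
Qed.

End FiniteInequalities.

(** * Anti-concentration from the characteristic function *)

Section AntiConcentration.
Context {R : realType}.
Local Notation N01 := (@stdnormal R).

Lemma measurable_cos' : measurable_fun setT (@cos R).
Proof. by apply: continuous_measurable_fun; exact: continuous_cos. Qed.
Lemma measurable_sin' : measurable_fun setT (@sin R).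
Proof. by apply: continuous_measurable_fun; exact: continuous_sin. Qed.

Lemma bmeas_cosf d (T : measurableType d) (f : T -> R) :
  measurable_fun setT f -> bmeas (fun x => cos (f x)).
Proof.
move=> mf; split; first exact: measurableT_comp measurable_cos' mf.
by exists 1 => x; exact: cos_max.
Qed.
Lemma bmeas_sinf d (T : measurableType d) (f : T -> R) :
  measurable_fun setT f -> bmeas (fun x => sin (f x)).
Proof.
move=> mf; split; first exact: measurableT_comp measurable_sin' mf.
by exists 1 => x; exact: sin_max.
Qed.

Context d (T : measurableType d) (m : probability T R).

Lemma gauss_law_scale (f : T -> R) (s c : R) :
  gauss_law m f s -> gauss_law m (fun x => c * f x) (c * s).
Proof.
move=> [mf l]; split; first exact: measurable_funM.
move=> F mF F0; rewrite (l (fun y => F (c * y)))//.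
  by apply: eq_integral => x _; rewrite mulrA.
by apply: measurableT_comp => //; apply: measurable_funM.
Qed.

Lemma gauss_law_exp (f : T -> R) (s a A : R) : gauss_law m f s -> 0 <= A ->
  (\int[m]_x (expR (- A * (a + f x) ^+ 2))%:E <=
   ((Num.sqrt (1 + 2 * A * (a ^+ 2 + s ^+ 2)))^-1)%:E)%E.
Proof.
move=> [mf l] A0.
have mE : measurable_fun setT (fun y : R => (expR (- A * (a + y) ^+ 2))%:E).
  apply/measurable_EFinP; apply: measurableT_comp => //.
  apply: measurable_funM => //; apply: measurable_funX; exact: measurable_funD.
rewrite (l (fun y => (expR (- A * (a + y) ^+ 2))%:E))//.
have s0 := sqr_ge0 s; have a0 := sqr_ge0 a.
set B := 1 + 2 * (A * s ^+ 2).
have B1 : 1 <= B by rewrite lerDl mulr_ge0// mulr_ge0.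
have B0 : 0 < B by exact: lt_le_trans B1.
under eq_integral => x _.
  have -> : - A * (a + s * x) ^+ 2 =
    - A * a ^+ 2 + (- (A * s ^+ 2) * x ^+ 2 + (- 2 * A * a * s) * x) by ring.
  rewrite expRD EFinM; over.
rewrite integralZl//; last exact: normal_integrable_exp_quad.
rewrite normal_exp_quad// -/B -EFinM lee_fin mulrCA -expRD.
set z := A * a ^+ 2 / B.
have z0 : 0 <= z by rewrite divr_ge0 ?(ltW B0)// mulr_ge0.
have -> : - A * a ^+ 2 + (- 2 * A * a * s) ^+ 2 / (2 * B) = - z.
  rewrite /z /B; field; rewrite -/B gt_eqF//.
have Ez : expR (- z) <= (Num.sqrt (1 + 2 * z))^-1.
  rewrite expRN lef_pV2 ?posrE ?expR_gt0 ?sqrtr_gt0//; last by lra.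
  rewrite -[leRHS]gtr0_norm ?expR_gt0// -sqrtr_sqr ler_sqrt ?sqr_ge0//.
  have -> : expR z ^+ 2 = expR (2 * z) by rewrite expr2 -expRD; congr expR; ring.
  exact: expR_ge1Dx.
apply: (@le_trans _ _ ((Num.sqrt B)^-1 * (Num.sqrt (1 + 2 * z))^-1)).
  by rewrite ler_wpM2l// invr_ge0 sqrtr_ge0.
rewrite -invfM -sqrtrM ?(ltW B0)//.
have -> // : B * (1 + 2 * z) = 1 + 2 * A * (a ^+ 2 + s ^+ 2).
by rewrite /z /B; field; rewrite -/B gt_eqF.
Qed.

Lemma Rintegral_cos_sqr (f : T -> R) : measurable_fun setT f ->
  (\int[m]_x cos (f x)) ^+ 2 <= \int[m]_x \int[m]_y cos (f x - f y).
Proof.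
move=> mf; set p := \int[m]_x _; pose q := \int[m]_x sin (f x).
have ic := bmeas_integrable m (bmeas_cosf mf).
have is' := bmeas_integrable m (bmeas_sinf mf).
have iz (c : R) (g : T -> R) : m.-integrable setT (EFin \o g) ->
    m.-integrable setT (EFin \o (fun x => c * g x)).
  by move=> ig; have := integrableZl measurableT c ig; apply: eq_integrable.
suff -> : \int[m]_x \int[m]_y cos (f x - f y) = p ^+ 2 + q ^+ 2.
  by rewrite lerDl sqr_ge0.
transitivity (\int[m]_x (p * cos (f x) + q * sin (f x))).
  apply: eq_Rintegral => x _.
  under eq_Rintegral do rewrite cosB.
  rewrite RintegralD//; [|exact: iz|exact: iz].
  by rewrite !RintegralZl// mulrC [X in _ + X]mulrC.
rewrite RintegralD//; [|exact: iz|exact: iz].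
by rewrite !RintegralZl// !expr2.
Qed.

(** Convexity of [exp] reduces a sum of squares of jointly Gaussian variables to
    single ones, weighted by their second moments. *)
Lemma gauss_law_exp_sum (J : finType) (a s : J -> R) (g : J -> T -> R) (A : R) :
  (forall j, gauss_law m (g j) (s j)) -> 0 <= A ->
  1 <= \sum_j (a j ^+ 2 + s j ^+ 2) ->
  (\int[m]_y (expR (- A * \sum_j (a j + g j y) ^+ 2))%:E <=
   ((Num.sqrt (1 + 2 * A))^-1)%:E)%E.
Proof.
move=> gg A0; set tau := \sum_j _ => tau1.
have tau0 : 0 < tau by exact: lt_le_trans tau1.
pose p j := (a j ^+ 2 + s j ^+ 2) / tau.
have q0 j : 0 <= a j ^+ 2 + s j ^+ 2 by rewrite addr_ge0 ?sqr_ge0.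
have pj0 j : 0 <= p j by apply: divr_ge0; [exact: q0|exact: ltW].
have p1 : \sum_j p j = 1 by rewrite -mulr_suml divff ?gt_eqF.
pose D := (Num.sqrt (1 + 2 * A))^-1.
pose ej j y := expR (- (A / p j) * (a j + g j y) ^+ 2).
have mg j : measurable_fun setT (fun y => (a j + g j y) ^+ 2).
  by apply: measurable_funX; apply: measurable_funD; [exact: measurable_cst|case: (gg j)].
have mej j : measurable_fun setT (ej j).
  by apply: (measurableT_comp (@measurable_expR R)); apply: measurable_funM;
    [exact: measurable_cst|exact: mg].
have ej0 j y : (0 <= (ej j y)%:E)%E by rewrite lee_fin expR_ge0.
have step (j : J) : (\int[m]_y (p j * ej j y)%:E <= (p j * D)%:E)%E.
  have -> : (\int[m]_y (p j * ej j y)%:E = (p j)%:E * \int[m]_y (ej j y)%:E)%E.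
    under eq_integral do rewrite EFinM.
    apply: ge0_integralZl; [exact: measurableT|exact/measurable_EFinP|by []|].
    by rewrite lee_fin.
  have [->|pn0] := eqVneq (p j) 0; first by rewrite mul0r mul0e.
  rewrite (EFinM (p j) D); apply: lee_wpmul2l; first by rewrite lee_fin.
  have Aj0 : 0 <= A / p j by apply: divr_ge0.
  apply: le_trans (gauss_law_exp (a j) (gg j) Aj0) _.
  have qn0 : a j ^+ 2 + s j ^+ 2 != 0.
    by apply: contra pn0 => /eqP; rewrite /p => ->; rewrite mul0r.
  have -> : 2 * (A / p j) * (a j ^+ 2 + s j ^+ 2) = 2 * A * tau.
    by rewrite /p; field; rewrite qn0 gt_eqF.
  have At : 2 * A <= 2 * A * tau by rewrite ler_peMr ?mulr_ge0.
  have A1 : 0 < 1 + 2 * A by rewrite ltr_pwDl ?mulr_ge0.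
  rewrite lee_fin /D lef_pV2 ?posrE ?sqrtr_gt0 ?ler_sqrt ?lerD2l//.
    by rewrite (le_trans (ltW A1))// lerD2l.
  by rewrite (lt_le_trans A1)// lerD2l.
apply: (@le_trans _ _ (\int[m]_y (\sum_j (p j * ej j y)%:E))%E).
  apply: ge0_le_integralT.
  - apply/measurable_EFinP; apply: (measurableT_comp (@measurable_expR R)).
    apply: measurable_funM; first exact: measurable_cst.
    by apply: measurable_sum => j; exact: mg.
  - apply: emeasurable_sum => j; apply/measurable_EFinP.
    by apply: measurable_funM; [exact: measurable_cst|exact: mej].
  - by move=> y; rewrite lee_fin expR_ge0.
  - move=> y; rewrite sumEFin lee_fin.
    apply: le_trans (expR_jensen (fun j => - (A / p j) * (a j + g j y) ^+ 2) pj0 p1).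
    rewrite ler_expR mulr_sumr; apply: ler_sum => j _.
    have [->|pn0] := eqVneq (p j) 0.
      by rewrite mul0r mulNr oppr_le0 mulr_ge0 ?sqr_ge0.
    by have -> // : p j * (- (A / p j) * (a j + g j y) ^+ 2) = - A * (a j + g j y) ^+ 2; field.
rewrite ge0_integral_sum; [|exact: measurableT| |]; last 2 first.
- move=> j; apply/measurable_EFinP.
  by apply: measurable_funM; [exact: measurable_cst|exact: mej].
- by move=> j y _; rewrite lee_fin mulr_ge0 ?expR_ge0.
apply: le_trans (lee_sum _ (fun j _ => step j)) _.
by rewrite sumEFin lee_fin -mulr_suml p1 mul1r.
Qed.

Lemma bmeas_Rintegral2 (h : T -> T -> R) : bmeas (fun z : T * T => h z.1 z.2) ->
  (\int[m]_x \int[m]_y h x y)%:E = (\int[m]_x \int[m]_y (h x y)%:E)%E.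
Proof.
move=> bh; have bi := bmeas_inner m m bh.
rewrite Rintegral_fine; last exact: bmeas_integrable.
apply: eq_integral => x _; rewrite Rintegral_fine//.
case: bh => bh [M hM]; apply: bmeas_integrable; split.
  exact: (measurableT_comp bh (pair1_measurable x)).
by exists M => y; exact: (hM (x, y)).
Qed.

Lemma Rintegral2_addc (c : R) (h : T -> T -> R) : bmeas (fun z : T * T => h z.1 z.2) ->
  \int[m]_x \int[m]_y (c + h x y) = c + \int[m]_x \int[m]_y h x y.
Proof.
move=> bh; have bi := bmeas_inner m m bh.
have i1 : m.-integrable setT (EFin \o cst c).
  exact: finite_measure_integrable_cst.
transitivity (\int[m]_x (c + \int[m]_y h x y)).
  apply: eq_Rintegral => x _; rewrite RintegralD//.
    by rewrite Rintegral_cst//= probability_setT mulr1.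
  case: bh => bh [M hM]; apply: bmeas_integrable; split.
    exact: (measurableT_comp bh (pair1_measurable x)).
  by exists M => y; exact: (hM (x, y)).
rewrite RintegralD//; last exact: (bmeas_integrable m bi).
by rewrite Rintegral_cst//= probability_setT mulr1.
Qed.

Lemma rot_inv_Rintegral (rp rm : T -> T -> T) (F : T * T -> R) :
  rot_inv m rp rm -> bmeas F ->
  \int[m]_x \int[m]_y F (rp x y, rm x y) = \int[m]_x \int[m]_y F (x, y).
Proof.
move=> [mrp mrm inv] bF; case: (bF) => mF [M FM].
have mr : measurable_fun setT (fun z : T * T => (rp z.1 z.2, rm z.1 z.2)).
  exact: measurable_fun_pair.
have bFr : bmeas (fun z : T * T => F (rp z.1 z.2, rm z.1 z.2)).
  by split; [exact: (measurableT_comp mF mr)|exists M => z].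
have MF z : 0 <= M + F z by have := FM z; rewrite ler_norml => /andP[]; lra.
have bMF (G : T * T -> R) : bmeas G -> bmeas (fun z => M + G z).
  move=> [mG [N GN]]; split; first by apply: measurable_funD; [exact: measurable_cst|].
  by exists (`|M| + N) => z; apply: le_trans (ler_normD _ _) _; rewrite lerD2l.
apply: (@addrI _ M).
rewrite -(Rintegral2_addc M (h := fun x y => F (rp x y, rm x y)) bFr).
have bF2 : bmeas (fun z : T * T => F (z.1, z.2)).
  by rewrite (_ : (fun _ => _) = F)//; apply/funext => -[].
rewrite -(Rintegral2_addc M (h := fun x y => F (x, y)) bF2).
apply: EFin_inj.
rewrite (bmeas_Rintegral2 (h := fun x y => M + F (rp x y, rm x y)) (bMF _ bFr)).
rewrite (bmeas_Rintegral2 (h := fun x y => M + F (x, y)) (bMF _ bF2)).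
apply: (inv (fun z => (M + F z)%:E)); last by move=> z; rewrite lee_fin.
by apply/measurable_EFinP; case: (bMF _ bF).
Qed.

Variables (rp rm : T -> T -> T) (Q : T -> R) (L : T -> T -> R).
Variables (J : finType) (a s : J -> R) (g : J -> T -> R).
Hypothesis rinv : rot_inv m rp rm.
Hypothesis mQ : measurable_fun setT Q.
Hypothesis QL : forall x y, Q (rp x y) - Q (rm x y) = L y x.
Hypothesis gg : forall j, gauss_law m (g j) (s j).
Hypothesis gL : forall y, gauss_law m (L y) (Num.sqrt (\sum_j (a j + g j y) ^+ 2)).
Hypothesis tau1 : 1 <= \sum_j (a j ^+ 2 + s j ^+ 2).

(** The square is at most the integral of cos (k (Q x - Q y)) over two independent
    copies. A rotation of the pair turns this difference into L y x, which is
    Gaussian in x for fixed y; the inner integral thus decays like a Gaussian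
    function of k, and averaging over y costs a power of k. *)
Lemma charfun_sqr_le (k b : R) :
  (\int[m]_x cos (k * Q x + b)) ^+ 2 <= (Num.sqrt (1 + k ^+ 2 / 2))^-1.
Proof.
have mk : measurable_fun setT (fun x => k * Q x + b).
  by apply: measurable_funD; [apply: measurable_funM; [exact: measurable_cst|]|exact: measurable_cst].
apply: le_trans (Rintegral_cos_sqr mk) _.
have bm : bmeas (fun z : T * T => cos (k * (Q z.1 - Q z.2))).
  apply: bmeas_cosf; apply: measurable_funM; first exact: measurable_cst.
  by apply: measurable_funB; [exact: (measurableT_comp mQ measurable_fst)|exact: (measurableT_comp mQ measurable_snd)].
have br : bmeas (fun z : T * T => cos (k * L z.2 z.1)).
  have [mrp mrm _] := rinv.
  have mr : measurable_fun setT (fun z : T * T => (rp z.1 z.2, rm z.1 z.2)).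
    exact: measurable_fun_pair.
  case: bm => bm1 _; split; last by exists 1 => z; exact: cos_max.
  rewrite (_ : (fun _ => _) = (fun z : T * T => cos (k * (Q z.1 - Q z.2))) \o
    (fun z : T * T => (rp z.1 z.2, rm z.1 z.2))); first exact: (measurableT_comp bm1 mr).
  by apply/funext => z /=; rewrite QL.
have bl := bmeas_swap br.
have E : \int[m]_x \int[m]_y cos (k * Q x + b - (k * Q y + b)) =
    \int[m]_y \int[m]_x cos (k * L y x).
  rewrite -(Fubini_bmeas m m br).
  apply: (etrans _ (etrans (esym (rot_inv_Rintegral rinv bm)) _)).
    apply: eq_Rintegral => x _; apply: eq_Rintegral => y _ /=; congr cos; ring.
  by apply: eq_Rintegral => x _; apply: eq_Rintegral => y _ /=; rewrite QL.
rewrite E.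
pose e (y : T) := expR (- (k ^+ 2 / 4) * \sum_j (a j + g j y) ^+ 2).
have S0 y : 0 <= \sum_j (a j + g j y) ^+ 2 by apply: sumr_ge0 => j _; exact: sqr_ge0.
have k0 : 0 <= k ^+ 2 / 4 by apply: divr_ge0; [exact: sqr_ge0|].
have me : bmeas e.
  split.
    apply: (measurableT_comp (@measurable_expR R)); apply: measurable_funM; first exact: measurable_cst.
    apply: measurable_sum => j; apply: measurable_funX; apply: measurable_funD; first exact: measurable_cst.
    by have [] := gg j.
  exists 1 => y; rewrite ger0_norm ?expR_ge0// -expR0 ler_expR mulNr oppr_le0.
  exact: mulr_ge0.
have inner y : \int[m]_x cos (k * L y x) <= e y.
  have := gauss_law_cos 0 (gauss_law_scale k (gL y)).
  under eq_Rintegral do rewrite add0r.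
  rewrite cos0 mul1r => ->; apply: le_trans (ler_norm _) _.
  apply: le_trans (cg_decay _) _; rewrite /e ler_expR exprMn sqr_sqrtr//.
  by have -> : - (k ^+ 2 * (\sum_j (a j + g j y) ^+ 2)) / 4 =
    - (k ^+ 2 / 4) * \sum_j (a j + g j y) ^+ 2 by field.
apply: (@le_trans _ _ (\int[m]_y e y)).
  apply: le_Rintegral; [exact: measurableT| | |].
  - exact: (bmeas_integrable m (bmeas_inner m m bl)).
  - exact: (bmeas_integrable m me).
  - by move=> y _; exact: inner.
rewrite -lee_fin Rintegral_fine; last exact: bmeas_integrable.
apply: le_trans (gauss_law_exp_sum gg k0 tau1) _.
by have -> : 2 * (k ^+ 2 / 4) = k ^+ 2 / 2 by field.
Qed.

Lemma charfun_le (k b : R) : 0 < k ->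
  \int[m]_x cos (k * Q x + b) <= Num.sqrt (2 / k).
Proof.
move=> k0; apply: le_trans (ler_norm _) _.
rewrite -sqrtr_sqr ler_sqrt; last by apply: divr_ge0; [|exact: ltW].
apply: le_trans (charfun_sqr_le k b) _.
rewrite -[leRHS]invrK lef_pV2 ?posrE ?sqrtr_gt0 ?invr_gt0 ?divr_gt0//; last first.
  by rewrite ltr_pwDl// divr_ge0// sqr_ge0.
rewrite invf_div -[leLHS]gtr0_norm ?divr_gt0// -sqrtr_sqr ler_sqrt; last first.
  by rewrite addr_ge0// divr_ge0// sqr_ge0.
by have := sqr_ge0 k; rewrite expr_div_n; lra.
Qed.

Lemma sum_cos_sin_sqr (N : nat) (y : R) :
  (\sum_(0 <= j < N) cos (j%:R * y)) ^+ 2 <=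
  \sum_(0 <= j < N) \sum_(0 <= l < N) cos ((j%:R - l%:R) * y).
Proof.
have -> : \sum_(0 <= j < N) \sum_(0 <= l < N) cos ((j%:R - l%:R) * y) =
  (\sum_(0 <= j < N) cos (j%:R * y)) ^+ 2 + (\sum_(0 <= j < N) sin (j%:R * y)) ^+ 2.
  rewrite !expr2 !mulr_suml -big_split/=; apply: eq_bigr => j _.
  rewrite !mulr_sumr -big_split/=; apply: eq_bigr => l _.
  by rewrite mulrBl cosB.
by rewrite lerDl sqr_ge0.
Qed.

(** Fejer's kernel, evaluated on the grid of step [1 / (N delta)], dominates the
    indicator of a [delta]-interval; its expectation only involves the
    characteristic function of [Q]. *)
Lemma anti_concentration (t delta : R) : 0 < delta ->
  (m [set x | `|Q x - t|%R <= delta]%R <= (28 * Num.sqrt delta)%:E)%E.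
Proof.
move=> d0.
have sd0 : 0 < Num.sqrt delta by rewrite sqrtr_gt0.
(* with this N the diagonal of the kernel is at most of the order of sqrt delta *)
have [N [N0 Nd]] : exists N : nat, (0 < N)%N /\ (Num.sqrt delta)^-1 <= N%:R.
  exists (Num.bound (Num.sqrt delta)^-1); split; last first.
    by apply/ltW/archi_boundP; rewrite invr_ge0 ltW.
  rewrite -(ltr_nat R); apply: lt_trans (archi_boundP _); rewrite ?invr_gt0//.
have NR0 : 0 < N%:R :> R by rewrite ltr0n.
have Nd0 : 0 < N%:R * delta by exact: mulr_gt0.
pose y x := (Q x - t) / (N%:R * delta).
have my : measurable_fun setT y.
  apply: measurable_funM; last exact: measurable_cst.
  by apply: measurable_funB; [exact: mQ|exact: measurable_cst].
pose K x := \sum_(0 <= j < N) \sum_(0 <= l < N) cos ((j%:R - l%:R) * y x).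
have ick (j l : nat) : m.-integrable setT (EFin \o (fun x => cos ((j%:R - l%:R) * y x))).
  apply: bmeas_integrable; apply: bmeas_cosf.
  by apply: measurable_funM; [exact: measurable_cst|].
pose B (k : nat) : R := if k is k'.+1 then Num.sqrt (2 * N%:R * delta / k%:R) else 1.
have B0 k : 0 <= B k by case: k => //= k; exact: sqrtr_ge0.
have hB (j l : nat) : \int[m]_x cos ((j%:R - l%:R) * y x) <= B ((j - l) + (l - j))%N.
  have pos (k : nat) : \int[m]_x cos (k.+1%:R * y x) <= B k.+1.
    have k0 : 0 < k.+1%:R / (N%:R * delta) by rewrite divr_gt0.
    have := charfun_le (- (k.+1%:R / (N%:R * delta) * t)) k0.
    rewrite /B; congr (_ <= _).
      apply: eq_Rintegral => x _; congr cos; rewrite /y; ring.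
    by congr Num.sqrt; field; rewrite !gt_eqF.
  have [jl|jl|->] := ltngtP j l.
  - rewrite (_ : (_ + _)%N = (l - j).-1.+1); last by lia.
    apply: le_trans (pos _); rewrite le_eqVlt; apply/orP; left; apply/eqP.
    apply: eq_Rintegral => x _; rewrite -cosN; congr cos.
    by rewrite prednK ?subn_gt0// natrB ?(ltnW jl)//; ring.
  - rewrite (_ : (_ + _)%N = (j - l).-1.+1); last by lia.
    apply: le_trans (pos _); rewrite le_eqVlt; apply/orP; left; apply/eqP.
    apply: eq_Rintegral => x _; congr cos.
    by rewrite prednK ?subn_gt0// natrB ?(ltnW jl).
  - rewrite subnn /=; apply: le_trans (ler_norm _) _.
    apply: Rintegral_bound; last by move=> x; exact: cos_max.
    by have [] := bmeas_cosf (f := fun x => (l%:R - l%:R) * y x) (measurable_funM (measurable_cst _) my).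
pose KK := \sum_(0 <= j < N) \sum_(0 <= l < N) \int[m]_x cos ((j%:R - l%:R) * y x).
have mK : measurable_fun setT K.
  apply: measurable_sum => j; apply: measurable_sum => l.
  by have [] := bmeas_cosf (f := fun x => (j%:R - l%:R) * y x) (measurable_funM (measurable_cst _) my).
have KE : (\int[m]_x (K x)%:E = KK%:E)%E.
  rewrite /KK -sumEFin.
  transitivity (\int[m]_x (\sum_(0 <= j < N) \sum_(0 <= l < N) (cos ((j%:R - l%:R) * y x))%:E))%E.
    apply: eq_integral => x _; rewrite /K -sumEFin; apply: eq_bigr => j _.
    by rewrite sumEFin.
  rewrite integral_sum; [|exact: measurableT|]; last first.
    by move=> j; apply: integrable_sum; [exact: measurableT|move=> l _; exact: ick].
  apply: eq_bigr => j _; rewrite -sumEFin integral_sum; [|exact: measurableT|by move=> l; exact: ick].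
  by apply: eq_bigr => l _; rewrite Rintegral_fine.
(* off the diagonal the characteristic function decays like the inverse square
   root of the distance, which sums to the square root of N *)
have KKb : KK <= N%:R * (1 + 4 * N%:R * Num.sqrt (2 * delta)).
  apply: (@le_trans _ _ (\sum_(0 <= j < N) (1 + 4 * N%:R * Num.sqrt (2 * delta)))); last first.
    by rewrite sumr_const_nat subn0 -[X in X <= _]mulr_natl.
  rewrite /KK big_nat [leRHS]big_nat; apply: ler_sum => j /andP[_ jN].
  apply: le_trans (ler_sum _ (fun l _ => hB j l)) _.
  apply: le_trans (sum_dist_le jN B0) _.
  rewrite lerD2l /B.
  have -> : \sum_(0 <= i < N) Num.sqrt (2 * N%:R * delta / i.+1%:R) =
    Num.sqrt (2 * N%:R * delta) * \sum_(0 <= i < N) (Num.sqrt i.+1%:R)^-1.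
    rewrite mulr_sumr; apply: eq_bigr => i _.
    by rewrite sqrtrM ?sqrtrV// mulr_ge0 ?(ltW d0)// mulr_ge0.
  have -> : 4 * N%:R * Num.sqrt (2 * delta) =
      2 * (Num.sqrt (2 * N%:R * delta) * (2 * Num.sqrt N%:R)) :> R.
    have -> : 2 * N%:R * delta = N%:R * (2 * delta) by ring.
    rewrite (sqrtrM _ (ltW NR0)); have := sqr_sqrtr (ltW NR0).
    set u := Num.sqrt N%:R; set v := Num.sqrt _ => uN.
    by rewrite -uN; ring.
  rewrite ler_wpM2l// ler_wpM2l ?sqrtr_ge0//; exact: sum_inv_sqrt.
set A := [set x | _].
have mA : measurable A.
  rewrite -[X in measurable X]setTI.
  apply: (measurable_fun_le (f := fun x => `|Q x - t|) (g := cst delta)) => //.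
  apply: measurableT_comp => //; apply: measurable_funB => //.
have K0 x : 0 <= K x by apply: le_trans (sum_cos_sin_sqr _ _); exact: sqr_ge0.
have KA x : `|Q x - t| <= delta -> N%:R ^+ 2 / 4 <= K x.
  move=> xd; apply: le_trans (sum_cos_sin_sqr _ _).
  have hy : `|y x| <= N%:R^-1.
    rewrite /y normrM normfV (gtr0_norm Nd0) ler_pdivrMr// mulrA mulVf ?gt_eqF//.
    by rewrite mul1r.
  have : N%:R / 2 <= \sum_(0 <= j < N) cos (j%:R * y x).
    have -> : N%:R / 2 = \sum_(0 <= j < N) (2^-1 : R).
      by rewrite sumr_const_nat subn0 -[RHS]mulr_natl.
    rewrite big_nat [leRHS]big_nat; apply: ler_sum => j /andP[_ jN].
    apply: le_trans (cos_ge _).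
    have : (j%:R * y x) ^+ 2 <= 1.
      have : `|j%:R * y x| <= 1.
        rewrite normrM normr_nat; apply: le_trans (ler_wpM2l (ler0n R j) hy) _.
        by rewrite ler_pdivrMr// mul1r ler_nat ltnW.
      by rewrite ler_norml => /andP[]; set z := _ * y x; nra.
    by lra.
  have N2 : 0 <= N%:R / 2 :> R by rewrite divr_ge0.
  have -> : N%:R ^+ 2 / 4 = (N%:R / 2) ^+ 2 :> R by field.
  by move=> h; rewrite lerXn2r ?nnegrE// (le_trans N2).
have N24 : 0 < N%:R ^+ 2 / 4 :> R by rewrite divr_gt0 ?exprn_gt0.
have main : ((N%:R ^+ 2 / 4)%:E * m A <= KK%:E)%E.
  rewrite -KE -(integral_cst m mA).
  apply: (@le_trans _ _ (\int[m]_(x in A) (K x)%:E)%E).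
    apply: ge0_le_integral => //.
    - by move=> x _; rewrite lee_fin ltW.
    - by apply/measurable_EFinP; exact: measurable_funS mK.
  apply: ge0_subset_integral => //; first exact/measurable_EFinP.
  by move=> x _; rewrite lee_fin.
rewrite -(@lee_pmul2l _ (N%:R ^+ 2 / 4)%:E)//.
apply: le_trans main _; rewrite -EFinM lee_fin.
apply: le_trans KKb _.
have s2 : Num.sqrt (2 * delta) <= 3 / 2 * Num.sqrt delta.
  rewrite (sqrtrM _ (ler0n R 2)) ler_pM2r//.
  rewrite -[leRHS]gtr0_norm ?divr_gt0// -sqrtr_sqr ler_sqrt ?sqr_ge0//.
  by rewrite expr_div_n; lra.
have Nd1 : 1 <= N%:R * Num.sqrt delta by rewrite -ler_pdivrMr// mul1r.
have : N%:R * (1 + 4 * N%:R * Num.sqrt (2 * delta)) <=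
   N%:R * (N%:R * Num.sqrt delta + 4 * N%:R * (3 / 2 * Num.sqrt delta)).
  by rewrite ler_pM2l// lerD// ler_wpM2l// mulr_ge0.
move=> h; apply: le_trans h _; rewrite le_eqVlt; apply/orP; left; apply/eqP; by field.
Qed.

End AntiConcentration.

(** * Gaussian polynomials of degree two *)

Section QuadraticForm.
Context {R : realType} (K : nat).
Implicit Types (lam b : 'I_K -> R) (c e : R).

(** The second-order polynomial c * sum_(i != j) <v_i, v_j> + sum_i <b, v_i> + e
    of vectors v_i, in terms of their sum and of the sum of their squares. *)
Definition qform lam b c e (s1 s2 : 'I_K -> R) : R :=
  c * \sum_k lam k * (s1 k ^+ 2 - s2 k) + \sum_k b k * s1 k + e.

Definition vsum d (T : measurableType d) (V : T -> 'I_K -> R) n (x : n.-tuple T) k : R :=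
  \sum_(i < n) V (tnth x i) k.
Definition vsum2 d (T : measurableType d) (V : T -> 'I_K -> R) n (x : n.-tuple T) k : R :=
  \sum_(i < n) V (tnth x i) k ^+ 2.

Lemma vsum_tcons d (T : measurableType d) (V : T -> 'I_K -> R) n z (x : n.-tuple T) k :
  vsum V (tcons (z, x)) k = V z k + vsum V x k.
Proof.
rewrite /vsum big_ord_recl tnth0; congr (_ + _).
by apply: eq_bigr => i _; rewrite tnthS.
Qed.

Lemma vsum2_tcons d (T : measurableType d) (V : T -> 'I_K -> R) n z (x : n.-tuple T) k :
  vsum2 V (tcons (z, x)) k = V z k ^+ 2 + vsum2 V x k.
Proof.
rewrite /vsum2 big_ord_recl tnth0; congr (_ + _).
by apply: eq_bigr => i _; rewrite tnthS.
Qed.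

Lemma qform_offdiag lam b c e n (v : 'I_n -> 'I_K -> R) :
  qform lam b c e (fun k => \sum_i v i k) (fun k => \sum_i v i k ^+ 2) =
  c * (\sum_(i < n) \sum_(j < n | i != j) \sum_k lam k * v i k * v j k)
   + \sum_(i < n) \sum_k b k * v i k + e.
Proof.
rewrite /qform; congr (c * _ + _ + e); last first.
  by rewrite exchange_big; apply: eq_bigr => k _; rewrite mulr_sumr.
have -> : \sum_(i < n) \sum_(j < n | i != j) \sum_k lam k * v i k * v j k =
  \sum_k \sum_(i < n) \sum_(j < n | i != j) lam k * v i k * v j k.
  rewrite [RHS]exchange_big; apply: eq_bigr => i _; exact: exchange_big.
apply: eq_bigr => k _.
rewrite expr2 mulr_suml -sumrB mulr_sumr; apply: eq_bigr => i _.
rewrite mulr_sumr (bigD1 i)//= expr2 addrC addrK mulr_sumr.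
by apply: eq_big => [j|j _]; [rewrite eq_sym|rewrite mulrA].
Qed.

(** The polynomial is affine in each of its vectors, so exchanging one of them
    only involves a single linear form. *)
Lemma qform_add lam b c e (s1 s2 v : 'I_K -> R) :
  qform lam b c e (fun k => v k + s1 k) (fun k => v k ^+ 2 + s2 k) =
  qform lam b c e s1 s2 + \sum_k (2 * c * lam k * s1 k + b k) * v k.
Proof.
rewrite /qform !mulr_sumr.
rewrite [RHS]addrAC; congr (_ + e); rewrite -!big_split/=.
by apply: eq_bigr => k _; ring.
Qed.

End QuadraticForm.

Section GaussianQuadraticForm.
Context {R : realType} (K n : nat).
Local Notation N01 := (@stdnormal R).
Variables (S : 'I_K -> 'I_K -> R) (lam b : 'I_K -> R) (c e : R).

Definition gvec : probability (K.-tuple R) R := pow N01 K.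

Definition glin (z : K.-tuple R) (k : 'I_K) : R := \sum_l S k l * tnth z l.

Lemma measurable_glin k : measurable_fun setT (glin ^~ k).
Proof.
apply: measurable_sum => l; apply: measurable_funM; first exact: measurable_cst.
exact: measurable_tnth.
Qed.

Lemma gauss_law_gvec (a : 'I_K -> R) :
  gauss_law gvec (fun z => \sum_l a l * tnth z l) (Num.sqrt (\sum_l a l ^+ 2)).
Proof.
exact: (gauss_law_pow (fun l => gauss_law_normal (a l))).
Qed.

Lemma gauss_law_glin (w : 'I_K -> R) :
  gauss_law gvec (fun z => \sum_k w k * glin z k)
    (Num.sqrt (\sum_l (\sum_k w k * S k l) ^+ 2)).
Proof.
have := gauss_law_gvec (fun l => \sum_k w k * S k l).
rewrite (_ : (fun z => _) = (fun z => \sum_k w k * glin z k))//.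
apply/funext => z; under eq_bigr do rewrite mulr_suml.
rewrite exchange_big/=; apply: eq_bigr => k _.
by rewrite /glin mulr_sumr; apply: eq_bigr => l _; rewrite mulrA.
Qed.

Definition gquad (x : n.-tuple (K.-tuple R)) : R :=
  qform lam b c e (vsum glin x) (vsum2 glin x).

Lemma measurable_vsum d (T : measurableType d) (V : T -> 'I_K -> R) m k :
  (forall k, measurable_fun setT (V ^~ k)) ->
  measurable_fun setT (fun x : m.-tuple T => vsum V x k).
Proof.
move=> mV; apply: measurable_sum => i.
exact: (measurableT_comp (mV k) (@measurable_tnth _ _ _ i)).
Qed.

Lemma measurable_vsum2 d (T : measurableType d) (V : T -> 'I_K -> R) m k :
  (forall k, measurable_fun setT (V ^~ k)) ->
  measurable_fun setT (fun x : m.-tuple T => vsum2 V x k).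
Proof.
move=> mV; apply: measurable_sum => i; apply: measurable_funX.
exact: (measurableT_comp (mV k) (@measurable_tnth _ _ _ i)).
Qed.

Lemma measurable_qform d (T : measurableType d) (s1 s2 : T -> 'I_K -> R) :
  (forall k, measurable_fun setT (s1 ^~ k)) ->
  (forall k, measurable_fun setT (s2 ^~ k)) ->
  measurable_fun setT (fun x => qform lam b c e (s1 x) (s2 x)).
Proof.
move=> m1 m2; apply: measurable_funD; last exact: measurable_cst.
apply: measurable_funD.
  apply: measurable_funM; first exact: measurable_cst.
  apply: measurable_sum => k; apply: measurable_funM; first exact: measurable_cst.
  by apply: measurable_funB; [apply: measurable_funX; exact: m1|exact: m2].
apply: measurable_sum => k; apply: measurable_funM; first exact: measurable_cst.
exact: m1.
Qed.

Lemma measurable_gquad : measurable_fun setT gquad.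
Proof.
apply: measurable_qform => k.
  by apply: measurable_vsum; exact: measurable_glin.
by apply: measurable_vsum2; exact: measurable_glin.
Qed.

Let rp1 := fun x y : R => (x + y) / Num.sqrt 2.
Let rm1 := fun x y : R => (y - x) / Num.sqrt 2.
Let rp := @tmap2 _ (K.-tuple R) (@tmap2 _ R rp1 K) n.
Let rm := @tmap2 _ (K.-tuple R) (@tmap2 _ R rm1 K) n.

Let glin_rp x y k : glin (tmap2 rp1 x y) k = (glin x k + glin y k) / Num.sqrt 2.
Proof.
rewrite /glin -big_split mulr_suml; apply: eq_bigr => l _ /=.
by rewrite tnth_mktuple /rp1; ring.
Qed.
Let glin_rm x y k : glin (tmap2 rm1 x y) k = (glin y k - glin x k) / Num.sqrt 2.
Proof.
rewrite /glin -sumrB mulr_suml; apply: eq_bigr => l _ /=.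
by rewrite tnth_mktuple /rm1; ring.
Qed.

Let u (y : n.-tuple (K.-tuple R)) (i : 'I_n) (k : 'I_K) : R :=
  2 * c * lam k * (vsum glin y k - glin (tnth y i) k) + Num.sqrt 2 * b k.
Let L (y x : n.-tuple (K.-tuple R)) : R :=
  \sum_(i < n) \sum_k u y i k * glin (tnth x i) k.

Let gquad_rot x y : gquad (rp x y) - gquad (rm x y) = L y x.
Proof.
have s20 : Num.sqrt 2 != 0 :> R by rewrite sqrtr_eq0 -ltNge.
have s22 : Num.sqrt 2 ^+ 2 = 2 :> R by rewrite sqr_sqrtr.
have E1 k : vsum glin (rp x y) k = (vsum glin x k + vsum glin y k) / Num.sqrt 2.
  rewrite /vsum -big_split mulr_suml; apply: eq_bigr => i _ /=.
  by rewrite tnth_mktuple glin_rp.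
have E2 k : vsum glin (rm x y) k = (vsum glin y k - vsum glin x k) / Num.sqrt 2.
  rewrite /vsum -sumrB mulr_suml; apply: eq_bigr => i _ /=.
  by rewrite tnth_mktuple glin_rm.
have E3 k : vsum2 glin (rp x y) k - vsum2 glin (rm x y) k =
    2 * \sum_(i < n) glin (tnth x i) k * glin (tnth y i) k.
  rewrite /vsum2 -sumrB mulr_sumr; apply: eq_bigr => i _ /=.
  rewrite !tnth_mktuple glin_rp glin_rm !expr_div_n s22.
  by field.
have E4 k : vsum glin (rp x y) k ^+ 2 - vsum glin (rm x y) k ^+ 2 =
    2 * (vsum glin x k * vsum glin y k).
  by rewrite E1 E2 !expr_div_n s22; field.
have E5 k : vsum glin (rp x y) k - vsum glin (rm x y) k = Num.sqrt 2 * vsum glin x k.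
  rewrite E1 E2 -mulrBl.
  have -> : Num.sqrt 2 * vsum glin x k = Num.sqrt 2 ^+ 2 * vsum glin x k / Num.sqrt 2 by field.
  by rewrite s22; congr (_ / _); ring.
rewrite /gquad /qform /L.
set a1 := \sum_k lam k * _; set a2 := \sum_k b k * _.
set a3 := \sum_k lam k * _; set a4 := \sum_k b k * _.
have -> : c * a1 + a2 + e - (c * a3 + a4 + e) = c * (a1 - a3) + (a2 - a4) by ring.
rewrite /a1 /a2 /a3 /a4 -!sumrB mulr_sumr -big_split/= exchange_big/=.
apply: eq_bigr => k _.
transitivity (c * lam k * ((vsum glin (rp x y) k ^+ 2 - vsum glin (rm x y) k ^+ 2)
   - (vsum2 glin (rp x y) k - vsum2 glin (rm x y) k))
   + b k * (vsum glin (rp x y) k - vsum glin (rm x y) k)); first by ring.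
rewrite E3 E4 E5.
have -> : \sum_(i < n) u y i k * glin (tnth x i) k =
   \sum_(i < n) ((2 * c * lam k * vsum glin y k + Num.sqrt 2 * b k) * glin (tnth x i) k
     - 2 * c * lam k * (glin (tnth x i) k * glin (tnth y i) k)).
  by apply: eq_bigr => i _; rewrite /u; ring.
rewrite sumrB -!mulr_sumr -/(vsum glin x k); ring.
Qed.

Let M (l m : 'I_K) : R := \sum_k S k l * lam k * S k m.
Let sb (l : 'I_K) : R := \sum_k b k * S k l.

(** The lower bound is on twice the variance of the polynomial. The difference of
    two rotated copies is bilinear, and its conditional variance given one copy
    is a sum of squares of Gaussian variables with that mean. *)
Lemma gquad_anti_concentration (t delta : R) : 0 < delta ->
  1 <= 2 * n%:R * (\sum_l (\sum_k b k * S k l) ^+ 2) +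
     4 * c ^+ 2 * (n%:R * (n%:R - 1)) *
       (\sum_l \sum_m (\sum_k S k l * lam k * S k m) ^+ 2) ->
  (pow gvec n [set x | `|gquad x - t|%R <= delta]%R <= (28 * Num.sqrt delta)%:E)%E.
Proof.
move=> d0 tau1.
pose a (j : 'I_n * 'I_K) := Num.sqrt 2 * sb j.2.
pose g (j : 'I_n * 'I_K) (y : n.-tuple (K.-tuple R)) :=
  \sum_(i < n) \sum_m (if i == j.1 then 0 else 2 * c * M j.2 m) * tnth (tnth y i) m.
pose s (j : 'I_n * 'I_K) := Num.sqrt (\sum_(i < n)
  (Num.sqrt (\sum_m (if i == j.1 then 0 else 2 * c * M j.2 m) ^+ 2)) ^+ 2).
have sq0 (I : finType) (f : I -> R) : 0 <= \sum_i f i ^+ 2.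
  by apply: sumr_ge0 => i _; exact: sqr_ge0.
apply: (anti_concentration (rp := rp) (rm := rm) (L := L) (a := a) (s := s) (g := g)) => //.
- by do 2! apply: rot_inv_pow; exact: rot_inv_normal.
- exact: measurable_gquad.
- move=> j; apply: (gauss_law_pow (fun i => gauss_law_gvec _)).
- move=> y.
  have := gauss_law_pow (fun i => gauss_law_glin (u y i)).
  congr (gauss_law _ _ (Num.sqrt _)).
  under eq_bigr do rewrite sqr_sqrtr//.
  rewrite pair_big/=; apply: eq_bigr => -[i l] _ /=; congr (_ ^+ 2).
  rewrite /a /g /= /u /sb mulr_sumr.
  have -> : \sum_(i0 < n) \sum_m (if i0 == i then 0 else 2 * c * M l m) * tnth (tnth y i0) m
     = 2 * c * \sum_k lam k * S k l * (vsum glin y k - glin (tnth y i) k).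
    have Ek k : vsum glin y k - glin (tnth y i) k =
        \sum_(i0 < n | i0 != i) glin (tnth y i0) k.
      by rewrite /vsum (bigD1 i)//= addrC addrK.
    rewrite (bigD1 i)//= eqxx big1 ?add0r; last by move=> m _; rewrite mul0r.
    under [in RHS]eq_bigr do rewrite Ek mulr_sumr.
    rewrite [in RHS]exchange_big mulr_sumr/=; apply: eq_bigr => i0 /negbTE ->.
    rewrite mulr_sumr.
    transitivity (\sum_m \sum_k 2 * c * (S k l * lam k * S k m) * tnth (tnth y i0) m).
      by apply: eq_bigr => m _; rewrite /M mulr_sumr mulr_suml.
    rewrite exchange_big/=; apply: eq_bigr => k _; rewrite /glin !mulr_sumr.
    by apply: eq_bigr => m _; ring.
  rewrite mulr_sumr -big_split/=; apply: eq_bigr => k _; ring.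
- apply: le_trans tau1 _; rewrite le_eqVlt; apply/orP; left; apply/eqP.
  rewrite big_split/=; congr (_ + _).
    transitivity (\sum_(i < n) \sum_l a (i, l) ^+ 2); last first.
      by rewrite pair_big/=; apply: eq_bigr => -[].
    transitivity (\sum_(i < n) (2 * \sum_l sb l ^+ 2)).
      by rewrite sumr_const card_ord -[RHS]mulr_natl /sb; ring.
    apply: eq_bigr => i _; rewrite mulr_sumr; apply: eq_bigr => l _.
    by rewrite /a /= exprMn sqr_sqrtr.
  transitivity (\sum_(i < n) \sum_l s (i, l) ^+ 2); last first.
    by rewrite pair_big/=; apply: eq_bigr => -[].
  have si i l : s (i, l) ^+ 2 = (n%:R - 1) * (4 * c ^+ 2 * \sum_m M l m ^+ 2).
    rewrite /s sqr_sqrtr//.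
    under eq_bigr do rewrite sqr_sqrtr//.
    rewrite (bigD1 i)//= eqxx big1 ?add0r; last by move=> m _; rewrite expr0n.
    transitivity (\sum_(j < n | j != i) (4 * c ^+ 2 * \sum_m M l m ^+ 2)).
      apply: eq_bigr => j /negbTE ->; rewrite mulr_sumr; apply: eq_bigr => m _; ring.
    rewrite sumr_const cardC1 card_ord -[LHS]mulr_natl; congr (_ * _).
    by rewrite -subn1 natrB//; case: (n) i => [[]|].
  transitivity (\sum_(i < n) ((n%:R - 1) * (4 * c ^+ 2 * \sum_l \sum_m M l m ^+ 2))).
    by rewrite sumr_const card_ord -[RHS]mulr_natl /M; ring.
  apply: eq_bigr => i _; rewrite !mulr_sumr; apply: eq_bigr => l _.
  by rewrite si.
Qed.

End GaussianQuadraticForm.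

(** * Exchanging the vectors one at a time *)

Section PowFubini.
Context (d : measure_display) (T : measurableType d) (R : realType).
Variable m : probability T R.

Lemma bmeas_tcons n (f : n.+1.-tuple T -> R) : bmeas f ->
  bmeas (fun z : T * n.-tuple T => f (tcons z)).
Proof.
move=> [mf [M fM]]; split; last by exists M => z.
exact: (measurableT_comp mf (@measurable_tcons _ T n)).
Qed.

Lemma Rintegral_powS n (f : n.+1.-tuple T -> R) : bmeas f ->
  \int[pow m n.+1]_x f x = \int[pow m n]_x \int[m]_z f (tcons (z, x)).
Proof.
move=> bf; have bft := bmeas_tcons bf.
rewrite -(Fubini_bmeas m (pow m n) bft) -(Fubini_bmeas1 m (pow m n) bft).
congr fine; rewrite /= integral_distribution//.
  by apply/measurable_EFinP; case: bf.
exact: (bmeas_integrable (m \x pow m n)%E bft).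
Qed.

End PowFubini.

Section BoundedMore.
Context (d : measure_display) (T : measurableType d) (R : realType).
Variable m : probability T R.

Lemma bmeas_B (f g : T -> R) : bmeas f -> bmeas g -> bmeas (fun x => f x - g x).
Proof.
move=> [mf [M fM]] [mg [N gN]]; split; first exact: measurable_funB.
by exists (M + N) => x; apply: le_trans (ler_normB _ _) _; rewrite lerD.
Qed.

Lemma bmeas_RintegralB (f g : T -> R) : bmeas f -> bmeas g ->
  \int[m]_x (f x - g x) = \int[m]_x f x - \int[m]_x g x.
Proof.
move=> bf bg; rewrite RintegralB//; exact: bmeas_integrable.
Qed.

Lemma bmeas_norm_Rintegral (f : T -> R) (e : T -> \bar R) : bmeas f ->
  measurable_fun setT e -> (forall x, (`|f x|%:E <= e x)%E) ->
  ((`|\int[m]_x f x|)%:E <= \int[m]_x e x)%E.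
Proof.
move=> bf me fe; have fi := bmeas_integrable m bf.
apply: (@le_trans _ _ (\int[m]_x (`|f x|)%:E)%E).
  rewrite -Rintegral_fine; last exact: integrable_norm.
  by rewrite lee_fin; apply: le_normr_Rintegral.
apply: ge0_le_integral => //.
by apply/measurable_EFinP; apply: measurableT_comp => //; case: bf.
Qed.

End BoundedMore.

Section Swap.
Context (d1 d2 : measure_display) (T1 : measurableType d1)
  (T2 : measurableType d2) (R : realType) (K : nat).
Variables (m1 : probability T1 R) (m2 : probability T2 R).
Variables (V1 : T1 -> 'I_K -> R) (V2 : T2 -> 'I_K -> R).
Variables (lam b : 'I_K -> R) (c e : R) (h : R -> R).
Hypothesis mV1 : forall k, measurable_fun setT (V1 ^~ k).
Hypothesis mV2 : forall k, measurable_fun setT (V2 ^~ k).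
Hypothesis bh : bmeas h.

Definition hyb_sum i j (p : i.-tuple T1 * j.-tuple T2) k : R :=
  vsum V1 p.1 k + vsum V2 p.2 k.

(** The hybrid sample of Lindeberg: [i] vectors of the first law followed by [j] of
    the second. *)
Definition hyb i j (p : i.-tuple T1 * j.-tuple T2) : R :=
  qform lam b c e (hyb_sum p) (fun k => vsum2 V1 p.1 k + vsum2 V2 p.2 k).

Definition hyb_coef i j (p : i.-tuple T1 * j.-tuple T2) k : R :=
  2 * c * lam k * hyb_sum p k + b k.

Lemma measurable_hyb_sum i j k : measurable_fun setT (fun p => @hyb_sum i j p k).
Proof.
apply: measurable_funD.
  exact: (measurableT_comp (measurable_vsum k mV1) measurable_fst).
exact: (measurableT_comp (measurable_vsum k mV2) measurable_snd).
Qed.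

Lemma measurable_hyb i j : measurable_fun setT (@hyb i j).
Proof.
apply: measurable_qform => k; first exact: measurable_hyb_sum.
apply: measurable_funD.
  exact: (measurableT_comp (measurable_vsum2 k mV1) measurable_fst).
exact: (measurableT_comp (measurable_vsum2 k mV2) measurable_snd).
Qed.

Lemma measurable_hyb_coef i j k : measurable_fun setT (fun p => @hyb_coef i j p k).
Proof.
apply: measurable_funD; last exact: measurable_cst.
by apply: measurable_funM; [exact: measurable_cst|exact: measurable_hyb_sum].
Qed.

Lemma hyb_tcons1 i j z (x : i.-tuple T1) (y : j.-tuple T2) :
  hyb (tcons (z, x), y) = hyb (x, y) + \sum_k hyb_coef (x, y) k * V1 z k.
Proof.
rewrite /hyb /hyb_coef -qform_add; congr qform; apply/funext => k.
  by rewrite /hyb_sum /= vsum_tcons addrA.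
by rewrite /= vsum2_tcons addrA.
Qed.

Lemma hyb_tcons2 i j z (x : i.-tuple T1) (y : j.-tuple T2) :
  hyb (x, tcons (z, y)) = hyb (x, y) + \sum_k hyb_coef (x, y) k * V2 z k.
Proof.
rewrite /hyb /hyb_coef -qform_add; congr qform; apply/funext => k.
  by rewrite /hyb_sum /= vsum_tcons addrCA.
by rewrite /= vsum2_tcons addrCA.
Qed.

Let bmeas_h d (T : measurableType d) (f : T -> R) : measurable_fun setT f ->
  bmeas (fun x => h (f x)).
Proof.
by case: bh => mh [M hM] mf; split; [exact: (measurableT_comp mh mf)|exists M].
Qed.

Definition hyb_int i j : R := \int[pow m1 i]_x \int[pow m2 j]_y h (hyb (x, y)).

Lemma hyb_int_step1 i j : hyb_int i.+1 j =
  \int[pow m1 i]_x \int[pow m2 j]_y \int[m1]_z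
    h (hyb (x, y) + \sum_k hyb_coef (x, y) k * V1 z k).
Proof.
rewrite /hyb_int Rintegral_powS; last first.
  exact: (bmeas_inner (pow m1 i.+1) (pow m2 j) (bmeas_h (@measurable_hyb i.+1 j))).
apply: eq_Rintegral => x _.
rewrite (Fubini_bmeas m1 (pow m2 j) (f := fun w => h (hyb (tcons (w.1, x), w.2)))).
  apply: eq_Rintegral => y _; apply: eq_Rintegral => z _.
  by rewrite hyb_tcons1.
apply: bmeas_h; apply: (measurableT_comp (@measurable_hyb i.+1 j)).
apply: measurable_fun_pair; last exact: measurable_snd.
apply: (measurableT_comp (@measurable_tcons _ T1 i)).
by apply: measurable_fun_pair; [exact: measurable_fst|exact: measurable_cst].
Qed.

Lemma hyb_int_step2 i j : hyb_int i j.+1 =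
  \int[pow m1 i]_x \int[pow m2 j]_y \int[m2]_z
    h (hyb (x, y) + \sum_k hyb_coef (x, y) k * V2 z k).
Proof.
apply: eq_Rintegral => x _; rewrite Rintegral_powS; last first.
  apply: bmeas_h; exact: (measurableT_comp (@measurable_hyb i j.+1) (pair1_measurable x)).
apply: eq_Rintegral => y _; apply: eq_Rintegral => z _.
by rewrite hyb_tcons2.
Qed.

Variables (C nu : R).
Hypothesis C0 : 0 <= C.
Hypothesis one_step : forall (w : 'I_K -> R) (t : R),
  ((`|\int[m1]_z h (t + \sum_k w k * V1 z k) - \int[m2]_z h (t + \sum_k w k * V2 z k)|)%:E
   <= C%:E * \int[m1]_z (`|\sum_k w k * V1 z k| `^ nu)%:E)%E.

Definition hyb_mom i j : \bar R :=
  (\int[pow m1 i]_x \int[pow m2 j]_y \int[m1]_z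
     (`|(\sum_k hyb_coef (x, y) k * V1 z k)%R| `^ nu)%:E)%E.

Let mlin i j d (T : measurableType d) (V : T -> 'I_K -> R) :
  (forall k, measurable_fun setT (V ^~ k)) ->
  measurable_fun setT (fun q : (i.-tuple T1 * j.-tuple T2) * T =>
    \sum_k hyb_coef q.1 k * V q.2 k).
Proof.
move=> mV; apply: measurable_sum => k; apply: measurable_funM.
  exact: (measurableT_comp (@measurable_hyb_coef i j k) measurable_fst).
exact: (measurableT_comp (mV k) measurable_snd).
Qed.

Let bstep i j d (T : measurableType d) (m : probability T R) (V : T -> 'I_K -> R) :
  (forall k, measurable_fun setT (V ^~ k)) ->
  bmeas (fun p : i.-tuple T1 * j.-tuple T2 =>
    \int[m]_z h (hyb p + \sum_k hyb_coef p k * V z k)).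
Proof.
move=> mV.
apply: (bmeas_inner (pow m1 i \x pow m2 j)%E m
  (f := fun q : (i.-tuple T1 * j.-tuple T2) * T =>
    h (hyb q.1 + \sum_k hyb_coef q.1 k * V q.2 k))).
apply: bmeas_h; apply: measurable_funD; last exact: mlin.
exact: (measurableT_comp (@measurable_hyb i j) measurable_fst).
Qed.

Lemma measurable_powabs d (T : measurableType d) (f : T -> R) :
  measurable_fun setT f -> measurable_fun setT (fun x => (`|f x| `^ nu)%:E).
Proof.
move=> mf; apply/measurable_EFinP.
apply: (measurableT_comp (measurable_powR nu)).
exact: measurableT_comp.
Qed.

Let mE i j : measurable_fun setT (fun p : i.-tuple T1 * j.-tuple T2 =>
  C%:E * \int[m1]_z (`|(\sum_k hyb_coef p k * V1 z k)%R| `^ nu)%:E)%E.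
Proof.
apply: measurable_funeM.
apply: (measurable_inner m1 (F := fun q : (i.-tuple T1 * j.-tuple T2) * T1 =>
  (`|(\sum_k hyb_coef q.1 k * V1 q.2 k)%R| `^ nu)%:E)).
  by apply: measurable_powabs; exact: mlin.
by move=> z; rewrite lee_fin powR_ge0.
Qed.

Lemma hyb_step i j :
  ((`|hyb_int i.+1 j - hyb_int i j.+1|)%:E <= C%:E * hyb_mom i j)%E.
Proof.
rewrite hyb_int_step1 hyb_int_step2.
have b1 := bstep i j m1 mV1; have b2 := bstep i j m2 mV2.
have b12 := bmeas_B b1 b2.
have Ex : \int[pow m1 i]_x \int[pow m2 j]_y (\int[m1]_z
    h (hyb (x, y) + \sum_k hyb_coef (x, y) k * V1 z k) - \int[m2]_z
    h (hyb (x, y) + \sum_k hyb_coef (x, y) k * V2 z k)) =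
  \int[pow m1 i]_x \int[pow m2 j]_y \int[m1]_z
    h (hyb (x, y) + \sum_k hyb_coef (x, y) k * V1 z k) -
  \int[pow m1 i]_x \int[pow m2 j]_y \int[m2]_z
    h (hyb (x, y) + \sum_k hyb_coef (x, y) k * V2 z k).
  rewrite -bmeas_RintegralB; [|exact: (bmeas_inner (pow m1 i) (pow m2 j) b1)|exact: (bmeas_inner (pow m1 i) (pow m2 j) b2)].
  apply: eq_Rintegral => x _.
  have bx (f : i.-tuple T1 * j.-tuple T2 -> R) : bmeas f -> bmeas (fun y => f (x, y)).
    by move=> [mf [M fM]]; split; [exact: (measurableT_comp mf (pair1_measurable x))|exists M].
  by rewrite bmeas_RintegralB//; [exact: (bx _ b1)|exact: (bx _ b2)].
rewrite -Ex.
set E := fun p : i.-tuple T1 * j.-tuple T2 =>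
  (C%:E * \int[m1]_z (`|(\sum_k hyb_coef p k * V1 z k)%R| `^ nu)%:E)%E.
have E0 p : (0 <= E p)%E.
  by apply: mule_ge0; [rewrite lee_fin|apply: integral_ge0 => z _; rewrite lee_fin powR_ge0].
apply: (@le_trans _ _ (\int[pow m1 i]_x \int[pow m2 j]_y E (x, y))%E).
  apply: bmeas_norm_Rintegral.
  - exact: (bmeas_inner (pow m1 i) (pow m2 j) b12).
  - exact: (measurable_inner (pow m2 j) (F := E) (@mE i j) E0).
  - move=> x; apply: bmeas_norm_Rintegral.
    + case: b12 => mb [M bM]; split; last by exists M => y.
      exact: (measurableT_comp mb (pair1_measurable x)).
    + exact: (measurableT_comp (@mE i j) (pair1_measurable x)).
    + by move=> y; exact: one_step.
have mI : measurable_fun setT (fun p : i.-tuple T1 * j.-tuple T2 =>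
    \int[m1]_z (`|(\sum_k hyb_coef p k * V1 z k)%R| `^ nu)%:E)%E.
  apply: (measurable_inner m1 (F := fun q : (i.-tuple T1 * j.-tuple T2) * T1 =>
    (`|(\sum_k hyb_coef q.1 k * V1 q.2 k)%R| `^ nu)%:E)).
    by apply: measurable_powabs; exact: mlin.
  by move=> z; rewrite lee_fin powR_ge0.
have I0 (p : i.-tuple T1 * j.-tuple T2) :
    (0 <= \int[m1]_z (`|(\sum_k hyb_coef p k * V1 z k)%R| `^ nu)%:E)%E.
  by apply: integral_ge0 => z _; rewrite lee_fin powR_ge0.
rewrite /hyb_mom -ge0_integralZl; [|exact: measurableT| | |]; last first.
- by rewrite lee_fin.
- by move=> x _; apply: integral_ge0.
- exact: (measurable_inner (pow m2 j) mI I0).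
have -> // : (\int[pow m1 i]_x \int[pow m2 j]_y E (x, y) =
  \int[pow m1 i]_x (C%:E * \int[pow m2 j]_y \int[m1]_z
   (`|(\sum_k hyb_coef (x, y) k * V1 z k)%R| `^ nu)%:E))%E.
apply: eq_integral => x _; rewrite -ge0_integralZl; [by []|exact: measurableT| | |].
- exact: (measurableT_comp mI (pair1_measurable x)).
- by move=> y _.
- by rewrite lee_fin.
Qed.

(** Telescoping over the hybrid samples. *)
Lemma swap_bound n :
  ((`|\int[pow m1 n]_x h (qform lam b c e (vsum V1 x) (vsum2 V1 x)) -
     \int[pow m2 n]_y h (qform lam b c e (vsum V2 y) (vsum2 V2 y))|)%:E <=
   \sum_(i < n) C%:E * hyb_mom i (n - i.+1)%N)%E.
Proof.
have nil0 (d : measure_display) (T : measurableType d) (V : T -> 'I_K -> R) (x : 0.-tuple T) k :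
    vsum V x k = 0 /\ vsum2 V x k = 0 by split; exact: big_ord0.
have Rcst (d : measure_display) (T : measurableType d) (m : probability T R) (r : R) :
    \int[m]_x r = r by rewrite Rintegral_cst//= probability_setT mulr1.
have -> : \int[pow m1 n]_x h (qform lam b c e (vsum V1 x) (vsum2 V1 x)) = hyb_int n (n - n).
  rewrite subnn; apply: eq_Rintegral => x _; rewrite -[LHS](Rcst _ _ (pow m2 0)).
  apply: eq_Rintegral => y _; congr (h (qform _ _ _ _ _ _)); apply/funext => k.
    by rewrite /hyb_sum /= (nil0 _ _ V2 y k).1 addr0.
  by rewrite /= (nil0 _ _ V2 y k).2 addr0.
have -> : \int[pow m2 n]_y h (qform lam b c e (vsum V2 y) (vsum2 V2 y)) = hyb_int 0 (n - 0).
  rewrite subn0 -[LHS](Rcst _ _ (pow m1 0)).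
  apply: eq_Rintegral => x _; apply: eq_Rintegral => y _.
  congr (h (qform _ _ _ _ _ _)); apply/funext => k.
    by rewrite /hyb_sum /= (nil0 _ _ V1 x k).1 add0r.
  by rewrite /= (nil0 _ _ V1 x k).2 add0r.
rewrite -(telescope_sumr (fun i => hyb_int i (n - i)) (leq0n n)) big_mkord.
apply: (@le_trans _ _ (\sum_(i < n) (`|hyb_int i.+1 (n - i.+1) - hyb_int i (n - i)|)%:E)%E).
  by rewrite sumEFin lee_fin ler_norm_sum.
apply: lee_sum => i _.
have -> : (n - i = (n - i.+1).+1)%N by rewrite subnSK.
exact: hyb_step.
Qed.

End Swap.

(** * Power inequalities and a smooth step *)

Section PowerInequalities.
Context {R : realType}.
Implicit Types x y z r nu th : R.

Lemma cube_le_powR y nu : 0 <= y <= 1 -> nu <= 3 -> y ^+ 3 <= y `^ nu.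
Proof.
move=> /andP[y0 y1] nu3; have [->|yn0] := eqVneq y 0.
  by rewrite expr0n /= powR_ge0.
have yp : 0 < y <= 1 by rewrite lt_neqAle eq_sym yn0 y0 y1.
by rewrite -powR_mulrn//; apply: ger_powR.
Qed.

Lemma sqr_le_powR y nu : 1 <= y -> 2 <= nu -> y ^+ 2 <= y `^ nu.
Proof.
by move=> y1 nu2; rewrite -powR_mulrn ?(le_trans ler01)//; apply: ler_powR.
Qed.

Lemma powR_le1 y nu : 0 <= y <= 1 -> 0 < nu -> y `^ nu <= 1.
Proof.
move=> /andP[y0 y1] nu0; have [->|yn0] := eqVneq y 0.
  by rewrite powR0 ?gt_eqF.
have yp : 0 < y <= 1 by rewrite lt_neqAle eq_sym yn0 y0 y1.
by rewrite -[leRHS](powRr0 y); apply: ger_powR => //; exact: ltW.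
Qed.

Lemma powR_le_quartic y nu : 0 <= y -> 0 < nu <= 4 -> y `^ nu <= 1 + y ^+ 4.
Proof.
move=> y0 /andP[nu0 nu4]; have y4 : 0 <= y ^+ 4 by exact: exprn_ge0.
have [y1|y1] := leP y 1.
  by apply: le_trans (powR_le1 _ nu0) _; [rewrite y0 y1|rewrite lerDl].
apply: (@le_trans _ _ (y ^+ 4)); last by rewrite lerDr.
by rewrite -powR_mulrn//; apply: ler_powR => //; exact: ltW.
Qed.

Lemma powR_scale y r nu : 0 <= y -> 0 < r -> y `^ nu = r `^ nu * (y / r) `^ nu.
Proof.
move=> y0 r0; rewrite -powRM ?divr_ge0 ?(ltW r0)//.
by rewrite mulrC divfK ?gt_eqF.
Qed.

Lemma sqr_le_split y r nu : 0 <= y -> 0 < r -> 2 <= nu ->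
  y ^+ 2 <= r ^+ 2 * (1 + (r `^ nu)^-1 * y `^ nu).
Proof.
move=> y0 r0 nu2; have rn0 : 0 < r `^ nu by exact: powR_gt0.
rewrite (powR_scale nu y0 r0) mulrA mulVf ?gt_eqF// mul1r.
have -> : y ^+ 2 = r ^+ 2 * (y / r) ^+ 2 by rewrite expr_div_n mulrC divfK// expf_neq0// gt_eqF.
rewrite ler_pM2l ?exprn_gt0//.
have z0 : 0 <= y / r by rewrite divr_ge0// ltW.
have [z1|z1] := leP (y / r) 1.
  by apply: le_trans (_ : 1 <= _); [rewrite expr_le1|rewrite lerDl powR_ge0].
by apply: le_trans (sqr_le_powR (ltW z1) nu2) _; rewrite lerDr.
Qed.

Lemma powR_le_split y r th : 0 <= y -> 0 < r -> 0 < th <= 1 ->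
  y `^ th <= r `^ th * (1 + r ^- 2 * y ^+ 2).
Proof.
move=> y0 r0 /andP[th0 th1].
rewrite (powR_scale th y0 r0) ler_pM2l ?powR_gt0//.
have z0 : 0 <= y / r by rewrite divr_ge0// ltW.
have -> : r ^- 2 * y ^+ 2 = (y / r) ^+ 2 by rewrite expr_div_n mulrC.
have [z1|z1] := leP (y / r) 1.
  by apply: le_trans (powR_le1 _ th0) _; [rewrite z0 z1|rewrite lerDl sqr_ge0].
apply: le_trans (ler1_powR (ltW z1) th1) _.
by have := sqr_ge0 (y / r - 1); nra.
Qed.

Lemma powR_subadd x y th : 0 <= x -> 0 <= y -> 0 < th <= 1 ->
  (x + y) `^ th <= x `^ th + y `^ th.
Proof.
move=> x0 y0 /andP[th0 th1].
have [xy0|xyn0] := eqVneq (x + y) 0.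
  by rewrite xy0 powR0 ?gt_eqF// addr_ge0 ?powR_ge0.
have s0 : 0 < x + y by rewrite lt_neqAle eq_sym xyn0 addr_ge0.
have h z : 0 <= z <= x + y -> z / (x + y) <= (z / (x + y)) `^ th.
  move=> /andP[z0 zs]; have [->|zn0] := eqVneq z 0.
    by rewrite mul0r powR_ge0.
  apply: ger1_powR => //; rewrite divr_gt0//; last by rewrite lt_neqAle eq_sym zn0.
  by rewrite ler_pdivrMr// mul1r.
rewrite (powR_scale th x0 s0) (powR_scale th y0 s0) -mulrDr.
rewrite -[leLHS]mulr1 ler_pM2l ?powR_gt0//.
apply: le_trans (lerD (h x _) (h y _)); last 2 first.
- by rewrite x0 lerDl.
- by rewrite y0 lerDr.
by rewrite -mulrDl divff.
Qed.

(** The signed power, up to a factor the derivative of [|x| `^ (th + 2)]. *)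
Definition spow th x : R := x * `|x| `^ th.

Lemma spow_holder th x y : 0 < th <= 1 ->
  `|spow th (x + y) - spow th x| <= 2 * `|y| * (`|x| `^ th + `|y| `^ th).
Proof.
move=> th01; have /andP[th0 th1] := th01.
have xp := powR_ge0 `|x| th; have yp := powR_ge0 `|y| th.
have zp := powR_ge0 `|x + y| th.
have x0 := normr_ge0 x; have y0 := normr_ge0 y.
have sub : `|x + y| `^ th <= `|x| `^ th + `|y| `^ th.
  apply: le_trans (powR_subadd x0 y0 th01).
  apply: ge0_ler_powR; rewrite ?nnegrE ?addr_ge0 ?normr_ge0 ?ler_normD//; exact: ltW.
have -> : spow th (x + y) - spow th x =
    y * `|x + y| `^ th + x * (`|x + y| `^ th - `|x| `^ th).
  by rewrite /spow; ring.
apply: le_trans (ler_normD _ _) _.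
rewrite !normrM (ger0_norm zp).
have h1 : `|y| * `|x + y| `^ th <= `|y| * (`|x| `^ th + `|y| `^ th).
  by rewrite ler_wpM2l.
suff h2 : `|x| * `| `|x + y| `^ th - `|x| `^ th| <= `|y| * (`|x| `^ th + `|y| `^ th) by lra.
have [xy|yx] := leP `|x| `|y|.
  apply: ler_pM => //; rewrite ler_norml; apply/andP; split; lra.
have xn0 : 0 < `|x| by apply: le_lt_trans yx.
pose u := `|x + y| / `|x|.
have u0 : 0 <= u by rewrite divr_ge0.
have uE : `|x + y| = `|x| * u by rewrite mulrC divfK ?gt_eqF.
have hu : `|u `^ th - 1| <= `|u - 1|.
  have [u1|u1] := leP 1 u.
    have a1 := ler1_powR u1 th1.
    have a2 : 1 <= u `^ th by rewrite -[leLHS](powRr0 u); apply: ler_powR => //; exact: ltW.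
    rewrite !ger0_norm ?subr_ge0//; lra.
  have [->|un0] := eqVneq u 0; first by rewrite powR0 ?gt_eqF.
  have up : 0 < u <= 1 by rewrite lt_neqAle eq_sym un0 u0 ltW.
  have a1 := ger1_powR up th1.
  have a2 : u `^ th <= 1 by apply: powR_le1 => //; rewrite u0 ltW.
  rewrite !ler0_norm ?subr_le0//; first lra.
  by rewrite ltW.
rewrite uE powRM// -{2}[`|x| `^ th]mulr1 -mulrBr normrM (ger0_norm xp).
have hxu : `|x| * `|u - 1| <= `|y|.
  rewrite -{1}[`|x|]ger0_norm// -normrM mulrBr mulr1 -uE.
  apply: le_trans (ler_dist_dist _ _) _.
  by rewrite addrAC subrr add0r.
rewrite mulrCA; apply: le_trans (_ : `|x| `^ th * (`|x| * `|u - 1|) <= _).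
  by rewrite ler_wpM2l// ler_wpM2l.
apply: le_trans (_ : `|x| `^ th * `|y| <= _); first by rewrite ler_wpM2l.
by rewrite mulrC ler_wpM2l// lerDl.
Qed.

(** Split |x + y|^nu into spow (x + y) x and spow (x + y) y; apply the inequality of
    Young to the first term and the continuity of the signed power to the second. *)
Lemma powR_taylor2 x y nu : 2 < nu <= 3 ->
  `|x + y| `^ nu <= `|x| `^ nu + nu * (spow (nu - 2) x * y) +
    6 * (`|x| `^ (nu - 2) * y ^+ 2 + `|y| `^ nu).
Proof.
move=> /andP[nu2 nu3].
have nu0 : 0 < nu by lra.
have th01 : 0 < nu - 2 <= 1 by apply/andP; split; lra.
set th := nu - 2 in th01 *.
have split2 z : `|z| `^ nu = `|z| ^+ 2 * `|z| `^ th.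
  have -> : nu = 2%:R + th by rewrite /th addrC subrK.
  rewrite powRD; last by apply/implyP => /eqP; rewrite /th; lra.
  by rewrite powR_mulrn.
have young : nu * (spow th (x + y) * x) <= (nu - 1) * `|x + y| `^ nu + `|x| `^ nu.
  set z := x + y.
  have p0 : 0 < nu - 1 by lra.
  have q0 : 0 < nu / (nu - 1) by rewrite divr_gt0.
  have pq : nu^-1 + (nu / (nu - 1))^-1 = 1 by rewrite invf_div; field; rewrite !gt_eqF.
  have zp : 0 <= `|z| `^ (nu - 1) by exact: powR_ge0.
  have := conjugate_powR (normr_ge0 x) zp nu0 q0 pq.
  rewrite -powRrM.
  have -> : (nu - 1) * (nu / (nu - 1)) = nu by field; rewrite gt_eqF.
  have -> : `|z| `^ (nu - 1) = `|z| * `|z| `^ th.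
    have -> : nu - 1 = 1 + th by rewrite /th; lra.
    rewrite powRD; last by apply/implyP => /eqP; rewrite /th; lra.
    by rewrite powRr1.
  have h : spow th z * x <= `|x| * (`|z| * `|z| `^ th).
    apply: le_trans (ler_norm _) _; rewrite /spow !normrM.
    by rewrite (ger0_norm (powR_ge0 _ _)) mulrC.
  move=> h2.
  have := le_trans h h2; rewrite -(ler_pM2l nu0) => h3.
  apply: le_trans h3 _; rewrite le_eqVlt; apply/orP; left; apply/eqP.
  by rewrite invf_div; field; rewrite gt_eqF.
have hh := spow_holder x y th01.
have e1 : `|x + y| `^ nu = spow th (x + y) * (x + y).
  by rewrite split2 real_normK ?num_real// /spow; ring.
have hd : (spow th (x + y) - spow th x) * y <=
    2 * (`|x| `^ th * y ^+ 2 + `|y| `^ nu).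
  apply: le_trans (ler_norm _) _; rewrite normrM.
  apply: le_trans (ler_wpM2r (normr_ge0 y) hh) _.
  rewrite split2 -[y ^+ 2]real_normK ?num_real//.
  rewrite le_eqVlt; apply/orP; left; apply/eqP; ring.
have W0 : 0 <= `|x| `^ th * y ^+ 2 + `|y| `^ nu.
  by rewrite addr_ge0 ?powR_ge0// mulr_ge0 ?powR_ge0// sqr_ge0.
have hnu : nu * ((spow th (x + y) - spow th x) * y) <=
   6 * (`|x| `^ th * y ^+ 2 + `|y| `^ nu).
  apply: le_trans (_ : nu * (2 * (`|x| `^ th * y ^+ 2 + `|y| `^ nu)) <= _).
    by rewrite ler_pM2l.
  by rewrite mulrA ler_wpM2r//; lra.
have : nu * `|x + y| `^ nu = nu * (spow th (x + y) * x) + nu * (spow th x * y)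
   + nu * ((spow th (x + y) - spow th x) * y) by rewrite e1; ring.
lra.
Qed.

End PowerInequalities.

Section SmoothStep.
Context {R : realType}.
Implicit Types x y nu : R.

Let p x : R := Num.max x 0.

Let pE x : (0 <= x /\ p x = x) \/ (x < 0 /\ p x = 0).
Proof.
by rewrite /p; have [x0|x0] := leP 0 x; [left|right].
Qed.

(** A cubic spline rising from 0 to 1 on the interval [0, 3], with its first two
    derivatives. *)
Definition sstep x : R :=
  (p x ^+ 3 - 3 * p (x - 1) ^+ 3 + 3 * p (x - 2) ^+ 3 - p (x - 3) ^+ 3) / 6.
Definition sstep1 x : R :=
  (p x ^+ 2 - 3 * p (x - 1) ^+ 2 + 3 * p (x - 2) ^+ 2 - p (x - 3) ^+ 2) / 2.
Definition sstep2 x : R :=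
  p x - 3 * p (x - 1) + 3 * p (x - 2) - p (x - 3).

Let cube_rem x y :
  `|p (x + y) ^+ 3 - p x ^+ 3 - 3 * p x ^+ 2 * y - 3 * p x * y ^+ 2| <= `|y| ^+ 3.
Proof.
have y0 := normr_ge0 y.
have [[x0 ->]|[x0 ->]] := pE x; have [[z0 ->]|[z0 ->]] := pE (x + y).
- by rewrite (_ : _ - _ = y ^+ 3) ?normrX//; ring.
- have yn : y < 0 by lra.
  rewrite (ltr0_norm yn).
  have -> : 0 ^+ 3 - x ^+ 3 - 3 * x ^+ 2 * y - 3 * x * y ^+ 2 = y ^+ 3 - (x + y) ^+ 3 by ring.
  have h : (- (x + y)) ^+ 3 <= (- y) ^+ 3 by rewrite lerXn2r ?nnegrE//; lra.
  have h0 : 0 <= (- (x + y)) ^+ 3 by rewrite exprn_ge0; lra.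
  have e1 : (- (x + y)) ^+ 3 = - (x + y) ^+ 3 by ring.
  have e2 : (- y) ^+ 3 = - y ^+ 3 by ring.
  rewrite e2; rewrite ler_norml; apply/andP; split; lra.
- have yp : 0 < y by lra.
  rewrite (gtr0_norm yp).
  have -> : (x + y) ^+ 3 - 0 ^+ 3 - 3 * 0 ^+ 2 * y - 3 * 0 * y ^+ 2 = (x + y) ^+ 3 by ring.
  rewrite ger0_norm ?exprn_ge0// lerXn2r ?nnegrE//; lra.
- have -> : 0 ^+ 3 - 0 ^+ 3 - 3 * 0 ^+ 2 * y - 3 * 0 * y ^+ 2 = 0 :> R by ring.
  by rewrite normr0 exprn_ge0.
Qed.

Lemma sstep_cubic x y :
  `|sstep (x + y) - sstep x - sstep1 x * y - sstep2 x * (y ^+ 2 / 2)| <= 4 / 3 * `|y| ^+ 3.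
Proof.
have h0 := cube_rem x y; have h1 := cube_rem (x - 1) y.
have h2 := cube_rem (x - 2) y; have h3 := cube_rem (x - 3) y.
have a1 : x + y - 1 = x - 1 + y by ring.
have a2 : x + y - 2 = x - 2 + y by ring.
have a3 : x + y - 3 = x - 3 + y by ring.
rewrite /sstep /sstep1 /sstep2 a1 a2 a3.
move: h0 h1 h2 h3; rewrite !ler_norml => /andP[? ?] /andP[? ?] /andP[? ?] /andP[? ?].
apply/andP; split; lra.
Qed.

Lemma sstep_le0 x : x <= 0 -> sstep x = 0.
Proof.
move=> x0; rewrite /sstep /p.
have h (z : R) : z <= 0 -> Num.max z 0 = 0 by move=> /max_idPr.
rewrite !h; try lra; by ring.
Qed.

Lemma sstep_ge3 x : 3 <= x -> sstep x = 1.
Proof.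
move=> x3; rewrite /sstep /p.
have h (z : R) : 0 <= z -> Num.max z 0 = z by move=> /max_idPl.
rewrite !h; try lra; by field.
Qed.

Lemma sstep_bounds x : [/\ 0 <= sstep x <= 1, `|sstep1 x| <= 1 & `|sstep2 x| <= 1].
Proof.
rewrite /sstep /sstep1 /sstep2.
have [[x0 ->]|[x0 ->]] := pE x; have [[x1 ->]|[x1 ->]] := pE (x - 1);
  have [[x2 ->]|[x2 ->]] := pE (x - 2); have [[x3 ->]|[x3 ->]] := pE (x - 3);
  try (exfalso; lra).
- by split; rewrite ?ler_norml; apply/andP; split; lra.
- split; rewrite ?ler_norml; apply/andP.
  + have -> : (x ^+ 3 - 3 * (x - 1) ^+ 3 + 3 * (x - 2) ^+ 3 - 0 ^+ 3) / 6 =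
      1 - (3 - x) ^+ 3 / 6 by field.
    have u0 : 0 <= 3 - x by lra.
    have u1 : 3 - x <= 1 by lra.
    have := exprn_ge0 3 u0; have := exprn_ile1 3 u0 u1; move=> ? ?; split; lra.
  + have -> : (x ^+ 2 - 3 * (x - 1) ^+ 2 + 3 * (x - 2) ^+ 2 - 0 ^+ 2) / 2 =
      (3 - x) ^+ 2 / 2 by field.
    have := sqr_ge0 (3 - x); have : (3 - x) ^+ 2 <= 1 by nra.
    move=> ? ?; split; lra.
  + by split; lra.
- split; rewrite ?ler_norml; apply/andP.
  + have -> : (x ^+ 3 - 3 * (x - 1) ^+ 3 + 3 * 0 ^+ 3 - 0 ^+ 3) / 6 =
      (1 + 3 * (x - 1) + (x - 1) ^+ 2 * (3 - 2 * (x - 1))) / 6 by field.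
    set u := x - 1 in x1 *; have u1 : u <= 1 by rewrite /u; lra.
    have q0 : 0 <= u ^+ 2 * (3 - 2 * u) by rewrite mulr_ge0 ?sqr_ge0//; lra.
    have q1 : 0 <= (1 - u) ^+ 2 * (1 + 2 * u) by rewrite mulr_ge0 ?sqr_ge0//; lra.
    have q2 : (1 - u) ^+ 2 * (1 + 2 * u) = 1 - u ^+ 2 * (3 - 2 * u) by ring.
    rewrite q2 in q1; split; lra.
  + by split; nra.
  + by split; lra.
- split; rewrite ?ler_norml; apply/andP.
  + have -> : (x ^+ 3 - 3 * 0 ^+ 3 + 3 * 0 ^+ 3 - 0 ^+ 3) / 6 = x ^+ 3 / 6 by field.
    have u1 : x <= 1 by lra.
    have := exprn_ge0 3 x0; have := exprn_ile1 3 x0 u1; move=> ? ?; split; lra.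
  + split; nra.
  + by split; lra.
- by rewrite !expr0n /= !mulr0 !subr0 !addr0 !mul0r normr0; split => //; rewrite lexx ler01.
Qed.

(** The remainder is cubic for small y and at most quadratic for large y, hence
    bounded by every power between two and three. *)
Lemma sstep_taylor x y nu : 2 < nu <= 3 ->
  `|sstep (x + y) - sstep x - sstep1 x * y - sstep2 x * (y ^+ 2 / 2)| <= 3 * `|y| `^ nu.
Proof.
move=> /andP[nu2 nu3].
have [y1|y1] := leP `|y| 1.
  apply: le_trans (sstep_cubic x y) _.
  have := cube_le_powR (_ : 0 <= `|y| <= 1) nu3; rewrite normr_ge0 y1 => /(_ isT).
  have := powR_ge0 `|y| nu; lra.
have [/andP[? ?] s1 s2] := sstep_bounds x.
have [/andP[? ?] _ _] := sstep_bounds (x + y).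
have y2 := sqr_le_powR (ltW y1) (ltW nu2).
have h1 : `|sstep1 x * y| <= `|y|.
  by rewrite normrM ler_piMl.
have h2 : `|sstep2 x * (y ^+ 2 / 2)| <= `|y| ^+ 2 / 2.
  rewrite normrM normrM normfV normrX (@ger0_norm _ 2)// ler_piMl//.
have y3 : `|y| <= `|y| ^+ 2 by rewrite expr2 ler_peMl// ltW.
move: h1 h2; rewrite !ler_norml => /andP[? ?] /andP[? ?].
apply/andP; split; lra.
Qed.

Lemma sstep_lipschitz x y : `|sstep x - sstep y| <= 3 * `|x - y|.
Proof.
have -> : x = y + (x - y) by rewrite addrC subrK.
set z := x - y; rewrite [y + z - y]addrC addKr.
have z0 := normr_ge0 z.
have [/andP[? ?] s1 s2] := sstep_bounds y.
have [/andP[? ?] _ _] := sstep_bounds (y + z).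
have [z1|z1] := leP `|z| 1; last first.
  by rewrite ler_norml; apply/andP; split; lra.
have h := sstep_cubic y z.
have h1 : `|sstep1 y * z| <= `|z|.
  by rewrite normrM ler_piMl.
have h2 : `|sstep2 y * (z ^+ 2 / 2)| <= `|z| ^+ 2 / 2.
  rewrite normrM normrM normfV normrX (@ger0_norm _ 2)// ler_piMl//.
have a2 : `|z| ^+ 2 <= `|z| by rewrite expr2 ler_piMl.
have a3 : `|z| ^+ 3 <= `|z| by rewrite exprS ler_piMr// expr_le1.
move: h h1 h2; rewrite !ler_norml => /andP[? ?] /andP[? ?] /andP[? ?].
apply/andP; split; lra.
Qed.

Lemma measurable_sstep : measurable_fun setT sstep.
Proof.
have mp (a : R) : measurable_fun setT (fun x : R => p (x - a)).
  by apply: measurable_maxr; [exact: measurable_funB|exact: measurable_cst].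
have mp0 : measurable_fun setT (fun x : R => p x).
  by apply: measurable_maxr; [exact: measurable_id|exact: measurable_cst].
apply: measurable_funM; last exact: measurable_cst.
apply: measurable_funB; last by apply: measurable_funX; exact: mp.
apply: measurable_funD; last first.
  by apply: measurable_funM; [exact: measurable_cst|apply: measurable_funX; exact: mp].
apply: measurable_funB; first exact: measurable_funX.
by apply: measurable_funM; [exact: measurable_cst|apply: measurable_funX; exact: mp].
Qed.

End SmoothStep.

(** * One step of the method of Lindeberg *)

Section SquareIntegrable.
Context (d : measure_display) (T : measurableType d) (R : realType).
Variable m : probability T R.

Definition sqint (f : T -> R) : Prop :=
  measurable_fun setT f /\ m.-integrable setT (EFin \o (fun x => f x ^+ 2)).

Lemma dominated_integrable (f g : T -> R) : measurable_fun setT f ->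
  m.-integrable setT (EFin \o g) -> (forall x, `|f x| <= g x) ->
  m.-integrable setT (EFin \o f).
Proof.
move=> mf gi fg; apply: le_integrable gi => //; first exact/measurable_EFinP.
by move=> x _ /=; rewrite lee_fin (le_trans (fg x))// ler_norm.
Qed.

Lemma sqint_cst (c : R) : sqint (fun=> c).
Proof.
split; first exact: measurable_cst.
by apply: bmeas_integrable; split; [exact: measurable_cst|exists `|c ^+ 2|].
Qed.

Lemma sqint_mul (f g : T -> R) : sqint f -> sqint g ->
  m.-integrable setT (EFin \o (fun x => f x * g x)).
Proof.
move=> [mf fi] [mg gi].
apply: (@dominated_integrable _ (fun x => f x ^+ 2 + g x ^+ 2)).
- exact: measurable_funM.
- exact: (integrableD measurableT fi gi).
- move=> x; rewrite ler_norml.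
  by have := sqr_ge0 (f x - g x); have := sqr_ge0 (f x + g x); have := sqr_ge0 (f x);
    have := sqr_ge0 (g x) => *; apply/andP; split; nra.
Qed.

Lemma sqint_integrable (f : T -> R) : sqint f -> m.-integrable setT (EFin \o f).
Proof.
move=> fs; have := sqint_mul fs (sqint_cst 1).
by congr (integrable _ _ _); apply/funext => x /=; rewrite mulr1.
Qed.

Lemma sqintD (f g : T -> R) : sqint f -> sqint g -> sqint (fun x => f x + g x).
Proof.
move=> fs gs; have [mf fi] := fs; have [mg gi] := gs.
split; first exact: measurable_funD.
have := integrableD measurableT (integrableD measurableT fi gi)
  (integrableD measurableT (sqint_mul fs gs) (sqint_mul fs gs)).
by congr (integrable _ _ _); apply/funext => x /=; rewrite -!EFinD; congr EFin; ring.
Qed.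

Lemma sqintZ (c : R) (f : T -> R) : sqint f -> sqint (fun x => c * f x).
Proof.
move=> [mf fi]; split; first exact: measurable_funM.
have := integrableZl measurableT (c ^+ 2) fi.
by congr (integrable _ _ _); apply/funext => x /=; rewrite -EFinM exprMn.
Qed.

Lemma sqintB (f g : T -> R) : sqint f -> sqint g -> sqint (fun x => f x - g x).
Proof.
move=> fs gs; have := sqintD fs (sqintZ (-1) gs).
by congr sqint; apply/funext => x; rewrite mulN1r.
Qed.

Lemma sqint_sum (I : Type) (r : seq I) (f : I -> T -> R) :
  (forall i, sqint (f i)) -> sqint (fun x => \sum_(i <- r) f i x).
Proof.
move=> fs; elim: r => [|i r IH].
  by under eq_fun do rewrite big_nil; exact: sqint_cst.
by under eq_fun do rewrite big_cons; exact: sqintD.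
Qed.

Lemma Rintegral_cst1 (c : R) : \int[m]_x c = c.
Proof.
by rewrite Rintegral_cst//= probability_setT /= mulr1.
Qed.

Lemma Rintegral_sum (I : Type) (r : seq I) (f : I -> T -> R) :
  (forall i, m.-integrable setT (EFin \o f i)) ->
  \int[m]_x (\sum_(i <- r) f i x) = \sum_(i <- r) \int[m]_x f i x.
Proof.
move=> fi; elim: r => [|i r IH].
  by rewrite big_nil; under eq_Rintegral do rewrite big_nil; rewrite Rintegral_cst1.
rewrite big_cons -IH -RintegralD//.
  by apply: eq_Rintegral => x _; rewrite big_cons.
have := @integrable_sum _ _ _ m setT measurableT I r xpredT _ (fun i _ => fi i).
by congr (integrable _ _ _); apply/funext => x /=; rewrite -sumEFin.
Qed.

End SquareIntegrable.

Section OneStep.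
Context (R : realType).
Variables (nu t0 delta : R).
Hypothesis nu23 : 2 < nu <= 3.
Hypothesis delta0 : 0 < delta.

Definition smooth x : R := sstep ((x - t0) / delta).

Lemma bmeas_smooth : bmeas smooth.
Proof.
split; last first.
  exists 1 => x; have [/andP[? ?] _ _] := sstep_bounds ((x - t0) / delta).
  by rewrite ger0_norm.
apply: (measurableT_comp (@measurable_sstep R)); apply: measurable_funM => //.
exact: measurable_funB.
Qed.

Lemma smooth_taylor x y :
  `|smooth (x + y) - smooth x - sstep1 ((x - t0) / delta) / delta * y -
    sstep2 ((x - t0) / delta) / (2 * delta ^+ 2) * y ^+ 2| <=
  3 * (delta `^ nu)^-1 * `|y| `^ nu.
Proof.
have d0 := gt_eqF delta0.
rewrite /smooth (_ : (x + y - t0) / delta = (x - t0) / delta + y / delta); last first.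
  by rewrite -mulrDl; congr (_ / _); ring.
have := sstep_taylor ((x - t0) / delta) (y / delta) nu23.
rewrite (_ : sstep1 _ * (y / delta) = sstep1 ((x - t0) / delta) / delta * y); last ring.
rewrite (_ : sstep2 _ * ((y / delta) ^+ 2 / 2) =
  sstep2 ((x - t0) / delta) / (2 * delta ^+ 2) * y ^+ 2); last by field; rewrite d0.
move=> h; apply: le_trans h _.
rewrite -mulrA ler_pM2l//; rewrite normrM normfV (gtr0_norm delta0) mulrC.
by rewrite [in leRHS](powR_scale nu (normr_ge0 y) delta0) mulKf ?gt_eqF ?powR_gt0// mulrC.
Qed.

(** The first order term vanishes because Y is centred. *)
Lemma smooth_expansion d (T : measurableType d) (m : probability T R) (Y : T -> R) t :
  sqint m Y -> \int[m]_x Y x = 0 ->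
  ((`|\int[m]_x smooth (t + Y x) - (smooth t +
      sstep2 ((t - t0) / delta) / (2 * delta ^+ 2) * \int[m]_x (Y x ^+ 2))|)%:E <=
   (3 * (delta `^ nu)^-1)%:E * \int[m]_x (`|Y x| `^ nu)%:E)%E.
Proof.
move=> Ys Y0; have [mY Yi2] := Ys; have Yi := sqint_integrable Ys.
set a := sstep1 ((t - t0) / delta) / delta.
set b := sstep2 _ / _.
have bh : bmeas (fun x => smooth (t + Y x)).
  apply: (@bmeas_comp _ _ _ _ _ (fun x => t + Y x) smooth); last exact: bmeas_smooth.
  exact: measurable_funD.
have hi := bmeas_integrable m bh.
have ci : m.-integrable setT (EFin \o (fun=> smooth t)).
  by apply: sqint_integrable; exact: sqint_cst.
have ai : m.-integrable setT (EFin \o (fun x => a * Y x)).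
  by apply: sqint_integrable; exact: sqintZ.
have bi : m.-integrable setT (EFin \o (fun x => b * Y x ^+ 2)).
  exact: (integrableZl measurableT b Yi2).
have ri : m.-integrable setT
    (EFin \o (fun x => smooth (t + Y x) - smooth t - a * Y x - b * Y x ^+ 2)).
  exact: (integrableB measurableT (integrableB measurableT (integrableB measurableT hi ci) ai) bi).
have E : \int[m]_x smooth (t + Y x) - (smooth t + b * \int[m]_x (Y x ^+ 2)) =
    \int[m]_x (smooth (t + Y x) - smooth t - a * Y x - b * Y x ^+ 2).
  rewrite RintegralB//; last exact: (integrableB measurableT (integrableB measurableT hi ci) ai).
  rewrite RintegralB//; last exact: (integrableB measurableT hi ci).
  rewrite RintegralB// Rintegral_cst1 (RintegralZl _ measurableT Yi) Y0.
  by rewrite (RintegralZl _ measurableT Yi2); ring.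
rewrite E; apply: (@le_trans _ _ (\int[m]_x (`|smooth (t + Y x) - smooth t - a * Y x - b * Y x ^+ 2|)%:E)%E).
  rewrite -Rintegral_fine; last exact: (integrable_norm ri).
  by rewrite lee_fin; exact: le_normr_Rintegral.
have mYn := @measurable_powabs _ nu _ _ _ mY.
have c0 : 0 <= 3 * (delta `^ nu)^-1 by rewrite mulr_ge0 ?invr_ge0 ?powR_ge0.
rewrite -ge0_integralZl_EFin//.
apply: ge0_le_integralT => //.
- apply/measurable_EFinP; apply: measurableT_comp => //.
  by move/integrableP: ri => [/measurable_EFinP].
- exact: measurable_funeM.
- by move=> x; rewrite -EFinM lee_fin; exact: smooth_taylor.
Qed.

(** The first two moments agree, so only the remainders of order nu are left. *)
Lemma lindeberg_step d1 d2 (T1 : measurableType d1) (T2 : measurableType d2)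
    (m1 : probability T1 R) (m2 : probability T2 R) (Y1 : T1 -> R) (Y2 : T2 -> R) (c t : R) :
  sqint m1 Y1 -> sqint m2 Y2 -> \int[m1]_x Y1 x = 0 -> \int[m2]_x Y2 x = 0 ->
  \int[m1]_x (Y1 x ^+ 2) = \int[m2]_x (Y2 x ^+ 2) -> 0 <= c ->
  (\int[m2]_x (`|Y2 x| `^ nu)%:E <= c%:E * \int[m1]_x (`|Y1 x| `^ nu)%:E)%E ->
  ((`|\int[m1]_x smooth (t + Y1 x) - \int[m2]_x smooth (t + Y2 x)|)%:E <=
   (3 * (delta `^ nu)^-1 * (1 + c))%:E * \int[m1]_x (`|Y1 x| `^ nu)%:E)%E.
Proof.
move=> s1 s2 z1 z2 e12 c0 le12.
have := smooth_expansion t s1 z1; have := smooth_expansion t s2 z2; rewrite -e12.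
set e := _ + _ * _; move=> h2 h1.
have k0 : 0 <= 3 * (delta `^ nu)^-1 by rewrite mulr_ge0 ?invr_ge0 ?powR_ge0.
apply: (@le_trans _ _ ((`|\int[m1]_x smooth (t + Y1 x) - e|)%:E +
   (`|\int[m2]_x smooth (t + Y2 x) - e|)%:E)%E).
  by rewrite -EFinD lee_fin (distrC (\int[m2]_x smooth (t + Y2 x))); exact: ler_distD.
apply: le_trans (leeD h1 h2) _.
move: (3 * _) k0 => k k0.
rewrite mulrDr mulr1 EFinD ge0_muleDl ?lee_fin//; last exact: mulr_ge0.
by rewrite leeD2l// EFinM -muleA; apply: lee_wpmul2l; rewrite ?lee_fin.
Qed.

End OneStep.

(** * Moments of order nu *)

Lemma integral_cst1 d (T : measurableType d) (R : realType) (m : probability T R)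
    (c : \bar R) : (\int[m]_x c = c)%E.
Proof.
transitivity (c * m setT)%E; first exact: (integral_cst m measurableT c).
by rewrite [X in (_ * X)%E]probability_setT mule1.
Qed.

Lemma ge0_integralDT d (T : measurableType d) (R : realType) (m : probability T R)
    (f g : T -> \bar R) : measurable_fun setT f -> measurable_fun setT g ->
  (forall x, 0 <= f x)%E -> (forall x, 0 <= g x)%E ->
  (\int[m]_x (f x + g x) = \int[m]_x f x + \int[m]_x g x)%E.
Proof. by move=> mf mg f0 g0; exact: (ge0_integralD m measurableT (fun x _ => f0 x) mf (fun x _ => g0 x) mg). Qed.

Lemma ge0_integralZT d (T : measurableType d) (R : realType) (m : probability T R)
    (k : R) (f : T -> \bar R) : measurable_fun setT f ->
  (forall x, 0 <= f x)%E -> 0 <= k ->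
  (\int[m]_x (k%:E * f x) = k%:E * \int[m]_x f x)%E.
Proof. by move=> mf f0; exact: (ge0_integralZl_EFin m measurableT (fun x _ => f0 x) mf). Qed.

Section Moments.
Context (d : measure_display) (T : measurableType d) (R : realType).
Variables (m : probability T R) (nu : R).
Hypothesis nu23 : 2 < nu <= 3.

Let nu0 : 0 < nu. Proof. by case/andP: nu23 => ? _; lra. Qed.

(** The inequality of Lyapunov up to a constant, by truncation. *)
Lemma second_moment_le (f : T -> R) (s : R) : sqint m f -> 0 <= s ->
  \int[m]_x (f x ^+ 2) = s ^+ 2 ->
  ((s `^ nu)%:E <= 3%:E * \int[m]_x (`|f x| `^ nu)%:E)%E.
Proof.
move=> [mf fi] s0 fs.
have mfn := @measurable_powabs _ nu _ _ _ mf.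
have i0 : (0 <= \int[m]_x (`|f x| `^ nu)%:E)%E.
  by apply: integral_ge0 => x _; rewrite lee_fin powR_ge0.
have [s00|sp] := leP s 0.
  have -> : s = 0 by lra.
  by rewrite powR0 ?gt_eqF// mule_ge0.
(* the truncation level sqrt (s^2 / 2) leaves half of the second moment *)
set r := Num.sqrt (s ^+ 2 / 2).
have r0 : 0 < r by rewrite sqrtr_gt0 divr_gt0// exprn_gt0.
have r2 : r ^+ 2 = s ^+ 2 / 2 by rewrite sqr_sqrtr// ltW// divr_gt0// exprn_gt0.
have rn0 : 0 < r `^ nu by exact: powR_gt0.
have h : ((s ^+ 2)%:E <= (r ^+ 2)%:E + (r ^+ 2 / r `^ nu)%:E * \int[m]_x (`|f x| `^ nu)%:E)%E.
  have ic : (r ^+ 2)%:E = (\int[m]_x (r ^+ 2)%:E)%E by rewrite integral_cst1.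
  rewrite -fs Rintegral_fine// [X in (_ <= X + _)%E]ic.
  have k0 : 0 <= r ^+ 2 / r `^ nu by rewrite divr_ge0 ?sqr_ge0// ltW.
  rewrite -ge0_integralZl_EFin// -ge0_integralD//; last 2 first.
  - by move=> x _; rewrite -EFinM lee_fin mulr_ge0// powR_ge0.
  - exact: measurable_funeM.
  - apply: ge0_le_integralT => //.
  + by apply/measurable_EFinP; exact: measurable_funX.
  + by apply: emeasurable_funD => //; exact: measurable_funeM.
  + by move=> x; rewrite lee_fin sqr_ge0.
  + move=> x; rewrite -EFinM -EFinD lee_fin.
    have nu2 : 2 <= nu by case/andP: nu23 => /ltW.
    have := sqr_le_split (normr_ge0 (f x)) r0 nu2; rewrite real_normK ?num_real//.
    by rewrite mulrDr mulr1 mulrA.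
  - by move=> x _; rewrite lee_fin sqr_ge0.
have snu : s `^ nu <= 3 * r `^ nu.
  have -> : s = 2 `^ (2^-1) * r.
    rewrite /r sqrtrM ?sqr_ge0// sqrtr_sqr gtr0_norm// powR12_sqrt//.
    by rewrite mulrCA -sqrtrM// divff ?sqrtr1 ?mulr1.
  rewrite powRM ?powR_ge0 ?(ltW r0)// ler_pM2r// -powRrM.
  apply: (@le_trans _ _ (2 `^ (3 / 2))).
    by apply: ler_powR => //; case/andP: nu23 => *; lra.
  rewrite -(@ler_pXn2r _ 2) ?nnegrE ?powR_ge0//.
  rewrite -[X in X <= _]powR_mulrn ?powR_ge0// -powRrM.
  rewrite (_ : 3 / 2 * 2%:R = 3%:R); last by field.
  by rewrite powR_mulrn//; lra.
move: h i0; case: (\int[m]_x _)%E => [M| |] //; last first.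
  by move=> _ _; rewrite gt0_muley ?lee_fin ?leey.
rewrite -!EFinM -EFinD !lee_fin => h M0.
apply: le_trans snu _; rewrite ler_pM2l//.
have : r ^+ 2 * r `^ nu <= r ^+ 2 * M.
  have : r ^+ 2 <= r ^+ 2 / r `^ nu * M by rewrite r2 in h *; lra.
  rewrite -mulrA mulrCA ler_pdivlMl// mulrC.
  by rewrite [X in X <= _]mulrC.
by rewrite ler_pM2l// exprn_gt0.
Qed.

(** The power nu is at most 1 + x^4, whose normal expectation is at most 65. *)
Lemma gauss_law_moment (f : T -> R) (s : R) : gauss_law m f s -> 0 <= s ->
  (\int[m]_x (`|f x| `^ nu)%:E <= (65 * s `^ nu)%:E)%E.
Proof.
move=> [mf fs] s0.
have mp : measurable_fun setT (fun y : R => (`|y| `^ nu)%:E).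
  by apply: (@measurable_powabs _ nu _ _ id).
rewrite (fs (fun y : R => (`|y| `^ nu)%:E))//.
apply: (@le_trans _ _ (\int[@stdnormal R]_x ((s `^ nu)%:E * (1 + (x ^+ 4)%:E)))%E).
  apply: ge0_le_integralT.
  - by apply: (@measurable_powabs _ nu _ _ (fun x => s * x)); apply: measurable_funM.
  - apply: measurable_funeM; apply: emeasurable_funD => //.
    by apply/measurable_EFinP; exact: measurable_exprn.
  - by move=> x; rewrite lee_fin powR_ge0.
  move=> x; rewrite normrM powRM// (ger0_norm s0) -EFinD -EFinM lee_fin ler_wpM2l ?powR_ge0//.
  have := @powR_le_quartic _ `|x| nu (normr_ge0 x).
  have -> : `|x| ^+ 4 = x ^+ 4.
    by rewrite (exprM _ 2 2) real_normK ?num_real// -exprM.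
  by apply; rewrite nu0; case/andP: nu23 => *; lra.
have m4 : measurable_fun setT (fun x : R => (x ^+ 4)%:E).
  by apply/measurable_EFinP; exact: measurable_exprn.
have x40 (x : R) : (0 <= (x ^+ 4)%:E)%E.
  by rewrite lee_fin (exprM _ 2 2) sqr_ge0.
rewrite ge0_integralZl_EFin ?powR_ge0//; last 2 first.
- by move=> x _; rewrite adde_ge0.
- by apply: emeasurable_funD.
rewrite [(65 * _)%R]mulrC EFinM lee_wpmul2l ?lee_fin ?powR_ge0//.
rewrite ge0_integralD// integral_cst1.
have -> : 65%:E = (1 + 64%:E)%E :> \bar R by rewrite -EFinD; congr EFin; ring.
by rewrite leeD2l//; exact: normal_x4_bound.
Qed.

End Moments.

(** * Moments of sums of independent centred variables *)

Section SumMoment.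
Context (d : measure_display) (T : measurableType d) (R : realType).
Variables (m : probability T R) (nu : R) (f : T -> R) (s : R).
Hypothesis nu23 : 2 < nu <= 3.
Hypothesis sf : sqint m f.
Hypothesis f0 : \int[m]_x f x = 0.
Hypothesis s0 : 0 <= s.
Hypothesis fs : \int[m]_x (f x ^+ 2) = s ^+ 2.

Let nu0 : 0 < nu. Proof. by case/andP: nu23 => ? _; lra. Qed.
Let mf : measurable_fun setT f. Proof. by case: sf. Qed.
Let fi : m.-integrable setT (EFin \o f). Proof. exact: sqint_integrable. Qed.
Let f2i : m.-integrable setT (EFin \o (fun x => f x ^+ 2)). Proof. by case: sf. Qed.

Definition tsum n (x : n.-tuple T) : R := \sum_(i < n) f (tnth x i).

Lemma measurable_tsum n : measurable_fun setT (@tsum n).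
Proof.
apply: measurable_sum => i.
exact: (measurableT_comp mf (@measurable_tnth _ _ _ i)).
Qed.

Lemma tsum_tcons n z (x : n.-tuple T) : tsum (tcons (z, x)) = tsum x + f z.
Proof.
rewrite /tsum big_ord_recl tnth0 addrC; congr (_ + _).
by apply: eq_bigr => i _; rewrite tnthS.
Qed.

Lemma integral_shift_sqr t : (\int[m]_z ((t + f z) ^+ 2)%:E = (t ^+ 2 + s ^+ 2)%:E)%E.
Proof.
have st : sqint m (fun z => t + f z) by apply: sqintD => //; exact: sqint_cst.
rewrite -Rintegral_fine; last by case: st.
congr EFin; rewrite -fs.
have ti : m.-integrable setT (EFin \o (fun=> t ^+ 2)) by apply: sqint_integrable; exact: sqint_cst.
have tfi : m.-integrable setT (EFin \o (fun z => 2 * t * f z)).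
  by apply: sqint_integrable; exact: sqintZ.
transitivity (\int[m]_z (t ^+ 2 + 2 * t * f z + f z ^+ 2)).
  by apply: eq_Rintegral => z _; ring.
rewrite RintegralD//; last exact: (integrableD measurableT ti tfi).
by rewrite RintegralD// Rintegral_cst1 (RintegralZl _ measurableT fi) f0 mulr0 addr0.
Qed.

Lemma integral_tsum_sqr n :
  (\int[pow m n]_x (tsum x ^+ 2)%:E = (n%:R * s ^+ 2)%:E)%E.
Proof.
have mt k : measurable_fun setT (fun x : k.-tuple T => (tsum x ^+ 2)%:E).
  by apply/measurable_EFinP; apply: measurable_funX; exact: measurable_tsum.
elim: n => [|n IH].
  under eq_integral do rewrite /tsum big_ord0 expr0n /=.
  by rewrite integral0 mul0r.
rewrite ge0_integral_powS2//; last by move=> x; rewrite lee_fin sqr_ge0.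
under eq_integral => x _.
  under eq_integral do rewrite tsum_tcons.
  rewrite integral_shift_sqr EFinD; over.
rewrite (ge0_integralDT _ (mt n) (measurable_cst _)) => [|x|x]; rewrite ?lee_fin ?sqr_ge0//.
by rewrite IH integral_cst1 -EFinD; congr EFin; rewrite -natr1; ring.
Qed.

(** Expectation of the second order Taylor inequality for the power nu: the first
    order term vanishes because f is centered. *)
Lemma integral_shift_powR t M : (\int[m]_z (`|f z| `^ nu)%:E = M%:E)%E ->
  (\int[m]_z (`|t + f z| `^ nu)%:E <=
   (`|t| `^ nu + 6 * s ^+ 2 * `|t| `^ (nu - 2) + 6 * M)%:E)%E.
Proof.
move=> fM.
have mfn := @measurable_powabs _ nu _ _ _ mf.
have fni : m.-integrable setT (EFin \o (fun z => `|f z| `^ nu)).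
  apply/integrableP; split => //.
  by under eq_integral do rewrite /= ger0_norm ?powR_ge0//; rewrite fM ltry.
pose a := nu * spow (nu - 2) t; pose b := 6 * `|t| `^ (nu - 2).
pose rhs z := `|t| `^ nu + (a * f z + (b * f z ^+ 2 + 6 * `|f z| `^ nu)).
have le z : `|t + f z| `^ nu <= rhs z.
  have := powR_taylor2 t (f z) nu23; rewrite /rhs /a /b => h.
  by apply: le_trans h _; rewrite le_eqVlt; apply/orP; left; apply/eqP; ring.
have i1 : m.-integrable setT (EFin \o (fun=> `|t| `^ nu)).
  by apply: sqint_integrable; exact: sqint_cst.
have i2 : m.-integrable setT (EFin \o (fun z => a * f z)).
  by apply: sqint_integrable; exact: sqintZ.
have i3 : m.-integrable setT (EFin \o (fun z => b * f z ^+ 2)).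
  exact: (integrableZl measurableT b f2i).
have i4 : m.-integrable setT (EFin \o (fun z => 6 * `|f z| `^ nu)).
  exact: (integrableZl measurableT 6 fni).
have i34 := integrableD measurableT i3 i4.
have i234 := integrableD measurableT i2 i34.
have ir : m.-integrable setT (EFin \o rhs) := integrableD measurableT i1 i234.
apply: (@le_trans _ _ (\int[m]_z (rhs z)%:E)%E).
  apply: ge0_le_integralT => //.
    by apply: (@measurable_powabs _ nu _ _ (fun z => t + f z)); exact: measurable_funD.
  by move/integrableP: ir => [].
rewrite -Rintegral_fine// lee_fin /rhs.
rewrite (RintegralD measurableT i1 i234) (RintegralD measurableT i2 i34).
rewrite (RintegralD measurableT i3 i4) Rintegral_cst1.
rewrite (RintegralZl _ measurableT fi) (RintegralZl _ measurableT f2i).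
rewrite (RintegralZl _ measurableT fni) f0 fs /b.
have -> : \int[m]_z (`|f z| `^ nu) = M by rewrite /Rintegral fM.
by rewrite le_eqVlt; apply/orP; left; apply/eqP; ring.
Qed.

Lemma integral_tsum_small_powR n N : (n <= N)%N -> (0 < N)%N ->
  ((s ^+ 2)%:E * \int[pow m n]_x (`|tsum x| `^ (nu - 2))%:E <=
   (2 * N%:R `^ (nu / 2 - 1) * s `^ nu)%:E)%E.
Proof.
move=> nN N0; have N0' : 0 < N%:R :> R by rewrite ltr0n.
have [s00|sp] := leP s 0.
  have -> : s = 0 by apply/eqP; rewrite eq_le s00.
  by rewrite expr0n /= mul0e lee_fin mulr_ge0 ?powR_ge0// mulr_ge0 ?powR_ge0.
have th01 : 0 < nu - 2 <= 1 by case/andP: nu23 => *; apply/andP; split; lra.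
set r := Num.sqrt N%:R * s.
have r0 : 0 < r by rewrite mulr_gt0 ?sqrtr_gt0.
have r2 : r ^+ 2 = N%:R * s ^+ 2 by rewrite exprMn sqr_sqrtr// ltW.
have rt : 0 <= r `^ (nu - 2) by exact: powR_ge0.
have mt := @measurable_tsum n.
have mt2 : measurable_fun setT (fun x : n.-tuple T => (tsum x ^+ 2)%:E).
  by apply/measurable_EFinP; exact: measurable_funX.
have h : (\int[pow m n]_x (`|tsum x| `^ (nu - 2))%:E <= (2 * r `^ (nu - 2))%:E)%E.
  apply: (@le_trans _ _ (\int[pow m n]_x ((r `^ (nu - 2))%:E * (1%:E + (r ^- 2)%:E * (tsum x ^+ 2)%:E)))%E).
    apply: ge0_le_integralT.
    - exact: (@measurable_powabs _ (nu - 2)).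
    - apply: measurable_funeM; apply: emeasurable_funD => //.
      exact: measurable_funeM.
    - by move=> x; rewrite lee_fin powR_ge0.
    - move=> x; rewrite -(EFinM (r ^- 2)) -EFinD -EFinM lee_fin.
      have := powR_le_split (normr_ge0 (tsum x)) r0 th01.
      by rewrite real_normK ?num_real.
  have p2 : 0 <= r ^- 2 by rewrite invr_ge0 sqr_ge0.
  have q2 (x : n.-tuple T) : (0 <= (r ^- 2)%:E * (tsum x ^+ 2)%:E)%E.
    by rewrite -EFinM lee_fin mulr_ge0// sqr_ge0.
  have mt3 : measurable_fun setT (fun x : n.-tuple T => (r ^- 2)%:E * (tsum x ^+ 2)%:E)%E.
    exact: measurable_funeM.
  have q3 (x : n.-tuple T) : (0 <= (tsum x ^+ 2)%:E)%E by rewrite lee_fin sqr_ge0.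
  have q4 (x : n.-tuple T) : (0 <= 1%:E + (r ^- 2)%:E * (tsum x ^+ 2)%:E)%E by rewrite adde_ge0.
  rewrite (ge0_integralZT _ (emeasurable_funD (measurable_cst _) mt3) q4 rt).
  rewrite (ge0_integralDT _ (measurable_cst _) mt3 (fun=> lee01) q2).
  rewrite integral_cst1 (ge0_integralZT _ mt2 q3 p2).
  rewrite integral_tsum_sqr -(EFinM (r ^- 2)) -EFinD -EFinM lee_fin mulrC ler_wpM2r//.
  have : r ^- 2 * (n%:R * s ^+ 2) <= 1.
    rewrite mulrC ler_pdivrMr ?exprn_gt0// mul1r r2 ler_pM2r ?exprn_gt0//.
    by rewrite ler_nat.
  lra.
apply: (@le_trans _ _ ((s ^+ 2)%:E * (2 * r `^ (nu - 2))%:E)%E).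
  by rewrite lee_wpmul2l// lee_fin sqr_ge0.
rewrite -EFinM lee_fin /r powRM ?sqrtr_ge0// -powR12_sqrt; last exact: ltW.
rewrite -powRrM (_ : 2^-1 * (nu - 2) = nu / 2 - 1); last by field.
have -> : s `^ nu = s ^+ 2 * s `^ (nu - 2).
  rewrite -powR_mulrn ?(ltW sp)// -powRD; last by rewrite (gt_eqF sp) implybT.
  by congr powR; ring.
by rewrite le_eqVlt; apply/orP; left; apply/eqP; ring.
Qed.

(** Induction on the number of summands; [N] dominates all the intermediate
    lengths, which keeps the increments uniform. *)
Lemma integral_tsum_powR_le n N M : (n <= N)%N -> (0 < N)%N ->
  (\int[m]_z (`|f z| `^ nu)%:E = M%:E)%E ->
  (\int[pow m n]_x (`|tsum x| `^ nu)%:E <=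
   (42 * n%:R * N%:R `^ (nu / 2 - 1) * M)%:E)%E.
Proof.
move=> + N0 fM.
have mt k := @measurable_powabs _ nu _ _ _ (@measurable_tsum k).
have mt' k := @measurable_powabs _ (nu - 2) _ _ _ (@measurable_tsum k).
have M0 : 0 <= M.
  by rewrite -lee_fin -fM; apply: integral_ge0 => x _; rewrite lee_fin powR_ge0.
have sM : s `^ nu <= 3 * M.
  by have := second_moment_le nu23 sf s0 fs; rewrite fM -EFinM lee_fin.
have N1 : 1 <= N%:R `^ (nu / 2 - 1) :> R.
  have e : 0 <= nu / 2 - 1 by case/andP: nu23 => *; lra.
  have e1 : 1 = 1 `^ (nu / 2 - 1) :> R by rewrite powR1.
  by rewrite [leLHS]e1 ge0_ler_powR// ?nnegrE// ler1n.
set A := _ `^ (nu / 2 - 1) in N1 *.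
elim: n => [|n IH] nN.
  under eq_integral do rewrite /tsum big_ord0 normr0 powR0 ?gt_eqF//.
  by rewrite integral0 mulr0 !mul0r.
have s6 : 0 <= 6 * s ^+ 2 by rewrite mulr_ge0// sqr_ge0.
have q (x : n.-tuple T) : (0 <= (6 * s ^+ 2)%:E * (`|tsum x| `^ (nu - 2))%:E)%E.
  by rewrite -EFinM lee_fin mulr_ge0// powR_ge0.
have M6 : (0 <= (6 * M)%:E)%E by rewrite lee_fin mulr_ge0.
have q' (x : n.-tuple T) : (0 <= (`|tsum x| `^ (nu - 2))%:E)%E by rewrite lee_fin powR_ge0.
have q2 (x : n.-tuple T) : (0 <= (`|tsum x| `^ nu)%:E)%E by rewrite lee_fin powR_ge0.
have m6 : measurable_fun setT (fun x : n.-tuple T => (6 * s ^+ 2)%:E * (`|tsum x| `^ (nu - 2))%:E)%E.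
  exact: measurable_funeM.
rewrite (ge0_integral_powS2 m (mt n.+1)); last by move=> x; rewrite lee_fin powR_ge0.
apply: (@le_trans _ _ (\int[pow m n]_x ((`|tsum x| `^ nu)%:E +
    ((6 * s ^+ 2)%:E * (`|tsum x| `^ (nu - 2))%:E + (6 * M)%:E)))%E).
  apply: ge0_le_integralT => //.
  - apply: (@measurable_inner _ _ _ _ _ m (fun q : n.-tuple T * T => (`|tsum (tcons (q.2, q.1))| `^ nu)%:E)).
      apply: measurableT_comp (mt n.+1) _; apply: measurableT_comp (@measurable_tcons _ T n) _.
      by apply: measurable_fun_pair; [exact: measurable_snd|exact: measurable_fst].
    by move=> z; rewrite lee_fin powR_ge0.
  - exact: (emeasurable_funD (mt n) (emeasurable_funD m6 (measurable_cst _))).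
  - by move=> x; apply: integral_ge0 => z _; rewrite lee_fin powR_ge0.
  - move=> x; under eq_integral do rewrite tsum_tcons.
    by apply: le_trans (integral_shift_powR _ fM) _; rewrite -EFinM -!EFinD addrA.
rewrite (ge0_integralDT _ (mt n) (emeasurable_funD m6 (measurable_cst _)) q2 (fun x => adde_ge0 (q x) M6)).
rewrite (ge0_integralDT _ m6 (measurable_cst _) q (fun=> M6)).
rewrite integral_cst1 (ge0_integralZT _ (mt' n) q' s6) (EFinM 6 (s ^+ 2)) -muleA.
have := integral_tsum_small_powR (ltnW nN) N0; rewrite -/A => h.
apply: (@le_trans _ _ ((42 * n%:R * A * M)%:E + (6%:E * (2 * A * s `^ nu)%:E + (6 * M)%:E))%E).
  by apply: leeD; [exact: IH (ltnW nN)|rewrite leeD2r// lee_wpmul2l].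
rewrite -EFinM -!EFinD lee_fin -natr1.
have A0 : 0 <= A by exact: powR_ge0.
have : A * s `^ nu <= A * (3 * M) by rewrite ler_wpM2l.
have : 1 * M <= A * M by rewrite ler_wpM2r.
nra.
Qed.

(** The moment inequality of Marcinkiewicz and Zygmund for sums of independent
    centered variables, with an unoptimised constant. *)
Lemma integral_tsum_powR n N : (n <= N)%N -> (0 < N)%N ->
  (\int[pow m n]_x (`|tsum x| `^ nu)%:E <=
   (42 * N%:R `^ (nu / 2))%:E * \int[m]_z (`|f z| `^ nu)%:E)%E.
Proof.
move=> nN N0; have N0' : 0 < N%:R :> R by rewrite ltr0n.
have NN : N%:R `^ (nu / 2) = N%:R * N%:R `^ (nu / 2 - 1) :> R.
  have {2}-> : N%:R = N%:R `^ 1 :> R by rewrite powRr1// ltW.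
  by rewrite -powRD; [congr powR; ring|rewrite (gt_eqF N0') implybT].
have i0 : (0 <= \int[m]_x (`|f x| `^ nu)%:E)%E.
  by apply: integral_ge0 => x _; rewrite lee_fin powR_ge0.
case fM : (\int[m]_z _)%E i0 => [M| |] // M0; last first.
  by rewrite gt0_muley ?leey// lte_fin mulr_gt0// powR_gt0.
apply: le_trans (integral_tsum_powR_le nN N0 fM) _.
rewrite -EFinM lee_fin ler_wpM2r// NN mulrA ler_wpM2r ?powR_ge0//.
by rewrite ler_pM2l// ler_nat.
Qed.

End SumMoment.

(** * Gaussian replacement in a polynomial of degree two *)

Section PowerTriangle.
Context {R : realType}.
Implicit Types x y z nu : R.

Lemma powR_norm_le x y nu : 0 < nu -> `|x| <= y -> `|x| `^ nu <= y `^ nu.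
Proof.
move=> nu0 xy; apply: ge0_ler_powR => //; rewrite ?nnegrE; first exact: ltW.
exact: le_trans xy.
Qed.

Lemma powR_triangle3 x y z nu : 0 < nu <= 3 ->
  `|x + y + z| `^ nu <= 27 * (`|x| `^ nu + `|y| `^ nu + `|z| `^ nu).
Proof.
move=> /andP[nu0 nu3].
have xp := powR_ge0 `|x| nu; have yp := powR_ge0 `|y| nu; have zp := powR_ge0 `|z| nu.
have tri : `|x + y + z| <= `|x| + `|y| + `|z|.
  by apply: le_trans (ler_normD _ _) _; rewrite lerD2r ler_normD.
have p27 : 3 `^ nu <= 27 :> R.
  have -> : 27 = 3 `^ 3 :> R by rewrite powR_mulrn//; ring.
  by apply: ler_powR => //; lra.
pose t := Num.max `|x| (Num.max `|y| `|z|).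
have xt : `|x| <= t by rewrite le_max lexx.
have yt : `|y| <= t by rewrite !le_max lexx orbT.
have zt : `|z| <= t by rewrite !le_max lexx !orbT.
have t0 : 0 <= t := le_trans (normr_ge0 x) xt.
have tE : [\/ t = `|x|, t = `|y| | t = `|z|].
  rewrite /t; have [_|_] := leP `|x|; last by constructor 1.
  by have [_|_] := leP `|y|; [constructor 3|constructor 2].
have tl : t `^ nu <= `|x| `^ nu + `|y| `^ nu + `|z| `^ nu.
  by case: tE => ->; [rewrite -addrA lerDl addr_ge0|rewrite addrAC lerDr addr_ge0|rewrite lerDr addr_ge0].
have h : `|x + y + z| <= 3 * t by apply: le_trans tri _; clear -xt yt zt; lra.
apply: le_trans (powR_norm_le nu0 h) _.
by rewrite powRM//; apply: ler_pM => //; exact: powR_ge0.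
Qed.

End PowerTriangle.

Section SeparatedBound.
Context (d1 d2 : measure_display) (T1 : measurableType d1) (T2 : measurableType d2)
  (R : realType).
Variables (m1 : probability T1 R) (m2 : probability T2 R).
Variables (F : T1 * T2 -> \bar R) (a : T1 -> \bar R) (b : T2 -> \bar R) (l : \bar R) (k D : R).
Hypotheses (mF : measurable_fun setT F) (F0 : forall p, (0 <= F p)%E).
Hypotheses (ma : measurable_fun setT a) (a0 : forall p, (0 <= a p)%E).
Hypotheses (mb : measurable_fun setT b) (b0 : forall p, (0 <= b p)%E).
Hypotheses (l0 : (0 <= l)%E) (k0 : 0 <= k) (D0 : 0 <= D).

Lemma integral2_sep_le :
  (forall x y, F (x, y) <= k%:E * (D%:E * a x + D%:E * b y + l))%E ->
  (\int[m1]_x \int[m2]_y F (x, y) <=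
   k%:E * (D%:E * \int[m1]_x a x + D%:E * \int[m2]_y b y + l))%E.
Proof.
move=> Fle.
have pos (t : \bar R) : (0 <= t)%E -> (0 <= D%:E * t)%E.
  by move=> t0; apply: mule_ge0; first by rewrite lee_fin.
set Ib := (\int[m2]_y b y)%E.
have DIb : (0 <= D%:E * Ib)%E by apply: pos; apply: integral_ge0 => y _; exact: b0.
have mDa := measurable_funeM D%:E ma; have mDb := measurable_funeM D%:E mb.
have c1 (t : \bar R) : measurable_fun [set: T1] (fun=> t) by exact: measurable_cst.
have c2 (t : \bar R) : measurable_fun [set: T2] (fun=> t) by exact: measurable_cst.
have pa x := pos _ (a0 x); have pb y := pos _ (b0 y).
have max := emeasurable_funD (emeasurable_funD mDa (c1 (D%:E * Ib)%E)) (c1 l).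
have mxb x := emeasurable_funD (emeasurable_funD (c2 (D%:E * a x)%E) mDb) (c2 l).
have Iy x : (\int[m2]_y (k%:E * (D%:E * a x + D%:E * b y + l)) =
    k%:E * (D%:E * a x + D%:E * Ib + l))%E.
  rewrite (ge0_integralZT _ (mxb x) (fun y => adde_ge0 (adde_ge0 (pa x) (pb y)) l0) k0).
  rewrite (ge0_integralDT _ (emeasurable_funD (c2 _) mDb) (c2 l) (fun y => adde_ge0 (pa x) (pb y)) (fun=> l0)).
  rewrite (ge0_integralDT _ (c2 _) mDb (fun=> pa x) pb).
  by rewrite !integral_cst1 (ge0_integralZT _ mb b0 D0).
apply: (@le_trans _ _ (\int[m1]_x (k%:E * (D%:E * a x + D%:E * Ib + l)))%E).
  apply: ge0_le_integralT.
  - exact: (measurable_inner m2 mF F0).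
  - exact: (measurable_funeM _ max).
  - by move=> x; apply: integral_ge0.
  - move=> x; rewrite -Iy; apply: ge0_le_integralT => //.
      exact: (measurableT_comp mF (pair1_measurable x)).
    exact: (measurable_funeM _ (mxb x)).
rewrite (ge0_integralZT _ max (fun x => adde_ge0 (adde_ge0 (pa x) DIb) l0) k0).
rewrite (ge0_integralDT _ (emeasurable_funD mDa (c1 _)) (c1 l) (fun x => adde_ge0 (pa x) DIb) (fun=> l0)).
rewrite (ge0_integralDT _ mDa (c1 _) pa (fun=> DIb)) !integral_cst1.
by rewrite (ge0_integralZT _ ma a0 D0).
Qed.

End SeparatedBound.

Lemma sep_const_le (R : realType) (k D A B c : R) (X Y Z l : \bar R) :
  0 <= k -> 0 <= D -> 0 <= A -> 0 <= B -> A + B <= c -> (0 <= X)%E -> (0 <= Y)%E ->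
  (0 <= Z)%E -> (X <= A%:E * Z)%E -> (Y <= B%:E * Z)%E ->
  (k%:E * (D%:E * X + D%:E * Y + l) <= k%:E * ((D * c)%:E * Z + l))%E.
Proof.
move=> k0 D0 A0 B0 ABc X0 Y0 Z0 XA YB.
rewrite lee_wpmul2l ?lee_fin// leeD2r// -ge0_muleDr// EFinM -muleA.
rewrite lee_wpmul2l ?lee_fin//; apply: le_trans (leeD XA YB) _.
by rewrite -ge0_muleDl ?lee_fin// -EFinD lee_wpmul2r// lee_fin.
Qed.

Section GaussianReplacement.
Context (d : measure_display) (T : measurableType d) (R : realType) (K N : nat).
Variables (m : probability T R) (V : T -> 'I_K -> R) (S : 'I_K -> 'I_K -> R).
Variables (lam b : 'I_K -> R) (c e nu : R).
Hypothesis N0 : (0 < N)%N.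
Hypothesis nu23 : 2 < nu <= 3.
Hypothesis sV : forall k, sqint m (V ^~ k).
Hypothesis V0 : forall k, \int[m]_x V x k = 0.
Hypothesis covV : forall k l, \int[m]_x (V x k * V x l) = \sum_j S k j * S l j.

Local Notation G := (glin S).
Local Notation gv := (@gvec R K).

Definition lin (v w : 'I_K -> R) : R := \sum_k w k * v k.
Definition lin_std (w : 'I_K -> R) : R := Num.sqrt (\sum_l (\sum_k w k * S k l) ^+ 2).

Lemma sqint_lin w : sqint m (fun x => lin (V x) w).
Proof. by apply: sqint_sum => k; exact: sqintZ. Qed.

Lemma Rintegral_lin w : \int[m]_x lin (V x) w = 0.
Proof.
rewrite Rintegral_sum; last by move=> k; apply: sqint_integrable; exact: sqintZ.
rewrite big1// => k _; rewrite (RintegralZl _ measurableT) ?V0 ?mulr0//.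
exact: sqint_integrable.
Qed.

Lemma lin_std_sqr w : lin_std w ^+ 2 = \sum_l (\sum_k w k * S k l) ^+ 2.
Proof. by rewrite sqr_sqrtr// sumr_ge0// => l _; exact: sqr_ge0. Qed.

Lemma Rintegral_lin_sqr w : \int[m]_x (lin (V x) w ^+ 2) = lin_std w ^+ 2.
Proof.
have i2 k l : m.-integrable setT (EFin \o (fun x => w k * w l * (V x k * V x l))).
  exact: (integrableZl measurableT (w k * w l) (sqint_mul (sV k) (sV l))).
have i1 k : m.-integrable setT (EFin \o (fun x => \sum_l w k * w l * (V x k * V x l))).
  have := @integrable_sum _ _ _ m setT measurableT _ (index_enum 'I_K) xpredT _ (fun l _ => i2 k l).
  by congr (integrable _ _ _); apply/funext => x /=; rewrite -sumEFin.
transitivity (\int[m]_x \sum_k \sum_l w k * w l * (V x k * V x l)).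
  apply: eq_Rintegral => x _; rewrite expr2 mulr_suml; apply: eq_bigr => k _.
  by rewrite mulr_sumr; apply: eq_bigr => l _; ring.
rewrite Rintegral_sum// lin_std_sqr.
transitivity (\sum_k \sum_l \sum_j (w k * S k j) * (w l * S l j)).
  apply: eq_bigr => k _; rewrite Rintegral_sum//; apply: eq_bigr => l _.
  rewrite (RintegralZl _ measurableT (sqint_mul (sV k) (sV l))) covV mulr_sumr.
  by apply: eq_bigr => j _; ring.
under eq_bigr do rewrite exchange_big/=.
rewrite exchange_big/=; apply: eq_bigr => j _.
rewrite expr2 mulr_suml; apply: eq_bigr => k _.
by rewrite mulr_sumr.
Qed.

Lemma gauss_law_lin w : gauss_law gv (fun z => lin (G z) w) (lin_std w).
Proof. exact: gauss_law_glin. Qed.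

Lemma gauss_law_sqint d' (T' : measurableType d') (m' : probability T' R) f s :
  gauss_law m' f s -> sqint m' f.
Proof.
move=> [mf fs]; split => //; apply/integrableP; split.
  by apply/measurable_EFinP; exact: measurable_funX.
have mF : measurable_fun setT (fun y : R => (`|y ^+ 2|)%:E).
  by apply/measurable_EFinP; apply: measurableT_comp => //; exact: measurable_exprn.
rewrite [ltLHS](fs (fun y : R => (`|y ^+ 2|)%:E))//.
have /integrableP[_] := integrableZl measurableT (s ^+ 2) (@normal_integrable_x2 R).
by congr (_ < _)%E; apply: eq_integral => x _; rewrite /= exprMn.
Qed.

Lemma gauss_law_mean d' (T' : measurableType d') (m' : probability T' R) f s :
  gauss_law m' f s -> \int[m']_x f x = 0.
Proof.
move=> [mf fs]; rewrite [LHS](same_law_Rintegral fs (F := id))//.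
have xi : (@stdnormal R).-integrable setT (EFin \o id).
  by apply: sqint_integrable; split => //; exact: normal_integrable_x2.
by rewrite (RintegralZl _ measurableT xi) normal_odd ?mulr0.
Qed.

Lemma gauss_law_sqr d' (T' : measurableType d') (m' : probability T' R) f s :
  gauss_law m' f s -> \int[m']_x (f x ^+ 2) = s ^+ 2.
Proof.
move=> [mf fs]; rewrite [LHS](same_law_Rintegral fs (F := fun y : R => y ^+ 2)); last exact: measurable_exprn.
under eq_Rintegral do rewrite exprMn.
by rewrite (RintegralZl _ measurableT (@normal_integrable_x2 R)) normal_x2 mulr1.
Qed.

Lemma lin_std_moment w :
  (((lin_std w) `^ nu)%:E <= 3%:E * \int[m]_x (`|lin (V x) w| `^ nu)%:E)%E.
Proof.
apply: second_moment_le => //; [exact: sqint_lin|exact: sqrtr_ge0|exact: Rintegral_lin_sqr].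
Qed.

Lemma glin_moment w : (\int[gv]_z (`|lin (G z) w| `^ nu)%:E <=
  195%:E * \int[m]_x (`|lin (V x) w| `^ nu)%:E)%E.
Proof.
apply: le_trans (gauss_law_moment nu23 (gauss_law_lin w) (sqrtr_ge0 _)) _.
rewrite EFinM (_ : 195 = 65 * 3); last ring.
by rewrite (EFinM 65 3) -muleA lee_wpmul2l ?lee_fin//; exact: lin_std_moment.
Qed.

(** The constant is 3 (1 + 195): the remainder of the spline, times the moments of
    the two laws. *)
Lemma gauss_one_step t0 delta w t : 0 < delta ->
  ((`|\int[m]_z smooth t0 delta (t + lin (V z) w) -
      \int[gv]_z smooth t0 delta (t + lin (G z) w)|)%:E <=
   (588 * (delta `^ nu)^-1)%:E * \int[m]_z (`|lin (V z) w| `^ nu)%:E)%E.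
Proof.
move=> delta0; rewrite (_ : 588 * _ = 3 * (delta `^ nu)^-1 * (1 + 195)); last ring.
have gl := gauss_law_lin w.
apply: lindeberg_step => //.
- exact: sqint_lin.
- exact: gauss_law_sqint gl.
- exact: Rintegral_lin.
- exact: gauss_law_mean gl.
- by rewrite Rintegral_lin_sqr (gauss_law_sqr gl).
- exact: glin_moment.
Qed.

Lemma tsum_lin d' (T' : measurableType d') (W : T' -> 'I_K -> R) w n (x : n.-tuple T') :
  \sum_k w k * vsum W x k = tsum (fun z => lin (W z) w) x.
Proof.
rewrite /tsum /lin /vsum exchange_big /=; apply: eq_bigr => k _.
by rewrite mulr_sumr.
Qed.

Lemma data_sum_moment w n : (n <= N)%N ->
  (\int[pow m n]_x (`|\sum_k w k * vsum V x k| `^ nu)%:E <=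
   (42 * N%:R `^ (nu / 2))%:E * \int[m]_z (`|lin (V z) w| `^ nu)%:E)%E.
Proof.
move=> nN; under eq_integral do rewrite tsum_lin.
apply: (integral_tsum_powR (s := lin_std w)) => //.
- exact: sqint_lin.
- exact: Rintegral_lin.
- exact: sqrtr_ge0.
- exact: Rintegral_lin_sqr.
Qed.

Lemma gauss_sum_moment w n : (n <= N)%N ->
  (\int[pow gv n]_y (`|\sum_k w k * vsum G y k| `^ nu)%:E <=
   (195 * N%:R `^ (nu / 2))%:E * \int[m]_z (`|lin (V z) w| `^ nu)%:E)%E.
Proof.
move=> nN; under eq_integral do rewrite tsum_lin.
have nu0 : 0 < nu by case/andP: nu23 => *; lra.
have gl := gauss_law_pow (fun i : 'I_n => gauss_law_lin w).
apply: le_trans (gauss_law_moment nu23 gl (sqrtr_ge0 _)) _.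
have -> : \sum_(i < n) lin_std w ^+ 2 = n%:R * lin_std w ^+ 2.
  by rewrite sumr_const card_ord mulr_natl.
rewrite sqrtrM// sqrtr_sqr ger0_norm ?sqrtr_ge0//.
rewrite powRM ?sqrtr_ge0//.
have h : Num.sqrt n%:R `^ nu <= N%:R `^ (nu / 2) :> R.
  rewrite -powR12_sqrt// -powRrM [2^-1 * _]mulrC; apply: ge0_ler_powR; rewrite ?nnegrE//.
    by rewrite divr_ge0 ?ltW.
  by rewrite ler_nat.
apply: (@le_trans _ _ ((65 * N%:R `^ (nu / 2))%:E * (lin_std w `^ nu)%:E)%E).
  rewrite -EFinM lee_fin mulrA ler_wpM2r ?powR_ge0//.
  by rewrite ler_pM2l.
rewrite (_ : 195 * _ = 65 * N%:R `^ (nu / 2) * 3); last ring.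
rewrite [(_ * 3)%:E]EFinM -muleA; apply: lee_wpmul2l; last exact: lin_std_moment.
by rewrite lee_fin mulr_ge0// powR_ge0.
Qed.

Definition ker_mom : \bar R :=
  (\int[m]_z \int[m]_x (`|lin (V z) (fun k => lam k * V x k)| `^ nu)%:E)%E.
Definition lin_mom : \bar R := (\int[m]_z (`|lin (V z) b| `^ nu)%:E)%E.

Let mV k : measurable_fun setT (V ^~ k). Proof. by case: (sV k). Qed.
Let mG k : measurable_fun setT (G ^~ k). Proof. exact: measurable_glin. Qed.
Let nu0 : 0 < nu. Proof. by case/andP: nu23 => *; lra. Qed.
Let mlinW d' (T' : measurableType d') (W : T' -> 'I_K -> R) :
  (forall k, measurable_fun setT (W ^~ k)) ->
  measurable_fun setT (fun q : T * T' => (`|\sum_k (lam k * V q.1 k) * W q.2 k| `^ nu)%:E).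
Proof.
move=> mW; apply: (@measurable_powabs _ nu _ _ (fun q : T * T' => \sum_k lam k * V q.1 k * W q.2 k)).
apply: measurable_sum => k; apply: measurable_funM.
  by apply: measurable_funM => //; exact: (measurableT_comp (mV k) measurable_fst).
exact: (measurableT_comp (mW k) measurable_snd).
Qed.

(** Given z, the coefficient of the exchanged vector is a sum of independent
    centered terms, to which the moment inequality applies; the two families
    are separated by the triangle inequality. *)
Lemma hyb_mom_le i j : (i <= N)%N -> (j <= N)%N ->
  (hyb_mom m gv V G lam b c nu i j <=
   27%:E * (((`|2 * c| `^ nu * (237 * N%:R `^ (nu / 2)))%:E * ker_mom) + lin_mom))%E.
Proof.
move=> iN jN.
pose w z k := lam k * V z k.
pose D := `|2 * c| `^ nu.
have D0 : 0 <= D by exact: powR_ge0.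
pose A z (x : i.-tuple T) := (`|\sum_k w z k * vsum V x k| `^ nu)%:E.
pose B z (y : j.-tuple (K.-tuple R)) := (`|\sum_k w z k * vsum G y k| `^ nu)%:E.
pose C z := (`|lin (V z) b| `^ nu)%:E.
have mA : measurable_fun setT (fun q : T * i.-tuple T => A q.1 q.2).
  by apply: mlinW => k; exact: measurable_vsum.
have mB : measurable_fun setT (fun q : T * j.-tuple (K.-tuple R) => B q.1 q.2).
  by apply: mlinW => k; exact: measurable_vsum.
have mC : measurable_fun setT C.
  by apply: (@measurable_powabs _ nu _ _ (fun z => lin (V z) b)); case: (sqint_lin b).
have A0 z x : (0 <= A z x)%E by rewrite lee_fin powR_ge0.
have B0 z x : (0 <= B z x)%E by rewrite lee_fin powR_ge0.
have C0 z : (0 <= C z)%E by rewrite lee_fin powR_ge0.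
have pt x y z : ((`|(\sum_k hyb_coef V G lam b c (x, y) k * V z k)%R| `^ nu)%:E <=
    27%:E * (D%:E * A z x + D%:E * B z y + C z))%E.
  have -> : \sum_k hyb_coef V G lam b c (x, y) k * V z k =
      2 * c * (\sum_k w z k * vsum V x k) + 2 * c * (\sum_k w z k * vsum G y k) + lin (V z) b.
    rewrite /lin !mulr_sumr -!big_split /=; apply: eq_bigr => k _.
    by rewrite /hyb_coef /hyb_sum /w /=; ring.
  have nu3 : 0 < nu <= 3 by rewrite nu0; case/andP: nu23.
  have := powR_triangle3 (2 * c * \sum_k w z k * vsum V x k)
    (2 * c * \sum_k w z k * vsum G y k) (lin (V z) b) nu3.
  by rewrite !(normrM (2 * c)) !(powRM nu (normr_ge0 (2 * c)) (normr_ge0 _)).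
have DE : D = `|2 * c| `^ nu by [].
clearbody D.
have pos (t : \bar R) : (0 <= t)%E -> (0 <= D%:E * t)%E.
  by move=> t0; apply: mule_ge0; first by rewrite lee_fin.
pose a x := (\int[m]_z A z x)%E; pose b' y := (\int[m]_z B z y)%E.
have a0 x : (0 <= a x)%E by apply: integral_ge0 => z _; exact: A0.
have b0 y : (0 <= b' y)%E by apply: integral_ge0 => z _; exact: B0.
have l0 : (0 <= lin_mom)%E by apply: integral_ge0 => z _; exact: C0.
have ma : measurable_fun setT a.
  exact: (@measurable_inner2 _ _ _ _ _ m (fun q => A q.1 q.2) mA (fun q => A0 q.1 q.2)).
have mb : measurable_fun setT b'.
  exact: (@measurable_inner2 _ _ _ _ _ m (fun q => B q.1 q.2) mB (fun q => B0 q.1 q.2)).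
have mAx x : measurable_fun setT (A ^~ x).
  exact: (measurableT_comp mA (pair2_measurable x)).
have mBy y : measurable_fun setT (B ^~ y).
  exact: (measurableT_comp mB (pair2_measurable y)).
have DA0 z x : (0 <= D%:E * A z x)%E by exact: pos.
have DB0 z y : (0 <= D%:E * B z y)%E by exact: pos.
have mDA x := measurable_funeM D%:E (mAx x).
have mDB y := measurable_funeM D%:E (mBy y).
have inner x y : (\int[m]_z (`|(\sum_k hyb_coef V G lam b c (x, y) k * V z k)%R| `^ nu)%:E <=
    27%:E * (D%:E * a x + D%:E * b' y + lin_mom))%E.
  apply: (@le_trans _ _ (\int[m]_z (27%:E * (D%:E * A z x + D%:E * B z y + C z)))%E).
    apply: ge0_le_integralT => //.
    - by apply: (@measurable_powabs _ nu); case: (sqint_lin (hyb_coef V G lam b c (x, y))).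
    - exact: (measurable_funeM _ (emeasurable_funD (emeasurable_funD (mDA x) (mDB y)) mC)).
  rewrite (ge0_integralZT _ (emeasurable_funD (emeasurable_funD (mDA x) (mDB y)) mC) (fun z => adde_ge0 (adde_ge0 (DA0 z x) (DB0 z y)) (C0 z)) (ler0n R 27)).
  rewrite (ge0_integralDT _ (emeasurable_funD (mDA x) (mDB y)) mC (fun z => adde_ge0 (DA0 z x) (DB0 z y)) C0).
  rewrite (ge0_integralDT _ (mDA x) (mDB y) (DA0 ^~ x) (DB0 ^~ y)).
  by rewrite (ge0_integralZT _ (mAx x) (A0 ^~ x) D0) (ge0_integralZT _ (mBy y) (B0 ^~ y) D0).
have mlm : measurable_fun setT (fun z => \int[m]_x (`|lin (V z) (fun k => lam k * V x k)| `^ nu)%:E)%E.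
  apply: (@measurable_inner _ _ _ _ _ m (fun q : T * T => (`|lin (V q.1) (fun k => lam k * V q.2 k)| `^ nu)%:E)).
    apply: (@measurable_powabs _ nu _ _ (fun q : T * T => lin (V q.1) (fun k => lam k * V q.2 k))).
    apply: measurable_sum => k; apply: measurable_funM.
      by apply: measurable_funM => //; exact: (measurableT_comp (mV k) measurable_snd).
    exact: (measurableT_comp (mV k) measurable_fst).
  by move=> q; rewrite lee_fin powR_ge0.
have lm0 z : (0 <= \int[m]_x (`|lin (V z) (fun k => lam k * V x k)| `^ nu)%:E)%E.
  by apply: integral_ge0 => x _; rewrite lee_fin powR_ge0.
have linC z x : lin (V z) (fun k => lam k * V x k) = lin (V x) (w z).
  by apply: eq_bigr => k _; rewrite /w mulrAC.
have ka : (\int[pow m i]_x a x <= (42 * N%:R `^ (nu / 2))%:E * ker_mom)%E.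
  have c0 : 0 <= 42 * N%:R `^ (nu / 2) by rewrite mulr_ge0 ?powR_ge0.
  rewrite -(tonelli_swap m (pow m i) mA A0) -(ge0_integralZT _ mlm lm0 c0).
  apply: ge0_le_integralT.
  - exact: (@measurable_inner _ _ _ _ _ (pow m i) (fun q => A q.1 q.2) mA (fun q => A0 q.1 q.2)).
  - exact: measurable_funeM.
  - by move=> z; apply: integral_ge0 => x _; exact: A0.
  - by move=> z; under [X in (_ <= _ * X)%E]eq_integral do rewrite linC; exact: data_sum_moment.
have kb : (\int[pow gv j]_y b' y <= (195 * N%:R `^ (nu / 2))%:E * ker_mom)%E.
  have c0 : 0 <= 195 * N%:R `^ (nu / 2) by rewrite mulr_ge0 ?powR_ge0.
  rewrite -(tonelli_swap m (pow gv j) mB B0) -(ge0_integralZT _ mlm lm0 c0).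
  apply: ge0_le_integralT.
  - exact: (@measurable_inner _ _ _ _ _ (pow gv j) (fun q => B q.1 q.2) mB (fun q => B0 q.1 q.2)).
  - exact: measurable_funeM.
  - by move=> z; apply: integral_ge0 => y _; exact: B0.
  - by move=> z; under [X in (_ <= _ * X)%E]eq_integral do rewrite linC; exact: gauss_sum_moment.
have kap0 : (0 <= ker_mom)%E by apply: integral_ge0 => z _; exact: lm0.
have mI : measurable_fun setT (fun p : i.-tuple T * j.-tuple (K.-tuple R) =>
    \int[m]_z (`|(\sum_k hyb_coef V G lam b c p k * V z k)%R| `^ nu)%:E)%E.
  apply: (measurable_inner m (F := fun q : (i.-tuple T * j.-tuple (K.-tuple R)) * T =>
    (`|(\sum_k hyb_coef V G lam b c q.1 k * V q.2 k)%R| `^ nu)%:E)).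
    apply: (@measurable_powabs _ nu _ _ (fun q : (i.-tuple T * j.-tuple (K.-tuple R)) * T =>
      \sum_k hyb_coef V G lam b c q.1 k * V q.2 k)).
    apply: measurable_sum => k; apply: measurable_funM.
      exact: (measurableT_comp (measurable_hyb_coef lam b c mV mG k) measurable_fst).
    exact: (measurableT_comp (mV k) measurable_snd).
  by move=> z; rewrite lee_fin powR_ge0.
have I0 (p : i.-tuple T * j.-tuple (K.-tuple R)) :
    (0 <= \int[m]_z (`|(\sum_k hyb_coef V G lam b c p k * V z k)%R| `^ nu)%:E)%E.
  by apply: integral_ge0 => z _; rewrite lee_fin powR_ge0.
have k27 : 0 <= 27 :> R by [].
have cN : 0 <= N%:R `^ (nu / 2) :> R by exact: powR_ge0.
have L := integral2_sep_le (pow m i) (pow gv j) mI I0 ma a0 mb b0 l0 k27 D0 inner.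
apply: (le_trans L).
rewrite -DE; apply: (sep_const_le lin_mom k27 D0 _ _ _ _ _ kap0 ka kb); rewrite ?mulr_ge0//.
- by rewrite -mulrDl; apply: ler_wpM2r => //; lra.
- by apply: integral_ge0 => x _; exact: a0.
- by apply: integral_ge0 => y _; exact: b0.
Qed.

Lemma gauss_replacement t0 delta : 0 < delta ->
  ((`|\int[pow m N]_x smooth t0 delta (qform lam b c e (vsum V x) (vsum2 V x)) -
      \int[pow gv N]_y smooth t0 delta (gquad S lam b c e y)|)%:E <=
   (588 * (delta `^ nu)^-1 * 27 * N%:R)%:E *
     ((`|2 * c| `^ nu * (237 * N%:R `^ (nu / 2)))%:E * ker_mom + lin_mom))%E.
Proof.
move=> delta0.
have C0 : 0 <= 588 * (delta `^ nu)^-1.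
  by apply: mulr_ge0; [exact: ler0n|rewrite invr_ge0; exact: powR_ge0].
have os w t := gauss_one_step t0 w t delta0.
move: (588 * _) C0 os => C C0 os.
set X := (_ * ker_mom + lin_mom)%E.
have h := swap_bound lam b c e mV mG (bmeas_smooth t0 delta) C0 os N.
apply: (le_trans h).
apply: (@le_trans _ _ (\sum_(i < N) C%:E * (27%:E * X))%E).
  apply: lee_sum => i _; apply: lee_wpmul2l; first by rewrite lee_fin.
  by apply: hyb_mom_le; [exact: ltnW|exact: leq_subr].
rewrite sumr_const card_ord -[leLHS]mule_natl muleA -EFinM muleA -EFinM.
by rewrite (_ : N%:R * _ * _ = C * 27 * N%:R)//; ring.
Qed.

End GaussianReplacement.

(** * From smooth test functions to probabilities *)

Section Smoothing.
Context (R : realType).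
Implicit Types t delta e : R.

Lemma smooth_le_ind t delta (x : R) : 0 < delta -> smooth t delta x <= (t < x)%R%:R.
Proof.
move=> d0; have [tx|xt] := ltP t x.
  by have [/andP[_ ?] _ _] := sstep_bounds ((x - t) / delta).
by rewrite /smooth sstep_le0// pmulr_lle0 ?invr_gt0// subr_le0.
Qed.

Lemma smooth_ge_ind t delta (x : R) : 0 < delta -> (t + 3 * delta <= x)%R%:R <= smooth t delta x.
Proof.
move=> d0; have [tx|xt] := leP (t + 3 * delta) x.
  by rewrite /smooth sstep_ge3// ler_pdivlMr// lerBrDl.
by have [/andP[? _] _ _] := sstep_bounds ((x - t) / delta).
Qed.

Lemma smooth_lipschitz t delta (x y : R) : 0 < delta ->
  `|smooth t delta x - smooth t delta y| <= 3 / delta * `|x - y|.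
Proof.
move=> d0; apply: le_trans (sstep_lipschitz _ _) _.
rewrite -mulrBl opprB addrA subrK normrM normfV (gtr0_norm d0).
by rewrite -mulrA [X in _ <= 3 * X]mulrC.
Qed.

Lemma Rintegral_ind d (T : measurableType d) (m : probability T R) (b : T -> bool) :
  measurable [set x | b x] -> \int[m]_x (b x)%:R = fine (m [set x | b x]).
Proof.
move=> mb; rewrite /Rintegral; congr fine.
have := integral_indic m measurableT mb; rewrite setIT => <-.
by apply: eq_integral => x _; rewrite indicE mem_setE.
Qed.

Lemma prob_le_Rintegral d (T : measurableType d) (m : probability T R) (b : T -> bool) (f : T -> R) :
  measurable [set x | b x] -> bmeas f -> (forall x, (b x)%:R <= f x) ->
  fine (m [set x | b x]) <= \int[m]_x f x.
Proof.
move=> mb bf bfle; rewrite -Rintegral_ind//; apply: le_Rintegral => //.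
  apply: bmeas_integrable; split; last by exists 1 => x; case: (b x); rewrite ?normr0 ?normr1.
  have -> : (fun x => (b x)%:R) = \1_[set x | b x] :> (T -> R).
    by apply/funext => x; rewrite indicE mem_setE.
  exact: measurable_indic.
exact: bmeas_integrable.
Qed.

Lemma Rintegral_le_prob d (T : measurableType d) (m : probability T R) (b : T -> bool) (f : T -> R) :
  measurable [set x | b x] -> bmeas f -> (forall x, f x <= (b x)%:R) ->
  \int[m]_x f x <= fine (m [set x | b x]).
Proof.
move=> mb bf bfle; rewrite -Rintegral_ind//; apply: le_Rintegral => //.
  exact: bmeas_integrable.
apply: bmeas_integrable; split; last by exists 1 => x; case: (b x); rewrite ?normr0 ?normr1.
have -> : (fun x => (b x)%:R) = \1_[set x | b x] :> (T -> R).
  by apply/funext => x; rewrite indicE mem_setE.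
exact: measurable_indic.
Qed.

Lemma measurable_gt d (T : measurableType d) (f : T -> R) t :
  measurable_fun setT f -> measurable [set x | (t < f x)%R].
Proof.
move=> mf; rewrite (_ : [set x | _] = f @^-1` `]t, +oo[%classic).
  by rewrite -[X in measurable X]setTI; exact: mf.
by apply/seteqP; split => x /=; rewrite in_itv/= andbT.
Qed.

Lemma measurable_close d (T : measurableType d) (f : T -> R) t e :
  measurable_fun setT f -> measurable [set x | (`|f x - t| <= e)%R].
Proof.
move=> mf; have mg : measurable_fun setT (fun x => `|f x - t|).
  by apply: measurableT_comp => //; exact: measurable_funB.
rewrite (_ : [set x | _] = (fun x => `|f x - t|) @^-1` `]-oo, e]%classic).
  by rewrite -[X in measurable X]setTI; exact: mg.
by apply/seteqP; split => x /=; rewrite in_itv/=.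
Qed.

Lemma bmeas_smooth_comp d (T : measurableType d) (f : T -> R) t delta :
  measurable_fun setT f -> bmeas (fun x => smooth t delta (f x)).
Proof. by move=> mf; apply: (bmeas_comp (g := f) mf); exact: bmeas_smooth. Qed.

Lemma fine_prob_le d (T : measurableType d) (m : probability T R) (A B : set T) :
  measurable A -> measurable B -> A `<=` B -> fine (m A) <= fine (m B).
Proof.
move=> mA mB AB; apply: fine_le; rewrite ?fin_num_measure//.
by apply: le_measure; rewrite ?inE.
Qed.

(** If expectations of smooth approximations of the indicator of a half line agree up
    to e, then so do its probabilities, up to the mass that the second law puts
    on the interval where the approximation differs from the indicator. *)
Lemma smoothing d1 d2 (T1 : measurableType d1) (T2 : measurableType d2)
    (m1 : probability T1 R) (m2 : probability T2 R) (f1 : T1 -> R) (f2 : T2 -> R) delta e c :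
  0 < delta -> measurable_fun setT f1 -> measurable_fun setT f2 ->
  (forall t, `|\int[m1]_x smooth t delta (f1 x) - \int[m2]_x smooth t delta (f2 x)| <= e) ->
  (forall t, fine (m2 [set x | (`|f2 x - t| <= 3 * delta)%R]) <= c) ->
  forall t, `|fine (m1 [set x | (t < f1 x)%R]) - fine (m2 [set x | (t < f2 x)%R])| <= e + c.
Proof.
move=> d0 mf1 mf2 he hc t.
have md1 s := measurable_gt s mf1; have md2 s := measurable_gt s mf2.
have bs1 s := bmeas_smooth_comp s delta mf1; have bs2 s := bmeas_smooth_comp s delta mf2.
have sub (A B C : set T2) : measurable A -> measurable B -> measurable C ->
    A `<=` B `|` C -> fine (m2 A) <= fine (m2 B) + fine (m2 C).
  move=> mA mB mC ABC; rewrite -fineD ?fin_num_measure//; apply: fine_le.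
  - exact: fin_num_measure.
  - by rewrite fin_numD !fin_num_measure.
  apply: le_trans (measureU2 _ mB mC).
  by apply: le_measure; rewrite ?inE//; exact: measurableU.
have mge1 s : measurable [set x | (s <= f1 x)%R].
  rewrite (_ : [set x | _] = f1 @^-1` `[s, +oo[%classic).
    by rewrite -[X in measurable X]setTI; exact: mf1.
  by apply/seteqP; split => x /=; rewrite in_itv/= andbT.
have mge2 s : measurable [set x | (s <= f2 x)%R].
  rewrite (_ : [set x | _] = f2 @^-1` `[s, +oo[%classic).
    by rewrite -[X in measurable X]setTI; exact: mf2.
  by apply/seteqP; split => x /=; rewrite in_itv/= andbT.
rewrite ler_norml; apply/andP; split.
- have h1 := @Rintegral_le_prob _ _ m1 (fun x => t < f1 x) _ (md1 t) (bs1 t) (fun x => smooth_le_ind t (f1 x) d0).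
  have h2 := @prob_le_Rintegral _ _ m2 (fun x => t + 3 * delta <= f2 x) _ (mge2 _) (bs2 t) (fun x => smooth_ge_ind t (f2 x) d0).
  have h3 := sub _ _ _ (md2 t) (mge2 (t + 3 * delta)) (measurable_close t (3 * delta) mf2).
  have {}h3 : fine (m2 [set x | (t < f2 x)%R]) <=
     fine (m2 [set x | (t + 3 * delta <= f2 x)%R]) + fine (m2 [set x | (`|f2 x - t| <= 3 * delta)%R]).
    apply: h3 => x /= tx; have [?|ge] := leP (t + 3 * delta) (f2 x); [by left|right].
    by rewrite ger0_norm ?subr_ge0 ?(ltW tx)// lerBlDl ltW.
  have := he t; rewrite ler_norml => /andP[? ?]; have := hc t; lra.
- pose s := t - 3 * delta.
  have h1 := @prob_le_Rintegral _ _ m1 (fun x => s + 3 * delta <= f1 x) _ (mge1 _) (bs1 s) (fun x => smooth_ge_ind s (f1 x) d0).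
  have h2 := @Rintegral_le_prob _ _ m2 (fun x => s < f2 x) _ (md2 s) (bs2 s) (fun x => smooth_le_ind s (f2 x) d0).
  have h3 : fine (m2 [set x | (s < f2 x)%R]) <=
     fine (m2 [set x | (t < f2 x)%R]) + fine (m2 [set x | (`|f2 x - t| <= 3 * delta)%R]).
    apply: sub => //; first exact: measurable_close.
    move=> x /= sx; have [?|le] := ltP t (f2 x); [by left|right].
    by rewrite ler0_norm ?subr_le0// opprB lerBlDl -lerBlDr ltW.
  have h4 : fine (m1 [set x | (t < f1 x)%R]) <= fine (m1 [set x | (s + 3 * delta <= f1 x)%R]).
    by apply: fine_prob_le => // x /= /ltW; rewrite /s subrK.
  have := he s; rewrite ler_norml => /andP[? ?]; have := hc t; lra.
Qed.

End Smoothing.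

(** * Square roots of positive semidefinite matrices *)

Module SpectralRoot.
Import spectral complex.
Import sesquilinear.
Local Open Scope sesquilinear_scope.

Lemma interpolation (F : fieldType) (f : F -> F) (s : seq F) :
  exists p : {poly F}, forall x, x \in s -> p.[x] = f x.
Proof.
elim: s => [|a s [p IH]]; first by exists 0.
have [as_|ns] := boolP (a \in s).
  by exists p => x; rewrite inE => /orP[/eqP->|]; exact: IH.
pose q := \prod_(y <- s) ('X - y%:P).
have q0 x : x \in s -> q.[x] = 0.
  by move=> xs; apply/eqP; rewrite -rootE root_prod_XsubC.
have qa : q.[a] != 0 by rewrite -rootE root_prod_XsubC.
exists (p + ((f a - p.[a]) / q.[a]) *: q) => x; rewrite inE hornerD hornerZ.
move=> /orP[/eqP->|xs]; first by rewrite divfK// addrC subrK.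
by rewrite (q0 _ xs) mulr0 addr0 IH.
Qed.

Lemma trmx_horner_mx (F : comNzRingType) n (A : 'M[F]_n.+1) (p : {poly F}) :
  A^T = A -> (horner_mx A p)^T = horner_mx A p.
Proof.
move=> As; elim/poly_ind: p => [|p c IH]; first by rewrite rmorph0 trmx0.
rewrite rmorphD rmorphM /= horner_mx_X horner_mx_C linearD /= tr_scalar_mx.
have -> : (horner_mx A p * A)^T = A^T * (horner_mx A p)^T by exact: trmx_mul.
rewrite As IH; congr (_ + _).
by have := comm_horner_mx p (erefl (A * A)); exact.
Qed.

Lemma horner_mx_fixed (F : fieldType) n (B U : 'M[F]_n.+1) (e : 'rV[F]_n.+1) (q : {poly F}) :
  U \in unitmx -> B = invmx U *m diag_mx e *m U ->
  (forall i, q.[e ord0 i] = e ord0 i) -> horner_mx B q = B.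
Proof.
move=> Uu -> qe; rewrite horner_mx_uconjC// horner_mx_diag.
suff -> : map_mx (horner q) e = e by [].
by apply/rowP => i; rewrite mxE qe.
Qed.

Section Root.
Context (R : realType) (n : nat).
Variable A : 'M[R]_n.+1.
Hypothesis A_sym : A^T = A.
Hypothesis A_psd : forall v : 'cV[R]_n.+1, 0 <= (v^T *m A *m v) ord0 ord0.

Local Notation toC := (real_complex R).
Local Notation AC := (map_mx toC A).
Local Notation P := (spectralmx AC).
Local Notation sp := (spectral_diag AC).

Lemma eigenvalue_ge0 a : eigenvalue A a -> 0 <= a.
Proof.
move=> /eigenvalueP[v vA v0].
have := A_psd v^T; rewrite trmxK vA -scalemxAl mxE.
have vv : 0 < (v *m v^T) ord0 ord0.
  rewrite mxE lt_neqAle; apply/andP; split; last first.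
    by apply: sumr_ge0 => j _; rewrite mxE -expr2 sqr_ge0.
  apply: contra v0 => /eqP/esym v2; apply/eqP/rowP => j; rewrite mxE.
  have := v2; under eq_bigr do rewrite mxE -expr2.
  move=> /psumr_eq0P h; apply/eqP; rewrite -sqrf_eq0; apply/eqP; apply: h => // i _.
  exact: sqr_ge0.
by rewrite pmulr_lge0.
Qed.

Lemma AC_herm : AC \is hermsymmx.
Proof.
apply: realsym_hermsym.
  apply/is_hermitianmxP; rewrite expr0 scale1r map_mx_id//.
  by rewrite map_trmx A_sym.
by apply/mxOverP => i j; rewrite mxE complex_real.
Qed.

Lemma ACE : AC = invmx P *m diag_mx sp *m P.
Proof. by apply/orthomx_spectralP; exact: hermitian_normalmx AC_herm. Qed.

Lemma psd_spectrum i : exists2 l : R, sp ord0 i = toC l & 0 <= l.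
Proof.
have /mxOverP/(_ ord0 i)/complex_realP[l spl] := hermitian_spectral_diag_real AC_herm.
exists l => //; apply: eigenvalue_ge0.
have : eigenvalue AC (toC l).
  apply/eigenvalueP; exists (row i P); last first.
    apply/eqP => r0; have := spectral_unit AC; rewrite -row_free_unit => /row_freeP[B PB].
    have /rowP/(_ i) : row i P *m B = row i 1%:M by rewrite -row_mul PB.
    by rewrite r0 mul0mx !mxE eqxx => /esym/eqP; rewrite oner_eq0.
  have PA : P *m AC = diag_mx sp *m P.
    by rewrite [X in _ *m X]ACE !mulmxA mulmxV ?spectral_unit// mul1mx.
  by rewrite -row_mul PA row_mul row_diag_mx -scalemxAl -rowE spl.
by rewrite eigenvalue_map.
Qed.

(** The root is a polynomial in A that interpolates the fourth root on the
    spectrum, so it is real and symmetric although the diagonalisation is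
    complex. The square of a symmetric fourth root is a square root of A that is
    positive semidefinite. *)
Lemma exists_fourth_root : exists Q : 'M[R]_n.+1, Q^T = Q /\ Q *m Q *m (Q *m Q) = A.
Proof.
have [p pE] := interpolation (fun x => Num.sqrt (Num.sqrt x))
  [seq complex.Re (sp ord0 i) | i <- enum 'I_n.+1].
exists (horner_mx A p); split; first exact: trmx_horner_mx.
have -> : horner_mx A p *m horner_mx A p *m (horner_mx A p *m horner_mx A p) =
    horner_mx A ((p * p) * (p * p)) by rewrite !rmorphM.
apply: (map_mx_inj (f := toC)); rewrite map_horner_mx.
apply: (horner_mx_fixed (spectral_unit AC) ACE) => i.
have [l spl l0] := psd_spectrum i.
have pl : p.[l] = Num.sqrt (Num.sqrt l).
  by apply: pE; apply/mapP; exists i; rewrite ?mem_enum// spl.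
rewrite spl horner_map; congr real_complex_def; rewrite !hornerM pl.
by rewrite -!expr2 !sqr_sqrtr// sqrtr_ge0.
Qed.

End Root.
End SpectralRoot.

Lemma psd_sqrtmxP (R : realType) (K : nat) (A : 'M[R]_K) :
  A^T = A -> (forall v : 'cV[R]_K, 0 <= (v^T *m A *m v) ord0 ord0) ->
  is_psd_sqrtmx A (psd_sqrtmx A).
Proof.
move=> As Ap; apply: xgetPex.
case: K A As Ap => [|n] A As Ap.
  exists 0; rewrite (flatmx0 A); split; rewrite ?trmx0 ?mulmx0// => v.
  by rewrite mulmx0 mul0mx mxE.
have [Q [Qs Q4]] := SpectralRoot.exists_fourth_root As Ap.
exists (Q *m Q); split => //; first by rewrite trmx_mul Qs.
move=> v; have -> : v^T *m (Q *m Q) *m v = (Q *m v)^T *m (Q *m v).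
  by rewrite trmx_mul Qs !mulmxA.
rewrite mxE.
by apply: sumr_ge0 => j _; rewrite mxE -expr2 sqr_ge0.
Qed.

(** * Absolute moments *)

Section PMoment.
Context (d : measure_display) (T : measurableType d) (R : realType).
Variable m : probability T R.
Implicit Types (p nu s : R) (f g h : T -> R).

(** The p-th power of the L_p norm, which adds and integrates without roots. *)
Definition pmom (p : R) (f : T -> R) : \bar R := (\int[m]_x (`|f x| `^ p)%:E)%E.

Lemma pmom_ge0 p f : (0 <= pmom p f)%E.
Proof. by apply: integral_ge0 => x _; rewrite lee_fin powR_ge0. Qed.

Lemma pmom_cst p (c : R) : pmom p (fun=> c) = (`|c| `^ p)%:E.
Proof. exact: integral_cst1. Qed.

Lemma pmom_triangle3 p f g h : measurable_fun setT f -> measurable_fun setT g ->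
  measurable_fun setT h -> 0 < p <= 3 ->
  (pmom p (fun x => (f x + g x + h x)%R) <= 27%:E * (pmom p f + pmom p g + pmom p h))%E.
Proof.
move=> mf mg mh p03.
have Mf := @measurable_powabs _ p _ _ _ mf; have Mg := @measurable_powabs _ p _ _ _ mg.
have Mh := @measurable_powabs _ p _ _ _ mh.
have q (k : T -> R) x : (0 <= (`|k x| `^ p)%:E)%E by rewrite lee_fin powR_ge0.
have Mfg := emeasurable_funD Mf Mg.
rewrite /pmom -(ge0_integralDT m Mf Mg (q f) (q g)).
rewrite -(ge0_integralDT m Mfg Mh (fun x => adde_ge0 (q f x) (q g x)) (q h)).
rewrite -(ge0_integralZT m (emeasurable_funD Mfg Mh) (fun x => adde_ge0 (adde_ge0 (q f x) (q g x)) (q h x)) (ler0n R 27)).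
apply: ge0_le_integralT.
- by apply: (@measurable_powabs _ p _ _ (fun x => f x + g x + h x)); apply: measurable_funD => //; exact: measurable_funD.
- exact: (measurable_funeM _ (emeasurable_funD Mfg Mh)).
- by move=> x; rewrite lee_fin powR_ge0.
- by move=> x; rewrite -!EFinD -EFinM lee_fin; exact: powR_triangle3.
Qed.

Lemma powR_sqr (x : R) : `|x| `^ 2 = x ^+ 2.
Proof. by rewrite powR_mulrn// real_normK ?num_real. Qed.

Lemma pmom2_double f g : measurable_fun setT f -> measurable_fun setT g ->
  (pmom 2 (fun x => (f x + g x)%R) <= 2%:E * (pmom 2 f + pmom 2 g))%E.
Proof.
move=> mf mg.
have Mf := @measurable_powabs _ 2 _ _ _ mf; have Mg := @measurable_powabs _ 2 _ _ _ mg.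
have q (k : T -> R) x : (0 <= (`|k x| `^ 2)%:E)%E by rewrite lee_fin powR_ge0.
rewrite /pmom -(ge0_integralDT m Mf Mg (q f) (q g)).
rewrite -(ge0_integralZT m (emeasurable_funD Mf Mg) (fun x => adde_ge0 (q f x) (q g x)) (ler0n R 2)).
apply: ge0_le_integralT.
- by apply: (@measurable_powabs _ 2 _ _ (fun x => f x + g x)); exact: measurable_funD.
- exact: (measurable_funeM _ (emeasurable_funD Mf Mg)).
- by move=> x; rewrite lee_fin powR_ge0.
- move=> x; rewrite -!EFinD -EFinM lee_fin !powR_sqr.
  by have := sqr_ge0 (f x - g x); lra.
Qed.

(** Splitting at the level [s], the higher moment controls the lower one; [s] stays
    free so that the bound can be made small. *)
Lemma pmom_change p nu s f : measurable_fun setT f -> 0 < p -> p <= nu -> 0 < s ->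
  (pmom p f <= (s `^ p)%:E * (1 + (s `^ nu)^-1%:E * pmom nu f))%E.
Proof.
move=> mf p0 pnu s0.
have nu0 : 0 < nu by exact: lt_le_trans pnu.
have Mp := @measurable_powabs _ p _ _ _ mf; have Mn := @measurable_powabs _ nu _ _ _ mf.
have sn0 : 0 <= (s `^ nu)^-1 by rewrite invr_ge0 powR_ge0.
have q x : (0 <= (`|f x| `^ nu)%:E)%E by rewrite lee_fin powR_ge0.
have q' x : (0 <= (s `^ nu)^-1%:E * (`|f x| `^ nu)%:E)%E by rewrite mule_ge0.
have Mn' := measurable_funeM (s `^ nu)^-1%:E Mn.
have c1 : measurable_fun [set: T] (fun=> 1%E : \bar R) by exact: measurable_cst.
rewrite -[X in (_ * (X + _))%E](integral_cst1 m 1%E) /pmom.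
rewrite -(ge0_integralZT m Mn q sn0) -(ge0_integralDT m c1 Mn' (fun=> lee01) q').
rewrite -(ge0_integralZT m (emeasurable_funD c1 Mn') (fun x => adde_ge0 lee01 (q' x)) (powR_ge0 s p)).
apply: ge0_le_integralT => //.
- exact: (measurable_funeM _ (emeasurable_funD c1 Mn')).
- move=> x; rewrite -(EFinM (s `^ nu)^-1) -(EFinD 1) -EFinM lee_fin.
  have y0 := normr_ge0 (f x).
  rewrite (powR_scale p y0 s0) (powR_scale nu y0 s0) ler_pM2l ?powR_gt0//.
  rewrite mulKf ?gt_eqF ?powR_gt0//.
  have [le1|gt1] := leP (`|f x| / s) 1.
    apply: le_trans (powR_le1 _ p0) _; first by rewrite le1 andbT; apply: divr_ge0 => //; exact: ltW.
    by rewrite lerDl powR_ge0.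
  apply: le_trans (_ : (`|f x| / s) `^ nu <= _); last by rewrite lerDr.
  by apply: ler_powR => //; exact: ltW.
Qed.

(** Jensen's inequality for the powers, from the tangent line bound given by Young's
    inequality. *)
Lemma jensen_powR p f : m.-integrable setT (EFin \o f) -> 1 < p ->
  ((`|\int[m]_x f x| `^ p)%:E <= pmom p f)%E.
Proof.
move=> fi p1; have mf : measurable_fun setT f.
  by move/integrableP: fi => [/measurable_EFinP].
have p0 : 0 < p by lra.
set a := `|_|; have a0 : 0 <= a by exact: normr_ge0.
have [fin|] := boolP (pmom p f \is a fin_num); last first.
  by rewrite ge0_fin_numE ?pmom_ge0// -leNgt leye_eq => /eqP->; rewrite leey.
have pi : m.-integrable setT (EFin \o (fun x => `|f x| `^ p)).
  apply/integrableP; split; first exact: measurable_powabs.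
  under eq_integral do rewrite /= ger0_norm ?powR_ge0//.
  by move: fin; rewrite ge0_fin_numE ?pmom_ge0.
have fni : m.-integrable setT (EFin \o (fun x => `|f x|)) by exact: (integrable_norm fi).
pose q := (1 - p^-1)^-1.
have q0 : 0 < q by rewrite invr_gt0 subr_gt0 invf_lt1.
have pq : p^-1 + q^-1 = 1 by rewrite invrK addrC subrK.
have tan t : 0 <= t -> p * a `^ (p - 1) * t <= t `^ p + (p - 1) * a `^ p.
  move=> t0; have := conjugate_powR t0 (powR_ge0 a (p - 1)) p0 q0 pq.
  rewrite -powRrM (_ : (p - 1) * q = p); last first.
    by rewrite /q; field; rewrite subr_eq0 !gt_eqF.
  rewrite -(ler_pM2l p0) => h; rewrite mulrAC -mulrA; apply: le_trans h _.
  by rewrite invrK le_eqVlt; apply/orP; left; apply/eqP; field; rewrite gt_eqF.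
have -> : pmom p f = (\int[m]_x (`|f x| `^ p))%:E by exact: (esym (Rintegral_fine pi)).
rewrite lee_fin.
have ci : m.-integrable setT (EFin \o (fun=> (p - 1) * a `^ p)).
  by apply: sqint_integrable; exact: sqint_cst.
have : \int[m]_x (p * a `^ (p - 1) * `|f x|) <= \int[m]_x (`|f x| `^ p + (p - 1) * a `^ p).
  apply: le_Rintegral => //.
  - exact: (integrableZl measurableT (p * a `^ (p - 1)) fni).
  - exact: (integrableD measurableT pi ci).
  - by move=> x _; apply: tan.
rewrite (RintegralZl _ measurableT fni) (RintegralD measurableT pi ci) Rintegral_cst1.
have af : a <= \int[m]_x `|f x| by exact: le_normr_Rintegral.
have ap : a `^ (p - 1) * a = a `^ p.
  have [->|an] := eqVneq a 0; first by rewrite mulr0 powR0// gt_eqF.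
  rewrite -[X in _ * X]powRr1// -powRD ?subrK//.
  by rewrite (negbTE an) implybT.
have : p * a `^ (p - 1) * a <= p * a `^ (p - 1) * \int[m]_x `|f x|.
  by rewrite ler_wpM2l// mulr_ge0 ?powR_ge0// ltW.
rewrite -!mulrA ap; lra.
Qed.

End PMoment.

Section ProductMoments.
Context (d : measure_display) (T : measurableType d) (R : realType).
Variable m : probability T R.
Implicit Types (p nu s : R) (f g h : T -> R).
Local Notation M2 := (m \x m)%E.

Lemma pmom_prod p (f : T * T -> R) : measurable_fun setT f ->
  pmom M2 p f = (\int[m]_x \int[m]_y (`|f (x, y)| `^ p)%:E)%E.
Proof.
move=> mf; have Mf := @measurable_powabs _ p _ _ _ mf.
by rewrite /pmom (fubini_tonelli1 _ Mf)// => z; rewrite lee_fin powR_ge0.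
Qed.

Lemma pmom_fst p (f : T -> R) : measurable_fun setT f ->
  pmom M2 p (fun z => f z.1) = pmom m p f.
Proof.
move=> mf; rewrite pmom_prod; last exact: measurableT_comp.
by apply: eq_integral => x _; rewrite /= integral_cst1.
Qed.

Lemma pmom_snd p (f : T -> R) : measurable_fun setT f ->
  pmom M2 p (fun z => f z.2) = pmom m p f.
Proof.
move=> mf; rewrite pmom_prod; last exact: (measurableT_comp mf measurable_snd).
exact: (integral_cst1 m (pmom m p f)).
Qed.

Lemma sqint_pmom d' (T' : measurableType d') (m' : probability T' R) (f : T' -> R) :
  measurable_fun setT f -> (pmom m' 2 f < +oo)%E -> sqint m' f.
Proof.
move=> mf fin; split => //; apply/integrableP; split.
  by apply/measurable_EFinP; exact: measurable_funX.
apply: le_lt_trans fin; rewrite le_eqVlt; apply/orP; left; apply/eqP.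
by apply: eq_integral => x _; rewrite /= powR_sqr ger0_norm ?sqr_ge0.
Qed.

Lemma pmom2_sqint d' (T' : measurableType d') (m' : probability T' R) (f : T' -> R) :
  sqint m' f -> pmom m' 2 f = (\int[m']_x (f x ^+ 2))%:E.
Proof.
by move=> [mf fi]; rewrite (Rintegral_fine fi); apply: eq_integral => x _; rewrite powR_sqr.
Qed.

Lemma sqint_fst (f : T -> R) : sqint m f -> sqint M2 (fun z => f z.1).
Proof.
move=> sf; have [mf _] := sf; apply: sqint_pmom; first exact: measurableT_comp.
by rewrite pmom_fst// pmom2_sqint// ltry.
Qed.

Lemma sqint_snd (f : T -> R) : sqint m f -> sqint M2 (fun z => f z.2).
Proof.
move=> sf; have [mf _] := sf; apply: sqint_pmom.
  exact: (measurableT_comp mf measurable_snd).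
by rewrite pmom_snd// pmom2_sqint// ltry.
Qed.

End ProductMoments.

(** * The kernel and its truncated expansions *)

Section KernelExpansion.
Context (d : measure_display) (T : measurableType d) (R : realType).
Variables (m : probability T R) (u : T -> T -> R) (phi : nat -> T -> R) (lam : nat -> R).
Local Notation M2 := (m \x m)%E.
Hypothesis mu_ : measurable_fun setT (fun z : T * T => u z.1 z.2).
Hypothesis u_sym : forall x y, u x y = u y x.
Hypothesis sphi : forall k, sqint m (phi k).
Implicit Types (K : nat) (p nu : R) (x y : T) (z : T * T).

Definition feat_mean k : R := \int[m]_x phi k x.
Definition cfeat k x : R := phi k x - feat_mean k.
Definition uexp K x y : R := \sum_(k < K) lam k * phi k x * phi k y.
Definition umean K : R := \sum_(k < K) lam k * feat_mean k ^+ 2.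
Definition uproj K x : R := \sum_(k < K) lam k * feat_mean k * cfeat k x.
Definition ukap K x y : R := \sum_(k < K) lam k * cfeat k x * cfeat k y.
Definition uerr K z : R := uexp K z.1 z.2 - u z.1 z.2.
Definition ucond x : R := \int[m]_y u x y.
Definition utot : R := \int[M2]_z u z.1 z.2.
Definition uproj_err K x : R := ucond x - (umean K + uproj K x).

Lemma sqint_cfeat k : sqint m (cfeat k).
Proof. by apply: sqintB => //; exact: sqint_cst. Qed.

Lemma cfeat_mean0 k : \int[m]_x cfeat k x = 0.
Proof.
rewrite RintegralB//; [|exact: sqint_integrable|by apply: sqint_integrable; exact: sqint_cst].
by rewrite Rintegral_cst1 subrr.
Qed.

(** The decomposition of Hoeffding of the truncated kernel into its constant,
    linear and degenerate parts. *)
Lemma uexp_decomp K x y : uexp K x y = umean K + uproj K x + uproj K y + ukap K x y.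
Proof.
rewrite /uexp /umean /uproj /ukap -!big_split /=; apply: eq_bigr => k _.
by rewrite /cfeat; ring.
Qed.

Let mphi k : measurable_fun setT (phi k). Proof. by case: (sphi k). Qed.

Lemma measurable_uexp K : measurable_fun setT (fun z => uexp K z.1 z.2).
Proof.
apply: measurable_sum => k; apply: measurable_funM.
  by apply: measurable_funM => //; exact: measurableT_comp.
exact: (measurableT_comp (mphi k) measurable_snd).
Qed.

Lemma measurable_uerr K : measurable_fun setT (uerr K).
Proof. by apply: measurable_funB => //; exact: measurable_uexp. Qed.

Lemma sqint_uproj K : sqint m (uproj K).
Proof. by apply: sqint_sum => k; apply: sqintZ; exact: sqint_cfeat. Qed.

Lemma uexp_integrable K : M2.-integrable setT (EFin \o (fun z => uexp K z.1 z.2)).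
Proof.
have h (k : 'I_K) : M2.-integrable setT (EFin \o (fun z => lam k * phi k z.1 * phi k z.2)).
  by apply: sqint_mul; [apply: sqintZ; exact: (sqint_fst (sphi k))|exact: (sqint_snd (sphi k))].
have := @integrable_sum _ _ _ M2 setT measurableT _ (index_enum 'I_K) xpredT _ (fun k _ => h k).
by congr (integrable _ _ _); apply/funext => z /=; rewrite -sumEFin.
Qed.

Lemma uexp_section_integrable K x : m.-integrable setT (EFin \o (uexp K x)).
Proof.
by apply: sqint_integrable; apply: sqint_sum => k; exact: sqintZ.
Qed.

Lemma uexp_section K x : \int[m]_y uexp K x y = umean K + uproj K x.
Proof.
have cs (c : R) : m.-integrable setT (EFin \o (fun=> c)) by apply: sqint_integrable; exact: sqint_cst.
have sk : sqint m (fun y => uproj K y + ukap K x y).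
  apply: sqintD; first exact: sqint_uproj.
  by apply: sqint_sum => k; apply: sqintZ; exact: sqint_cfeat.
under eq_Rintegral do rewrite uexp_decomp -addrA.
rewrite (RintegralD measurableT (cs _) (sqint_integrable sk)) Rintegral_cst1.
rewrite (_ : \int[m]_y _ = 0) ?addr0//.
under eq_Rintegral => y _.
  rewrite /uproj /ukap -big_split /=.
  under eq_bigr do rewrite -mulrDl.
  over.
rewrite Rintegral_sum; last first.
  by move=> k; apply: sqint_integrable; apply: sqintZ; exact: sqint_cfeat.
rewrite big1// => k _; rewrite (RintegralZl _ measurableT) ?cfeat_mean0 ?mulr0//.
by apply: sqint_integrable; exact: sqint_cfeat.
Qed.

Lemma uexp_total K : \int[M2]_z uexp K z.1 z.2 = umean K.
Proof.
transitivity (\int[m]_x \int[m]_y uexp K x y).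
  have := integral12_prod_meas1 (uexp_integrable K) => /(congr1 fine) h.
  rewrite [LHS](esym h); congr fine; apply: eq_integral => x _.
  exact: (esym (Rintegral_fine (uexp_section_integrable K x))).
under eq_Rintegral do rewrite uexp_section.
rewrite RintegralD//; [|by apply: sqint_integrable; exact: sqint_cst|by apply: sqint_integrable; exact: sqint_uproj].
rewrite Rintegral_cst1 (_ : \int[m]_x uproj K x = 0) ?addr0//.
rewrite Rintegral_sum; last first.
  by move=> k; apply: sqint_integrable; apply: sqintZ; exact: sqint_cfeat.
rewrite big1// => k _; rewrite (RintegralZl _ measurableT) ?cfeat_mean0 ?mulr0//.
by apply: sqint_integrable; exact: sqint_cfeat.
Qed.

Lemma measurable_ucond : measurable_fun setT ucond.
Proof.
apply: (measurableT_comp (f := @fine R)); first exact: fine_measurable.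
have mE : measurable_fun setT (fun z : T * T => (u z.1 z.2)%:E) by exact/measurable_EFinP.
have -> : (fun x => \int[m]_y (u x y)%:E)%E =
  (fun x => \int[m]_y ((fun z => (u z.1 z.2)%:E)^\+%E (x, y)) - \int[m]_y ((fun z => (u z.1 z.2)%:E)^\-%E (x, y)))%E.
  apply/funext => x; rewrite [LHS]integralE; congr (_ - _)%E; apply: eq_integral => y _; by rewrite ?funeposE ?funenegE.
apply: emeasurable_funB.
  exact: (measurable_inner m (measurable_funepos mE) (funepos_ge0 _)).
exact: (measurable_inner m (measurable_funeneg mE) (funeneg_ge0 _)).
Qed.

Lemma measurable_uproj_err K : measurable_fun setT (uproj_err K).
Proof.
apply: measurable_funB; first exact: measurable_ucond.
by apply: measurable_funD => //; case: (sqint_uproj K).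
Qed.

(** The conditional expectation of the approximation error, controlled at every point:
    where the section of u fails to be integrable the bound is infinite. *)
Lemma uproj_err_le p K x : 1 < p ->
  ((`|uproj_err K x| `^ p)%:E <= pmom m p (fun y => uerr K (x, y)))%E.
Proof.
move=> p1; have me : measurable_fun setT (fun y => uerr K (x, y)).
  exact: (measurableT_comp (measurable_uerr K) (pair1_measurable x)).
have [fin|] := boolP (pmom m p (fun y => uerr K (x, y)) \is a fin_num); last first.
  by rewrite ge0_fin_numE ?pmom_ge0// -leNgt leye_eq => /eqP->; rewrite leey.
have ei : m.-integrable setT (EFin \o (fun y => uerr K (x, y))).
  apply/integrableP; split; first exact/measurable_EFinP.
  apply: (@le_lt_trans _ _ (pmom m 1 (fun y => uerr K (x, y)))).
    rewrite le_eqVlt; apply/orP; left; apply/eqP; apply: eq_integral => y _.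
    by rewrite /= powRr1.
  have := pmom_change m me (ltr01) (ltW p1) (ltr01); move=> h; apply: (le_lt_trans h).
  by rewrite !powR1 invr1 !mul1e -(fineK fin) -EFinD ltry.
have ui : m.-integrable setT (EFin \o u x).
  have := integrableB measurableT (uexp_section_integrable K x) ei.
  by congr (integrable _ _ _); apply/funext => y /=; rewrite -EFinB; congr EFin; rewrite /uerr /=; ring.
have -> : uproj_err K x = - \int[m]_y uerr K (x, y).
  rewrite /uproj_err /uerr /= (RintegralB measurableT (uexp_section_integrable K x) ui).
  by rewrite uexp_section opprB.
by rewrite normrN; exact: jensen_powR.
Qed.

Lemma uproj_err_pmom p K : 1 < p -> (pmom m p (uproj_err K) <= pmom M2 p (uerr K))%E.
Proof.
move=> p1; rewrite pmom_prod; last exact: measurable_uerr.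
have me := @measurable_powabs _ p _ _ _ (measurable_uerr K).
apply: ge0_le_integralT.
- exact: (measurable_powabs _ (measurable_uproj_err K)).
- by apply: (measurable_inner m me) => z; rewrite lee_fin powR_ge0.
- by move=> x; rewrite lee_fin powR_ge0.
- by move=> x; exact: uproj_err_le.
Qed.

Section Integrable.
Hypothesis ui : M2.-integrable setT (EFin \o (fun z => u z.1 z.2)).

Lemma umean_err p K : 1 < p -> ((`|umean K - utot| `^ p)%:E <= pmom M2 p (uerr K))%E.
Proof.
move=> p1; rewrite -uexp_total /utot -(RintegralB measurableT (uexp_integrable K) ui).
apply: jensen_powR => //; exact: (integrableB measurableT (uexp_integrable K) ui).
Qed.

(** The difference of the degenerate parts of the truncated kernel and of u. The
    final 0 gives the second sum the three terms of the triangle inequality. *)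
Definition ures K z : R := uerr K z + (umean K - utot) + (uproj_err K z.1 + uproj_err K z.2 + 0).

Lemma ukapE K x y : ukap K x y =
  (u x y - utot) - (ucond x - utot) - (ucond y - utot) + ures K (x, y).
Proof.
have := uexp_decomp K x y; rewrite /ures /uerr /uproj_err /= => ->; ring.
Qed.

Let mc (D : measure_display) (S : measurableType D) (c : R) : measurable_fun [set: S] (fun=> c).
Proof. exact: measurable_cst. Qed.
Let m1e K : measurable_fun setT (fun z : T * T => uproj_err K z.1).
Proof. exact: (measurableT_comp (measurable_uproj_err K) measurable_fst). Qed.
Let m2e K : measurable_fun setT (fun z : T * T => uproj_err K z.2).
Proof. exact: (measurableT_comp (measurable_uproj_err K) measurable_snd). Qed.

Lemma measurable_ures K : measurable_fun setT (ures K).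
Proof.
apply: measurable_funD; first by apply: measurable_funD => //; exact: measurable_uerr.
by apply: measurable_funD => //; exact: measurable_funD.
Qed.

Lemma pmom_ures p K : 1 < p <= 3 -> (pmom M2 p (ures K) <= (27 * 27 * 4)%:E * pmom M2 p (uerr K))%E.
Proof.
move=> /andP[p1 p3]; have p03 : 0 < p <= 3 by rewrite p3 andbT; lra.
set E := pmom M2 p (uerr K); have E0 : (0 <= E)%E by exact: pmom_ge0.
have h1 : (pmom M2 p (fun z => (uproj_err K z.1 + uproj_err K z.2 + 0)%R) <= 27%:E * (E + E + 0))%E.
  apply: le_trans (pmom_triangle3 M2 (m1e K) (m2e K) (mc 0) p03) _.
  have c0 : pmom M2 p (fun=> 0) = 0%E.
    by rewrite pmom_cst normr0 powR0// gt_eqF//; case/andP: p03.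
  rewrite c0 (pmom_fst _ _ (measurable_uproj_err K)) (pmom_snd _ _ (measurable_uproj_err K)).
  apply: lee_wpmul2l; first by rewrite lee_fin.
  by apply: leeD => //; apply: leeD; exact: uproj_err_pmom.
have m3 : measurable_fun setT (fun z : T * T => uproj_err K z.1 + uproj_err K z.2 + 0).
  by apply: measurable_funD => //; exact: measurable_funD.
apply: le_trans (pmom_triangle3 M2 (measurable_uerr K) (mc (umean K - utot)) m3 p03) _.
apply: (@le_trans _ _ (27%:E * (E + E + 27%:E * (E + E + 0)))%E).
  apply: lee_wpmul2l; first by rewrite lee_fin.
  by apply: leeD; [apply: leeD; [exact: lexx|rewrite pmom_cst; exact: umean_err]|exact: h1].
rewrite adde0; case: E E0 {h1} => [e| |] // e0; last first.
  by rewrite [leRHS]gt0_muley ?leey// lte_fin.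
by rewrite -!EFinD -!EFinM lee_fin; move: e0; rewrite lee_fin; lra.
Qed.

Let mD (c : R) : measurable_fun setT (fun z : T * T => u z.1 z.2 - c).
Proof. exact: measurable_funB. Qed.
Let mg (c : R) : measurable_fun setT (fun x => ucond x - c).
Proof. by apply: measurable_funB => //; exact: measurable_ucond. Qed.

(** The inequality of Jensen in the second variable. *)
Lemma ucond_pmom p : 1 < p ->
  (pmom m p (fun x => (ucond x - utot)%R) <= pmom M2 p (fun z => (u z.1 z.2 - utot)%R))%E.
Proof.
move=> p1; have me := @measurable_powabs _ p _ _ _ (mD utot).
rewrite (pmom_prod _ _ (mD utot)); apply: ge0_le_integralT.
- exact: (measurable_powabs _ (mg utot)).
- by apply: (measurable_inner m me) => z; rewrite lee_fin powR_ge0.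
- by move=> x; rewrite lee_fin powR_ge0.
move=> x; have mx : measurable_fun setT (fun y => u x y - utot).
  exact: (measurableT_comp (mD utot) (pair1_measurable x)).
have [fin|] := boolP (pmom m p (fun y => u x y - utot) \is a fin_num); last first.
  by rewrite ge0_fin_numE ?pmom_ge0// -leNgt leye_eq => /eqP h; rewrite [leRHS]h leey.
have uxi : m.-integrable setT (EFin \o (fun y => u x y - utot)).
  apply/integrableP; split; first exact/measurable_EFinP.
  apply: (@le_lt_trans _ _ (pmom m 1 (fun y => u x y - utot))).
    rewrite le_eqVlt; apply/orP; left; apply/eqP; apply: eq_integral => y _.
    by rewrite /= powRr1.
  have := pmom_change m mx (ltr01) (ltW p1) (ltr01); move=> h; apply: (le_lt_trans h).
  by rewrite !powR1 invr1 !mul1e -(fineK fin) -EFinD ltry.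
have ci : m.-integrable setT (EFin \o (fun=> utot)).
  by apply: sqint_integrable; exact: sqint_cst.
have uxi2 : m.-integrable setT (EFin \o u x).
  have := integrableD measurableT uxi ci.
  by congr (integrable _ _ _); apply/funext => y /=; rewrite -EFinD subrK.
have -> : ucond x - utot = \int[m]_y (u x y - utot).
  by rewrite (RintegralB measurableT uxi2 ci) Rintegral_cst1.
exact: jensen_powR.
Qed.

Lemma pmom_ukap p K : 1 < p <= 3 ->
  (pmom M2 p (fun z => ukap K z.1 z.2) <=
   (27 * 27 * 27 * 4)%:E * (pmom M2 p (fun z => (u z.1 z.2 - utot)%R) + pmom M2 p (uerr K)))%E.
Proof.
move=> p13; have /andP[p1 p3] := p13; have p03 : 0 < p <= 3 by rewrite p3 andbT; lra.
set A := pmom _ _ (fun z => u _ _ - _); set E := pmom _ _ (uerr K).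
have A0 : (0 <= A)%E by exact: pmom_ge0.
have E0 : (0 <= E)%E by exact: pmom_ge0.
have ma : measurable_fun setT (fun z : T * T => - (ucond z.1 - utot)).
  by apply: measurableT_comp => //; exact: (measurableT_comp (mg utot) measurable_fst).
have mb : measurable_fun setT (fun z : T * T => - (ucond z.2 - utot)).
  by apply: measurableT_comp => //; exact: (measurableT_comp (mg utot) measurable_snd).
have oppE (f : T * T -> R) : pmom M2 p (fun z => - f z) = pmom M2 p f.
  by apply: eq_integral => x _; rewrite normrN.
have c0 : pmom M2 p (fun=> 0) = 0%E.
  by rewrite pmom_cst normr0 powR0// gt_eqF//; case/andP: p03.
have mabc : measurable_fun setT (fun z : T * T => (u z.1 z.2 - utot) + - (ucond z.1 - utot) + - (ucond z.2 - utot)).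
  by apply: measurable_funD => //; exact: measurable_funD.
have h1 : (pmom M2 p (fun z => ((u z.1 z.2 - utot) + - (ucond z.1 - utot) + - (ucond z.2 - utot))%R) <= 27%:E * (A + A + A))%E.
  apply: le_trans (pmom_triangle3 M2 (mD utot) ma mb p03) _.
  rewrite !oppE (pmom_fst _ _ (mg utot)) (pmom_snd _ _ (mg utot)).
  apply: lee_wpmul2l; first by rewrite lee_fin.
  have hu := ucond_pmom p1; rewrite -/A in hu.
  exact: (leeD (leeD (lexx A) hu) hu).
have -> : (fun z => ukap K z.1 z.2) = (fun z => ((u z.1 z.2 - utot) + - (ucond z.1 - utot) + - (ucond z.2 - utot)) + ures K z + 0).
  by apply/funext => -[x y] /=; rewrite ukapE addr0.
apply: le_trans (pmom_triangle3 M2 mabc (measurable_ures K) (mc 0) p03) _.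
rewrite c0 adde0; apply: (@le_trans _ _ (27%:E * (27%:E * (A + A + A) + (27 * 27 * 4)%:E * E))%E).
  apply: lee_wpmul2l; first by rewrite lee_fin.
  by apply: leeD => //; exact: pmom_ures.
have h27 : (27%:E * (27 * 27 * 4)%:E = (27 * 27 * 27 * 4)%:E :> \bar R)%E by rewrite -EFinM !mulrA.
rewrite -h27 -muleA; apply: lee_wpmul2l; first by rewrite lee_fin.
rewrite (ge0_muleDr _ A0 E0); apply: leeD; last exact: lexx.
case: A A0 {h1} => [e| |] // e0; last by rewrite [leRHS]gt0_muley ?leey// lte_fin.
by rewrite -!EFinD -!EFinM lee_fin; move: e0; rewrite lee_fin; lra.
Qed.

Lemma pmom_uproj p K : 1 < p <= 3 ->
  (pmom m p (uproj K) <=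
   27%:E * (pmom m p (fun x => (ucond x - utot)%R) + pmom M2 p (uerr K) + pmom M2 p (uerr K)))%E.
Proof.
move=> /andP[p1 p3]; have p03 : 0 < p <= 3 by rewrite p3 andbT; lra.
have oppE (f : T -> R) : pmom m p (fun x => - f x) = pmom m p f.
  by apply: eq_integral => x _; rewrite normrN.
have -> : uproj K = (fun x => (ucond x - utot) + - (umean K - utot) + - uproj_err K x).
  by apply/funext => x; rewrite /uproj_err; ring.
have mn : measurable_fun setT (fun x => - uproj_err K x).
  by apply: measurableT_comp => //; exact: measurable_uproj_err.
apply: le_trans (pmom_triangle3 m (mg utot) (mc (- (umean K - utot))) mn p03) _.
apply: lee_wpmul2l; first by rewrite lee_fin.
rewrite oppE pmom_cst normrN; apply: leeD; last exact: uproj_err_pmom.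
by apply: leeD => //; exact: umean_err.
Qed.

(** Quadratic comparisons with a constant close to one half on the main term: they
    keep the variance of the approximations bounded below. *)
Lemma full_variance_le K :
  (pmom M2 2 (fun z => (u z.1 z.2 - utot)%R) <=
   2%:E * (pmom M2 2 (fun z => (uexp K z.1 z.2 - umean K)%R) + 54%:E * pmom M2 2 (uerr K)))%E.
Proof.
have p13 : 1 < 2 :> R by lra.
have p03 : (0 < (2 : R)) && ((2 : R) <= 3) by apply/andP; split; lra.
set E := pmom _ _ (uerr K); have E0 : (0 <= E)%E by exact: pmom_ge0.
have me : measurable_fun setT (fun z => uexp K z.1 z.2 - umean K).
  by apply: measurable_funB => //; exact: measurable_uexp.
have mn : measurable_fun setT (fun z => - uerr K z).
  by apply: measurableT_comp => //; exact: measurable_uerr.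
have mr : measurable_fun setT (fun z => - uerr K z + (umean K - utot) + 0).
  by apply: measurable_funD => //; exact: measurable_funD.
have -> : (fun z : T * T => u z.1 z.2 - utot) =
    (fun z => (uexp K z.1 z.2 - umean K) + (- uerr K z + (umean K - utot) + 0)).
  by apply/funext => z; rewrite /uerr; ring.
apply: le_trans (pmom2_double M2 me mr) _.
apply: lee_wpmul2l; first by rewrite lee_fin.
apply: leeD => //; apply: le_trans (pmom_triangle3 M2 mn (mc _) (mc 0) p03) _.
have c0 : pmom M2 2 (fun=> 0) = 0%E by rewrite pmom_cst normr0 powR0.
have oppE : pmom M2 2 (fun z => - uerr K z) = E.
  by apply: eq_integral => x _; rewrite normrN.
rewrite c0 adde0 oppE pmom_cst.
apply: (@le_trans _ _ (27%:E * (E + E))%E).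
  apply: lee_wpmul2l; first by rewrite lee_fin.
  by apply: leeD => //; exact: umean_err.
case: E E0 {oppE} => [e| |] // e0; last by rewrite [leRHS]gt0_muley ?leey// lte_fin.
by rewrite -!EFinD -!EFinM lee_fin; move: e0; rewrite lee_fin; lra.
Qed.

Lemma cond_variance_le K :
  (pmom m 2 (fun x => (ucond x - utot)%R) <=
   2%:E * (pmom m 2 (uproj K) + 54%:E * pmom M2 2 (uerr K)))%E.
Proof.
have p13 : 1 < 2 :> R by lra.
have p03 : (0 < (2 : R)) && ((2 : R) <= 3) by apply/andP; split; lra.
set E := pmom _ _ (uerr K); have E0 : (0 <= E)%E by exact: pmom_ge0.
have mb : measurable_fun setT (uproj K) by case: (sqint_uproj K).
have mr : measurable_fun setT (fun x => uproj_err K x + (umean K - utot) + 0).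
  by apply: measurable_funD => //; apply: measurable_funD => //; exact: measurable_uproj_err.
have -> : (fun x => ucond x - utot) =
    (fun x => uproj K x + (uproj_err K x + (umean K - utot) + 0)).
  by apply/funext => x; rewrite /uproj_err; ring.
apply: le_trans (pmom2_double m mb mr) _.
apply: lee_wpmul2l; first by rewrite lee_fin.
apply: leeD => //; apply: le_trans (pmom_triangle3 m (measurable_uproj_err K) (mc _) (mc 0) p03) _.
have c0 : pmom m 2 (fun=> 0) = 0%E by rewrite pmom_cst normr0 powR0.
rewrite c0 adde0 pmom_cst.
apply: (@le_trans _ _ (27%:E * (E + E))%E).
  apply: lee_wpmul2l; first by rewrite lee_fin.
  by apply: leeD; [exact: uproj_err_pmom|exact: umean_err].
case: E E0 => [e| |] // e0; last by rewrite [leRHS]gt0_muley ?leey// lte_fin.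
by rewrite -!EFinD -!EFinM lee_fin; move: e0; rewrite lee_fin; lra.
Qed.

End Integrable.

End KernelExpansion.

(** * Second moments of kernels *)

Section GaussianKernel.
Context (d : measure_display) (T : measurableType d) (R : realType) (K : nat).
Variables (m : probability T R) (V : T -> 'I_K -> R) (S : 'I_K -> 'I_K -> R).
Hypothesis sV : forall k, sqint m (V ^~ k).
Hypothesis V0 : forall k, \int[m]_x V x k = 0.
Hypothesis covV : forall k l, \int[m]_x (V x k * V x l) = \sum_j S k j * S l j.
Local Notation G := (glin S).
Local Notation gv := (@gvec R K).

Let mV k : measurable_fun setT (V ^~ k). Proof. by case: (sV k). Qed.
Let mG k : measurable_fun setT (G ^~ k). Proof. exact: measurable_glin. Qed.

Lemma integral_data_lin_sqr w :
  (\int[m]_x (lin (V x) w ^+ 2)%:E = (lin_std S w ^+ 2)%:E)%E.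
Proof.
by have [_ /Rintegral_fine <-] := sqint_lin sV w; rewrite (Rintegral_lin_sqr sV covV).
Qed.

Lemma integral_gauss_lin_sqr w :
  (\int[gv]_z (lin (G z) w ^+ 2)%:E = (lin_std S w ^+ 2)%:E)%E.
Proof.
have gl := gauss_law_lin S w.
by have [_ /Rintegral_fine <-] := gauss_law_sqint gl; rewrite (gauss_law_sqr gl).
Qed.

(** Both sides are determined by the covariance that the two laws share. *)
Lemma gauss_kernel_sqr (w : 'I_K -> R) :
  (\int[gv]_z \int[gv]_z' ((\sum_k w k * G z k * G z' k) ^+ 2)%:E =
   \int[m]_x \int[m]_y ((\sum_k w k * V x k * V y k) ^+ 2)%:E)%E.
Proof.
have mGV : measurable_fun setT (fun q : K.-tuple R * T => ((\sum_k w k * G q.1 k * V q.2 k) ^+ 2)%:E).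
  apply/measurable_EFinP; apply: measurable_funX; apply: measurable_sum => k.
  apply: measurable_funM; last exact: (measurableT_comp (mV k) measurable_snd).
  by apply: measurable_funM => //; exact: (measurableT_comp (mG k) measurable_fst).
transitivity (\int[gv]_z \int[m]_y ((\sum_k w k * G z k * V y k) ^+ 2)%:E)%E.
  apply: eq_integral => z _; rewrite [LHS](integral_gauss_lin_sqr (fun k => w k * G z k)).
  by rewrite -integral_data_lin_sqr.
rewrite (tonelli_swap gv m mGV); last by move=> z y; rewrite lee_fin sqr_ge0.
transitivity (\int[m]_y \int[m]_x ((\sum_k w k * V x k * V y k) ^+ 2)%:E)%E; last first.
  apply: eq_integral => x _; apply: eq_integral => y _; congr (_ ^+ 2)%:E.
  by apply: eq_bigr => k _; rewrite mulrAC.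
apply: eq_integral => y _.
have E (z : 'I_K -> R) : \sum_k w k * z k * V y k = lin z (fun k => w k * V y k).
  by apply: eq_bigr => k _; rewrite mulrAC.
under eq_integral do rewrite E.
rewrite integral_gauss_lin_sqr -integral_data_lin_sqr.
by apply: eq_integral => x _; rewrite E.
Qed.

(** The summands of the Hoeffding decomposition are orthogonal. *)
Lemma hoeffding_second_moment (lam b : 'I_K -> R) :
  (\int[m]_x \int[m]_y ((lin (V x) b + lin (V y) (fun k => (b k + lam k * V x k)%R)) ^+ 2)%:E =
   (2 * (\sum_l (\sum_k b k * S k l) ^+ 2) +
     \sum_l \sum_j (\sum_k S k l * lam k * S k j) ^+ 2)%:E)%E.
Proof.
pose c l k := lam k * S k l.
have inner x : (\int[m]_y ((lin (V x) b + lin (V y) (fun k => (b k + lam k * V x k)%R)) ^+ 2)%:E =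
    (lin (V x) b ^+ 2 + \sum_l (\sum_k b k * S k l + lin (V x) (c l)) ^+ 2)%:E)%E.
  rewrite (integral_shift_sqr (s := lin_std S (fun k => b k + lam k * V x k))).
  - rewrite lin_std_sqr; congr (_ + _)%:E; apply: eq_bigr => l _; congr (_ ^+ 2).
    by rewrite /lin -big_split; apply: eq_bigr => k _ /=; rewrite /c; ring.
  - exact: sqint_lin.
  - exact: Rintegral_lin.
  - exact: Rintegral_lin_sqr.
under eq_integral do rewrite inner.
have sl l : sqint m (fun x => \sum_k b k * S k l + lin (V x) (c l)).
  by apply: sqintD; [exact: sqint_cst|exact: sqint_lin].
have si l : m.-integrable setT (EFin \o (fun x => (\sum_k b k * S k l + lin (V x) (c l)) ^+ 2)).
  by case: (sl l).
have [_ bi] := sqint_lin sV b.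
have ssi : m.-integrable setT (EFin \o (fun x => \sum_l (\sum_k b k * S k l + lin (V x) (c l)) ^+ 2)).
  have := @integrable_sum _ _ _ m setT measurableT _ (index_enum 'I_K) xpredT _ (fun l _ => si l).
  by congr (integrable _ _ _); apply/funext => x /=; rewrite -sumEFin.
rewrite -(Rintegral_fine (integrableD measurableT bi ssi)) (RintegralD measurableT bi ssi).
rewrite Rintegral_sum// (Rintegral_lin_sqr sV covV) lin_std_sqr; congr EFin.
rewrite mulr2n mulrDl mul1r -addrA; congr (_ + _); rewrite -big_split /=.
apply: eq_bigr => l _; apply: EFin_inj; rewrite (Rintegral_fine (si l)).
rewrite (integral_shift_sqr (s := lin_std S (c l))).
- rewrite lin_std_sqr; congr (_ + _)%:E; apply: eq_bigr => j _; congr (_ ^+ 2).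
  by apply: eq_bigr => k _; rewrite /c; ring.
- exact: sqint_lin.
- exact: Rintegral_lin.
- exact: Rintegral_lin_sqr.
Qed.

End GaussianKernel.

Section LawIntegrals.
Context (d d' : measure_display) (Omega : measurableType d') (T : measurableType d)
  (R : realType).
Variables (P : probability Omega R) (m : probability T R).

Lemma same_law_of_sets (f : Omega -> T) : measurable_fun setT f ->
  (forall B, measurable B -> P [set w | B (f w)] = m B) -> same_law P m f id.
Proof.
move=> mf fB F mF F0.
pose fm := isMeasurableFun.Build _ _ _ _ f mf.
pose ff : {mfun Omega >-> T} := HB.pack f fm.
rewrite -[LHS](@ge0_integral_distribution _ _ _ _ _ P ff F mF F0).
by apply: eq_measure_integral => A mA _; exact: fB.
Qed.

End LawIntegrals.

Section OffDiagonal.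
Context (d d' : measure_display) (Omega : measurableType d') (T : measurableType d)
  (R : realType) (N : nat).
Variables (P : probability Omega R) (m : probability T R) (Y : 'I_N -> {mfun Omega >-> T}).
Hypothesis Y_indep : mutually_independent P (fun i => Y i : Omega -> T).
Hypothesis Y_law : forall i, has_law P (Y i) m.
Local Notation M2 := (m \x m)%E.

Lemma same_law_pair i j : i != j ->
  same_law P M2 (fun w => (Y i w, Y j w)) id.
Proof.
move=> ij; apply: same_law_of_sets; first by apply: measurable_fun_pair.
by move=> B mB; exact: (law_pair ij Y_indep Y_law).
Qed.

Lemma same_law_one i : same_law P m (Y i) id.
Proof. by apply: same_law_of_sets => // B mB; exact: Y_law. Qed.

Definition offdiag_sum (f : T * T -> R) (g : T -> R) (c : R) (w : Omega) : R :=
  c * (\sum_(i < N) \sum_(j < N | i != j) f (Y i w, Y j w)) + \sum_(i < N) g (Y i w).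

(** The triangle inequality leaves one term for each pair of indices, to which the
    law of a pair of sample points applies. *)
Lemma offdiag_sum_abs f g c s p A B : measurable_fun setT f -> measurable_fun setT g ->
  0 <= c -> 0 < s -> 1 <= p ->
  (pmom M2 p f <= A%:E)%E -> (pmom m p g <= B%:E)%E ->
  (\int[P]_w (`|offdiag_sum f g c w|)%:E <=
   (c * (N%:R ^+ 2 * (s * (1 + (s `^ p)^-1 * A))) + N%:R * (s * (1 + (s `^ p)^-1 * B)))%:E)%E.
Proof.
move=> mf mg c0 s0 p1 fA gB.
have p0 : 0 < p by lra.
have sp0 : 0 <= (s `^ p)^-1 by rewrite invr_ge0 powR_ge0.
have mfij (i j : 'I_N) : measurable_fun setT (fun w => f (Y i w, Y j w)).
  by apply: (measurableT_comp mf); exact: measurable_fun_pair.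
have mgi (i : 'I_N) : measurable_fun setT (fun w => g (Y i w)).
  exact: measurableT_comp.
have absle (h : Omega -> R) (H : R) : measurable_fun setT h ->
    (\int[P]_w (`|h w| `^ p)%:E <= H%:E)%E ->
    (\int[P]_w (`|h w|)%:E <= (s * (1 + (s `^ p)^-1 * H))%:E)%E.
  move=> mh hH.
  have := pmom_change P mh ltr01 p1 s0.
  rewrite [X in (X <= _)%E](_ : _ = \int[P]_w (`|h w|)%:E)%E; last first.
    by apply: eq_integral => w _; rewrite powRr1.
  move=> h1; apply: (le_trans h1); rewrite powRr1; last exact: ltW.
  rewrite EFinM EFinD EFinM; apply: lee_wpmul2l; first by rewrite lee_fin ltW.
  by apply: leeD => //; apply: lee_wpmul2l; rewrite ?lee_fin.
have hf (i j : 'I_N) : i != j ->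
    (\int[P]_w (`|f (Y i w, Y j w)|)%:E <= (s * (1 + (s `^ p)^-1 * A))%:E)%E.
  move=> ij; apply: absle => //.
  have := @same_law_pair i j ij (fun z => (`|f z| `^ p)%:E) (measurable_powabs _ mf).
  by move=> -> // z; rewrite lee_fin powR_ge0.
have hg (i : 'I_N) : (\int[P]_w (`|g (Y i w)|)%:E <= (s * (1 + (s `^ p)^-1 * B))%:E)%E.
  apply: absle => //.
  have := @same_law_one i (fun z => (`|g z| `^ p)%:E) (measurable_powabs _ mg).
  by move=> -> // z; rewrite lee_fin powR_ge0.
set a := s * (1 + _ * A) in hf *; set b := s * (1 + _ * B) in hg *.
have a0 : 0 <= a.
  have A0 : 0 <= A by rewrite -lee_fin; apply: le_trans fA; exact: pmom_ge0.
  apply: mulr_ge0; first exact: ltW.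
  by apply: addr_ge0 => //; exact: mulr_ge0.
pose F i w := (\sum_(j < N) (if i != j then (`|f (Y i w, Y j w)|)%:E else 0))%E.
have mabs (h : Omega -> R) : measurable_fun setT h -> measurable_fun setT (fun w => (`|h w|)%:E).
  by move=> mh; apply/measurable_EFinP; exact: measurableT_comp.
have mFj (i j : 'I_N) : measurable_fun setT (fun w => if i != j then (`|f (Y i w, Y j w)|)%:E else 0%E).
  by case: (i != j); [exact: mabs|exact: measurable_cst].
have Fj0 (i j : 'I_N) w : (0 <= if i != j then (`|f (Y i w, Y j w)|)%:E else 0)%E by case: (i != j).
have mF i : measurable_fun setT (F i) by apply: emeasurable_sum.
have F0 i w : (0 <= F i w)%E by apply: sume_ge0.
have mSF : measurable_fun setT (fun w => \sum_(i < N) F i w)%E by apply: emeasurable_sum.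
have SF0 w : (0 <= \sum_(i < N) F i w)%E by apply: sume_ge0.
have mSG : measurable_fun setT (fun w => \sum_(i < N) (`|g (Y i w)|)%:E)%E.
  by apply: emeasurable_sum => i; exact: mabs.
have SG0 w : (0 <= \sum_(i < N) (`|g (Y i w)|)%:E)%E by apply: sume_ge0.
have cSF0 w : (0 <= c%:E * \sum_(i < N) F i w)%E by rewrite mule_ge0.
apply: (@le_trans _ _ (\int[P]_w (c%:E * (\sum_(i < N) F i w) + \sum_(i < N) (`|g (Y i w)|)%:E))%E).
  apply: ge0_le_integralT => //.
  - apply: mabs; apply: measurable_funD; last by apply: measurable_sum.
    apply: measurable_funM => //; apply: measurable_sum => i.
    under eq_fun do rewrite big_mkcond /=.
    by apply: measurable_sum => j; case: (i != j).
  - by apply: emeasurable_funD => //; exact: measurable_funeM.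
  - move=> w; have FE i : F i w = (\sum_(j < N | i != j) `|f (Y i w, Y j w)|)%:E.
      by rewrite -sumEFin [RHS]big_mkcond.
    under eq_bigr do rewrite FE; rewrite /offdiag_sum !sumEFin -EFinM -EFinD lee_fin.
    apply: le_trans (ler_normD _ _) _; apply: lerD; last exact: ler_norm_sum.
    rewrite normrM ger0_norm//; apply: ler_wpM2l => //.
    by apply: le_trans (ler_norm_sum _ _ _) _; apply: ler_sum => i _; exact: ler_norm_sum.
rewrite (ge0_integralDT P (measurable_funeM _ mSF) mSG cSF0 SG0) (ge0_integralZT P mSF SF0 c0).
rewrite EFinD EFinM; apply: leeD.
  apply: lee_wpmul2l => //.
  rewrite (ge0_integral_sum P measurableT mF) //.
  apply: (@le_trans _ _ (\sum_(i < N) \sum_(j < N) a%:E)%E).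
    apply: lee_sum => i _; rewrite /F (ge0_integral_sum P measurableT (mFj i))//.
    apply: lee_sum => j _; have [ij|ij] := boolP (i != j); first exact: hf.
    by rewrite integral0 lee_fin.
  rewrite !sumEFin lee_fin !sumr_const !card_ord.
  by rewrite -mulrnA -[leLHS]mulr_natl natrM expr2.
rewrite ge0_integral_sum//; last by move=> i; exact: mabs.
apply: (@le_trans _ _ (\sum_(i < N) b%:E)%E); first by apply: lee_sum => i _.
by rewrite sumEFin lee_fin sumr_const card_ord mulr_natl.
Qed.

End OffDiagonal.

(** * The polynomials of a fixed truncation order *)

Lemma ereal_lincomb_le (R : realType) (k dn Nr P1 P2 y c1 c2 w : R) (X Y : \bar R) :
  0 <= y -> 0 <= P2 -> (0 <= X)%E -> (0 <= Y)%E -> 0 <= k -> 0 <= dn -> 0 <= Nr ->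
  0 <= P1 -> 0 <= w -> 0 <= c1 /\ 0 <= c2 ->
  Nr * P1 <= c1 * w -> Nr * P2 <= c2 * w * y ->
  ((k * dn * Nr)%:E * (P1%:E * X + P2%:E * Y) <=
   (k * (c1 + c2) * dn * w)%:E * (X + y%:E * Y))%E.
Proof.
move=> y0 P20 X0 Y0 k0 dn0 N0 P10 w0 [c10 c20] h1 h2.
rewrite ge0_muleDr ?mule_ge0 ?lee_fin// ge0_muleDr ?mule_ge0 ?lee_fin//.
rewrite !muleA -!EFinM; apply: leeD; apply: lee_wpmul2r => //; rewrite lee_fin.
- rewrite -!mulrA; apply: ler_wpM2l => //; rewrite (mulrCA _ dn); apply: ler_wpM2l => //.
  by apply: (le_trans h1); rewrite ler_wpM2r// lerDl.
- rewrite -!mulrA; apply: ler_wpM2l => //; rewrite (mulrCA _ dn); apply: ler_wpM2l => //.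
  by apply: (le_trans h2); rewrite -mulrA ler_wpM2r ?mulr_ge0// lerDr.
Qed.

Section FixedTruncation.
Context (d : measure_display) (T : measurableType d) (R : realType).
Variables (m : probability T R) (u : T -> T -> R) (phi : nat -> T -> R) (lam : nat -> R).
Local Notation M2 := (m \x m)%E.
Hypothesis mu_ : measurable_fun setT (fun z : T * T => u z.1 z.2).
Hypothesis sphi : forall k, sqint m (phi k).
Hypothesis ui : M2.-integrable setT (EFin \o (fun z => u z.1 z.2)).
Variables (N : nat) (s e : R).
Hypothesis N2 : (2 <= N)%N.
Hypothesis s0 : 0 < s.

Local Notation D := (utot m u).
Local Notation Uerr := (uerr u phi lam).

Definition scale : R := Num.sqrt (N%:R * (N%:R - 1)) / s.
Definition quad_coef : R := scale / (N%:R * (N%:R - 1)).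
Definition lin_coef k : R := 2 * scale / N%:R * (lam k * feat_mean m phi k).

Let N0 : 0 < N%:R :> R. Proof. by rewrite ltr0n (ltn_trans _ N2). Qed.
Let N10 : 0 < N%:R - 1 :> R. Proof. by rewrite subr_gt0 ltr1n. Qed.
Let NN0 : 0 < N%:R * (N%:R - 1) :> R. Proof. by rewrite mulr_gt0. Qed.

Lemma scale_gt0 : 0 < scale.
Proof. by rewrite divr_gt0// sqrtr_gt0. Qed.

Lemma scale_sqr : scale ^+ 2 = N%:R * (N%:R - 1) / s ^+ 2.
Proof. by rewrite expr_div_n sqr_sqrtr// ltW. Qed.

Lemma quad_coef_gt0 : 0 < quad_coef.
Proof. by rewrite divr_gt0// scale_gt0. Qed.

Lemma quad_coef_powR nu : 2 < nu <= 3 ->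
  N%:R * (`|2 * quad_coef| `^ nu * N%:R `^ (nu / 2)) <=
  32 * (N%:R `^ (1 - nu / 2) * (s `^ nu)^-1).
Proof.
move=> /andP[nu2 nu3]; have nu0 : 0 <= nu / 2 by lra.
set x := N%:R `^ (nu / 2); set y := (N%:R - 1) `^ (nu / 2).
have x0 : 0 < x by exact: powR_gt0.
have y0 : 0 < y by exact: powR_gt0.
have sn0 : 0 < s `^ nu by exact: powR_gt0.
have q0 : 0 < quad_coef := quad_coef_gt0.
have nux : nu = nu / 2 + nu / 2 by field.
have qE : `|2 * quad_coef| `^ nu * ((s `^ nu) * (x * y)) = 2 `^ nu.
  rewrite -powRM ?(ltW N0) ?(ltW N10)//.
  have -> : (N%:R * (N%:R - 1)) `^ (nu / 2) = Num.sqrt (N%:R * (N%:R - 1)) `^ nu.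
    by rewrite -powR12_sqrt ?(ltW NN0)// -powRrM [2^-1 * nu]mulrC.
  rewrite -!powRM ?sqrtr_ge0 ?mulr_ge0 ?sqrtr_ge0 ?(ltW s0)//.
  have p0 : 0 < 2 * quad_coef by rewrite mulr_gt0.
  suff -> : `|2 * quad_coef| * (s * Num.sqrt (N%:R * (N%:R - 1))) = 2 by [].
  rewrite (gtr0_norm p0) /quad_coef /scale.
  have q2 : Num.sqrt (N%:R * (N%:R - 1)) ^+ 2 = N%:R * (N%:R - 1) :> R.
    by rewrite sqr_sqrtr// ltW.
  have r0 : 0 < Num.sqrt (N%:R * (N%:R - 1)) :> R by rewrite sqrtr_gt0.
  by rewrite -[X in _ / s / X]q2; move: r0; set r := Num.sqrt _ => r0; field; rewrite !gt_eqF.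
have rxy : x <= 4 * y.
  have : x <= (2 * (N%:R - 1)) `^ (nu / 2).
    apply: ge0_ler_powR; rewrite ?nnegrE ?(ltW N0)// ?mulr_ge0 ?(ltW N10)//.
    have : 2 <= N%:R :> R by rewrite ler_nat.
    lra.
  rewrite powRM ?(ltW N10)// -/y => h; apply: (le_trans h); rewrite ler_pM2r//.
  have -> : 4 = 2 `^ 2 :> R by rewrite powR_mulrn//; ring.
  by apply: ler_powR => //; lra.
have t8 : 2 `^ nu <= 8 :> R.
  have -> : 8 = 2 `^ 3 :> R by rewrite powR_mulrn//; ring.
  by apply: ler_powR => //; lra.
have -> : N%:R `^ (1 - nu / 2) = N%:R / x :> R.
  by rewrite powRB ?powRr1 ?(ltW N0)//; rewrite (gt_eqF N0) implybT.
have -> : `|2 * quad_coef| `^ nu = 2 `^ nu / (s `^ nu * (x * y)).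
  by rewrite -qE mulfK// gt_eqF// !mulr_gt0.
have e1 : N%:R * (2 `^ nu / (s `^ nu * (x * y)) * x) = N%:R / (s `^ nu * y * x) * (2 `^ nu * x).
  by field; rewrite !gt_eqF.
have e2 : 32 * (N%:R / x / s `^ nu) = N%:R / (s `^ nu * y * x) * (8 * (4 * y)).
  by field; rewrite !gt_eqF.
rewrite e1 e2.
apply: ler_wpM2l; first by rewrite divr_ge0 ?ltW// !mulr_gt0.
apply: ler_pM => //; exact: powR_ge0.
Qed.

Lemma scale_powR nu : 2 < nu <= 3 ->
  N%:R * (2 * scale / N%:R) `^ nu <=
  8 * (N%:R `^ (1 - nu / 2) * (s `^ nu)^-1) * (N%:R - 1) `^ (nu / 2).
Proof.
move=> /andP[nu2 nu3]; have nu0 : 0 <= nu / 2 by lra.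
set x := N%:R `^ (nu / 2); set y := (N%:R - 1) `^ (nu / 2).
have x0 : 0 < x by exact: powR_gt0.
have y0 : 0 < y by exact: powR_gt0.
have sn0 : 0 < s `^ nu by exact: powR_gt0.
have t8 : 2 `^ nu <= 8 :> R.
  have -> : 8 = 2 `^ 3 :> R by rewrite powR_mulrn//; ring.
  by apply: ler_powR => //; lra.
have xx : N%:R `^ nu = x * x :> R.
  by rewrite -powRD ?(gt_eqF N0) ?implybT//; congr powR; field.
have -> : N%:R `^ (1 - nu / 2) = N%:R / x :> R.
  by rewrite powRB ?powRr1 ?(ltW N0)//; rewrite (gt_eqF N0) implybT.
have sE : (2 * scale / N%:R) `^ nu * (s `^ nu * (x * x)) = 2 `^ nu * (x * y).
  have -> : x * y = Num.sqrt (N%:R * (N%:R - 1)) `^ nu.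
    rewrite /x /y -powRM ?(ltW N0) ?(ltW N10)//.
    by rewrite -powR12_sqrt ?(ltW NN0)// -powRrM [2^-1 * nu]mulrC.
  have p1 : 0 <= 2 * scale / N%:R by rewrite divr_ge0 ?(ltW N0)// mulr_ge0// ltW// scale_gt0.
  have sN : 0 <= s * N%:R by rewrite mulr_ge0 ?ltW.
  rewrite -xx -(powRM _ (ltW s0) (ltW N0)) -(powRM _ p1 sN) -powRM ?sqrtr_ge0//.
  suff -> : 2 * scale / N%:R * (s * N%:R) = 2 * Num.sqrt (N%:R * (N%:R - 1)) by [].
  by rewrite /scale; field; rewrite !gt_eqF.
have -> : (2 * scale / N%:R) `^ nu = 2 `^ nu * (x * y) / (s `^ nu * (x * x)).
  by rewrite -sE mulfK// gt_eqF// !mulr_gt0.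
have e1 : N%:R * (2 `^ nu * (x * y) / (s `^ nu * (x * x))) = N%:R / (s `^ nu * x) * y * 2 `^ nu.
  by field; rewrite !gt_eqF.
have e2 : 8 * (N%:R / x / s `^ nu) * y = N%:R / (s `^ nu * x) * y * 8.
  by field; rewrite !gt_eqF.
rewrite e1 e2.
apply: ler_wpM2l => //; rewrite mulr_ge0 ?(ltW y0)// divr_ge0 ?(ltW N0)//.
by rewrite mulr_ge0 ?ltW.
Qed.

Lemma measurable_ukap K : measurable_fun setT (fun z : T * T => ukap m phi lam K z.1 z.2).
Proof.
have mk k : measurable_fun setT (cfeat m phi k) by case: (sqint_cfeat sphi k).
apply: measurable_sum => k; apply: measurable_funM.
  by apply: measurable_funM => //; exact: (measurableT_comp (mk _) measurable_fst).
exact: (measurableT_comp (mk _) measurable_snd).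
Qed.

Section AtK.
Variables (K : nat) (S : 'I_K -> 'I_K -> R).
Hypothesis covS : forall k l : 'I_K,
  \int[m]_x (cfeat m phi k x * cfeat m phi l x) = \sum_j S k j * S l j.

Definition fvec x (k : 'I_K) : R := cfeat m phi k x.
Definition klam (k : 'I_K) : R := lam k.
Definition klin (k : 'I_K) : R := lin_coef k.
Definition klin0 (k : 'I_K) : R := lam k * feat_mean m phi k.

Lemma sqint_fvec k : sqint m (fvec ^~ k). Proof. exact: sqint_cfeat. Qed.
Lemma fvec_mean0 k : \int[m]_x fvec x k = 0. Proof. exact: cfeat_mean0. Qed.

Lemma uproj_lin x : uproj m phi lam K x = lin (fvec x) klin0.
Proof. by []. Qed.

Lemma ukap_lin z x : ukap m phi lam K x z = lin (fvec z) (fun k => klam k * fvec x k).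
Proof. by []. Qed.

Definition beta2 : R := \sum_l (\sum_k klin0 k * S k l) ^+ 2.
Definition tau2 : R := \sum_l \sum_j (\sum_k S k l * klam k * S k j) ^+ 2.

Lemma beta2_ge0 : 0 <= beta2. Proof. by apply: sumr_ge0 => l _; exact: sqr_ge0. Qed.
Lemma tau2_ge0 : 0 <= tau2.
Proof. by apply: sumr_ge0 => l _; apply: sumr_ge0 => j _; exact: sqr_ge0. Qed.

Lemma uproj_second_moment : pmom m 2 (uproj m phi lam K) = beta2%:E.
Proof.
rewrite -[RHS](_ : (lin_std S klin0 ^+ 2)%:E = _); last by rewrite lin_std_sqr.
rewrite -(integral_data_lin_sqr sqint_fvec covS).
by apply: eq_integral => x _; rewrite powR_sqr.
Qed.

Lemma uexp_second_moment :
  pmom M2 2 (fun z => uexp phi lam K z.1 z.2 - umean m phi lam K) = (2 * beta2 + tau2)%:E.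
Proof.
rewrite pmom_prod; last by apply: measurable_funB => //; exact: measurable_uexp.
rewrite -(hoeffding_second_moment sqint_fvec fvec_mean0 covS).
apply: eq_integral => x _; apply: eq_integral => y _; rewrite powR_sqr; congr (_ ^+ 2)%:E.
rewrite /= (uexp_decomp m) uproj_lin (ukap_lin y) [uproj _ _ _ _ y]uproj_lin /lin.
rewrite [RHS](_ : _ = \sum_k klin0 k * fvec x k +
   (\sum_k klin0 k * fvec y k + \sum_k klam k * fvec x k * fvec y k)); last first.
  by rewrite -[in RHS]big_split; congr (_ + _); apply: eq_bigr => k _; rewrite mulrDl.
by ring.
Qed.

(** One of the two variances of u is large by hypothesis, and the truncated kernel
    has nearly the same: the constant 216 makes the loss at most half of s^2. *)
Lemma gauss_variance_ge1 e2 : (pmom M2 2 (Uerr K) <= e2%:E)%E ->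
  216 * (N%:R - 1) * e2 <= s ^+ 2 ->
  ((s ^+ 2)%:E <= pmom M2 2 (fun z => (u z.1 z.2 - D)%R))%E \/
  ((s ^+ 2)%:E <= (N%:R - 1)%:E * pmom m 2 (fun x => (ucond m u x - D)%R))%E ->
  1 <= 2 * N%:R * (\sum_l (\sum_k klin k * S k l) ^+ 2) +
       4 * quad_coef ^+ 2 * (N%:R * (N%:R - 1)) * tau2.
Proof.
move=> Ee2 e2s full_or_cond.
have e20 : 0 <= e2 by rewrite -lee_fin; apply: le_trans Ee2; exact: pmom_ge0.
have s20 : 0 < s ^+ 2 by rewrite exprn_gt0.
have b0 := beta2_ge0; have t0 := tau2_ge0.
have nN : N%:R != 0 :> R by rewrite gt_eqF.
have nN1 : N%:R - 1 != 0 :> R by rewrite gt_eqF.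
have nS : s != 0 by rewrite gt_eqF.
have N11 : 1 <= N%:R - 1 :> R by rewrite lerBrDr -(natrD _ 1 1) ler_nat.
suff key : s ^+ 2 <= 8 * (N%:R - 1) * beta2 + 4 * tau2.
  have -> : \sum_l (\sum_k klin k * S k l) ^+ 2 = (2 * scale / N%:R) ^+ 2 * beta2.
    rewrite /beta2 mulr_sumr; apply: eq_bigr => l _; rewrite -exprMn; congr (_ ^+ 2).
    by rewrite mulr_sumr; apply: eq_bigr => k _; rewrite /klin /lin_coef -(mulrA (2 * scale / N%:R)).
  rewrite (_ : 2 * N%:R * _ + _ = (8 * (N%:R - 1) * beta2 + 4 * tau2) / s ^+ 2).
    by rewrite ler_pdivlMr// mul1r.
  rewrite (_ : _ + _ = scale ^+ 2 * (8 / N%:R * beta2 + 4 / (N%:R * (N%:R - 1)) * tau2)).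
    rewrite scale_sqr; field; rewrite nN nN1 nS//.
  rewrite /quad_coef; field; rewrite nN nN1//.
have Q54 : (54%:E * pmom M2 2 (Uerr K) <= (54 * e2)%:E)%E.
  by rewrite EFinM; apply: lee_wpmul2l; rewrite ?lee_fin.
case: full_or_cond => h.
- have : ((s ^+ 2)%:E <= 2%:E * ((2 * beta2 + tau2)%:E + (54 * e2)%:E))%E.
    apply: (le_trans h); apply: (le_trans (full_variance_le lam mu_ sphi ui K)).
    by rewrite uexp_second_moment; apply: lee_wpmul2l; rewrite ?lee_fin//; apply: leeD.
  rewrite -EFinD -EFinM lee_fin => h1.
  have : e2 <= (N%:R - 1) * e2 by rewrite ler_peMl.
  have : beta2 <= (N%:R - 1) * beta2 by rewrite ler_peMl.
  move: e2s; rewrite -!mulrA; set x := _ * e2; set y := _ * beta2; lra.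
- have : ((s ^+ 2)%:E <= (N%:R - 1)%:E * (2%:E * (beta2%:E + (54 * e2)%:E)))%E.
    apply: (le_trans h); apply: lee_wpmul2l; first by rewrite lee_fin ltW.
    apply: (le_trans (cond_variance_le lam mu_ sphi ui K)).
    by rewrite uproj_second_moment; apply: lee_wpmul2l; rewrite ?lee_fin//; apply: leeD.
  rewrite -EFinD -!EFinM lee_fin => h1.
  have e3 : (N%:R - 1) * (2 * (beta2 + 54 * e2)) = 2 * ((N%:R - 1) * beta2) + 108 * ((N%:R - 1) * e2).
    by ring.
  have : 0 <= (N%:R - 1) * beta2 by rewrite mulr_ge0// ltW.
  move: h1 e2s; rewrite e3 -!mulrA; set x := _ * e2; set y := _ * beta2; lra.
Qed.

(** The constant 49 exceeds 28 sqrt 3, the window being 3 delta wide. *)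
Lemma fixed_anti_concentration e2 t delta : 0 < delta -> (pmom M2 2 (Uerr K) <= e2%:E)%E ->
  216 * (N%:R - 1) * e2 <= s ^+ 2 ->
  ((s ^+ 2)%:E <= pmom M2 2 (fun z => (u z.1 z.2 - D)%R))%E \/
  ((s ^+ 2)%:E <= (N%:R - 1)%:E * pmom m 2 (fun x => (ucond m u x - D)%R))%E ->
  (pow (@gvec R K) N [set x | `|gquad S klam klin quad_coef e x - t|%R <= 3 * delta]%R <=
    (49 * Num.sqrt delta)%:E)%E.
Proof.
move=> d0 h1 h2 h3.
have d30 : 0 < 3 * delta by rewrite mulr_gt0.
apply: le_trans (gquad_anti_concentration e t d30 (gauss_variance_ge1 h1 h2 h3)) _.
rewrite lee_fin sqrtrM// mulrA ler_wpM2r ?sqrtr_ge0//.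
have : Num.sqrt 3 <= 7 / 4 :> R.
  by rewrite -[leRHS]gtr0_norm// -sqrtr_sqr ler_wsqrtr//; lra.
lra.
Qed.

Lemma fixed_gauss_replacement nu t0 delta : 2 < nu <= 3 -> 0 < delta ->
  ((`|\int[pow m N]_x smooth t0 delta (qform klam klin quad_coef e (vsum fvec x) (vsum2 fvec x)) -
      \int[pow (@gvec R K) N]_y smooth t0 delta (gquad S klam klin quad_coef e y)|)%:E <=
   ((588 * 27 * (32 * 237 + 8)) * (delta `^ nu)^-1 * (N%:R `^ (1 - nu / 2) * (s `^ nu)^-1))%:E *
     (pmom M2 nu (fun z => ukap m phi lam K z.1 z.2) +
      ((N%:R - 1) `^ (nu / 2))%:E * pmom m nu (uproj m phi lam K)))%E.
Proof.
move=> nu23 d0; have nu0 : 0 < nu by case/andP: nu23 => *; lra.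
have := gauss_replacement klam klin quad_coef e (ltnW N2) nu23 sqint_fvec fvec_mean0 covS t0 d0.
move=> h; apply: (le_trans h) => {h}.
have -> : ker_mom m fvec klam nu = pmom M2 nu (fun z => ukap m phi lam K z.1 z.2).
  rewrite (pmom_prod _ _ (measurable_ukap K)).
  apply: eq_integral => z _; apply: eq_integral => x _; rewrite -ukap_lin.
  by congr ((`| _ | `^ _)%:E); apply: eq_bigr => k _; rewrite /= mulrAC.
have -> : lin_mom m fvec klin nu = (((2 * scale / N%:R) `^ nu)%:E * pmom m nu (uproj m phi lam K))%E.
  have mp : measurable_fun setT (fun x => (`|uproj m phi lam K x| `^ nu)%:E).
    by apply: measurable_powabs; case: (sqint_uproj lam sphi K).
  have p0 : 0 < 2 * scale / N%:R by rewrite divr_gt0// mulr_gt0// scale_gt0.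
  have q x : (0 <= (`|uproj m phi lam K x| `^ nu)%:E)%E by rewrite lee_fin powR_ge0.
  rewrite /pmom -(ge0_integralZT m mp q (powR_ge0 _ _)).
  apply: eq_integral => x _; rewrite -EFinM -powRM ?(ltW p0)// -[X in (X * _) `^ _](gtr0_norm p0) -normrM.
  rewrite uproj_lin /lin mulr_sumr; congr (`| _ | `^ _)%:E; apply: eq_bigr => k _.
  by rewrite /klin /lin_coef -(mulrA (2 * scale / N%:R)).
have [sn0 xy0] : 0 < s `^ nu /\ 0 < N%:R `^ (nu / 2) * (N%:R - 1) `^ (nu / 2).
  by rewrite powR_gt0// mulr_gt0// powR_gt0.
have E1 : N%:R * (`|2 * quad_coef| `^ nu * (237 * N%:R `^ (nu / 2))) <=
    32 * 237 * (N%:R `^ (1 - nu / 2) * (s `^ nu)^-1).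
  rewrite (mulrCA _ 237) (mulrCA _ 237) -mulrA (mulrCA 32) ler_pM2l//; exact: quad_coef_powR.
have E2 : N%:R * (2 * scale / N%:R) `^ nu <=
    8 * (N%:R `^ (1 - nu / 2) * (s `^ nu)^-1) * (N%:R - 1) `^ (nu / 2) by exact: scale_powR.
have dn0 : 0 < (delta `^ nu)^-1 by rewrite invr_gt0 powR_gt0.
have k0 : 0 <= 588 * 27 :> R by rewrite -natrM; exact: ler0n.
have X0 := pmom_ge0 M2 nu (fun z => ukap m phi lam K z.1 z.2).
have Y0 := pmom_ge0 m nu (uproj m phi lam K).
rewrite (mulrAC 588).
apply: (ereal_lincomb_le (powR_ge0 _ _) (powR_ge0 _ _) X0 Y0 k0 (ltW dn0) (ltW N0) _ _ _ E1 E2).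
- by apply: mulr_ge0; [exact: powR_ge0|apply: mulr_ge0 => //; exact: powR_ge0].
- by rewrite divr_ge0 ?powR_ge0.
- by split; [apply: mulr_ge0; exact: ler0n|exact: ler0n].
Qed.

End AtK.
End FixedTruncation.

(** * Approximation of the statistic *)

Section SmallErrors.
Context (R : realType).

Lemma Rintegral_smooth_close d (T : measurableType d) (m : probability T R) (f g : T -> R) (h : T -> R)
    (t0 delta B : R) : 0 < delta -> measurable_fun setT f -> measurable_fun setT g ->
  (forall x, f x - g x = h x) -> (\int[m]_x (`|h x|)%:E <= B%:E)%E ->
  `|\int[m]_x smooth t0 delta (f x) - \int[m]_x smooth t0 delta (g x)| <= 3 / delta * B.
Proof.
move=> d0 mf mg fgh hB.
have bf := bmeas_smooth_comp t0 delta mf; have bg := bmeas_smooth_comp t0 delta mg.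
have mh : measurable_fun setT (fun x => (`|h x|)%:E).
  apply/measurable_EFinP; apply: measurableT_comp => //.
  have -> : h = (fun x => f x - g x) by apply/funext => x; rewrite fgh.
  exact: measurable_funB.
rewrite -bmeas_RintegralB// -lee_fin.
have d3 : 0 <= 3 / delta by rewrite divr_ge0// ltW.
have me : measurable_fun setT (fun x => (3 / delta)%:E * (`|h x|)%:E)%E by exact: measurable_funeM.
apply: (@le_trans _ _ (\int[m]_x ((3 / delta)%:E * (`|h x|)%:E))%E).
  apply: (bmeas_norm_Rintegral m (bmeas_B bf bg) me) => x.
  by rewrite -EFinM lee_fin -fgh; exact: smooth_lipschitz.
rewrite (ge0_integralZT m mh)// (EFinM (3 / delta) B).
by apply: lee_wpmul2l; rewrite ?lee_fin.
Qed.

End SmallErrors.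

Section DataSide.
Context (d d' : measure_display) (T : measurableType d) (Omega : measurableType d') (R : realType).
Variables (m : probability T R) (u : T -> T -> R) (phi : nat -> T -> R) (lam : nat -> R).
Local Notation M2 := (m \x m)%E.
Hypothesis mu_ : measurable_fun setT (fun z : T * T => u z.1 z.2).
Hypothesis sphi : forall k, sqint m (phi k).
Hypothesis ui : M2.-integrable setT (EFin \o (fun z => u z.1 z.2)).
Variables (N : nat) (s : R).
Hypothesis N2 : (2 <= N)%N.
Hypothesis s0 : 0 < s.
Variables (P : probability Omega R) (X : 'I_N -> {mfun Omega >-> T}).
Hypothesis X_indep : mutually_independent P (fun i => X i : Omega -> T).
Hypothesis X_law : forall i, has_law P (X i) m.

Local Notation D := (utot m u).
Local Notation a := (scale N s).
Local Notation c := (quad_coef N s).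

Definition stat (w : Omega) : R :=
  (N%:R * (N%:R - 1))^-1 * \sum_(i < N) \sum_(j < N | i != j) u (X i w) (X j w).

Definition data_qform K (w : Omega) : R :=
  qform (klam lam (K:=K)) (klin m phi lam N s (K:=K)) c (a * D)
    (fun k => \sum_i fvec m phi (X i w) k) (fun k => \sum_i fvec m phi (X i w) k ^+ 2).

Lemma measurable_stat : measurable_fun setT stat.
Proof.
apply: measurable_funM; first exact: measurable_cst.
apply: measurable_sum => i; under eq_fun do rewrite big_mkcond /=.
apply: measurable_sum => j; case: (i != j); last exact: measurable_cst.
have mp : measurable_fun setT (fun w => (X i w, X j w)) by exact: measurable_fun_pair.
exact: (measurableT_comp mu_ mp).
Qed.

Let mV K (k : 'I_K) : measurable_fun setT (fun x => fvec m phi x k).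
Proof. by case: (sqint_fvec sphi k). Qed.

Lemma measurable_data_qform K : measurable_fun setT (data_qform K).
Proof.
apply: measurable_qform => k.
  by apply: measurable_sum => i; exact: (measurableT_comp (mV k) (measurable_funPT (X i))).
by apply: measurable_sum => i; apply: measurable_funX; exact: (measurableT_comp (mV k) (measurable_funPT (X i))).
Qed.

Lemma data_qform_law K t0 delta :
  \int[P]_w smooth t0 delta (data_qform K w) =
  \int[pow m N]_x smooth t0 delta (qform (klam lam (K:=K)) (klin m phi lam N s (K:=K)) c (a * D)
    (vsum (fvec m phi (K:=K)) x) (vsum2 (fvec m phi (K:=K)) x)).
Proof.
have mt : measurable_fun setT (fun w => [tuple X i w | i < N]) by exact: measurable_mktuple.
have sl : same_law P (pow m N) (fun w => [tuple X i w | i < N]) id.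
  by apply: same_law_of_sets => // B mB; exact: (law_mktuple X_indep X_law).
pose F (x : N.-tuple T) := smooth t0 delta (qform (klam lam (K:=K)) (klin m phi lam N s (K:=K)) c (a * D)
    (vsum (fvec m phi (K:=K)) x) (vsum2 (fvec m phi (K:=K)) x)).
have mF : measurable_fun setT F.
  have [mh _] := bmeas_smooth t0 delta; apply: (measurableT_comp mh).
  by apply: measurable_qform => k; [exact: measurable_vsum|exact: measurable_vsum2].
have E1 w : (fun k : 'I_K => \sum_i fvec m phi (X i w) k) = vsum (fvec m phi (K:=K)) [tuple X i w | i < N].
  by apply/funext => k; apply: eq_bigr => i _; rewrite tnth_mktuple.
have E2 w : (fun k : 'I_K => \sum_i fvec m phi (X i w) k ^+ 2) = vsum2 (fvec m phi (K:=K)) [tuple X i w | i < N].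
  by apply/funext => k; apply: eq_bigr => i _; rewrite tnth_mktuple.
rewrite -[RHS](same_law_Rintegral sl mF).
by apply: eq_Rintegral => w _; rewrite /data_qform E1 E2.
Qed.

Lemma stat_sub_data_qform K w : a * stat w - data_qform K w =
  offdiag_sum X (fun z => - uerr u phi lam K z) (fun=> a * (umean m phi lam K - D) / N%:R) c w.
Proof.
have N0 : N%:R != 0 :> R by rewrite pnatr_eq0 -lt0n (ltn_trans _ N2).
have N1 : N%:R - 1 != 0 :> R by rewrite subr_eq0 pnatr_eq1; case: N N2 => [|[]].
rewrite /data_qform (qform_offdiag _ _ _ _ (fun i k => fvec m phi (X i w) k)) /offdiag_sum.
rewrite sumr_const card_ord.
have off (f : 'I_N -> 'I_N -> R) (g : 'I_N -> R) :
    (forall i j, f i j = g i) -> \sum_(i < N) \sum_(j < N | i != j) f i j = (N%:R - 1) * \sum_i g i.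
  move=> fg; rewrite mulr_sumr; apply: eq_bigr => i _.
  under eq_bigr do rewrite fg.
  have : \sum_(j < N) g i = g i + \sum_(j < N | i != j) g i.
    by rewrite (bigD1 i)//=; congr (_ + _); apply: eq_bigl => j; rewrite eq_sym.
  have hs : \sum_(j < N) g i = N%:R * g i by rewrite sumr_const card_ord mulr_natl.
  by rewrite hs mulrBl mul1r => ->; rewrite addrC addKr.
have offr (f : 'I_N -> 'I_N -> R) (g : 'I_N -> R) :
    (forall i j, f i j = g j) -> \sum_(i < N) \sum_(j < N | i != j) f i j = (N%:R - 1) * \sum_i g i.
  move=> fg; rewrite -(off (fun i j => f j i) g)//.
  rewrite (exchange_big_dep xpredT)//=; apply: eq_bigr => i _.
  by apply: eq_bigl => j; rewrite eq_sym.
pose U i j := u (X i w) (X j w).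
have uE i j : - uerr u phi lam K (X i w, X j w) = U i j -
    (\sum_(k < K) klam lam k * fvec m phi (X i w) k * fvec m phi (X j w) k) -
    uproj m phi lam K (X i w) - uproj m phi lam K (X j w) - umean m phi lam K.
  rewrite -[X in _ = U i j - X - _ - _ - _]/(ukap m phi lam K (X i w) (X j w)).
  by rewrite /uerr /= (uexp_decomp m) /U; ring.
under [in RHS]eq_bigr do under eq_bigr do rewrite uE.
have split4 (A B C E F : 'I_N -> 'I_N -> R) :
   \sum_(i < N) \sum_(j < N | i != j) (A i j - B i j - C i j - E i j - F i j) =
   \sum_(i < N) \sum_(j < N | i != j) A i j - \sum_(i < N) \sum_(j < N | i != j) B i j -
   \sum_(i < N) \sum_(j < N | i != j) C i j - \sum_(i < N) \sum_(j < N | i != j) E i j -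
   \sum_(i < N) \sum_(j < N | i != j) F i j.
  by rewrite -!sumrB; apply: eq_bigr => i _; rewrite -!sumrB.
rewrite split4 (off (fun i _ => uproj m phi lam K (X i w)) (fun i => uproj m phi lam K (X i w)))//.
rewrite (offr (fun _ j => uproj m phi lam K (X j w)) (fun i => uproj m phi lam K (X i w)))//.
rewrite (off (fun _ _ => umean m phi lam K) (fun=> umean m phi lam K))//.
rewrite sumr_const card_ord.
have linE : \sum_(i < N) \sum_(k < K) klin m phi lam N s k * fvec m phi (X i w) k =
    2 * a / N%:R * \sum_i uproj m phi lam K (X i w).
  rewrite mulr_sumr; apply: eq_bigr => i _; rewrite mulr_sumr; apply: eq_bigr => k _.
  by rewrite /klin /lin_coef /fvec -!mulrA.
rewrite linE /stat /quad_coef -[X in _ = _ + X]mulr_natl -[umean m phi lam K *+ N]mulr_natl.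
set S1 := \sum_(i < N) _; set S2 := \sum_(i < N) _; set S3 := \sum_(i < N) _.
by field; rewrite N0 N1.
Qed.

(** The spline is Lipschitz, and the statistic differs from the polynomial by a sum
    of approximation errors, small in mean. *)
Lemma data_close nu delta eta : 2 < nu <= 3 -> 0 < delta -> 0 < eta ->
  exists2 r : R, 0 < r & forall K t0, (pmom M2 nu (uerr u phi lam K) <= (r `^ nu)%:E)%E ->
  `|\int[P]_w smooth t0 delta (a * stat w) - \int[P]_w smooth t0 delta (data_qform K w)| <= eta.
Proof.
move=> nu23 d0 e0; have nu2 : 2 < nu by case/andP: nu23.
have nu0 : 0 < nu by lra.
have c0 : 0 < c by exact: quad_coef_gt0.
have a0 : 0 < a by exact: scale_gt0.
have N0 : 0 < N%:R :> R by rewrite ltr0n (ltn_trans _ N2).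
pose A := c * (N%:R ^+ 2 * 2) + N%:R * (1 + (a / N%:R) `^ nu).
have A0 : 0 < A.
  have ? : 0 <= (a / N%:R) `^ nu by exact: powR_ge0.
  have N20 : 0 < N%:R ^+ 2 * 2 :> R by apply: mulr_gt0 => //; exact: exprn_gt0.
  apply: ltr_pwDl; first exact: mulr_gt0.
  by apply: mulr_ge0; [exact: ltW|exact: addr_ge0].
have dA0 : 0 < 3 / delta * A by apply: mulr_gt0 => //; exact: divr_gt0.
exists (eta / (3 / delta * A)); first exact: divr_gt0.
set r := eta / _; have r0 : 0 < r by exact: divr_gt0.
move=> K t0 Er.
have rn0 : 0 < r `^ nu by exact: powR_gt0.
have me := measurable_uerr lam mu_ sphi K.
have men : measurable_fun setT (fun z => - uerr u phi lam K z) by exact: measurableT_comp.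
have h1 : (pmom M2 nu (fun z => (- uerr u phi lam K z)%R) <= (r `^ nu)%:E)%E.
  have En : pmom M2 nu (fun z => (- uerr u phi lam K z)%R) = pmom M2 nu (uerr u phi lam K).
    by apply: eq_integral => z _; rewrite normrN.
  by rewrite En.
have h2 : (pmom m nu (fun=> (a * (umean m phi lam K - D) / N%:R)%R) <= ((a / N%:R) `^ nu * r `^ nu)%:E)%E.
  have aN0 : 0 < a / N%:R by exact: divr_gt0.
  have nE : `|a * (umean m phi lam K - D) / N%:R| = a / N%:R * `|umean m phi lam K - D|.
    by rewrite mulrAC normrM gtr0_norm.
  rewrite pmom_cst lee_fin nE powRM// ?(ltW aN0)//.
  apply: ler_wpM2l; first exact: powR_ge0.
  rewrite -lee_fin; apply: le_trans Er; apply: umean_err => //; lra.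
have nu1 : 1 <= nu by lra.
have := offdiag_sum_abs X_indep X_law men (measurable_cst _) (ltW c0) r0 nu1 h1 h2.
move=> hB.
have := Rintegral_smooth_close t0 d0 (measurable_funM (measurable_cst a) measurable_stat)
  (measurable_data_qform K) (stat_sub_data_qform K) hB.
move=> h; apply: le_trans h _.
rewrite mulVf ?gt_eqF// (mulrCA (r `^ nu)^-1) mulVf ?gt_eqF// mulr1.
rewrite (_ : c * _ + _ = A * r); last by rewrite /A; ring.
by rewrite mulrA mulrC /r divfK// gt_eqF.
Qed.

End DataSide.

(** * Comparison of truncation orders *)

Section QformLaw.
Context (d d' : measure_display) (T : measurableType d) (Omega : measurableType d') (R : realType) (K N : nat).
Variables (P : probability Omega R) (m : probability T R) (Y : 'I_N -> {mfun Omega >-> T}).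
Hypothesis Y_indep : mutually_independent P (fun i => Y i : Omega -> T).
Hypothesis Y_law : forall i, has_law P (Y i) m.
Variables (W : T -> 'I_K -> R) (lam b : 'I_K -> R) (c e : R).
Hypothesis mW : forall k, measurable_fun setT (W ^~ k).

Definition sample_qform (w : Omega) : R :=
  qform lam b c e (fun k => \sum_i W (Y i w) k) (fun k => \sum_i W (Y i w) k ^+ 2).

Lemma measurable_sample_qform : measurable_fun setT sample_qform.
Proof.
apply: measurable_qform => k.
  by apply: measurable_sum => i; exact: (measurableT_comp (mW k) (measurable_funPT (Y i))).
by apply: measurable_sum => i; apply: measurable_funX; exact: (measurableT_comp (mW k) (measurable_funPT (Y i))).
Qed.

Lemma sample_qformE w : sample_qform w =
  qform lam b c e (vsum W [tuple Y i w | i < N]) (vsum2 W [tuple Y i w | i < N]).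
Proof.
have E1 : (fun k : 'I_K => \sum_i W (Y i w) k) = vsum W [tuple Y i w | i < N].
  by apply/funext => k; apply: eq_bigr => i _; rewrite tnth_mktuple.
have E2 : (fun k : 'I_K => \sum_i W (Y i w) k ^+ 2) = vsum2 W [tuple Y i w | i < N].
  by apply/funext => k; apply: eq_bigr => i _; rewrite tnth_mktuple.
by rewrite /sample_qform E1 E2.
Qed.

Let mq : measurable_fun setT (fun x : N.-tuple T => qform lam b c e (vsum W x) (vsum2 W x)).
Proof. by apply: measurable_qform => k; [exact: measurable_vsum|exact: measurable_vsum2]. Qed.

Lemma sample_qform_smooth t0 delta : \int[P]_w smooth t0 delta (sample_qform w) =
  \int[pow m N]_x smooth t0 delta (qform lam b c e (vsum W x) (vsum2 W x)).
Proof.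
have mt : measurable_fun setT (fun w => [tuple Y i w | i < N]) by exact: measurable_mktuple.
have sl : same_law P (pow m N) (fun w => [tuple Y i w | i < N]) id.
  by apply: same_law_of_sets => // B mB; exact: (law_mktuple Y_indep Y_law).
pose F (x : N.-tuple T) := smooth t0 delta (qform lam b c e (vsum W x) (vsum2 W x)).
have mF : measurable_fun setT F.
  by have [mh _] := bmeas_smooth t0 delta; exact: (measurableT_comp mh mq).
rewrite -[RHS](same_law_Rintegral sl mF).
by apply: eq_Rintegral => w _; rewrite sample_qformE.
Qed.

Lemma sample_qform_close t h : P [set w | (`|sample_qform w - t| <= h)%R] =
  pow m N [set x | (`|qform lam b c e (vsum W x) (vsum2 W x) - t| <= h)%R].
Proof.
rewrite -(law_mktuple Y_indep Y_law); last exact: measurable_close.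
by congr (P _); apply/seteqP; split => w /=; rewrite sample_qformE.
Qed.

End QformLaw.

Lemma sum_narrow (R : realType) (K K' : nat) (le : (K <= K')%N) (F : 'I_K' -> R) :
  \sum_k F k - \sum_(k < K) F (widen_ord le k) = \sum_(k < K') (if (K <= k)%N then F k else 0).
Proof.
rewrite -(big_ord_narrow le) (bigID (fun k : 'I_K' => (k < K)%N)) /=.
rewrite addrAC subrr add0r [LHS]big_mkcond; apply: eq_bigr => k _.
by rewrite -leqNgt.
Qed.

Lemma gram_sum (R : realType) (K L : nat) (A : 'I_K -> 'I_L -> R) (w : 'I_K -> R) :
  \sum_l (\sum_k w k * A k l) ^+ 2 = \sum_k \sum_j w k * w j * (\sum_l A k l * A j l).
Proof.
transitivity (\sum_l \sum_k \sum_j w k * w j * (A k l * A j l)).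
  apply: eq_bigr => l _; rewrite expr2 mulr_suml; apply: eq_bigr => k _.
  by rewrite mulr_sumr; apply: eq_bigr => j _; ring.
rewrite exchange_big; apply: eq_bigr => k _; rewrite exchange_big; apply: eq_bigr => j _.
by rewrite mulr_sumr.
Qed.

Section GaussSide.
Context (d d' : measure_display) (T : measurableType d) (Omega : measurableType d') (R : realType).
Variables (m : probability T R) (u : T -> T -> R) (phi : nat -> T -> R) (lam : nat -> R).
Local Notation M2 := (m \x m)%E.
Hypothesis mu_ : measurable_fun setT (fun z : T * T => u z.1 z.2).
Hypothesis sphi : forall k, sqint m (phi k).
Hypothesis ui : M2.-integrable setT (EFin \o (fun z => u z.1 z.2)).
Variables (N : nat) (s e : R).
Hypothesis N2 : (2 <= N)%N.
Hypothesis s0 : 0 < s.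
Variable P : probability Omega R.
Variable S : forall K, 'I_K -> 'I_K -> R.
Hypothesis covS : forall K (k l : 'I_K),
  \int[m]_x (cfeat m phi k x * cfeat m phi l x) = \sum_j S k j * S l j.
Variable eta : forall K, 'I_N -> {mfun Omega >-> K.-tuple R}.
Hypothesis eta_indep : forall K, mutually_independent P (fun i => eta K i : Omega -> K.-tuple R).
Hypothesis eta_gauss : forall K i, std_gaussian_vector P (eta K i).

Local Notation D := (utot m u).
Local Notation a := (scale N s).
Local Notation c := (quad_coef N s).

Lemma eta_law K i : has_law P (eta K i) (@gvec R K).
Proof.
move=> A mA; have [yi yl] := eta_gauss K i.
have mY (k : 'I_K) : measurable_fun setT (fun w => tnth (eta K i w) k).
  exact: (measurableT_comp (@measurable_tnth _ _ _ k) (measurable_funPT (eta K i))).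
pose Y (k : 'I_K) : {mfun Omega >-> R} :=
  HB.pack (fun w => tnth (eta K i w) k) (isMeasurableFun.Build _ _ _ _ (fun w => tnth (eta K i w) k) (mY k)).
have yi' : mutually_independent P (fun k => Y k : Omega -> R) by exact: yi.
have yl' k : has_law P (Y k) (@stdnormal R) by move=> B mB; rewrite stdnormalE; exact: yl.
rewrite /gvec -(law_mktuple yi' yl' mA); congr (P _).
apply/seteqP; split => w /=.
  by rewrite (_ : [tuple _ | k < K] = eta K i w)//; apply: eq_from_tnth => k; rewrite tnth_mktuple.
by rewrite (_ : [tuple _ | k < K] = eta K i w)//; apply: eq_from_tnth => k; rewrite tnth_mktuple.
Qed.

Definition gauss_qform K : Omega -> R :=
  sample_qform (eta K) (glin (S (K:=K))) (klam lam (K:=K)) (klin m phi lam N s (K:=K)) c e.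

(** The polynomial of order [K] at the first [K] coordinates of the vectors that
    [gauss_qform K'] uses, so that the two can be subtracted. *)
Definition trunc_qform K K' (le : (K <= K')%N) : Omega -> R :=
  sample_qform (eta K') (fun z k => glin (S (K:=K')) z (widen_ord le k))
    (klam lam (K:=K)) (klin m phi lam N s (K:=K)) c e.

Let mG K (k : 'I_K) : measurable_fun setT (fun z => glin (S (K:=K)) z k).
Proof. exact: measurable_glin. Qed.

Lemma measurable_gauss_qform K : measurable_fun setT (gauss_qform K).
Proof. by apply: measurable_sample_qform => k; exact: mG. Qed.

(** Truncating the features of a finer approximation gives the coarser one in law:
    the linear forms have the same Gaussian laws, so no exchange costs
    anything. *)
Lemma trunc_qform_smooth K K' (le : (K <= K')%N) t0 delta :
  \int[P]_w smooth t0 delta (trunc_qform le w) = \int[P]_w smooth t0 delta (gauss_qform K w).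
Proof.
rewrite [LHS](sample_qform_smooth (@eta_indep K') (@eta_law K') _ _ _ _ (fun k => mG (widen_ord le k))).
rewrite [RHS](sample_qform_smooth (@eta_indep K) (@eta_law K) _ _ _ _ (mG (K:=K))).
pose V1 (z : K'.-tuple R) (k : 'I_K) := glin (S (K:=K')) z (widen_ord le k).
have mV1 k : measurable_fun setT (V1 ^~ k) by exact: mG.
have os w t : ((`|\int[@gvec R K']_z smooth t0 delta (t + \sum_k w k * V1 z k) -
     \int[@gvec R K]_z smooth t0 delta (t + \sum_k w k * glin (S (K:=K)) z k)|)%:E
   <= 0%:E * \int[@gvec R K']_z (`|(\sum_k w k * V1 z k)%R| `^ 2)%:E)%E.
  have g2 := gauss_law_glin (S (K:=K)) w.
  have g1 : gauss_law (@gvec R K') (fun z => \sum_k w k * V1 z k)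
      (Num.sqrt (\sum_l (\sum_k w k * S k l) ^+ 2)).
    have := gauss_law_gvec (fun l => \sum_k w k * S (widen_ord le k) l).
    rewrite (_ : (fun z => _) = (fun z => \sum_k w k * V1 z k)); last first.
      apply/funext => z; under eq_bigr do rewrite mulr_suml.
      rewrite exchange_big/=; apply: eq_bigr => k _.
      by rewrite /V1 /glin mulr_sumr; apply: eq_bigr => l _; rewrite mulrA.
    rewrite (gram_sum (fun k l => S (widen_ord le k) l)) gram_sum.
    suff -> : \sum_k \sum_j w k * w j * (\sum_l S (widen_ord le k) l * S (widen_ord le j) l) =
      \sum_k \sum_j w k * w j * (\sum_l S k l * S j l) by [].
    by apply: eq_bigr => k _; apply: eq_bigr => j _; rewrite -!covS.
  have mh : measurable_fun setT (fun y => smooth t0 delta (t + y)).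
    have [mh _] := bmeas_smooth t0 delta; apply: (measurableT_comp mh).
    exact: measurable_funD.
  rewrite (same_law_Rintegral (F := fun y => smooth t0 delta (t + y)) g1.2 mh).
  rewrite (same_law_Rintegral (F := fun y => smooth t0 delta (t + y)) g2.2 mh).
  by rewrite subrr normr0 mul0e.
have := swap_bound (klam lam (K:=K)) (klin m phi lam N s (K:=K)) c e mV1 (mG (K:=K))
  (bmeas_smooth t0 delta) (lexx 0) os N.
rewrite big1; last by move=> i _; rewrite mul0e.
by rewrite lee_fin normr_le0 subr_eq0 => /eqP.
Qed.

Definition tail_lam K K' (k : 'I_K') : R := if (K <= k)%N then lam k else 0.
Definition tail_lin K K' (k : 'I_K') : R := if (K <= k)%N then lin_coef m phi lam N s k else 0.

Lemma gauss_qform_sub K K' (le : (K <= K')%N) w :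
  gauss_qform K' w - trunc_qform le w =
  offdiag_sum (eta K') (fun z => \sum_k tail_lam K k * glin (S (K:=K')) z.1 k * glin (S (K:=K')) z.2 k)
    (fun z => lin (glin (S (K:=K')) z) (tail_lin K (K':=K'))) c w.
Proof.
rewrite /gauss_qform /trunc_qform /sample_qform /offdiag_sum.
rewrite (qform_offdiag _ _ _ _ (fun i k => glin (S (K:=K')) (eta K' i w) k)).
rewrite (qform_offdiag _ _ _ _ (fun i k => glin (S (K:=K')) (eta K' i w) (widen_ord le k))).
have E1 (v v' : 'I_K' -> R) : \sum_k tail_lam K k * v k * v' k =
    \sum_k klam lam k * v k * v' k - \sum_k klam lam k * v (widen_ord le k) * v' (widen_ord le k).
  rewrite (sum_narrow le (fun k => klam lam k * v k * v' k)); apply: eq_bigr => k _.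
  by rewrite /tail_lam; case: ifP => //; rewrite !mul0r.
have E2 (v : 'I_K' -> R) : lin v (tail_lin K (K':=K')) =
    \sum_k klin m phi lam N s k * v k - \sum_k klin m phi lam N s k * v (widen_ord le k).
  rewrite (sum_narrow le (fun k => klin m phi lam N s k * v k)); apply: eq_bigr => k _.
  by rewrite /tail_lin; case: ifP => //; rewrite !mul0r.
under [in RHS]eq_bigr do under eq_bigr do rewrite E1.
under [X in _ = _ + X]eq_bigr do rewrite E2.
under [X in _ = c * X + _]eq_bigr do rewrite sumrB.
by rewrite !sumrB; ring.
Qed.

Lemma ukap_tail K K' (le : (K <= K')%N) x y :
  \sum_(k < K') tail_lam K k * fvec m phi x k * fvec m phi y k =
  ures m u phi lam K' (x, y) + - ures m u phi lam K (x, y).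
Proof.
have -> : ures m u phi lam K' (x, y) + - ures m u phi lam K (x, y) =
    ukap m phi lam K' x y - ukap m phi lam K x y.
  by rewrite !(ukapE m u); ring.
have := sum_narrow le (fun k => lam k * cfeat m phi k x * cfeat m phi k y).
rewrite /ukap => ->; apply: eq_bigr => k _.
by rewrite /tail_lam; case: ifP => //; rewrite !mul0r.
Qed.

Lemma uproj_tail K K' (le : (K <= K')%N) x :
  lin (fvec m phi x) (tail_lin K (K':=K')) =
  2 * a / N%:R * ((- (umean m phi lam K' - D) + (umean m phi lam K - D)) +
    (- uproj_err m u phi lam K' x + uproj_err m u phi lam K x)).
Proof.
have -> : (- (umean m phi lam K' - D) + (umean m phi lam K - D)) +
    (- uproj_err m u phi lam K' x + uproj_err m u phi lam K x) =
    uproj m phi lam K' x - uproj m phi lam K x by rewrite /uproj_err; ring.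
have := sum_narrow le (fun k => lam k * feat_mean m phi k * cfeat m phi k x).
rewrite /uproj => ->; rewrite mulr_sumr; apply: eq_bigr => k _.
by rewrite /tail_lin; case: ifP => _; rewrite ?mul0r ?mulr0// /lin_coef -(mulrA (2 * a / N%:R)).
Qed.

(** Second moments of kernels agree under the Gaussian and the data laws, and under
    the latter the tail is a difference of two residuals. *)
Lemma tail_kernel_moment K K' (le : (K <= K')%N) r2 :
  (pmom M2 2 (uerr u phi lam K) <= r2%:E)%E -> (pmom M2 2 (uerr u phi lam K') <= r2%:E)%E ->
  (pmom (@gvec R K' \x @gvec R K')%E 2 (fun z => (\sum_k tail_lam K k * glin (S (K:=K')) z.1 k * glin (S (K:=K')) z.2 k)%R) <=
    (2 * (27 * 27 * 4 * r2 + 27 * 27 * 4 * r2))%:E)%E.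
Proof.
move=> h1 h2.
have p13 : (1 < (2 : R)) && ((2 : R) <= 3) by apply/andP; split; lra.
have mGG : measurable_fun setT (fun z : K'.-tuple R * K'.-tuple R =>
    \sum_k tail_lam K k * glin (S (K:=K')) z.1 k * glin (S (K:=K')) z.2 k).
  apply: measurable_sum => k; apply: measurable_funM.
    by apply: measurable_funM => //; exact: (measurableT_comp (mG _) measurable_fst).
  exact: (measurableT_comp (mG _) measurable_snd).
rewrite (pmom_prod _ _ mGG).
have -> : (\int[@gvec R K']_x \int[@gvec R K']_y
    (`|(\sum_k tail_lam K k * glin (S (K:=K')) (x, y).1 k * glin (S (K:=K')) (x, y).2 k)%R| `^ 2)%:E =
  \int[m]_x \int[m]_y ((\sum_(k < K') tail_lam K k * fvec m phi x k * fvec m phi y k) ^+ 2)%:E)%E.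
  rewrite -(gauss_kernel_sqr (sqint_fvec sphi (K:=K')) (covS (K:=K'))).
  by apply: eq_integral => x _; apply: eq_integral => y _; rewrite powR_sqr.
have mr K0 := measurable_ures (m := m) lam mu_ sphi K0.
have mrn : measurable_fun setT (fun z => - ures m u phi lam K z) by exact: measurableT_comp.
have -> : (\int[m]_x \int[m]_y ((\sum_(k < K') tail_lam K k * fvec m phi x k * fvec m phi y k) ^+ 2)%:E =
    pmom M2 2 (fun z => (ures m u phi lam K' z + - ures m u phi lam K z)%R))%E.
  rewrite pmom_prod; last exact: measurable_funD.
  by apply: eq_integral => x _; apply: eq_integral => y _; rewrite powR_sqr (ukap_tail le).
apply: le_trans (pmom2_double M2 (mr K') mrn) _.
have En : pmom M2 2 (fun z => (- ures m u phi lam K z)%R) = pmom M2 2 (ures m u phi lam K).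
  by apply: eq_integral => z _; rewrite normrN.
rewrite En (EFinM 2) (EFinD (27 * 27 * 4 * r2)); apply: lee_wpmul2l; first by rewrite lee_fin.
have c0 : 0 <= 27 * 27 * 4 :> R by rewrite -!natrM; exact: ler0n.
have bd K0 : (pmom M2 2 (uerr u phi lam K0) <= r2%:E)%E ->
    (pmom M2 2 (ures m u phi lam K0) <= (27 * 27 * 4 * r2)%:E)%E.
  move=> h; apply: le_trans (pmom_ures lam mu_ sphi ui K0 p13) _.
  by rewrite (EFinM (27 * 27 * 4)); apply: lee_wpmul2l; rewrite ?lee_fin.
exact: (leeD (bd _ h2) (bd _ h1)).
Qed.

Lemma tail_lin_moment K K' (le : (K <= K')%N) r2 :
  (pmom M2 2 (uerr u phi lam K) <= r2%:E)%E -> (pmom M2 2 (uerr u phi lam K') <= r2%:E)%E ->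
  (pmom (@gvec R K') 2 (fun z => lin (glin (S (K:=K')) z) (tail_lin K (K':=K'))) <=
    ((2 * a / N%:R) ^+ 2 * (16 * r2))%:E)%E.
Proof.
move=> h1 h2; have p1 : 1 < 2 :> R by lra.
have -> : pmom (@gvec R K') 2 (fun z => lin (glin (S (K:=K')) z) (tail_lin K (K':=K'))) =
    pmom m 2 (fun x => lin (fvec m phi x) (tail_lin K (K':=K'))).
  transitivity ((lin_std (S (K:=K')) (tail_lin K (K':=K')) ^+ 2)%:E).
    rewrite -(integral_gauss_lin_sqr (S (K:=K'))).
    by apply: eq_integral => x _; rewrite powR_sqr.
  rewrite -(integral_data_lin_sqr (sqint_fvec sphi (K:=K')) (covS (K:=K'))).
  by apply: eq_integral => x _; rewrite powR_sqr.
pose A (x : T) : R := - (umean m phi lam K' - D) + (umean m phi lam K - D).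
pose B x := - uproj_err m u phi lam K' x + uproj_err m u phi lam K x.
have me K0 := measurable_uproj_err (m := m) lam mu_ sphi K0.
have men : measurable_fun setT (fun x => - uproj_err m u phi lam K' x) by exact: measurableT_comp.
have mA : measurable_fun setT A by exact: measurable_cst.
have mB : measurable_fun setT B by exact: measurable_funD.
have hA : (pmom m 2 A <= (2 * (r2 + r2))%:E)%E.
  apply: le_trans (pmom2_double m (measurable_cst (- (umean m phi lam K' - D))) (measurable_cst (umean m phi lam K - D))) _.
  rewrite !pmom_cst normrN (EFinM 2) (EFinD r2); apply: lee_wpmul2l; first by rewrite lee_fin.
  by apply: leeD; [apply: le_trans h2|apply: le_trans h1]; exact: umean_err.
have hB : (pmom m 2 B <= (2 * (r2 + r2))%:E)%E.
  apply: le_trans (pmom2_double m men (me K)) _.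
  have En : pmom m 2 (fun x => (- uproj_err m u phi lam K' x)%R) = pmom m 2 (uproj_err m u phi lam K').
    by apply: eq_integral => x _; rewrite normrN.
  rewrite En (EFinM 2) (EFinD r2); apply: lee_wpmul2l; first by rewrite lee_fin.
  by apply: leeD; [apply: le_trans h2|apply: le_trans h1]; exact: uproj_err_pmom.
have hAB : (pmom m 2 (fun x => (A x + B x)%R) <= (16 * r2)%:E)%E.
  apply: le_trans (pmom2_double m mA mB) _.
  apply: (@le_trans _ _ (2%:E * ((2 * (r2 + r2))%:E + (2 * (r2 + r2))%:E))%E).
    apply: lee_wpmul2l; first by rewrite lee_fin.
    exact: (leeD hA hB).
  by rewrite -(EFinD (2 * (r2 + r2))) -(EFinM 2) lee_fin; lra.
have mAB := @measurable_powabs _ 2 _ _ _ (measurable_funD mA mB).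
have q x : (0 <= (`|A x + B x| `^ 2)%:E)%E by rewrite lee_fin powR_ge0.
have k0 : 0 <= (2 * a / N%:R) ^+ 2 by exact: sqr_ge0.
have -> : pmom m 2 (fun x => lin (fvec m phi x) (tail_lin K (K':=K'))) =
    (((2 * a / N%:R) ^+ 2)%:E * pmom m 2 (fun x => (A x + B x)%R))%E.
  rewrite /pmom -(ge0_integralZT m mAB q k0); apply: eq_integral => x _.
  by rewrite -EFinM !powR_sqr -exprMn (uproj_tail le).
by rewrite (EFinM ((2 * a / N%:R) ^+ 2)); apply: lee_wpmul2l; rewrite ?lee_fin.
Qed.

Lemma gauss_close delta eps : 0 < delta -> 0 < eps ->
  exists2 r : R, 0 < r & forall K K' t0, (K <= K')%N ->
  (pmom M2 2 (uerr u phi lam K) <= (r ^+ 2)%:E)%E ->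
  (pmom M2 2 (uerr u phi lam K') <= (r ^+ 2)%:E)%E ->
  `|\int[P]_w smooth t0 delta (gauss_qform K' w) - \int[P]_w smooth t0 delta (gauss_qform K w)| <= eps.
Proof.
move=> d0 e0.
have c0 : 0 < c by exact: quad_coef_gt0.
have N0 : 0 < N%:R :> R by rewrite ltr0n (ltn_trans _ N2).
pose C1 : R := 2 * (27 * 27 * 4 + 27 * 27 * 4); pose C2 : R := (2 * a / N%:R) ^+ 2 * 16.
pose A := c * (N%:R ^+ 2 * (1 + C1)) + N%:R * (1 + C2).
have C10 : 0 <= C1 by rewrite /C1 -!natrM -natrD -natrM; exact: ler0n.
have C20 : 0 <= C2 by apply: mulr_ge0 => //; exact: sqr_ge0.
have A0 : 0 < A.
  have p1 : 0 < 1 + C1 by rewrite ltr_pwDl.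
  have p2 : 0 < 1 + C2 by rewrite ltr_pwDl.
  have N20 : 0 < N%:R ^+ 2 * (1 + C1) by apply: mulr_gt0 => //; exact: exprn_gt0.
  by apply: addr_gt0; exact: mulr_gt0.
have dA0 : 0 < 3 / delta * A by apply: mulr_gt0 => //; exact: divr_gt0.
exists (eps / (3 / delta * A)); first exact: divr_gt0.
set r := eps / _; have r0 : 0 < r by exact: divr_gt0.
move=> K K' t0 le h1 h2.
rewrite -(trunc_qform_smooth le).
have mf : measurable_fun setT (fun z : K'.-tuple R * K'.-tuple R =>
    \sum_k tail_lam K k * glin (S (K:=K')) z.1 k * glin (S (K:=K')) z.2 k).
  apply: measurable_sum => k; apply: measurable_funM.
    by apply: measurable_funM => //; exact: (measurableT_comp (mG _) measurable_fst).
  exact: (measurableT_comp (mG _) measurable_snd).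
have mg : measurable_fun setT (fun z => lin (glin (S (K:=K')) z) (tail_lin K (K':=K'))).
  by apply: measurable_sum => k; apply: measurable_funM => //; exact: mG.
have two1 : 1 <= 2 :> R by lra.
have hB := offdiag_sum_abs (@eta_indep K') (@eta_law K') mf mg (ltW c0) r0 two1
  (tail_kernel_moment le h1 h2) (tail_lin_moment le h1 h2).
have mq : measurable_fun setT (trunc_qform le).
  by apply: measurable_sample_qform => k; exact: mG.
have := Rintegral_smooth_close t0 d0 (measurable_gauss_qform K') mq (gauss_qform_sub le) hB.
move=> h; apply: le_trans h _.
have rr : r `^ 2 = r ^+ 2 by rewrite powR_mulrn// ltW.
rewrite rr (_ : _ + _ = A * r); last first.
  by rewrite /A /C1 /C2; field; rewrite !gt_eqF.
by rewrite mulrA mulrC /r divfK// gt_eqF.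
Qed.

End GaussSide.

(** * Conditional expectation given one sample point *)

Section ConditionalExpectation.
Context (d d' : measure_display) (Omega : measurableType d') (T : measurableType d) (R : realType).
Variable P : probability Omega R.

Lemma cond_expectation_unique (Y : Omega -> R) (X : {mfun Omega >-> T}) (Z1 Z2 : Omega -> R) :
  is_cond_expectation P Y X Z1 -> is_cond_expectation P Y X Z2 ->
  ae_eq P setT (EFin \o Z1) (EFin \o Z2).
Proof.
move=> [m1 i1 h1] [m2 i2 h2].
have sub A : g_sigma_algebra_preimage X A -> measurable A.
  by move=> [B mB <-]; exact: (measurable_funPT X).
pose h w := Z1 w - Z2 w.
have hi : P.-integrable setT (EFin \o h) by exact: (integrableB measurableT i1 i2).
pose A := [set w | (0 < h w)%R].
have sA : g_sigma_algebra_preimage X A.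
  have mh : measurable_fun [set: g_sigma_algebra_preimageType X] h by exact: measurable_funB.
  have := mh measurableT `]0, +oo[%classic (measurable_itv _); rewrite setTI.
  congr (g_sigma_algebra_preimage X _); apply/seteqP; split => w /=; by rewrite in_itv/= andbT.
have sAC : g_sigma_algebra_preimage X (~` A).
  have mh : measurable_fun [set: g_sigma_algebra_preimageType X] h by exact: measurable_funB.
  have := mh measurableT `]-oo, 0]%classic (measurable_itv _); rewrite setTI.
  congr (g_sigma_algebra_preimage X _); apply/seteqP; split => w /=.
    by rewrite in_itv/= => hw /(lt_le_trans)/(_ hw); rewrite ltxx.
  by rewrite in_itv/= => /negP; rewrite -leNgt.
have mA := sub _ sA; have mAC := sub _ sAC.
have z B : g_sigma_algebra_preimage X B -> (\int[P]_(w in B) (h w)%:E = 0)%E.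
  move=> sB; have mB := sub _ sB.
  have j1 : P.-integrable B (EFin \o Z1) by apply: integrableS i1.
  have j2 : P.-integrable B (EFin \o Z2) by apply: integrableS i2.
  rewrite (_ : (fun w => (h w)%:E) = (fun w => (Z1 w)%:E - (Z2 w)%:E)%E)//.
  rewrite integralB// (h1 _ sB) -(h2 _ sB) subee//.
  exact: integrable_fin_num.
have mhE : measurable_fun setT (fun w => (h w)%:E) by move/integrableP: hi => [].
have abs0 : (\int[P]_w `|(h w)%:E| = 0)%E.
  rewrite -(setUv A) ge0_integral_setU//; last 2 first.
  - by rewrite setUv; exact: measurableT_comp.
  - by apply/disj_setPS => w [].
  rewrite [X in (X + _)%E](_ : _ = \int[P]_(w in A) (h w)%:E)%E; last first.
    by apply: eq_integral => w; rewrite inE => /= hw; rewrite ger0_norm// ltW.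
  rewrite (z _ sA) add0e [LHS](_ : _ = \int[P]_(w in ~` A) (- (h w)%:E))%E; last first.
    apply: eq_integral => w; rewrite inE => /= /negP; rewrite -leNgt => hw.
    by rewrite ler0_norm.
  rewrite integralN; first by rewrite (z _ sAC) oppe0.
  have hiC : P.-integrable (~` A) (EFin \o h) by apply: integrableS hi.
  apply: fin_num_adde_defl; rewrite fin_numN; exact: (integrable_neg_fin_num mAC hiC).
have [+ _] := ae_eq_integral_abs P measurableT mhE; move=> /(_ abs0).
apply: filterS => w /= /(_ I) [] /eqP; rewrite subr_eq0 => /eqP hw _.
by rewrite hw.
Qed.

Variables (m : probability T R) (u : T -> T -> R).
Hypothesis mu_ : measurable_fun setT (fun z : T * T => u z.1 z.2).
Hypothesis u_sym : forall x y, u x y = u y x.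
Hypothesis ui : (m \x m)%E.-integrable setT (EFin \o (fun z => u z.1 z.2)).
Variables (X1 X2 : {mfun Omega >-> T}).
Hypothesis pair_law : same_law P (m \x m)%E (fun w => (X1 w, X2 w)) id.
Hypothesis law2 : same_law P m X2 id.
Variable g : T -> R.
Hypothesis mg : measurable_fun setT g.
Hypothesis gE : forall y, g y = \int[m]_x u y x.

Lemma same_law_integrable d1 d2 d3 (A : measurableType d1) (B : measurableType d2) (C : measurableType d3)
    (p1 : probability A R) (p2 : probability B R) (f1 : A -> C) (f2 : B -> C) (F : C -> R) :
  measurable_fun setT f1 -> same_law p1 p2 f1 f2 -> measurable_fun setT F ->
  p2.-integrable setT (EFin \o (fun x => F (f2 x))) ->
  p1.-integrable setT (EFin \o (fun x => F (f1 x))).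
Proof.
move=> mf sl mF /integrableP[_ fin]; apply/integrableP; split.
  by apply/measurable_EFinP; exact: measurableT_comp.
have mA : measurable_fun setT (fun y => (`|F y|)%:E) by apply/measurable_EFinP; exact: measurableT_comp.
by rewrite [ltLHS](sl (fun y => (`|F y|)%:E)).
Qed.

Lemma g_integrable : m.-integrable setT (EFin \o g).
Proof.
apply/integrableP; split; first exact/measurable_EFinP.
have /integrableP[mU fin] := ui.
have mab : measurable_fun setT (fun z : T * T => (`|u z.1 z.2|)%:E).
  by apply/measurable_EFinP; exact: measurableT_comp.
apply: (@le_lt_trans _ _ (\int[m]_y \int[m]_x (`|u y x|)%:E)%E).
  apply: ge0_le_integralT.
  - by apply: measurableT_comp => //; exact/measurable_EFinP.
  - exact: (measurable_inner m mab (fun z => normr_ge0 (u z.1 z.2))).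
  - by move=> y.
  - move=> y; rewrite /= gE.
    have my : measurable_fun setT (fun x => (u y x)%:E).
      apply/measurable_EFinP; exact: (measurableT_comp mu_ (pair1_measurable y)).
    apply: le_trans (le_abse_integral m measurableT my).
    rewrite /Rintegral; case: (\int[m]_x _)%E => //=.
    + by rewrite normr0 leey.
    + by rewrite normr0 leey.
rewrite -(fubini_tonelli1 _ mab) in fin *; last by move=> z; rewrite lee_fin.
exact: fin.
Qed.

(** Fubini, since the pair has the product law. *)
Lemma cond_expectation_version :
  is_cond_expectation P (fun w => u (X1 w) (X2 w)) X2 (fun w => g (X2 w)).
Proof.
split.
- move=> _ B mB; rewrite setTI; exists (g @^-1` B); last by rewrite setTI.
  by rewrite -[X in measurable X]setTI; exact: mg.
- exact: (same_law_integrable (measurable_funPT X2) law2 mg g_integrable).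
move=> _ [B mB <-]; rewrite setTI.
have mXB : measurable (X2 @^-1` B) by rewrite -[X in measurable X]setTI; exact: measurable_funPT.
pose ind (y : T) : R := \1_B y.
have mind : measurable_fun setT ind by exact: measurable_indic.
have res (f : Omega -> R) : (\int[P]_(w in X2 @^-1` B) (f w)%:E = \int[P]_w (ind (X2 w) * f w)%:E)%E.
  rewrite integral_mkcond; apply: eq_integral => w _; rewrite patchE /ind indicE.
  have -> : (w \in X2 @^-1` B) = (X2 w \in B) by apply/idP/idP; rewrite !inE.
  by case: ifP; rewrite ?mul1r ?mul0r.
rewrite !res.
have -> : (\int[P]_w (ind (X2 w) * g (X2 w))%:E = \int[m]_y (ind y * g y)%:E)%E.
  by apply: (same_law_integral (F := fun y => (ind y * g y)%:E) law2); apply/measurable_EFinP; exact: measurable_funM.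
pose k (z : T * T) : R := ind z.2 * u z.1 z.2.
have mk : measurable_fun setT k.
  by apply: measurable_funM => //; exact: (measurableT_comp mind measurable_snd).
have -> : (\int[P]_w (ind (X2 w) * u (X1 w) (X2 w))%:E = \int[(m \x m)%E]_z (k z)%:E)%E.
  by apply: (same_law_integral (F := fun z => (k z)%:E) pair_law); exact/measurable_EFinP.
have ki : (m \x m)%E.-integrable setT (EFin \o k).
  apply: (dominated_integrable mk (integrable_norm ui)) => z /=.
  rewrite normrM ler_piMl// /ind indicE; case: (_ \in _); rewrite ?normr1 ?normr0//.
rewrite -[RHS](integral12_prod_meas1 ki) (Fubini ki).
have aei := ae_integrable2 ui.
apply: ae_eq_integral => //.
- by apply/measurable_EFinP; exact: measurable_funM.
- exact: (measurable_fubini_G ki).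
apply: filterS aei => y iy _.
have uyi : m.-integrable setT (fun x => (u x y)%:E) by exact: iy.
rewrite /fubini_G /k /=.
transitivity (\int[m]_x ((ind y)%:E * (u x y)%:E))%E; last by apply: eq_integral.
rewrite integralZl// EFinM gE; congr (_ * _)%E.
under eq_Rintegral do rewrite u_sym.
by rewrite (Rintegral_fine uyi).
Qed.

(** Versions agree almost everywhere, so they share their moments. *)
Lemma cond_expectation_pmom p c : 
  pmom P p (fun w => cond_expectation P (fun w' => u (X1 w') (X2 w')) X2 w - c) =
  pmom m p (fun y => g y - c).
Proof.
have vZ : is_cond_expectation P (fun w => u (X1 w) (X2 w)) X2
    (cond_expectation P (fun w' => u (X1 w') (X2 w')) X2).
  rewrite /cond_expectation; apply: xgetPex.
  by exists (fun w => g (X2 w)); exact: cond_expectation_version.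
have ae := cond_expectation_unique vZ cond_expectation_version.
have mgc : measurable_fun setT (fun y => g y - c) by exact: measurable_funB.
have mgp := @measurable_powabs _ p _ _ _ mgc.
transitivity (pmom P p (fun w => g (X2 w) - c)); last first.
  by apply: (law2 mgp) => y; rewrite lee_fin powR_ge0.
have [_ /integrableP[/measurable_EFinP mZ _] _] := vZ.
apply: ae_eq_integral => //.
- by apply: (@measurable_powabs _ p _ _ (fun w => _ w - c)); exact: measurable_funB.
- by apply: (measurableT_comp mgp); exact: measurable_funPT.
by apply: filterS ae => w /(_ I) [] ->.
Qed.

End ConditionalExpectation.

(** * Comparison of the statistic with the Gaussian polynomials *)

Section RateConstant.
Context (R : realType).

(** The factor 588 comes from one exchange, 27 from the triangle inequality with
    three terms, 32 * 237 and 8 from the quadratic and the linear coefficients. *)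
Definition replacement_const : R := 588 * 27 * (32 * 237 + 8).
(** The last summand 50 = 49 + 1 collects the anti-concentration bound and the
    approximation error of the statistic. *)
Definition rate_const : R := replacement_const * (27 * 27 * 27 * 4 * 2 + 27) + 50.

Lemma replacement_const_ge0 : 0 <= replacement_const.
Proof. by rewrite /replacement_const -!natrM -natrD -natrM; exact: ler0n. Qed.

Lemma rate_const_gt0 : 0 < rate_const.
Proof.
apply: ltr_wpDl => //; apply: mulr_ge0; first exact: replacement_const_ge0.
by rewrite -!natrM -natrD; exact: ler0n.
Qed.

End RateConstant.

Section Comparison.
Context (d d1 d2 : measure_display) (T : measurableType d) (Omega : measurableType d1)
  (Omega' : measurableType d2) (R : realType).
Variables (m : probability T R) (u : T -> T -> R) (phi : nat -> T -> R) (lam : nat -> R).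
Local Notation M2 := (m \x m)%E.
Hypothesis mu_ : measurable_fun setT (fun z : T * T => u z.1 z.2).
Hypothesis sphi : forall k, sqint m (phi k).
Hypothesis ui : M2.-integrable setT (EFin \o (fun z => u z.1 z.2)).
Variables (N : nat) (s nu : R).
Hypothesis N2 : (2 <= N)%N.
Hypothesis s0 : 0 < s.
Hypothesis nu23 : 2 < nu <= 3.
Variables (P : probability Omega R) (X : 'I_N -> {mfun Omega >-> T}).
Hypothesis X_indep : mutually_independent P (fun i => X i : Omega -> T).
Hypothesis X_law : forall i, has_law P (X i) m.
Variable P' : probability Omega' R.
Variable S : forall K, 'I_K -> 'I_K -> R.
Hypothesis covS : forall K (k l : 'I_K),
  \int[m]_x (cfeat m phi k x * cfeat m phi l x) = \sum_j S k j * S l j.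
Variable eta : forall K, 'I_N -> {mfun Omega' >-> K.-tuple R}.
Hypothesis eta_indep : forall K, mutually_independent P' (fun i => eta K i : Omega' -> K.-tuple R).
Hypothesis eta_gauss : forall K i, std_gaussian_vector P' (eta K i).

Local Notation D := (utot m u).
Local Notation a := (scale N s).
Local Notation Q := (gauss_qform m phi lam s (a * D) S eta).

Hypothesis full_or_cond :
  ((s ^+ 2)%:E <= pmom M2 2 (fun z => (u z.1 z.2 - D)%R))%E \/
  ((s ^+ 2)%:E <= (N%:R - 1)%:E * pmom m 2 (fun x => (ucond m u x - D)%R))%E.
Hypothesis err0 : forall eps, 0 < eps ->
  exists K0, forall K, (K0 <= K)%N -> (pmom M2 nu (uerr u phi lam K) <= eps%:E)%E.

Let nu0 : 0 < nu. Proof. by case/andP: nu23 => *; lra. Qed.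
Let N10 : 0 < N%:R - 1 :> R. Proof. by rewrite subr_gt0 ltr1n. Qed.

Lemma err2_small eps : 0 < eps ->
  exists K0, forall K, (K0 <= K)%N -> (pmom M2 2 (uerr u phi lam K) <= eps%:E)%E.
Proof.
move=> e0; pose r := Num.sqrt (eps / 2).
have r0 : 0 < r by rewrite sqrtr_gt0 divr_gt0.
have rn0 : 0 < r `^ nu by exact: powR_gt0.
have [K0 h] := err0 rn0; exists K0 => K /h{}h.
have two0 : 0 < 2 :> R by [].
have nu2 : 2 <= nu by case/andP: nu23 => *; lra.
apply: le_trans (pmom_change M2 (measurable_uerr lam mu_ sphi K) two0 nu2 r0) _.
have r2 : r `^ 2 = eps / 2 by rewrite powR_mulrn ?ltW// sqr_sqrtr// ltW// divr_gt0.
apply: (@le_trans _ _ ((r `^ 2)%:E * (1 + (r `^ nu)^-1%:E * (r `^ nu)%:E))%E).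
  apply: lee_wpmul2l; first by rewrite lee_fin powR_ge0.
  by apply: leeD => //; apply: lee_wpmul2l => //; rewrite lee_fin invr_ge0 ltW.
rewrite -(EFinM (r `^ nu)^-1) mulVf ?gt_eqF// -(EFinD 1) -(EFinM (r `^ 2)) lee_fin r2.
by lra.
Qed.

Lemma gauss_anti_concentration K t delta e2 : 0 < delta ->
  (pmom M2 2 (uerr u phi lam K) <= e2%:E)%E -> 216 * (N%:R - 1) * e2 <= s ^+ 2 ->
  fine (P' [set w | (`|Q K w - t| <= 3 * delta)%R]) <= 49 * Num.sqrt delta.
Proof.
move=> d0 h1 h2.
have mG (k : 'I_K) : measurable_fun setT (fun z => glin (S (K:=K)) z k) by exact: measurable_glin.
have -> : P' [set w | (`|Q K w - t| <= 3 * delta)%R] = _ :=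
  sample_qform_close (@eta_indep K) (@eta_law _ _ _ _ _ eta eta_gauss K) _ _ _ _ mG _ _.
have := fixed_anti_concentration mu_ sphi ui (a * D) N2 s0 (covS (K:=K)) t d0 h1 h2 full_or_cond.
set p := pow _ _ _ => h; rewrite -lee_fin; apply: le_trans h; rewrite /p.
rewrite fineK// fin_num_measure//; apply: measurable_close.
by apply: measurable_qform => k; [exact: measurable_vsum|exact: measurable_vsum2].
Qed.

(** At a fixed smoothing scale delta the smoothed probabilities of two truncations
    get arbitrarily close, and anti-concentration bounds the smoothing error;
    delta is such that 49 sqrt delta = eps / 2. *)
Lemma gauss_prob_cauchy eps : 0 < eps -> exists K0, forall K K' t, (K0 <= K)%N -> (K0 <= K')%N ->
  `|fine (P' [set w | (t < Q K w)%R]) - fine (P' [set w | (t < Q K' w)%R])| <= eps.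
Proof.
move=> e0; pose delta := (eps / 98) ^+ 2.
have e98 : 0 < eps / 98 by rewrite divr_gt0.
have d0 : 0 < delta by rewrite exprn_gt0.
have e20 : 0 < eps / 2 by rewrite divr_gt0.
have [r r0 close] := gauss_close (S := S) lam mu_ sphi ui (a * D) N2 s0 covS eta_indep eta_gauss d0 e20.
pose e2 := Num.min (r ^+ 2) (s ^+ 2 / (216 * (N%:R - 1))).
have N216 : 0 < 216 * (N%:R - 1) :> R by apply: mulr_gt0.
have e2p : 0 < e2 by rewrite lt_min exprn_gt0//= divr_gt0// exprn_gt0.
have [K0 h] := err2_small e2p; exists K0.
suff main K K' t : (K0 <= K)%N -> (K <= K')%N ->
    `|fine (P' [set w | (t < Q K' w)%R]) - fine (P' [set w | (t < Q K w)%R])| <= eps.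
  move=> K K' t KK KK'; have [le|/ltnW le] := leqP K K'; last exact: main.
  by rewrite distrC; exact: main.
move=> K0K KK'.
have e2r : e2 <= r ^+ 2 by rewrite ge_min lexx.
have e2s : 216 * (N%:R - 1) * e2 <= s ^+ 2.
  by rewrite mulrC -ler_pdivlMr// ge_min lexx orbT.
have hK := h _ K0K; have hK' := h _ (leq_trans K0K KK').
have rK : (pmom M2 2 (uerr u phi lam K) <= (r ^+ 2)%:E)%E by apply: le_trans hK _; rewrite lee_fin.
have rK' : (pmom M2 2 (uerr u phi lam K') <= (r ^+ 2)%:E)%E by apply: le_trans hK' _; rewrite lee_fin.
have mQ k := measurable_gauss_qform m phi lam s (a * D) S eta k.
have := smoothing d0 (mQ K') (mQ K) (fun t => close K K' t KK' rK rK')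
  (fun t => gauss_anti_concentration t d0 hK e2s) t.
move=> h1; apply: le_trans h1 _.
by rewrite /delta sqrtr_sqr gtr0_norm//; lra.
Qed.

Variables (a0 b0 : R).
Hypothesis a0_gt0 : 0 < a0.
Hypothesis full_mom : pmom M2 nu (fun z => u z.1 z.2 - D) = a0%:E.
Hypothesis cond_mom : pmom m nu (fun x => ucond m u x - D) = b0%:E.

(** The cost of the Gaussian replacement at smoothing scale 1, up to a constant. *)
Definition kappa : R :=
  N%:R `^ (1 - nu / 2) * (s `^ nu)^-1 * (a0 + (N%:R - 1) `^ (nu / 2) * b0).

Lemma kappa_gt0 : 0 < kappa.
Proof.
have b00 : 0 <= b0 by rewrite -lee_fin -cond_mom; exact: pmom_ge0.
apply: mulr_gt0.
  by apply: mulr_gt0; [apply: powR_gt0; rewrite ltr0n (ltn_trans _ N2)|rewrite invr_gt0 powR_gt0].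
by apply: ltr_pwDl => //; apply: mulr_ge0 => //; exact: powR_ge0.
Qed.

(** Three errors add up: approximation of the statistic by a polynomial, replacement
    of the data by Gaussian vectors, and anti-concentration. The first becomes
    negligible for large truncation orders. *)
Lemma data_gauss_close : exists K0, forall K t, (K0 <= K)%N ->
  `|fine (P [set w | (t < a * stat u X w)%R]) - fine (P' [set w | (t < Q K w)%R])| <=
  rate_const R * kappa `^ (2 * nu + 1)^-1.
Proof.
have nu2 : 2 < nu by case/andP: nu23.
have k0 := kappa_gt0; have p0 : 0 < 2 * nu + 1 by lra.
have b00 : 0 <= b0 by rewrite -lee_fin -cond_mom; exact: pmom_ge0.
(* this choice balances delta^(-nu) kappa against sqrt delta *)
pose delta := kappa `^ (2 / (2 * nu + 1)).
have d0 : 0 < delta by exact: powR_gt0.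
have sd : Num.sqrt delta = kappa `^ (2 * nu + 1)^-1.
  rewrite -powR12_sqrt ?ltW// -powRrM; congr powR; field; rewrite gt_eqF//.
have sd0 : 0 < Num.sqrt delta by rewrite sqrtr_gt0.
have dk : (delta `^ nu)^-1 * kappa = kappa `^ (2 * nu + 1)^-1.
  have -> : (2 * nu + 1)^-1 = 1 - 2 / (2 * nu + 1) * nu by field; rewrite gt_eqF.
  rewrite powRB ?(gt_eqF k0) ?implybT// powRr1 ?ltW// [in RHS]powRrM mulrC//.
have [r r0 dclose] := data_close lam mu_ sphi ui N2 s0 X_indep X_law nu23 d0 sd0.
pose y := (N%:R - 1) `^ (nu / 2); have y0 : 0 < y by exact: powR_gt0.
(* for large truncation orders the moment a0 absorbs the approximation error,
   even after multiplication by the weight y of the linear part *)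
pose e1 := Num.min (r `^ nu) (Num.min a0 (a0 / (2 * y))).
have e10 : 0 < e1 by rewrite !lt_min powR_gt0// a0_gt0 divr_gt0// mulr_gt0.
have e1r : e1 <= r `^ nu by rewrite ge_min lexx.
have e1a : e1 <= a0 by rewrite !ge_min lexx orbT.
have e1y : 2 * y * e1 <= a0 by rewrite mulrC -ler_pdivlMr ?mulr_gt0// !ge_min lexx !orbT.
pose e2 := s ^+ 2 / (216 * (N%:R - 1)).
have N216 : 0 < 216 * (N%:R - 1) :> R by apply: mulr_gt0.
have e2p : 0 < e2 by rewrite divr_gt0// exprn_gt0.
have e2s : 216 * (N%:R - 1) * e2 <= s ^+ 2 by rewrite /e2 mulrC divfK// gt_eqF.
have [K1 h1] := err0 e10; have [K2 h2] := err2_small e2p.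
exists (maxn K1 K2) => K t; rewrite geq_max => /andP[/h1{}h1 /h2{}h2].
have p13 : 1 < nu <= 3 by case/andP: nu23 => *; apply/andP; split; lra.
pose C0 := replacement_const R; have C00 : 0 <= C0 by exact: replacement_const_ge0.
pose w := N%:R `^ (1 - nu / 2) * (s `^ nu)^-1.
have w0 : 0 <= w by rewrite mulr_ge0 ?powR_ge0// invr_ge0 powR_ge0.
pose c1 : R := 27 * 27 * 27 * 4.
have c10 : 0 <= c1 by rewrite /c1 -!natrM; exact: ler0n.
have X_le : (pmom M2 nu (fun z => ukap m phi lam K z.1 z.2) <= (c1 * (a0 + a0))%:E)%E.
  apply: le_trans (pmom_ukap lam mu_ sphi ui K p13) _.
  rewrite full_mom (EFinM c1) (EFinD a0); apply: lee_wpmul2l; first by rewrite lee_fin.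
  by apply: leeD => //; apply: le_trans h1 _; rewrite lee_fin.
have Y_le : (pmom m nu (uproj m phi lam K) <= (27 * (b0 + e1 + e1))%:E)%E.
  apply: le_trans (pmom_uproj lam mu_ sphi ui K p13) _.
  rewrite cond_mom (EFinM 27) (EFinD (b0 + e1)) (EFinD b0).
  apply: lee_wpmul2l; first by rewrite lee_fin.
  by apply: leeD => //; apply: leeD.
have swap t0 : `|\int[P]_w smooth t0 delta (data_qform m u phi lam s X K w) -
    \int[P']_w smooth t0 delta (Q K w)| <= C0 * (c1 * 2 + 27) * Num.sqrt delta.
  rewrite (data_qform_law u lam sphi s X_indep X_law).
  have mG (k : 'I_K) : measurable_fun setT (fun z => glin (S (K:=K)) z k) by exact: measurable_glin.
  rewrite [X in `|_ - X|](sample_qform_smooth (@eta_indep K) (@eta_law _ _ _ _ _ eta eta_gauss K) _ _ _ _ mG).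
  have := fixed_gauss_replacement lam sphi (a * D) N2 s0 (covS (K:=K)) t0 nu23 d0.
  rewrite -lee_fin => h; apply: le_trans h _.
  rewrite -/(replacement_const R) -/C0 -/w -/y.
  have c00 : 0 <= C0 * (delta `^ nu)^-1 * w.
    by rewrite mulr_ge0// mulr_ge0// invr_ge0 powR_ge0.
  apply: (@le_trans _ _ ((C0 * (delta `^ nu)^-1 * w)%:E * ((c1 * (a0 + a0))%:E + (y * (27 * (b0 + e1 + e1)))%:E))%E).
    apply: lee_wpmul2l; first by rewrite lee_fin.
    apply: leeD => //; rewrite (EFinM y); apply: lee_wpmul2l => //.
    by rewrite lee_fin ltW.
  rewrite -(EFinD (c1 * (a0 + a0))) -EFinM lee_fin sd -dk.
  have -> : C0 * (c1 * 2 + 27) * ((delta `^ nu)^-1 * kappa) =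
     C0 * (delta `^ nu)^-1 * w * ((c1 * 2 + 27) * (a0 + y * b0)).
    by rewrite /kappa -/w -/y; ring.
  apply: ler_wpM2l => //.
  have yb : 0 <= y * b0 by apply: mulr_ge0 => //; exact: ltW.
  have cyb : 0 <= c1 * (y * b0) by exact: mulr_ge0.
  have -> : c1 * (a0 + a0) + y * (27 * (b0 + e1 + e1)) =
    c1 * 2 * a0 + 27 * (y * b0) + 27 * (2 * y * e1) by ring.
  have -> : (c1 * 2 + 27) * (a0 + y * b0) =
    c1 * 2 * a0 + 27 * (y * b0) + 27 * a0 + 2 * (c1 * (y * b0)) by ring.
  move: e1y cyb; set z1 := 2 * y * e1; set z2 := c1 * (y * b0); lra.
have close t0 : `|\int[P]_w smooth t0 delta (a * stat u X w) - \int[P']_w smooth t0 delta (Q K w)| <=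
    Num.sqrt delta + C0 * (c1 * 2 + 27) * Num.sqrt delta.
  have hr : (pmom M2 nu (uerr u phi lam K) <= (r `^ nu)%:E)%E by apply: le_trans h1 _; rewrite lee_fin.
  apply: le_trans (ler_distD (\int[P]_w smooth t0 delta (data_qform m u phi lam s X K w)) _ _) _.
  by apply: lerD; [exact: dclose|exact: swap].
have ms : measurable_fun setT (fun w => a * stat u X w).
  by apply: measurable_funM => //; exact: measurable_stat.
have mQ := measurable_gauss_qform m phi lam s (a * D) S eta K.
have := smoothing d0 ms mQ close (fun t => gauss_anti_concentration t d0 h2 e2s) t.
move=> h; apply: le_trans h _.
by rewrite -sd /rate_const -/C0 -/c1; move: (C0 * _) => C1; lra.
Qed.

End Comparison.

(** * Means, covariances and exponents *)

Section MatrixForms.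
Context (R : realType).

Lemma quad_diag_mx K (p q : 'cV[R]_K) (e : 'rV[R]_K) :
  (p^T *m diag_mx e *m q) ord0 ord0 = \sum_k e ord0 k * p k ord0 * q k ord0.
Proof.
rewrite mxE; apply: eq_bigr => k _.
by rewrite mul_mx_diag !mxE [p _ _ * _]mulrC.
Qed.

Lemma mulmx_glin K (S : 'M[R]_K) (z : K.-tuple R) k :
  (S *m \col_l tnth z l) k ord0 = glin (fun k l => S k l) z k.
Proof. by rewrite mxE; apply: eq_bigr => l _; rewrite mxE. Qed.

End MatrixForms.

Section Covariance.
Context (dO dT : measure_display) (Omega : measurableType dO) (R : realType) (d : nat).
Variables (P : probability Omega R) (m : probability (d.-tuple R) R).
Variable X1 : {mfun Omega >-> d.-tuple R}.
Hypothesis law1 : same_law P m X1 id.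
Variable phi : nat -> d.-tuple R -> R.
Hypothesis sphi : forall k, sqint m (phi k).

Let mphi k : measurable_fun setT (phi k). Proof. by case: (sphi k). Qed.

Lemma expectation_feature k : fine ('E_P[fun w => phi k (X1 w)])%E = feat_mean m phi k.
Proof.
rewrite unlock; congr fine.
by apply: (same_law_integral (F := fun x => (phi k x)%:E) law1); exact/measurable_EFinP.
Qed.

Lemma phi_vecE K (k : 'I_K) : (fun w => (phi_vec phi K \o X1) w k ord0) = (fun w => phi k (X1 w)).
Proof. by apply/funext => w; rewrite /= mxE. Qed.

Lemma mu_vecE K (k : 'I_K) : mu_vec P X1 phi K k ord0 = feat_mean m phi k.
Proof. by rewrite mxE phi_vecE expectation_feature. Qed.

Lemma Sigma_mxE K (k l : 'I_K) : Sigma_mx P X1 phi K k l =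
  \int[m]_x (cfeat m phi k x * cfeat m phi l x).
Proof.
rewrite mxE !phi_vecE covariance.unlock !expectation_feature unlock; congr fine.
pose F (x : d.-tuple R) : \bar R := (cfeat m phi k x * cfeat m phi l x)%:E.
apply: (same_law_integral (F := F) law1); apply/measurable_EFinP.
by apply: measurable_funM; [case: (sqint_cfeat sphi k)|case: (sqint_cfeat sphi l)].
Qed.

(** The quadratic form of the covariance matrix is the second moment of a linear
    combination of centred features, hence nonnegative. *)
Lemma Sigma_sqrt K : is_psd_sqrtmx (Sigma_mx P X1 phi K) (psd_sqrtmx (Sigma_mx P X1 phi K)).
Proof.
apply: psd_sqrtmxP.
  apply/matrixP => k l; rewrite mxE !Sigma_mxE.
  by apply: eq_Rintegral => x _; rewrite mulrC.
move=> v.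
pose f x := \sum_(k < K) v k ord0 * cfeat m phi k x.
have sc k := sqint_cfeat sphi k.
suff -> : (v^T *m Sigma_mx P X1 phi K *m v) ord0 ord0 = \int[m]_x (f x ^+ 2).
  by apply: Rintegral_ge0 => x _; exact: sqr_ge0.
have i2 (k l : 'I_K) : m.-integrable setT (EFin \o (fun x => v k ord0 * v l ord0 * (cfeat m phi k x * cfeat m phi l x))).
  exact: (integrableZl measurableT (v k ord0 * v l ord0) (sqint_mul (sc k) (sc l))).
have i1 (k : 'I_K) : m.-integrable setT (EFin \o (fun x => \sum_(l < K) v k ord0 * v l ord0 * (cfeat m phi k x * cfeat m phi l x))).
  have := @integrable_sum _ _ _ m setT measurableT _ (index_enum 'I_K) xpredT _ (fun l _ => i2 k l).
  by congr (integrable _ _ _); apply/funext => x /=; rewrite -sumEFin.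
transitivity (\int[m]_x \sum_(k < K) \sum_(l < K) v k ord0 * v l ord0 * (cfeat m phi k x * cfeat m phi l x)).
  rewrite Rintegral_sum// mxE.
  transitivity (\sum_(l < K) \sum_(k < K) v k ord0 * v l ord0 * \int[m]_x (cfeat m phi k x * cfeat m phi l x)).
    apply: eq_bigr => l _; rewrite mxE mulr_suml; apply: eq_bigr => k _.
    by rewrite mxE Sigma_mxE mulrAC.
  rewrite exchange_big; apply: eq_bigr => k _; rewrite Rintegral_sum//.
  apply: eq_bigr => l _.
  by rewrite (RintegralZl _ measurableT (sqint_mul (sc k) (sc l))).
apply: eq_Rintegral => x _; rewrite expr2 mulr_suml; apply: eq_bigr => k _.
by rewrite mulr_sumr; apply: eq_bigr => l _; ring.
Qed.

Lemma sqrt_cov K (k l : 'I_K) : \int[m]_x (cfeat m phi k x * cfeat m phi l x) =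
  \sum_j psd_sqrtmx (Sigma_mx P X1 phi K) k j * psd_sqrtmx (Sigma_mx P X1 phi K) l j.
Proof.
have [St _ SS] := Sigma_sqrt K; rewrite -Sigma_mxE -[in LHS]SS mxE.
by apply: eq_bigr => j _; congr (_ * _); rewrite -[in LHS]St mxE.
Qed.

End Covariance.

Section FinalAlgebra.
Context (R : realType).

(** Each of the two summands is at most the power of the larger norm, whence the
    factor 2. *)
Lemma max_moment_bound (A B : \bar R) (s nu C r : R) : (0 <= A)%E -> (0 <= B)%E ->
  0 < s -> 2 < nu -> 0 <= C * r ->
  ((C * r)%:E * (A `^ nu / s%:E `^ nu + B `^ nu / s%:E `^ nu) `^ (2 * nu + 1)^-1 <=
   (2 `^ (2 * nu + 1)^-1 * C * r)%:E * (Order.max A B / s%:E) `^ (nu / (2 * nu + 1)))%E.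
Proof.
move=> A0 B0 s0 nu2 Cr; have p0 : 0 <= (2 * nu + 1)^-1 by rewrite invr_ge0; lra.
have sn0 : s `^ nu != 0 by rewrite gt_eqF// powR_gt0.
set M := Order.max A B; have M0 : (0 <= M)%E by rewrite le_max A0.
have AM : (A <= M)%E by rewrite le_max lexx.
have BM : (B <= M)%E by rewrite le_max lexx orbT.
have s1 : (0 <= (s^-1)%:E)%E by rewrite lee_fin invr_ge0 ltW.
have nup : 0 <= nu by lra.
have mono (x y : \bar R) (r' : R) : 0 <= r' -> (0 <= x)%E -> (x <= y)%E -> (x `^ r' <= y `^ r')%E.
  move=> r0 x0 xy; apply: gt0_ler_poweR => //; rewrite in_itv/= ?x0 ?leey//.
  by rewrite (le_trans x0 xy).
have Mn : ((M / s%:E) `^ nu = M `^ nu / s%:E `^ nu)%E.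
  rewrite poweR_EFin !inver (gt_eqF s0) (negbTE sn0) poweRM//.
  by rewrite poweR_EFin -powR_inv1 ?(ltW s0)// -!powRrM mulrC powRrM powR_inv1 ?powR_ge0.
have Q0 : (0 <= (M / s%:E) `^ nu)%E by exact: poweR_ge0.
have si : (0 <= (s%:E `^ nu)^-1)%E by rewrite poweR_EFin inver (negbTE sn0) lee_fin invr_ge0 powR_ge0.
have AQ : (A `^ nu / s%:E `^ nu <= (M / s%:E) `^ nu)%E.
  by rewrite Mn; apply: lee_wpmul2r => //; exact: mono.
have BQ : (B `^ nu / s%:E `^ nu <= (M / s%:E) `^ nu)%E.
  by rewrite Mn; apply: lee_wpmul2r => //; exact: mono.
have sumQ : (A `^ nu / s%:E `^ nu + B `^ nu / s%:E `^ nu <= 2%:E * (M / s%:E) `^ nu)%E.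
  have two : (2%:E = 1 + 1 :> \bar R)%E by rewrite -EFinD; congr EFin; lra.
  by rewrite two ge0_muleDl// mul1e; exact: leeD.
have sum0 : (0 <= A `^ nu / s%:E `^ nu + B `^ nu / s%:E `^ nu)%E.
  by apply: adde_ge0; apply: mule_ge0 => //; exact: poweR_ge0.
have := mono _ _ _ p0 sum0 sumQ; rewrite poweRM// (poweR_EFin 2) -poweRrM => h.
rewrite (_ : _ * C * r = C * r * 2 `^ (2 * nu + 1)^-1); last by ring.
rewrite (EFinM (C * r)) -muleA; apply: lee_wpmul2l; first by rewrite lee_fin.
exact: h.
Qed.

Lemma kappa_rate N (s nu a0 b0 : R) : (2 <= N)%N -> 0 < s -> 2 < nu -> 0 <= a0 -> 0 <= b0 ->
  kappa N s nu a0 b0 `^ (2 * nu + 1)^-1 =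
  N%:R `^ (- ((nu - 2) / (4 * nu + 2))) *
  (a0 / s `^ nu + (N%:R - 1) `^ (nu / 2) * b0 / s `^ nu) `^ (2 * nu + 1)^-1.
Proof.
move=> N2 s0 nu2 a00 b00.
have sn0 : 0 <= (s `^ nu)^-1 by rewrite invr_ge0 powR_ge0.
rewrite /kappa -mulrA powRM ?powR_ge0//; last first.
  by rewrite mulr_ge0// addr_ge0// mulr_ge0// powR_ge0.
rewrite -powRrM; congr (_ `^ _ * _ `^ _).
  by field; apply/andP; split; rewrite gt_eqF//; lra.
by rewrite mulrC mulrDl.
Qed.

End FinalAlgebra.

(** * Norms as moments *)

Section NormsAsMoments.
Context (dO dT : measure_display) (Omega : measurableType dO) (R : realType) (d : nat).
Variables (P : probability Omega R) (m : probability (d.-tuple R) R).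
Variable u : d.-tuple R -> d.-tuple R -> R.
Local Notation M2 := (m \x m)%E.
Local Notation D := (utot m u).
Hypothesis u_sym : forall x y, u x y = u y x.
Hypothesis mu_ : measurable_fun setT (fun z : d.-tuple R * d.-tuple R => u z.1 z.2).
Variables X1 X2 : {mfun Omega >-> d.-tuple R}.
Hypothesis pair_law : same_law P M2 (fun w => (X1 w, X2 w)) id.
Hypothesis law2 : same_law P m X2 id.

Lemma U_meanE : U_mean P u X1 X2 = D.
Proof.
rewrite /U_mean unlock /utot /Rintegral; congr fine.
by apply: (same_law_integral (F := fun z => (u z.1 z.2)%:E) pair_law); exact/measurable_EFinP.
Qed.

Lemma Lnorm_pow (f : Omega -> R) p : 0 < p ->
  ('N[P]_p%:E [(fun w => (f w)%:E)] `^ p = pmom P p f)%E.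
Proof. by move=> p0; rewrite powR_Lnorm ?gt_eqF. Qed.

Lemma pmom_pair p (F : d.-tuple R * d.-tuple R -> R) : measurable_fun setT F ->
  pmom P p (fun w => F (X1 w, X2 w)) = pmom M2 p F.
Proof.
move=> mF; apply: (same_law_integral (F := fun z => (`|F z| `^ p)%:E) pair_law).
apply/measurable_EFinP; apply: (@measurableT_comp _ _ _ _ _ _ (fun x : R => x `^ p)).
  exact: measurable_powR.
exact: measurableT_comp.
Qed.

Lemma full_norm_pow p : 0 < p ->
  (M_full P u X1 X2 p `^ p = pmom M2 p (fun z => (u z.1 z.2 - D)%R))%E.
Proof.
move=> p0; rewrite Lnorm_pow// U_meanE.
by apply: (@pmom_pair p (fun z => u z.1 z.2 - D)); apply: measurable_funB.
Qed.

Lemma eps_norm_pow phi lam K p : 0 < p -> (forall k, sqint m (phi k)) ->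
  (eps_approx P u X1 X2 phi lam K p `^ p = pmom M2 p (uerr u phi lam K))%E.
Proof.
move=> p0 sphi; rewrite Lnorm_pow//.
by apply: (@pmom_pair p (uerr u phi lam K)); exact: (measurable_uerr lam mu_ sphi).
Qed.

Hypothesis ui : M2.-integrable setT (EFin \o (fun z => u z.1 z.2)).

Lemma cond_norm_pow p : 0 < p ->
  (M_cond P u X1 X2 p `^ p = pmom m p (fun x => (ucond m u x - D)%R))%E.
Proof.
move=> p0; rewrite Lnorm_pow// U_meanE.
by apply: (cond_expectation_pmom mu_ u_sym ui pair_law law2 (measurable_ucond m mu_)).
Qed.

Lemma eps_cvg_pow phi lam p : 0 < p -> (forall k, sqint m (phi k)) ->
  eps_approx P u X1 X2 phi lam K p @[K --> \oo] --> 0%E ->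
  forall eps, 0 < eps -> exists K0, forall K, (K0 <= K)%N ->
    (pmom M2 p (uerr u phi lam K) <= eps%:E)%E.
Proof.
move=> p0 sphi h eps e0; pose r := eps `^ p^-1; have r0 : 0 < r by exact: powR_gt0.
have nb : nbhs (0%E : \bar R) [set y | (y < r%:E)%E].
  by apply: open_nbhs_nbhs; split; [exact: open_ereal_lt_ereal|rewrite /= lte_fin].
have [K0 _ hK] := h _ nb.
exists K0 => K KK; rewrite -(eps_norm_pow lam K p0 sphi).
have -> : eps%:E = (r%:E `^ p)%E.
  by rewrite poweR_EFin -powRrM mulVf ?gt_eqF// powRr1 ?ltW.
have l := ltW (hK K KK); have n0 : (0 <= eps_approx P u X1 X2 phi lam K p)%E by exact: Lnorm_ge0.
by apply: gt0_ler_poweR => //; rewrite ?ltW// in_itv/= ?n0 ?leey ?lee_fin ?ltW.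
Qed.

End NormsAsMoments.

(** u is an integrable truncation minus an error with a finite moment. *)
Lemma kernel_integrable (dT : measure_display) (T : measurableType dT) (R : realType)
  (m : probability T R) (u : T -> T -> R) phi lam K nu :
  measurable_fun setT (fun z : T * T => u z.1 z.2) -> (forall k, sqint m (phi k)) ->
  1 < nu -> (pmom (m \x m)%E nu (uerr u phi lam K) < +oo)%E ->
  (m \x m)%E.-integrable setT (EFin \o (fun z : T * T => u z.1 z.2)).
Proof.
move=> mu_ sphi nu1 fin.
have me := measurable_uerr lam mu_ sphi K.
have ei : (m \x m)%E.-integrable setT (EFin \o uerr u phi lam K).
  apply/integrableP; split; first exact/measurable_EFinP.
  have -> : (\int[m \x m]_x `|(EFin \o uerr u phi lam K) x| = pmom (m \x m)%E 1 (uerr u phi lam K))%E.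
    by apply: eq_integral => z _; rewrite /= powRr1.
  apply: (le_lt_trans (pmom_change (m \x m)%E me ltr01 (ltW nu1) ltr01)).
  rewrite !powR1 mul1e invr1 mul1e; exact: lte_add_pinfty (ltry _) fin.
have := integrableB measurableT (uexp_integrable lam sphi K) ei.
congr (integrable _ _ _); apply/funext => z /=; rewrite -EFinB; congr EFin.
by rewrite /uerr opprB addrC subrK.
Qed.

(** * The limit of the Gaussian polynomials *)

Section FinalReduction.
Context (dO dO' : measure_display) (Omega : measurableType dO) (Omega' : measurableType dO')
  (R : realType) (d : nat).
Variables (P : probability Omega R) (m : probability (d.-tuple R) R).
Variable u : d.-tuple R -> d.-tuple R -> R.
Local Notation M2 := (m \x m)%E.
Local Notation D := (utot m u).
Hypothesis mu_ : measurable_fun setT (fun z : d.-tuple R * d.-tuple R => u z.1 z.2).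
Variables X1 X2 : {mfun Omega >-> d.-tuple R}.
Hypothesis pair_law : same_law P M2 (fun w => (X1 w, X2 w)) id.
Hypothesis law1 : same_law P m X1 id.
Variables (phi : nat -> d.-tuple R -> R) (lam : nat -> R).
Hypothesis sphi : forall k, sqint m (phi k).

Definition cov_root K (k l : 'I_K) : R := psd_sqrtmx (Sigma_mx P X1 phi K) k l.

(** As the root of the covariance is symmetric it can be moved onto the Gaussian
    vectors, where the form is diagonal. *)
Lemma U_gauss_qform n s (eta : forall K, 'I_n -> {mfun Omega' >-> K.-tuple R}) K w :
  scale n s * U_gauss P u X1 X2 phi lam (eta K) w =
  gauss_qform m phi lam s (scale n s * D) cov_root eta K w.
Proof.
rewrite /gauss_qform /sample_qform qform_offdiag /U_gauss.
set S := psd_sqrtmx _; set L := Lambda_mx _ _.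
have [St _ _] := Sigma_sqrt law1 sphi K; rewrite -/S in St.
set z := fun i : 'I_n => \col_k tnth (eta K i w) k.
have quad i j : ((z i)^T *m S *m L *m S *m z j) ord0 ord0 =
    \sum_k klam lam k * glin (cov_root (K:=K)) (eta K i w) k * glin (cov_root (K:=K)) (eta K j w) k.
  have -> : (z i)^T *m S *m L *m S *m z j = (S *m z i)^T *m L *m (S *m z j).
    by rewrite trmx_mul St !mulmxA.
  rewrite quad_diag_mx; apply: eq_bigr => k _; rewrite mxE.
  by rewrite (mulmx_glin S (eta K i w)) (mulmx_glin S (eta K j w)).
have linr i : ((mu_vec P X1 phi K)^T *m L *m S *m z i) ord0 ord0 =
    \sum_(k < K) lam k * feat_mean m phi k * glin (cov_root (K:=K)) (eta K i w) k.
  rewrite -mulmxA quad_diag_mx; apply: eq_bigr => k _; rewrite mxE.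
  by rewrite (mulmx_glin S (eta K i w)) (mu_vecE law1).
rewrite [LHS]mulrDr [X in X + _ = _]mulrDr (U_meanE mu_ pair_law); congr (_ + _ + _).
  rewrite mulrA; congr (_ * _); apply: eq_bigr => i _; apply: eq_bigr => j _; exact: quad.
rewrite mulrA mulr_sumr; apply: eq_bigr => i _; rewrite linr mulr_sumr.
by apply: eq_bigr => k _; rewrite /klin /lin_coef; ring.
Qed.

End FinalReduction.

Lemma cauchy_real_cvg (R : realType) (v : nat -> R) :
  (forall eps, 0 < eps -> exists K0, forall K K', (K0 <= K)%N -> (K0 <= K')%N -> `|v K - v K'| <= eps) ->
  cvgn v.
Proof.
move=> h; apply/cauchy_cvgP/cauchy_exP => eps e0.
have e2 : 0 < eps / 2 by rewrite divr_gt0.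
have [K0 hK] := h _ e2; exists (v K0); exists K0 => // K KK /=.
have l := hK _ _ (leqnn K0) KK; rewrite /ball/=.
by apply: (le_lt_trans l); rewrite ltr_pdivrMr// ltr_pMr// ltr1n.
Qed.

Lemma limit_dist_le (R : realType) (x c : R) (v : nat -> R) : cvgn v ->
  (exists K0, forall K, (K0 <= K)%N -> `|x - v K| <= c) -> `|x - limn v| <= c.
Proof.
move=> cv [K0 h].
have cd : `|x - v K| @[K --> \oo] --> `|x - limn v| by apply: cvg_norm; apply: cvgB => //; exact: cvg_cst.
rewrite -(cvg_lim _ cd)//; apply: limr_le; first by apply/cvg_ex; exists `|x - limn v|.
by exists K0 => // K KK; exact: h.
Qed.

(** If this moment vanished then so would both variances, by the comparison of
    moments and the inequality of Jensen. *)
Lemma full_moment_gt0 (dT : measure_display) (T : measurableType dT) (R : realType)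
  (m : probability T R) (u : T -> T -> R) N s nu :
  measurable_fun setT (fun z : T * T => u z.1 z.2) -> (2 <= N)%N -> 0 < s -> 2 < nu ->
  ((s ^+ 2)%:E <= pmom (m \x m)%E 2 (fun z => (u z.1 z.2 - utot m u)%R))%E \/
  ((s ^+ 2)%:E <= (N%:R - 1)%:E * pmom m 2 (fun x => (ucond m u x - utot m u)%R))%E ->
  (0 < pmom (m \x m)%E nu (fun z => (u z.1 z.2 - utot m u)%R))%E.
Proof.
move=> mu_ N2 s0 nu2 foc; rewrite lt_neqAle pmom_ge0 andbT; apply/eqP => z0.
have N0 : 2 <= N%:R :> R by rewrite ler_nat.
have two0 : 0 < 2 :> R by [].
pose r := s / (2 * N%:R); have r0 : 0 < r by rewrite divr_gt0// mulr_gt0//; lra.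
have sr : s = 2 * N%:R * r by rewrite mulrC divfK// gt_eqF// mulr_gt0//; lra.
have mf : measurable_fun setT (fun z : T * T => u z.1 z.2 - utot m u) by apply: measurable_funB.
have := pmom_change (m \x m)%E mf two0 (ltW nu2) r0.
rewrite -z0 mule0 adde0 mule1 powR_mulrn ?(ltW r0)// => h2.
have r2 : 0 < r ^+ 2 by exact: exprn_gt0.
have [h|h] := foc.
  have := le_trans h h2; rewrite lee_fin sr exprMn leNgt => /negP; apply.
  by rewrite ltr_pMl//; nra.
have one2 : 1 < 2 :> R by rewrite ltr1n.
have := le_trans (ucond_pmom m mu_ one2) h2 => h3.
have N1 : (0 <= (N%:R - 1)%:E :> \bar R)%E by rewrite lee_fin; lra.
have := le_trans h (lee_wpmul2l N1 h3); rewrite -EFinM lee_fin sr exprMn leNgt => /negP; apply.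
by rewrite ltr_pM2r//; nra.
Qed.

Theorem theorem2 (R : realType) :
  exists2 C : R, 0 < C &
  forall (d : nat) (law : probability (d.-tuple R) R)
    (u : d.-tuple R -> d.-tuple R -> R)
    (u_sym : forall x y, u x y = u y x)
    (u_meas : measurable_fun [set: d.-tuple R * d.-tuple R]
                (fun z => u z.1 z.2))
    (n : nat) (n_ge2 : (2 <= n)%N)
    (* X_1, ..., X_n i.i.d. with the given law *)
    (dO : measure_display) (Omega : measurableType dO)
    (P : probability Omega R) (X : 'I_n -> {RV P >-> d.-tuple R})
    (X_indep : mutually_independent P (fun i => X i : Omega -> d.-tuple R))
    (X_law : forall i, has_law P (X i) law)
    (nu : R) (nu_gt2 : 2 < nu) (nu_le3 : nu <= 3)
    (phi : nat -> d.-tuple R -> R) (lam : nat -> R)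
    (* eta^K_1, ..., eta^K_n i.i.d. standard Gaussian in R^K, for every K *)
    (dO' : measure_display) (Omega' : measurableType dO')
    (P' : probability Omega' R)
    (eta : forall K : nat, 'I_n -> {RV P' >-> K.-tuple R})
    (eta_indep : forall K,
       mutually_independent P' (fun i => eta K i : Omega' -> K.-tuple R))
    (eta_gauss : forall K i, std_gaussian_vector P' (eta K i)),
  let X1 : Omega -> d.-tuple R := X (Ordinal (ltnW n_ge2)) in
  let X2 : Omega -> d.-tuple R := X (Ordinal n_ge2) in
  let smax : \bar R := sigma_max P u X1 X2 n in
  let a : R := Num.sqrt (n%:R * (n%:R - 1)) / fine smax in
  let rate : R := n%:R `^ (- ((nu - 2) / (4 * nu + 2))) in
  let pD (t : R) : \bar R := P [set w | t < a * U_stat u X w] in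
  let pU (t : R) (K : nat) : \bar R :=
    P' [set w | t < a * U_gauss P u X1 X2 phi lam (eta K) w] in
  let Mfull : \bar R := M_full P u X1 X2 nu in
  let Mcond : \bar R := ((Num.sqrt (n%:R - 1))%:E * M_cond P u X1 X2 nu)%E in
  let Mmax : \bar R := M_max P u X1 X2 n nu in
  let bound : \bar R :=
    ((C * rate)%:E *
      (Mfull `^ nu / smax `^ nu + Mcond `^ nu / smax `^ nu)
        `^ (2 * nu + 1)^-1)%E in
  (0 < smax < +oo)%E ->
  (forall k, measurable_fun [set: d.-tuple R] (phi k)) ->
  (forall k, ('E_P[fun w => (phi k (X1 w) ^+ 2)%R] < +oo)%E) ->
  eps_approx P u X1 X2 phi lam K nu @[K --> \oo] --> 0%E ->
  [/\ (forall t : R, cvgn (pU t)),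
      (ereal_sup (range (fun t : R => `| pD t - limn (pU t) |)) <= bound)%E &
      (bound <= (2 `^ (2 * nu + 1)^-1 * C * rate)%:E *
                  (Mmax / smax) `^ (nu / (2 * nu + 1)))%E].
Proof.
exists (rate_const R); first exact: rate_const_gt0.
move=> d law u u_sym u_meas n n_ge2 dO Omega P X X_indep X_law nu nu_gt2 nu_le3 phi lam.
move=> dO' Omega' P' eta eta_indep eta_gauss X1 X2 smax a rate pD pU Mfull Mcond Mmax bound.
move=> smaxP mphi phi2 epsc.
pose i1 := Ordinal (ltnW n_ge2); pose i2 := Ordinal n_ge2.
have pair_law := same_law_pair X_indep X_law (isT : i1 != i2).
have law1 := same_law_one X_law i1; have law2 := same_law_one X_law i2.
have nu0 : 0 < nu by lra.
have nu23 : 2 < nu <= 3 by rewrite nu_gt2.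
have N10 : 0 < n%:R - 1 :> R by rewrite subr_gt0 ltr1n.
have sphi k : sqint law (phi k).
  split; first exact: mphi.
  have m2 : measurable_fun setT (fun x => (phi k x ^+ 2)%:E).
    by apply/measurable_EFinP; exact: measurable_funX.
  apply/integrableP; split; first exact: m2.
  have := phi2 k; rewrite unlock (same_law_integral (F := fun x => (phi k x ^+ 2)%:E) law1 m2) => h.
  apply: le_lt_trans h; rewrite le_eqVlt; apply/orP; left; apply/eqP.
  by apply: eq_integral => x _; rewrite /= ger0_norm// sqr_ge0.
have err0 := eps_cvg_pow u_meas pair_law nu0 sphi epsc.
have ui : (law \x law)%E.-integrable setT (EFin \o (fun z => u z.1 z.2)).
  have [K0 h] := err0 1 ltr01; apply: (kernel_integrable (phi := phi) (lam := lam) (K := K0) (nu := nu)) => //.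
    by lra.
  exact: le_lt_trans (h K0 (leqnn _)) (ltry _).
pose D := utot law u; pose s := fine smax.
have smaxE : smax = s%:E.
  by rewrite /s fineK// ge0_fin_numE ?(ltW (andP smaxP).1)//; case/andP: smaxP.
have s0 : 0 < s by rewrite -lte_fin -smaxE; case/andP: smaxP.
have two0 : 0 < 2 :> R by [].
have fullE p (p0 : 0 < p) := full_norm_pow u_meas pair_law p0.
have condE p (p0 : 0 < p) := cond_norm_pow u_sym u_meas pair_law law2 ui p0.
have sq2 : ((s ^+ 2)%:E = s%:E `^ 2)%E by rewrite poweR_EFin powR_mulrn ?ltW.
have sqn : ((Num.sqrt (n%:R - 1 : R))%:E `^ 2 = (n%:R - 1)%:E)%E.
  by rewrite poweR_EFin powR_mulrn ?sqrtr_ge0// sqr_sqrtr// ltW.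
have full_or_cond :
  ((s ^+ 2)%:E <= pmom (law \x law)%E 2 (fun z => (u z.1 z.2 - D)%R))%E \/
  ((s ^+ 2)%:E <= (n%:R - 1)%:E * pmom law 2 (fun x => (ucond law u x - D)%R))%E.
  rewrite -(fullE 2 two0) -(condE 2 two0) sq2 -smaxE /smax /sigma_max.
  case: (leP (sigma_full P u X1 X2) ((Num.sqrt (n%:R - 1))%:E * sigma_cond P u X1 X2)%E) => _; last by left.
  right.
  rewrite poweRM ?lee_fin ?sqrtr_ge0//; last exact: Lnorm_ge0.
  by rewrite sqn; exact: lexx.
have covS := sqrt_cov law1 sphi.
pose Q := gauss_qform law phi lam s (scale n s * D) (cov_root P (X i1) phi) eta.
pose v t K := fine (P' [set w | t < Q K w]).
have mQ t K : measurable [set w | t < Q K w].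
  by apply: measurable_gt; exact: measurable_gauss_qform.
have aU K w : a * U_gauss P u X1 X2 phi lam (eta K) w = Q K w.
  exact: (U_gauss_qform u_meas (X2 := X i2) pair_law law1 lam sphi s eta).
have pUE t : pU t = EFin \o v t.
  apply/funext => K; rewrite /= /v fineK ?fin_num_measure//; congr (P' _).
  by apply/funext => w; congr (_ < _) => //; exact: aU.
have pDE t : pD t = (fine (P [set w | t < scale n s * stat u X w]))%:E.
  rewrite fineK// fin_num_measure//; apply: measurable_gt.
  by apply: measurable_funM => //; exact: measurable_stat.
have vC t : cvgn (v t).
  apply: cauchy_real_cvg => eps e0.
  have [K0 h] := gauss_prob_cauchy u_meas sphi ui n_ge2 s0 nu23 covS eta_indep eta_gauss full_or_cond err0 e0.
  by exists K0 => K K' KK KK'; exact: h.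
have pUlim t : limn (pU t) = (limn (v t))%:E by rewrite pUE EFin_lim.
have C0 := rate_const_gt0 R.
have rate0 : 0 < rate by rewrite powR_gt0// ltr0n; exact: ltnW.
have p0 : 0 < (2 * nu + 1)^-1 by rewrite invr_gt0; lra.
have sn0 : 0 < s `^ nu by exact: powR_gt0.
have Mfull0 : (0 <= Mfull)%E by exact: Lnorm_ge0.
have Mcond0 : (0 <= Mcond)%E by rewrite mule_ge0 ?lee_fin ?sqrtr_ge0//; exact: Lnorm_ge0.
split.
- move=> t; rewrite pUE; apply/cvg_ex; exists (limn (v t))%:E.
  by apply: cvg_EFin; [exact: nearW|exact: vC].
- have fm : (Mfull `^ nu = pmom (law \x law)%E nu (fun z => (u z.1 z.2 - D)%R))%E by exact: fullE.
  have cm : (Mcond `^ nu = ((n%:R - 1) `^ (nu / 2))%:E * pmom law nu (fun x => (ucond law u x - D)%R))%E.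
    rewrite /Mcond poweRM ?lee_fin ?sqrtr_ge0//; last exact: Lnorm_ge0.
    by rewrite (condE nu nu0) poweR_EFin -powR12_sqrt ?ltW// -powRrM (mulrC 2^-1).
  have := full_moment_gt0 u_meas n_ge2 s0 nu_gt2 full_or_cond.
  have nu1 : 1 < nu by lra.
  have := ucond_pmom law u_meas nu1.
  rewrite /bound fm cm smaxE poweR_EFin inver (gt_eqF sn0) -/D.
  have := pmom_ge0 law nu (fun x => ucond law u x - D).
  case fullm : (pmom (law \x law)%E nu _) => [a0| |] //; last first.
    (* an infinite moment makes the right hand side infinite *)
    move=> cond0 _ _.
    rewrite gt0_mulye ?lte_fin ?invr_gt0// addye; last first.
      by rewrite gt_eqF// (lt_le_trans (ltNyr 0))// mule_ge0// ?mule_ge0// lee_fin ?powR_ge0// invr_ge0 ltW.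
    by rewrite poweRyr ?gt_eqF// gt0_muley ?lte_fin ?mulr_gt0// leey.
  case condm : (pmom law nu _) => [b0| |] //; rewrite lee_fin lte_fin => b00 _ a00.
  have [K1 hK] := data_gauss_close u_meas sphi ui n_ge2 s0 nu23 X_indep X_law covS eta_indep eta_gauss full_or_cond err0 a00 fullm condm.
  (* the comparison is uniform in t for large K, so it survives the limit *)
  apply: ge_ereal_sup => _ [t _ <-].
  have -> : (a0%:E * ((s `^ nu)^-1)%:E + ((n%:R - 1) `^ (nu / 2))%:E * b0%:E * ((s `^ nu)^-1)%:E =
    (a0 / s `^ nu + (n%:R - 1) `^ (nu / 2) * b0 / s `^ nu)%:E)%E by [].
  rewrite pDE pUlim -EFinB abse_EFin poweR_EFin -(EFinM (rate_const R * rate)) lee_fin.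
  have kr := kappa_rate n_ge2 s0 nu_gt2 (ltW a00) b00; rewrite -/rate in kr.
  rewrite -[leRHS]mulrA -kr.
  by apply: limit_dist_le => //; exists K1 => K KK; exact: hK.
- rewrite /bound smaxE; apply: max_moment_bound => //; exact: mulr_ge0 (ltW C0) (ltW rate0).
Qed.
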